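(* The identity $[T,L^1]=L\log L$ holds as an order and bicontinuous isomorphism between Banach function spaces (i.e. the two spaces coincide as sets and their norms are equivalent). Hence $T\colon L\log L\to L^1$ does not admit a continuous linear ($L^1$-valued) extension to any strictly larger Banach function space within $L^0$.
   Context: All functions are complex-valued, Lebesgue measurable on $(-1,1)$, identified when equal a.e.; $L^0$ denotes the space of all of them and $L^1=L^1(-1,1)$. A Banach function space (B.f.s.) on $(-1,1)$ is a Banach space $X\subseteq L^0$ such that $f\in X$, $g\in L^0$, $|g|\le|f|$ a.e. imply $g\in X$ and $\|g\|_X\le\|f\|_X$, and which has the Fatou property: if $0\le f_n\le f_{n+1}\uparrow f$ a.e. with $f_n\in X$ and $\sup_n\|f_n\|_X<\infty$, then $f\in X$ and $\|f_n\|_X\to\|f\|_X$. The decreasing rearrangement of $f$ is $f^*(t)=\inf\{\lambda\ge 0: |\{x\in(-1,1):|f(x)|>\lambda\}|\le t\}$, $0<t<2$. The Zygmund space $L\log L=L\log L(-1,1)$ consists of all measurable $f$ with $\|f\|_{L\log L}:=\int_0^2 f^*(t)\log\big(\tfrac{2e}{t}\big)\,dt<\infty$, with this norm; it is a B.f.s. contained in $L^1$. For $f\in L^1$ the finite Hilbert transform is $$T(f)(t)=\lim_{\varepsilon\to0^+}\frac1\pi\Big(\int_{-1}^{t-\varepsilon}+\int_{t+\varepsilon}^1\Big)\frac{f(x)}{x-t}\,dx ,$$ which exists for a.e. $t\in(-1,1)$ and is measurable; $T$ maps $L\log L$ boundedly into $L^1$. The optimal domain is $$[T,L^1]:=\{f\in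 L^1:\ T(h)\in L^1\text{ for all } h\in L^0 \text{ with }|h|\le|f|\},$$ with norm $\|f\|_{[T,L^1]}:=\sup\{\|T(h)\|_{L^1}:\ |h|\le|f|\}$. *)

(* Defs.v *)
From HB Require Import structures.
From mathcomp Require Import all_boot all_order all_algebra.
From mathcomp Require Import complex.
From mathcomp Require Import all_classical all_reals all_analysis.

Set Implicit Arguments.
Unset Strict Implicit.
Unset Printing Implicit Defensive.

Import Order.TTheory GRing.Theory Num.Theory numFieldNormedType.Exports.

Local Open Scope classical_set_scope.
Local Open Scope ring_scope.

(* R[i] folded as a [numClosedFieldType]: this is what lets the topology of the
   modulus, declared for every [numClosedFieldType], be found on it. *)
Definition C (R : realType) : numClosedFieldType := R[i].

(* R with the sigma-algebra of Lebesgue (not merely Borel) measurable sets, on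
   which [completed_lebesgue_measure] is defined. *)
Notation leb R := (@completed_lebesgue_measure R).
Notation lebType R := (caratheodory_type ((@wlength R idfun)^*)%mu).

(* Functions on (-1,1) are represented by functions on R of which only the
   values on (-1,1) matter; the identification of a.e. equal functions is made
   explicit through [aeI]. *)
Definition I11 {R : realType} : set R := `]-1, 1[%classic.

Section FunctionSpaces.
Variable R : realType.
Implicit Types (f g h : R -> C R) (t e : R).

Definition re (z : C R) : R := complex.Re z.
Definition im (z : C R) : R := complex.Im z.
Definition modulus (z : C R) : R := ComplexField.Normc.normc z.

Definition aeI (P : R -> Prop) : Prop := {ae leb R, forall x, I11 x -> P x}.

Definition L0 : set (R -> C R) :=
  [set f : R -> C R | measurable_fun (I11 : set (lebType R)) (re \o f) /\
           measurable_fun (I11 : set (lebType R)) (im \o f)].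

Definition dominated f g : Prop := aeI (fun x => modulus (f x) <= modulus (g x)).

Definition cintegral (D : set R) f : C R :=
  Complex (Rintegral (leb R) D (re \o f)) (Rintegral (leb R) D (im \o f)).

Definition L1norm f : \bar R :=
  (\int[leb R]_(x in I11) (modulus (f x))%:E)%E.

Definition L1 : set (R -> C R) := [set f : R -> C R | L0 f /\ (L1norm f < +oo)%E].

Definition distribution_fun f (lambda : R) : \bar R :=
  leb R (I11 `&` [set x | lambda < modulus (f x)]).

Definition rearrangement f t : \bar R :=
  ereal_inf [set lambda%:E |
    lambda in [set l : R | 0 <= l /\ (distribution_fun f l <= t%:E)%E]].

Definition LlogLnorm f : \bar R :=
  (\int[leb R]_(t in `]0%R, 2%R[%classic)
     (rearrangement f t * (ln (2 * expR 1 / t))%:E))%E.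

Definition LlogL : set (R -> C R) := [set f : R -> C R | L0 f /\ (LlogLnorm f < +oo)%E].

(* The principal value; the value of [lim] is arbitrary at those points, of
   measure zero when f is integrable, where the limit does not exist. *)
Definition truncated_hilbert f t e : C R :=
  let k := fun x : R => f x / real_complex R (x - t) in
  real_complex R pi^-1 *
    (cintegral `]-1, t - e[%classic k + cintegral `]t + e, 1[%classic k).

Definition finite_hilbert f : R -> C R :=
  fun t => lim (truncated_hilbert f t e @[e --> 0^'+]).

Definition optimal_domain : set (R -> C R) :=
  [set f : R -> C R | L1 f /\
    forall h, L0 h -> dominated h f -> L1 (finite_hilbert h)].

Definition optimal_norm f : \bar R :=
  ereal_sup [set L1norm (finite_hilbert h) |
    h in [set h : R -> C R | L0 h /\ dominated h f]].

(* A norm on X is given by a function with values in \bar R whose values are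
   finite on X and irrelevant elsewhere.  [bfs_ideal] applied to a.e. equal
   functions shows that X and N are compatible with a.e. equality. *)
Record is_bfs (X : set (R -> C R)) (N : (R -> C R) -> \bar R) : Prop := IsBfs {
  bfs_sub_L0 : X `<=` L0 ;
  bfs_zero : X (fun=> 0) ;
  bfs_add : forall f g, X f -> X g -> X (f \+ g) ;
  bfs_scale : forall (a : C R) f, X f -> X (a \*o f) ;
  bfs_norm_fin : forall f, X f -> (0 <= N f < +oo)%E ;
  bfs_norm_eq0 : forall f, X f -> N f = 0%E -> aeI (fun x => f x = 0) ;
  bfs_normZ : forall (a : C R) f, X f -> N (a \*o f) = ((modulus a)%:E * N f)%E ;
  bfs_normD : forall f g, X f -> X g -> (N (f \+ g)%R <= N f + N g)%E ;
  bfs_complete : forall u : nat -> R -> C R, (forall n, X (u n)) ->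
    (forall e : R, 0 < e -> exists n0 : nat, forall m n : nat,
      (n0 <= m)%N -> (n0 <= n)%N -> (N (u m \- u n)%R < e%:E)%E) ->
    exists2 f, X f & N (u n \- f)%R @[n --> \oo] --> 0%E ;
  bfs_ideal : forall f g, X f -> L0 g -> dominated g f ->
    X g /\ (N g <= N f)%E ;
  (* [<=] on C compares complex numbers with the same imaginary part, so the
     order hypothesis includes that the functions are real-valued. *)
  bfs_fatou : forall (u : nat -> R -> C R) f, (forall n, X (u n)) -> L0 f ->
    aeI (fun x => forall n, 0 <= u n x <= u n.+1 x) ->
    aeI (fun x => u n x @[n --> \oo] --> f x) ->
    (ereal_sup (range (fun n => N (u n))) < +oo)%E ->
    X f /\ N (u n) @[n --> \oo] --> N f }.

(* [S], acting on representatives, induces a continuous linear operator from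
   (X, N) to L^1. *)
Record continuous_linear_to_L1 (X : set (R -> C R)) (N : (R -> C R) -> \bar R)
    (S : (R -> C R) -> R -> C R) : Prop := ContinuousLinearToL1 {
  cl_L1 : forall f, X f -> L1 (S f) ;
  cl_ae : forall f g, X f -> X g -> aeI (fun x => f x = g x) ->
    aeI (fun t => S f t = S g t) ;
  cl_add : forall f g, X f -> X g ->
    aeI (fun t => S (f \+ g) t = S f t + S g t) ;
  cl_scale : forall (a : C R) f, X f ->
    aeI (fun t => S (a \*o f) t = a * S f t) ;
  cl_continuous : forall f, X f -> forall e : R, 0 < e ->
    exists2 d : R, 0 < d & forall g, X g -> (N (g \- f)%R < d%:E)%E ->
      (L1norm (S g \- S f)%R < e%:E)%E }.

Definition extends_finite_hilbert (S : (R -> C R) -> R -> C R) : Prop :=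
  forall f, LlogL f -> aeI (fun t => S f t = finite_hilbert f t).

End FunctionSpaces.

(* Main.v *)
(** For a finite union of intervals, [T] of the indicator is the logarithm of a
  product of linear fractions, and the roots of [1 - Σ c_i/(x - a_i)], whose sum
  is [Σ a_i + Σ c_i] (Boole), give the exact size of its level sets.  Hence
  the Stein-Weiss tail bound for [T 1_A] and the weak type (1,1) of [T] on
  step functions; with Cotlar's inequality and the Hardy-Littlewood maximal
  function, also of the maximal truncation, so that principal values exist
  a.e. on [L1].

  The norm of [f] in [L log L] is the integral over [λ > 0] of [W d(λ)], where
  [d] is the distribution function and [W s = s ln (2e/s) + s].  Integrating
  the Stein-Weiss bound over the level sets of [f] gives
  [|T f|_1 <= (20/π) |f|_{L log L}].

  For the converse, [T] is tested on level sets by duality: the Cauchy sum of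
  point masses proportional to the mass of [|f|] on small cells exceeds 1 on a
  set [A] of size comparable with that of the level set, and [T 1_A = ln |1 - r|]
  for that Cauchy sum [r], which is large on most of every cell.  A gliding hump
  shows that a function of the optimal domain has a finite bound
  [sup {|T h|_1 : |h| <= |f|}], so it lies in [L log L].

  An extension to a larger space [X] is continuous at 0; by homogeneity this
  bounds [T] on all [h] with [|h| <= |f|], for every [f] in [X], which puts [f]
  in [L log L]. *)
Require Import Defs.
From HB Require Import structures.
From mathcomp Require Import all_boot all_order all_algebra.
From mathcomp Require Import complex polyrcf ring lra.
From mathcomp Require Import all_classical all_reals all_analysis.
From mathcomp Require Import measurable_realfun.

Set Implicit Arguments.
Unset Strict Implicit.
Unset Printing Implicit Defensive.

Import Order.TTheory GRing.Theory Num.Theory numFieldNormedType.Exports.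

Local Open Scope classical_set_scope.
Local Open Scope ring_scope.

(** * Boole's identity for sums of simple poles *)

(** [T] is unbounded on [L1], but it is closed there: if [u_n] tends to [u] fast enough in [L1], the
    principal values converge a.e. With Fatou's lemma this makes the [L1] norm of [T u] lower
    semicontinuous in [u], and limits are taken in this form in the upper bound, in the gliding hump
    and in the Fatou property of the optimal norm.

    Both bounds rest on one identity, [prod (x - t_i)/(x - a_i) = 1 - sum c_i/(x - a_i)]. Given the
    intervals [[a_i, t_i]], it describes the level sets of [T 1_A]; given the masses [c_i], it
    produces the test set [A], of length [sum c_i]. The masses are therefore normalised to total 1:
    then [A] stays in [(-1, 1)] except for the end of its last interval, which is cut at 1 at the
    price of a term [|ln (1 - x)|].

    The duality needs the upper bound first. The pairing of [T h] with a step function passes from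
    step functions to bounded [h] because bounded [L1] convergence implies convergence in [Phi],
    where [T] is continuous into [L1]. *)

Section Poles.
Variable R : realType.
Implicit Types (a c t : nat -> R) (n : nat) (x l : R).

Lemma big_map_iota (T S : Type) (idx : S) (op : S -> S -> S) n (f : nat -> T)
    (F : T -> S) :
  \big[op/idx]_(p <- [seq f i | i <- iota 0 n]) F p =
  \big[op/idx]_(i < n) F (f i).
Proof. by rewrite big_map -(big_mkord xpredT (F \o f)) /index_iota subn0. Qed.

(** The numerator of [1 - \sum c_i / (x - a_i)] over the common denominator. As a polynomial it
    keeps a meaningful value at the poles, which is where its sign is read off. *)
Definition pole_poly n a c : {poly R} :=
  \prod_(i < n) ('X - (a i)%:P) -
  \sum_(i < n) c i *: \prod_(j < n | j != i) ('X - (a j)%:P).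

Lemma horner_pole_poly n a c x :
  (pole_poly n a c).[x] = \prod_(i < n) (x - a i) -
     \sum_(i < n) c i * \prod_(j < n | j != i) (x - a j).
Proof.
rewrite /pole_poly hornerD hornerN horner_prod horner_sum.
congr (_ - _); first by apply: eq_bigr => i _; rewrite hornerXsubC.
apply: eq_bigr => i _; rewrite hornerZ horner_prod; congr (_ * _).
by apply: eq_bigr => j _; rewrite hornerXsubC.
Qed.

Lemma horner_pole_polyE n a c x : (forall i, (i < n)%N -> x != a i) ->
  (pole_poly n a c).[x] =
  \prod_(i < n) (x - a i) * (1 - \sum_(i < n) c i / (x - a i)).
Proof.
move=> xa; rewrite horner_pole_poly mulrBr mulr1 mulr_sumr; congr (_ - _).
apply: eq_bigr => i _; rewrite [in RHS](bigD1 i)//=.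
have : x - a i != 0 by rewrite subr_eq0 xa.
move: (\prod_(_ < _ | _) _) => p h; field.
exact: h.
Qed.

Lemma horner_pole_poly_pole n a c (i : 'I_n) :
  (pole_poly n a c).[a i] = - (c i * \prod_(j < n | j != i) (a i - a j)).
Proof.
rewrite horner_pole_poly (bigD1 i)//= subrr mul0r sub0r; congr (- _).
rewrite (bigD1 i)//= [X in _ + X]big1 ?addr0// => k ki.
by rewrite (bigD1 i) 1?eq_sym//= subrr mul0r mulr0.
Qed.

Lemma size_prod_poles n a (P : pred 'I_n) :
  size (\prod_(j < n | P j) ('X - (a j)%:P)) = #|P|.+1.
Proof.
rewrite -big_filter size_prod_XsubC; congr _.+1.
by rewrite cardE /enum_mem; congr size; apply: eq_filter => j; rewrite inE.
Qed.

Lemma size_pole_tail n a c :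
  (size (\sum_(i < n) c i *: \prod_(j < n | j != i) ('X - (a j)%:P))%R
    <= n)%N.
Proof.
apply: (leq_trans (poly.size_sum _ _ _)); apply/bigmax_leqP => i _.
apply: (leq_trans (size_scale_leq _ _)).
rewrite (size_prod_poles a (fun j => j != i)).
have -> : #|(fun j : 'I_n => j != i)| = #|predC1 i| by apply: eq_card.
by rewrite cardC1 card_ord; case: n i => [[]|].
Qed.

Lemma size_prod_pole n a : size (\prod_(i < n) ('X - (a i)%:P)) = n.+1.
Proof. by rewrite size_prod_poles; rewrite (eq_card (B := 'I_n)) ?card_ord. Qed.

Lemma size_pole_poly n a c : size (pole_poly n a c) = n.+1.
Proof.
rewrite /pole_poly size_polyDl ?size_prod_pole// size_polyN.
by rewrite ltnS size_pole_tail.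
Qed.

Lemma lead_coef_pole_poly n a c : lead_coef (pole_poly n a c) = 1.
Proof.
rewrite /pole_poly lead_coefDl ?lead_coef_prod_XsubC//.
by rewrite size_prod_pole size_polyN ltnS size_pole_tail.
Qed.

Lemma coef_pole_poly n a c : (0 < n)%N ->
  (pole_poly n a c)`_n.-1 = - \sum_(i < n) a i - \sum_(i < n) c i.
Proof.
move=> n0; rewrite /pole_poly coefB; congr (_ - _).
  have := @coefPn_prod_XsubC R [seq a i | i <- iota 0 n].
  rewrite size_map size_iota -lt0n => /(_ n0).
  by rewrite !big_map_iota.
rewrite coef_sum; apply: eq_bigr => i _; rewrite coefZ -[RHS]mulr1; congr (_ * _).
have := monic_prod_XsubC (index_enum 'I_n) (fun j => j != i) (fun j : 'I_n => a j).
rewrite monicE lead_coefE (size_prod_poles a (fun j => j != i)) => /eqP.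
have -> : #|(fun j : 'I_n => j != i)| = #|predC1 i| by apply: eq_card.
by rewrite cardC1 card_ord.
Qed.

(* Between consecutive poles the polynomial changes sign; after the last one it
   is negative at the pole and nonnegative at distance [\sum c]. *)
Lemma pole_poly_roots n a c :
  (forall i j, (i < j < n)%N -> a i < a j) ->
  (forall i, (i < n)%N -> 0 < c i) ->
  exists t, [/\ forall i, (i < n)%N -> a i < t i,
    forall i, (i.+1 < n)%N -> t i < a i.+1,
    forall i j, (i < j < n)%N -> t i < t j &
    forall i, (i < n)%N -> root (pole_poly n a c) (t i)].
Proof.
move=> aI c0.
have P0 i : (i < n)%N -> (pole_poly n a c).[a i] != 0.
  move=> ilt; rewrite (horner_pole_poly_pole a c (Ordinal ilt)) oppr_eq0/=.
  apply: mulf_neq0; first by rewrite gt_eqF// c0.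
  apply/prodf_neq0 => j; rewrite -val_eqE/=.
  by rewrite neq_ltn => /orP[h|h]; rewrite subr_eq0;
    [rewrite gt_eqF// aI ?h| rewrite lt_eqF// aI ?h/=].
have tex i : exists t : R, (i < n)%N ->
    [/\ a i < t, (i.+1 < n)%N -> t < a i.+1 & root (pole_poly n a c) t].
  have [ilt|] := ltnP i n; last by exists 0.
  have [i1lt|i1ge] := ltnP i.+1 n.
    have [||t] := @poly_ivtoo _ (pole_poly n a c) (a i) (a i.+1).
    - by rewrite ltW// aI// leqnn.
    - rewrite (horner_pole_poly_pole a c (Ordinal ilt)).
      rewrite (horner_pole_poly_pole a c (Ordinal i1lt))/= mulrNN.
      rewrite (bigD1 (Ordinal i1lt)) ?(bigD1 (P := fun j => j != Ordinal i1lt) (Ordinal ilt))//=;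
        try by rewrite -val_eqE/= ?gtn_eqF// ltn_eqF.
      rewrite (eq_bigl (fun j : 'I_n => (j != Ordinal ilt) && (j != Ordinal i1lt)));
        last by move=> j; rewrite andbC.
      set p := \prod_(_ < _ | _) _; set q := \prod_(_ < _ | _) _.
      (* No pole lies between [a i] and [a i.+1], so the two factors coming from any third pole have
         the same sign. *)
      have pq : 0 < p * q.
        rewrite /p /q.
        rewrite [X in _ * X](eq_bigl (fun j : 'I_n => (j != Ordinal ilt) && (j != Ordinal i1lt)));
          last by move=> j; rewrite andbC.
        rewrite -big_split/= prodr_gt0// => j /andP[].
        rewrite -!val_eqE/= => ji ji1.
        move: ji; rewrite neq_ltn => /orP[ji|ij].
          by rewrite mulr_gt0// subr_gt0 aI// ?ji// (ltn_trans ji) ?ltnS.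
        have ij1 : (i.+1 < j)%N by rewrite ltn_neqAle eq_sym ji1.
        by rewrite -mulrNN !opprB mulr_gt0// subr_gt0 aI// ?ij ?ij1/=.
      have -> : c i * ((a i - a i.+1) * p) * (c i.+1 * ((a i.+1 - a i) * q)) =
        - ((c i * c i.+1) * ((a i.+1 - a i) ^+ 2) * (p * q)) by ring.
      have cc : 0 < c i * c i.+1 by apply: mulr_gt0; apply: c0.
      have aa : 0 < (a i.+1 - a i) ^+ 2 by rewrite exprn_gt0// subr_gt0 aI// leqnn.
      by rewrite oppr_lt0; apply: mulr_gt0 => //; apply: mulr_gt0.
    - by rewrite -val_eqE/= ltn_eqF.
    - by move=> /= /[!in_itv]/= /andP[h1 h2] h3; exists t.
  have i_last j : (j < n)%N -> j != i -> (j < i)%N.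
    move=> jn ji; rewrite ltn_neqAle ji/= -ltnS.
    by rewrite (leq_trans jn).
  have Sc : 0 < \sum_(j < n) c j.
    by rewrite (bigD1 (Ordinal ilt))//= ltr_wpDr ?c0// sumr_ge0// => j _; rewrite ltW ?c0.
  have aile j : (j < n)%N -> a j <= a i.
    have [->//|ji jn] := eqVneq j i.
    by rewrite ltW// aI// i_last//.
  have [||t] := @poly_ivt _ (pole_poly n a c) (a i) (a i + \sum_(j < n) c j).
  - by rewrite lerDl ltW.
  - apply/andP; split.
      rewrite (horner_pole_poly_pole a c (Ordinal ilt)) oppr_le0 mulr_ge0//.
        by rewrite ltW ?c0.
      rewrite prodr_ge0// => j; rewrite -val_eqE/= => ji.
      by rewrite subr_ge0 aile.
    (* Here [i] is the last index. At distance [\sum c] to its right every denominator is at least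
       [\sum c], so the fractions add up to at most 1. *)
    have posx j : (j < n)%N -> \sum_(k < n) c k <= a i + \sum_(k < n) c k - a j.
      by move=> jn; have := aile _ jn; lra.
    rewrite horner_pole_polyE; last first.
      by move=> j jn; have := posx _ jn; apply: contraTneq => <-; rewrite subrr -ltNge.
    rewrite mulr_ge0 ?prodr_ge0//.
      by move=> j _; rewrite (le_trans _ (posx _ _))// ltW.
    rewrite subr_ge0 -[leRHS](divff (lt0r_neq0 Sc)) mulr_suml ler_sum// => j _.
    rewrite ler_wpM2l ?(ltW (c0 _ _))// lef_pV2 ?posx// ?posrE//.
    by rewrite (lt_le_trans Sc)// posx.
  - move=> /andP[h1 h2] h3; exists t => _; split => //.
    + by rewrite lt_neqAle h1 andbT; apply: contraTneq h3 => <-; apply: P0.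
have [t tP] := boolp.choice tex.
exists t; split => [i ilt|i ilt|i j /andP[ij jn]|i ilt].
- by have [] := tP _ ilt.
- by have [_ + _] := tP _ (ltnW ilt); apply.
- have [_ /(_ (leq_ltn_trans ij jn)) ti _] := tP _ (ltn_trans ij jn).
  have [tj _ _] := tP _ jn.
  apply: (lt_le_trans ti); apply: ltW; apply: le_lt_trans tj.
  move: ij; rewrite leq_eqVlt => /orP[/eqP->//|ij].
  by rewrite ltW// aI// ij.
- by have [] := tP _ ilt.
Qed.

(** A monic polynomial of degree [n] with [n] distinct roots is the product of its linear factors;
    comparing coefficients of degree [n - 1] gives the sum of the roots. *)
Lemma boole_roots n a c :
  (forall i j, (i < j < n)%N -> a i < a j) ->
  (forall i, (i < n)%N -> 0 < c i) ->
  exists t, [/\ forall i, (i < n)%N -> a i < t i,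
    forall i, (i.+1 < n)%N -> t i < a i.+1,
    \sum_(i < n) t i = \sum_(i < n) a i + \sum_(i < n) c i &
    forall x, (forall i, (i < n)%N -> x != a i) ->
      1 - \sum_(i < n) c i / (x - a i) = \prod_(i < n) ((x - t i) / (x - a i))].
Proof.
move=> aI c0; have [t [at_ ta tt rt]] := pole_poly_roots aI c0.
exists t; split => //.
  case: (posnP n) => [->|n0]; first by rewrite !big_ord0 addr0.
  have := coef_pole_poly a c n0.
  rewrite (@all_roots_prod_XsubC _ (pole_poly n a c) [seq t i | i <- iota 0 n]);
    rewrite ?size_map ?size_iota ?size_pole_poly//; last 2 first.
  - by apply/allP => _ /mapP[i + ->]; rewrite mem_iota => /rt.
  - rewrite uniq_rootsE map_inj_in_uniq ?iota_uniq// => i j.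
    rewrite !mem_iota/= add0n => ilt jlt.
    have [ij|ji|//] := ltngtP i j.
      by move=> h; have := tt i j; rewrite ij jlt h ltxx => /(_ isT).
    by move=> h; have := tt j i; rewrite ji ilt h ltxx => /(_ isT).
  rewrite lead_coef_pole_poly scale1r.
  have := @coefPn_prod_XsubC R [seq t i | i <- iota 0 n].
  rewrite size_map size_iota -lt0n => /(_ n0) ->.
  rewrite !big_map_iota.
  by move=> h; apply: oppr_inj; rewrite h opprD.
move=> x xa.
have xa0 : \prod_(i < n) (x - a i) != 0.
  by apply/prodf_neq0 => i _; rewrite subr_eq0 xa.
apply: (mulfI xa0); rewrite -horner_pole_polyE//.
rewrite (@all_roots_prod_XsubC _ (pole_poly n a c) [seq t i | i <- iota 0 n]);
    rewrite ?size_map ?size_iota ?size_pole_poly//; last 2 first.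
- by apply/allP => _ /mapP[i + ->]; rewrite mem_iota => /rt.
- rewrite uniq_rootsE map_inj_in_uniq ?iota_uniq// => i j.
  rewrite !mem_iota/= add0n => ilt jlt.
  have [ij|ji|//] := ltngtP i j.
    by move=> h; have := tt i j; rewrite ij jlt h ltxx => /(_ isT).
  by move=> h; have := tt j i; rewrite ji ilt h ltxx => /(_ isT).
rewrite lead_coef_pole_poly scale1r horner_prod big_map_iota.
rewrite prodf_div mulrCA divff// mulr1.
by apply: eq_bigr => i _; rewrite hornerXsubC.
Qed.

End Poles.

(** * Measure of the level sets of a sum of simple poles *)

Section Boole.
Variable R : realType.
Local Notation mu := (@lebesgue_measure R).
Implicit Types (x l : R).

(** On an arbitrary set [lebesgue_measure] takes the value of the outer measure. Monotonicity and
    subadditivity therefore hold for all sets, and exceptional sets can be estimated below without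
    proving them measurable. *)
Lemma le_mu (A B : set R) : A `<=` B -> (mu A <= mu B)%E.
Proof. exact: (le_outer_measure ((@wlength R idfun)^*)%mu). Qed.

Lemma mu_ge0 (A : set R) : (0 <= mu A)%E.
Proof. exact: (outer_measure_ge0 ((@wlength R idfun)^*)%mu). Qed.

Lemma mu_setU (A B : set R) : (mu (A `|` B) <= mu A + mu B)%E.
Proof. exact: (outer_measureU2 ((@wlength R idfun)^*)%mu). Qed.

Lemma mu_bigcup (F : nat -> set R) :
  (mu (\bigcup_n F n) <= \sum_(n <oo) mu (F n))%E.
Proof. exact: (outer_measure_sigma_subadditive ((@wlength R idfun)^*)%mu). Qed.

Lemma mu_seq0 (s : seq R) : mu [set x | x \in s] = 0%E.
Proof.
apply: countable_lebesgue_measure0; apply: finite_set_countable.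
exact: finite_seq.
Qed.

Lemma mu_cover (I : seq (R * R)) (A : set R) :
  (forall p, p \in I -> p.1 <= p.2) ->
  (forall x, A x -> exists2 p, p \in I & p.1 <= x <= p.2) ->
  (mu A <= (\sum_(p <- I) (p.2 - p.1))%:E)%E.
Proof.
elim: I A => [|p I IH] A pI AI.
  rewrite big_nil; have -> : A = set0; last by rewrite measure0.
  by apply/seteqP; split => // x /AI[].
pose B := A `&` ~` `[p.1, p.2]%classic.
have AB : A `<=` `[p.1, p.2]%classic `|` B.
  by move=> x Ax; have [h|h] := pselect (`[p.1, p.2]%classic x); [left|right].
apply: (le_trans (le_mu AB)); apply: (le_trans (mu_setU _ _)).
rewrite big_cons EFinD; apply: leeD.
  rewrite lebesgue_measure_itv/=; case: ifPn => _; first by rewrite EFinB.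
  by rewrite lee_fin subr_ge0 pI ?mem_head.
apply: IH => [q qI|x [Ax]]; first by rewrite pI// inE qI orbT.
rewrite /= in_itv/= => xp; have [q] := AI _ Ax.
by rewrite inE => /predU1P[->//|qI xq]; exists q.
Qed.

(** Apply [boole_roots] with the weights divided by [l]. The sum exceeds [l] exactly when the
    product of the [(x - t i)/(x - a i)] is negative, which needs a negative factor, that is [x]
    between a pole and the next root. The lengths [t i - a i] add up to the total weight. Poles of
    weight 0 are dropped first because [boole_roots] asks for positive weights. *)
Lemma boole_cover (s : seq (R * R)) l : 0 < l ->
  sorted (fun p q => p.1 < q.1) s -> (forall p, p \in s -> 0 <= p.2) ->
  exists I : seq (R * R), [/\ forall p, p \in I -> p.1 <= p.2,
    \sum_(p <- I) (p.2 - p.1) = (\sum_(p <- s) p.2) / l &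
    forall x, l < \sum_(p <- s) p.2 / (x - p.1) ->
      exists2 p, p \in I & p.1 <= x <= p.2].
Proof.
move=> l0 ss s0.
pose s' := [seq p <- s | 0 < p.2].
have drop F : (forall p, p.2 = 0 -> F p = 0) ->
    \sum_(p <- s) F p = \sum_(p <- s') F p :> R.
  move=> F0; rewrite big_filter [RHS]big_mkcond/= big_seq [RHS]big_seq.
  apply: eq_bigr => p ps; case: ifPn => // p2; apply: F0.
  by apply/eqP; rewrite eq_le s0// andbT leNgt.
rewrite (drop (fun p => p.2))//.
have ss' : sorted (fun p q => p.1 < q.1) s'.
  by apply: sorted_filter => // p q r /=; apply: lt_trans.
pose a i := (nth (0, 0) s' i).1; pose c i := (nth (0, 0) s' i).2 / l.
pose n := size s'.
have tr : transitive (fun p q : R * R => p.1 < q.1).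
  by move=> p q r /=; apply: lt_trans.
have aI i j : (i < j < n)%N -> a i < a j.
  move=> /andP[ij jn]; have := sorted_ltn_nth tr (0, 0) ss'.
  by apply=> //; rewrite inE// (ltn_trans ij).
have c0 i : (i < n)%N -> 0 < c i.
  move=> ilt; apply: divr_gt0 => //.
  by have := mem_nth (0, 0) ilt; rewrite mem_filter => /andP[].
have [t [at_ ta st rt]] := boole_roots aI c0.
exists [seq (a i, t i) | i <- iota 0 n]; split.
- by move=> p /mapP[i + ->]; rewrite mem_iota/= add0n => /at_/ltW.
- rewrite big_map_iota/= sumrB st [LHS]addrAC subrr add0r mulr_suml.
  by rewrite (big_nth (0, 0)) big_mkord.
- move=> x lx.
  (* At a pole the sum has an artificial value, since [0^-1 = 0]; the closed interval contains the
     pole in any case. *)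
  have [[i ilt xai]|xa] := pselect (exists2 i, (i < n)%N & x = a i).
    exists (a i, t i); first by apply/mapP; exists i; rewrite ?mem_iota.
    by rewrite /= xai lexx/= ltW// at_.
  have xa' i : (i < n)%N -> x != a i by move=> ilt; apply/eqP => h; apply: xa; exists i.
  have := rt _ xa'.
  have sE : \sum_(i < n) c i / (x - a i) = (\sum_(p <- s) p.2 / (x - p.1)) / l.
    rewrite (drop (fun p => p.2 / (x - p.1))); last by move=> p ->; rewrite mul0r.
    rewrite mulr_suml (big_nth (0, 0)) big_mkord; apply: eq_bigr => i _.
    by rewrite /c mulrAC.
  have h : 1 - (\sum_(p <- s) p.2 / (x - p.1)) / l < 0.
    by rewrite subr_lt0 ltr_pdivlMr// mul1r.
  rewrite sE => E; move: h; rewrite E => h.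
  have [i ilt hi] : exists2 i, (i < n)%N & (x - t i) / (x - a i) < 0.
    apply: contrapT => H; move: h; apply/negP; rewrite -leNgt.
    apply: prodr_ge0 => i _; rewrite leNgt; apply/negP => hi.
    by apply: H; exists (nat_of_ord i).
  exists (a i, t i); first by apply/mapP; exists i; rewrite ?mem_iota.
  move: hi; rewrite /=; have := at_ _ ilt.
  have [xai|xai|<-] := ltgtP x (a i).
  - move=> ait; have : 0 < (x - t i) / (x - a i); last by lra.
    by rewrite -mulrNN -invrN !opprB divr_gt0// subr_gt0// (lt_trans xai).
  - move=> ait; rewrite pmulr_llt0 ?invr_gt0 ?subr_gt0// subr_lt0.
    by move=> /ltW.
  - by rewrite subrr invr0 mulr0 ltxx.
Qed.

(** The reflection of the line exchanges the levels above [l] and below [- l]. The list is reversed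
    as well, to keep the poles sorted. *)
Lemma boole_ineq (s : seq (R * R)) l : 0 < l ->
  sorted (fun p q => p.1 < q.1) s -> (forall p, p \in s -> 0 <= p.2) ->
  (mu [set x | (l < `|\sum_(p <- s) p.2 / (x - p.1)|)%R]
    <= (2 * (\sum_(p <- s) p.2)%R / l)%:E)%E.
Proof.
move=> l0 ss s0.
pose rs := [seq (- p.1, p.2) | p <- rev s].
have rss : sorted (fun p q => p.1 < q.1) rs.
  rewrite /rs map_rev rev_sorted; elim: s ss {s0 rs} => //= p s IH.
  case: s IH => //= q s IH /andP[pq qs]; rewrite ltrN2 pq/=.
  exact: IH.
have rs0 p : p \in rs -> 0 <= p.2.
  by move=> /mapP[q]; rewrite mem_rev => qs ->/=; exact: s0.
have rsE F : \sum_(p <- rs) F p = \sum_(p <- s) F (- p.1, p.2) :> R.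
  by rewrite /rs big_map big_rev.
have [I [I0 IS Ic]] := boole_cover l0 ss s0.
have [J [J0 JS Jc]] := boole_cover l0 rss rs0.
pose K := I ++ [seq (- p.2, - p.1) | p <- J].
have KS : \sum_(p <- K) (p.2 - p.1) = 2 * (\sum_(p <- s) p.2) / l.
  rewrite /K big_cat/= big_map/= IS.
  under [X in _ + X]eq_bigr do rewrite -opprD addrC opprD opprK addrC.
  rewrite [X in _ + X](_ : _ = \sum_(p <- J) (p.2 - p.1)); last first.
    by apply: eq_bigr => p _; ring.
  rewrite JS (rsE (fun p => p.2))/=; ring.
rewrite -KS; apply: mu_cover => [p|x /=].
  by rewrite mem_cat => /orP[/I0//|/mapP[q /J0 qJ ->/=]]; rewrite lerN2.
rewrite lter_normr => /orP[/Ic[p pI xp]|h].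
  by exists p => //; rewrite mem_cat pI.
have [|p pJ xp] := Jc (- x).
  rewrite (rsE (fun p => p.2 / (- x - p.1)))/=.
  rewrite (eq_bigr (fun p => - (p.2 / (x - p.1)))) ?sumrN// => p _.
  by rewrite -mulrN -invrN opprD !opprK addrC.
exists (- p.2, - p.1); first by rewrite mem_cat; apply/orP; right; apply/mapP; exists p.
by move: xp => /= /andP[h1 h2]; apply/andP; split; lra.
Qed.

End Boole.

(** * The Hilbert transform of a finite union of intervals *)

Section SteinWeiss.
Variable R : realType.
Local Notation mu := (@lebesgue_measure R).
Implicit Types (s : seq (R * R)) (x l : R).

Definition intervals s :=
  all (fun p => p.1 < p.2) s && pairwise (fun p q => p.2 <= q.1) s.

Lemma intervals_cons p s : intervals (p :: s) ->
  [/\ p.1 < p.2, forall q, q \in s -> p.2 <= q.1,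
      forall q, q \in s -> q.1 < q.2 & intervals s].
Proof.
rewrite /intervals /= => /andP[/andP[-> as_] /andP[/allP ps pw]].
by rewrite as_ pw; split => // q qs; move/allP : as_; apply.
Qed.

(** A new leftmost factor [(x - b)/(x - a)] multiplies the residue at [p.1] by
    [(p.1 - b)/(p.1 - a)], which is nonnegative since [p.1] lies to the right of [b], and adds a
    pole at [a]. Its residue is [b - a] times the value at [a] of the shorter product, known by
    induction; this also makes the weights add up to the total length. *)
Lemma partial_fractions_left s : intervals s ->
  exists2 c : R * R -> R,
    (forall p, p \in s -> 0 <= c p) &
    \sum_(p <- s) c p = \sum_(p <- s) (p.2 - p.1) /\
    forall x, (forall p, p \in s -> x != p.1) ->
      \prod_(p <- s) ((x - p.2) / (x - p.1)) = 1 - \sum_(p <- s) c p / (x - p.1).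
Proof.
elim: s => [_|[a b] s IH /intervals_cons[/= ab bs qs /IH[c c0 [cs cE]]]].
  by exists (fun=> 0) => //; split; rewrite ?big_nil// => x _; rewrite !big_nil subr0.
have sa q : q \in s -> a < q.1 by move=> /bs; apply: lt_le_trans.
have absn q : q \in s -> q != (a, b).
  by move=> /sa; apply: contraTneq => ->; rewrite ltxx.
pose ca := (b - a) * \prod_(p <- s) ((a - p.2) / (a - p.1)).
pose c' p := if p == (a, b) then ca else c p * ((p.1 - b) / (p.1 - a)).
have c'a : c' (a, b) = ca by rewrite /c' eqxx.
have c'E p : p \in s -> c' p = c p * ((p.1 - b) / (p.1 - a)).
  by move=> /absn; rewrite /c' => /negbTE ->.
have aE : ca = (b - a) * (1 - \sum_(p <- s) c p / (a - p.1)).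
  by rewrite /ca cE// => p /sa; apply: contraTneq => ->; rewrite ltxx.
exists c'.
  move=> p; rewrite inE /c'; case: eqVneq => [-> _|pab /= ps].
    apply: mulr_ge0; first by rewrite subr_ge0 ltW.
    rewrite big_seq; apply: prodr_ge0 => q qs'.
    by rewrite -mulrNN -invrN !opprB divr_ge0// subr_ge0 ?ltW ?(sa _ qs')// (lt_trans (sa _ qs')) ?qs.
  by rewrite mulr_ge0 ?c0// divr_ge0// subr_ge0 ?bs// ltW ?sa.
split.
  rewrite !big_cons c'a (eq_big_seq _ c'E) -cs aE mulrBr mulr1 -addrA /=.
  congr (_ + _); rewrite addrC.
  rewrite mulr_sumr -sumrN -big_split/= big_seq [RHS]big_seq; apply: eq_bigr => p ps.
  have : p.1 - a != 0 by rewrite subr_eq0 gt_eqF ?sa.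
  have : a - p.1 != 0 by rewrite subr_eq0 lt_eqF ?sa.
  by move=> h1 h2; field; rewrite h1 h2.
move=> x xs; rewrite !big_cons /= cE; last by move=> p ps; apply: xs; rewrite inE ps orbT.
have xa : x - a != 0 by rewrite subr_eq0; apply: (xs (a, b)); exact: mem_head.
rewrite c'a aE.
have -> : (x - b) / (x - a) = 1 - (b - a) / (x - a) by field.
set S1 := \sum_(p <- s) c p / (x - p.1).
set S2 := \sum_(p <- s) c p / (a - p.1).
set S3 := \sum_(p <- s) _.
suff : (b - a) / (x - a) * (S1 - S2) = S1 - S3 by move=> h; move: h; lra.
rewrite /S1 /S2 /S3 -!sumrB mulr_sumr.
apply: eq_big_seq => p ps; rewrite c'E//.
have h1 : p.1 - a != 0 by rewrite subr_eq0 gt_eqF ?sa.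
have h2 : a - p.1 != 0 by rewrite subr_eq0 lt_eqF ?sa.
have h3 : x - p.1 != 0 by rewrite subr_eq0 xs// inE ps orbT.
by field; rewrite h1 h2 h3 xa.
Qed.

(** The same for the reciprocal product, whose poles are the right endpoints; it serves the level
    sets where the logarithm is very negative. *)
Lemma partial_fractions_right s : intervals s ->
  exists2 c : R * R -> R,
    (forall p, p \in s -> 0 <= c p) &
    \sum_(p <- s) c p = \sum_(p <- s) (p.2 - p.1) /\
    forall x, (forall p, p \in s -> x != p.2) ->
      \prod_(p <- s) ((x - p.1) / (x - p.2)) = 1 + \sum_(p <- s) c p / (x - p.2).
Proof.
elim: s => [_|[a b] s IH /intervals_cons[/= ab bs qs /IH[c c0 [cs cE]]]].
  by exists (fun=> 0) => //; split; rewrite ?big_nil// => x _; rewrite !big_nil addr0.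
have sb q : q \in s -> b < q.2 by move=> /[dup] /bs h /qs; apply: le_lt_trans.
have absn q : q \in s -> q != (a, b).
  by move=> /sb; apply: contraTneq => ->; rewrite ltxx.
pose cb := (b - a) * \prod_(p <- s) ((b - p.1) / (b - p.2)).
pose c' p := if p == (a, b) then cb else c p * ((p.2 - a) / (p.2 - b)).
have c'b : c' (a, b) = cb by rewrite /c' eqxx.
have c'E p : p \in s -> c' p = c p * ((p.2 - a) / (p.2 - b)).
  by move=> /absn; rewrite /c' => /negbTE ->.
have bE : cb = (b - a) * (1 + \sum_(p <- s) c p / (b - p.2)).
  by rewrite /cb cE// => p /sb; apply: contraTneq => ->; rewrite ltxx.
exists c'.
  move=> p; rewrite inE /c'; case: eqVneq => [-> _|pab /= ps].
    apply: mulr_ge0; first by rewrite subr_ge0 ltW.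
    rewrite big_seq; apply: prodr_ge0 => q qs'.
    by rewrite -mulrNN -invrN !opprB divr_ge0// subr_ge0 ?bs// ltW ?sb.
  by rewrite mulr_ge0 ?c0// divr_ge0// subr_ge0 ltW ?sb// (lt_trans ab) ?sb.
split.
  rewrite !big_cons c'b (eq_big_seq _ c'E) -cs bE mulrDr mulr1 -addrA /=.
  congr (_ + _).
  rewrite mulr_sumr -big_split/= big_seq [RHS]big_seq; apply: eq_bigr => p ps.
  have : p.2 - b != 0 by rewrite subr_eq0 gt_eqF ?sb.
  have : b - p.2 != 0 by rewrite subr_eq0 lt_eqF ?sb.
  by move=> h1 h2; field; rewrite h1 h2.
move=> x xs; rewrite !big_cons /= cE; last by move=> p ps; apply: xs; rewrite inE ps orbT.
have xa : x - b != 0 by rewrite subr_eq0; apply: (xs (a, b)); exact: mem_head.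
rewrite c'b bE.
have -> : (x - a) / (x - b) = 1 + (b - a) / (x - b) by field.
set S1 := \sum_(p <- s) c p / (x - p.2).
set S2 := \sum_(p <- s) c p / (b - p.2).
set S3 := \sum_(p <- s) _.
suff : (b - a) / (x - b) * (S1 - S2) = S3 - S1 by move=> h; move: h; lra.
rewrite /S1 /S2 /S3 -!sumrB mulr_sumr.
apply: eq_big_seq => p ps; rewrite c'E//.
have h1 : p.2 - b != 0 by rewrite subr_eq0 gt_eqF ?sb.
have h2 : b - p.2 != 0 by rewrite subr_eq0 lt_eqF ?sb.
have h3 : x - p.2 != 0 by rewrite subr_eq0 xs// inE ps orbT.
by field; rewrite h1 h2 h3 xa.
Qed.

Definition logsum s x : R := \sum_(p <- s) (ln `|p.2 - x| - ln `|p.1 - x|).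

Lemma expR_logsum s x : (forall p, p \in s -> x != p.1 /\ x != p.2) ->
  expR (logsum s x) = `|\prod_(p <- s) ((x - p.2) / (x - p.1))|.
Proof.
move=> xs; rewrite expR_sum normr_prod; apply: eq_big_seq => p /xs[x1 x2].
rewrite expRB normrM normfV !lnK ?posrE ?normr_gt0 ?subr_eq0 1?eq_sym//.
by rewrite ![`|_ - x|]distrC.
Qed.

Lemma mu_shifted_sum_gt (s : seq (R * R)) l : 1 < l ->
  sorted (fun p q => p.1 < q.1) s -> (forall p, p \in s -> 0 <= p.2) ->
  forall A : set R, (forall x, A x -> exists2 e : R, `|e| = 1 &
     l < `|1 + e * (\sum_(p <- s) p.2 / (x - p.1))|) ->
  (mu A <= (2 * (\sum_(p <- s) p.2)%R / (l - 1))%:E)%E.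
Proof.
move=> l1 ss s0 A As; apply: le_trans (boole_ineq (l := l - 1) _ ss s0); last first.
  by rewrite subr_gt0.
apply: le_mu => x /As[e e1] lx /=; rewrite ltrBlDl; apply: (lt_le_trans lx).
by apply: (le_trans (ler_normD _ _)); rewrite normr1 normrM e1 mul1r.
Qed.

(** Both [expR (logsum s x)] and its inverse are, up to sign, 1 plus or minus a sum of simple poles
    with total weight the length of the set. If one of them exceeds [expR l], the sum exceeds
    [expR l - 1] in absolute value. Each of the two cases costs the factor 2 of [boole_ineq]. The
    endpoints form a finite, hence null, set. *)
Lemma stein_weiss s l : intervals s -> 0 < l ->
  (mu [set x | (l < `|logsum s x|)%R] <=
    (4 * (\sum_(p <- s) (p.2 - p.1))%R / (expR l - 1))%:E)%E.
Proof.
move=> si l0.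
have el : 1 < expR l by rewrite expR_gt1.
have [c c0 [cs cE]] := partial_fractions_left si.
have [d d0 [ds dE]] := partial_fractions_right si.
have s1 : sorted (fun p q : R * R => p.1 < q.1) s /\ sorted (fun p q : R * R => p.2 < q.2) s.
  elim: s si {c c0 cs cE d d0 ds dE} => //= p s IH /intervals_cons[pp ps qs /IH].
  case: s ps qs {IH} => //= q s ps qs [-> ->]; rewrite !andbT; split.
    by rewrite (lt_le_trans pp)// ps// mem_head.
  by rewrite (le_lt_trans (ps q _))// ?mem_head// qs// mem_head.
pose N := [set x | x \in [seq p.1 | p <- s] ++ [seq p.2 | p <- s]].
pose A := [set x | (l < logsum s x)%R] `\` N.
pose B := [set x | (l < - logsum s x)%R] `\` N.
have sub : [set x | (l < `|logsum s x|)%R] `<=` N `|` (A `|` B).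
  move=> x /=; rewrite lter_normr => h; have [|xN] := pselect (N x); first by left.
  by right; case/orP: h => h; [left|right].
have offN x : ~ N x -> forall p, p \in s -> x != p.1 /\ x != p.2.
  move=> xN p ps; split; apply/eqP => xp; apply: xN; rewrite /N /= mem_cat; apply/orP.
    by left; apply/mapP; exists p.
  by right; apply/mapP; exists p.
apply: (le_trans (le_mu sub)); apply: (le_trans (mu_setU _ _)).
rewrite [X in (X + _ <= _)%E]mu_seq0 add0e; apply: (le_trans (mu_setU _ _)).
have -> : 4 * (\sum_(p <- s) (p.2 - p.1))%R / (expR l - 1) =
  2 * (\sum_(p <- s) (p.2 - p.1))%R / (expR l - 1) + 2 * (\sum_(p <- s) (p.2 - p.1))%R / (expR l - 1).
  by rewrite -mulrDl -mulrDl; congr (_ * _ / _); ring.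
rewrite EFinD; apply: leeD.
  rewrite -cs -(big_map (fun p => (p.1, c p)) xpredT (fun q => q.2)).
  apply: mu_shifted_sum_gt => //.
  - by rewrite sorted_map; exact: s1.1.
  - by move=> _ /mapP[p ps ->] /=; exact: c0.
  move=> x [/= lx /offN xs]; exists (-1); first by rewrite normrN1.
  rewrite big_map/= mulN1r -cE; last by move=> p /xs[].
  by rewrite -expR_logsum// ltr_expR.
rewrite -ds -(big_map (fun p => (p.2, d p)) xpredT (fun q => q.2)).
apply: mu_shifted_sum_gt => //.
- by rewrite sorted_map; exact: s1.2.
- by move=> _ /mapP[p ps ->] /=; exact: d0.
move=> x [/= lx /offN xs]; exists 1; first by rewrite normr1.
rewrite big_map/= mul1r -dE; last by move=> p /xs[].
have -> : \prod_(p <- s) ((x - p.1) / (x - p.2)) = (\prod_(p <- s) ((x - p.2) / (x - p.1)))^-1.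
  by rewrite -prodfV; apply: eq_bigr => p _; rewrite invf_div.
by rewrite normfV -expR_logsum// -expRN ltr_expR.
Qed.

End SteinWeiss.

(** * Integration tools *)

Section Tonelli.
Local Open Scope ereal_scope.

Lemma tonelli_on d1 d2 (T1 : measurableType d1) (T2 : measurableType d2)
    (R : realType) (m1 : {sigma_finite_measure set T1 -> \bar R})
    (m2 : {sigma_finite_measure set T2 -> \bar R}) (D : set T1) (E : set T2)
    (F : T1 -> T2 -> \bar R) : measurable D -> measurable E ->
  measurable_fun (D `*` E) (fun z : T1 * T2 => F z.1 z.2 : \bar R) ->
  (forall x y, D x -> E y -> 0 <= F x y) ->
  \int[m1]_(x in D) \int[m2]_(y in E) F x y =
  \int[m2]_(y in E) \int[m1]_(x in D) F x y.
Proof.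
move=> mD mE mF F0; pose G := (fun z : T1 * T2 => F z.1 z.2) \_ (D `*` E).
have G0 z : 0 <= G z.
  by rewrite /G patchE; case: ifPn => // /set_mem[]; exact: F0.
have mG : measurable_fun setT G.
  by apply/(measurable_restrictT _ _).1 => //; exact: measurableX.
transitivity (\int[m1]_x \int[m2]_y G (x, y)).
  rewrite integral_mkcond; apply: eq_integral => x _; rewrite patchE.
  case: ifPn => [/set_mem Dx|/negP Dx].
    rewrite integral_mkcond; apply: eq_integral => y _; rewrite /G !patchE.
    case: ifPn => [/set_mem Ey|/negP Ey]; first by rewrite ifT// inE.
    by rewrite ifF//; apply/negP => /set_mem[_ /mem_set].
  rewrite integral0_eq// => y _; rewrite /G patchE ifF//.
  by apply/negP => /set_mem[/mem_set].
rewrite (fubini_tonelli _ mG G0).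
rewrite [RHS]integral_mkcond; apply: eq_integral => y _; rewrite patchE.
case: ifPn => [/set_mem Ey|/negP Ey].
  rewrite [RHS]integral_mkcond; apply: eq_integral => x _; rewrite /G !patchE.
  case: ifPn => [/set_mem[Dx _]|/negP Dx]; first by rewrite ifT// inE.
  by rewrite ifF//; apply/negP => /set_mem Dx'; apply: Dx; rewrite inE.
rewrite integral0_eq// => x _; rewrite /G patchE ifF//.
by apply/negP => /set_mem[_ /mem_set].
Qed.

Lemma measurable_fun_lt_indic d (T : measurableType d) (R : realType) (D : set T)
    (f g : T -> R) : measurable D -> measurable_fun D f -> measurable_fun D g ->
  measurable_fun D (fun x => (f x < g x)%R%:R%:E : \bar R).
Proof.
move=> mD mf mg; apply/measurable_EFinP.
rewrite (_ : (fun x => _) = (fun x => if (f x < g x)%R then 1%R else 0%R)); last first.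
  by apply/funext => x; case: ifPn.
by apply: measurable_fun_if => //; exact: measurable_fun_ltr.
Qed.

Lemma integral_lt_indic d (T : measurableType d) (R : realType)
    (m : {measure set T -> \bar R}) (D : set T) (f g : T -> R) : measurable D ->
  measurable_fun D f -> measurable_fun D g ->
  \int[m]_(x in D) (f x < g x)%R%:R%:E = m (D `&` [set x | f x < g x]%R).
Proof.
move=> mD mf mg; set A := _ `&` _.
have mA : measurable A.
  rewrite /A -[X in _ `&` X](_ : (fun x => f x < g x)%R @^-1` [set true] = _).
    exact: measurable_fun_ltr.
  by apply/seteqP; split.
rewrite -[in RHS](setIidl (A := A) (B := D)); last by move=> ? [].
rewrite -integral_indic//; apply: eq_integral => x /set_mem Dx.
rewrite indicE; congr ((nat_of_bool _)%:R%:E); apply/idP/idP => [h|/set_mem[_]//].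
by rewrite inE.
Qed.

Lemma lebesgue_measure_itvoo_max (R : realType) (a b : R) :
  lebesgue_measure `]a, b[%classic = (Num.max (b - a)%R 0%R)%:E.
Proof.
rewrite lebesgue_measure_itv/= lte_fin; case: ltP => h.
  by rewrite -EFinB; congr _%:E; apply/esym/max_idPl; rewrite subr_ge0 ltW.
by congr _%:E; apply/esym/max_idPr; rewrite subr_le0.
Qed.

Lemma layer_cake d (T : measurableType d) (R : realType)
    (m : {sigma_finite_measure set T -> \bar R}) (D : set T) (f : T -> R) (l0 : R) :
  measurable D -> measurable_fun D f ->
  \int[m]_(x in D) (Num.max (f x - l0)%R 0%R)%:E =
  \int[lebesgue_measure]_(l in `]l0, +oo[) m (D `&` [set x | l < f x]%R).
Proof.
move=> mD mf.
transitivity (\int[m]_(x in D) \int[lebesgue_measure]_(l in `]l0, +oo[)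
    ((l < f x)%R%:R%:E : \bar R)).
  apply: eq_integral => x _; rewrite integral_lt_indic//.
  rewrite (_ : _ `&` _ = `]l0, f x[%classic); last first.
    apply/seteqP; split => y /=; rewrite !in_itv/= ?andbT; first by case=> -> ->.
    by move=> /andP[].
  exact/esym/lebesgue_measure_itvoo_max.
rewrite tonelli_on//.
- by apply: eq_integral => l _; rewrite integral_lt_indic.
- apply: (@measurable_fun_lt_indic _ _ R (D `*` _) (fun z => z.2) (fun z => f z.1)).
  + exact: measurableX.
  + by apply: measurable_funTS; exact: measurable_snd.
  + apply: (measurable_comp mD) => //; last by apply: measurable_funTS; exact: measurable_fst.
    by move=> _ [[x y] [Dx _] <-].
Qed.

End Tonelli.

Section FTC.
Variable R : realType.
Local Notation mu := (@lebesgue_measure R).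
Implicit Types (f F : R -> R).

Lemma FTC_closed f F (a b : R) : a <= b ->
  (forall x, a <= x <= b -> is_derive x 1 F (f x)) ->
  (forall x, a <= x <= b -> {for x, continuous f}) ->
  (\int[mu]_(x in `[a, b]) (f x)%:E = (F b - F a)%:E)%E.
Proof.
rewrite le_eqVlt => /predU1P[<- _ _|ab Ff cf].
  by rewrite set_itv1 integral_set1 subrr.
have cF x : a <= x <= b -> {for x, continuous F}.
  by move=> /Ff h; apply: differentiable_continuous; apply/derivable1_diffP; exact: ex_derive.
have sub x : x \in `]a, b[ -> a <= x <= b.
  by rewrite in_itv/= => /andP[/ltW -> /ltW ->].
rewrite (continuous_FTC2 (F := F))// ?EFinB//.
- apply: continuous_in_subspaceT => x; rewrite inE/= in_itv/= => h; exact: cf.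
- split.
  + by move=> x /sub /Ff h; exact: ex_derive.
  + by apply: cvg_at_right_filter; apply: cF; rewrite lexx ltW.
  + by apply: cvg_at_left_filter; apply: cF; rewrite lexx ltW.
- by move=> x /sub /Ff h; rewrite derive1E; exact: derive_val.
Qed.

(** For integrals that are improper at an end, singular or infinite: compact intervals exhaust the
    domain, and monotone convergence replaces any integrability requirement. *)
Lemma FTC_ge0_bigcup f F (u v : nat -> R) (lu lv : R) :
  nonincreasing_seq u -> nondecreasing_seq v -> (forall n, u n <= v n) ->
  (forall n x, u n <= x <= v n -> is_derive x 1 F (f x)) ->
  (forall n x, u n <= x <= v n -> {for x, continuous f}) ->
  (forall n x, u n <= x <= v n -> 0 <= f x) ->
  F (u n) @[n --> \oo] --> lu -> F (v n) @[n --> \oo] --> lv ->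
  (\int[mu]_(x in (\bigcup_n `[u n, v n]%classic)%classic) (f x)%:E = (lv - lu)%:E)%E.
Proof.
move=> nu nv uv Ff cf f0 Fu Fv.
have H := @ge0_nondecreasing_set_cvg_integral _ (measurableTypeR R) R (fun n => `[u n, v n]%classic)
  (EFin \o f) mu.
have : (fun n => \int[mu]_(x in `[u n, v n]) (f x)%:E)%E @ \oo --> (lv - lu)%:E.
  under eq_fun do rewrite (FTC_closed (uv _) (Ff _) (cf _)).
  by apply: cvg_EFin; [exact: nearW|exact: cvgB].
apply: cvg_unique; first exact: ereal_hausdorff.
apply: H => //.
- move=> n m nm; apply/subsetPset => x /=; rewrite !in_itv/= => /andP[h1 h2].
    by rewrite (le_trans (nu _ _ nm) h1) (le_trans h2 (nv _ _ nm)).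
- move=> n; apply/measurable_EFinP; apply: subspace_continuous_measurable_fun => //.
    by apply: continuous_in_subspaceT => x; rewrite inE/= in_itv/=; exact: cf.
Qed.

End FTC.

(** * Integrals of the logarithmic kernel *)

Section LogIntegrals.
Variable R : realType.
Local Notation mu := (@lebesgue_measure R).
Implicit Types (a d x y : R).

(** The constant [ln 2] makes the kernel nonnegative at every distance between two points of
    [(-1, 1)]; at 0 it is [ln 2], by the convention [ln 0 = 0]. *)
Definition logk y : R := ln 2 - ln y.
Definition logG y : R := y * logk y + y.

Lemma logG0 : logG 0 = 0.
Proof. by rewrite /logG mul0r addr0. Qed.

Lemma logk_ge0 y : 0 <= y <= 2 -> 0 <= logk y.
Proof.
move=> /andP[]; rewrite le_eqVlt => /predU1P[<- _|y0 y2].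
  by rewrite /logk (@ln0 _ 0)// subr0 ln_ge0// ler1n.
by rewrite subr_ge0 ler_ln ?posrE.
Qed.

Lemma continuous_logk y : 0 < y -> {for y, continuous logk}.
Proof. by move=> y0; apply: cvgB; [exact: cvg_cst|exact: continuous_ln]. Qed.

Lemma is_derive_logG y : 0 < y -> is_derive y 1 logG (logk y).
Proof.
move=> y0; have dln := is_derive1_ln y0.
have dk : is_derive y 1 logk (- y^-1).
  by have := is_deriveB (is_derive_cst (ln 2 : R) y 1) dln; rewrite sub0r.
have := is_deriveD (is_deriveM (is_derive_id y (1 : R)) dk) (is_derive_id y (1 : R)).
move/is_derive_eq; apply; rewrite /GRing.scale/= mulr1 mulrN divff ?gt_eqF//.
by rewrite addrAC addNr add0r.
Qed.

(** The square is there to let the crude bound [ln (n + 1) <= n + 1] suffice: one factor [1/(n + 1)]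
    absorbs the logarithm and the other one still tends to 0. *)
Lemma logG_harmonic d : 0 < d -> logG (d * n.+1%:R^-1 ^+ 2) @[n --> \oo] --> (0 : R).
Proof.
move=> d0; pose h n : R := n.+1%:R^-1.
have h0 : h n @[n --> \oo] --> (0 : R) by exact: cvg_harmonic.
have hgt n : 0 < h n by rewrite invr_gt0 ltr0n.
have bnd n : `|logG (d * h n ^+ 2)| <= d * (`|logk d| + 1) * h n ^+ 2 + (2 * d) * h n.
  have E : logk (d * h n ^+ 2) = logk d + 2 * ln n.+1%:R.
    rewrite /logk lnM ?posrE// ?exprn_gt0// lnXn// lnV ?posrE ?ltr0n//; lra.
  rewrite /logG E; apply: (le_trans (ler_normD _ _)).
  have dh : 0 < d * h n ^+ 2 by rewrite mulr_gt0// exprn_gt0.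
  rewrite normrM (gtr0_norm dh).
  have L0 : 0 <= ln (n.+1%:R : R) by apply: ln_ge0; rewrite ler1n.
  have L1 : ln (n.+1%:R : R) <= n.+1%:R by rewrite ltW// ln_sublinear// ltr0n.
  have T : `|logk d + 2 * ln n.+1%:R| <= `|logk d| + 2 * n.+1%:R.
    apply: (le_trans (ler_normD _ _)); rewrite lerD2l normrM ger0_norm// ger0_norm//.
    by rewrite ler_wpM2l.
  apply: (@le_trans _ _ (d * h n ^+ 2 * (`|logk d| + 2 * n.+1%:R) + d * h n ^+ 2)).
    by rewrite lerD2r ler_wpM2l// ltW.
  have nh : n.+1%:R * h n = 1 by rewrite mulfV// pnatr_eq0.
  have -> : d * h n ^+ 2 * (`|logk d| + 2 * n.+1%:R) + d * h n ^+ 2 =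
    d * (`|logk d| + 1) * h n ^+ 2 + 2 * d * h n * (n.+1%:R * h n) by ring.
  by rewrite nh mulr1.
apply/norm_cvg0P; apply: (@squeeze_cvgr _ _ _ _ (fun=> 0)
  (fun n => d * (`|logk d| + 1) * h n ^+ 2 + (2 * d) * h n)).
- by apply: nearW => n; rewrite normr_ge0 bnd.
- exact: cvg_cst.
- rewrite -[X in _ --> X](_ : d * (`|logk d| + 1) * 0 ^+ 2 + (2 * d) * 0 = 0); last first.
    by rewrite expr0n/= !mulr0 addr0.
  apply: cvgD; apply: cvgMr; last exact: h0.
  by rewrite expr2; under eq_fun do rewrite expr2; exact: cvgM.
Qed.

Lemma logk_integral_right a d : 0 <= d <= 2 ->
  (\int[mu]_(x in `]a, (a + d)%R[) (logk (x - a))%:E = (logG d)%:E)%E.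
Proof.
move=> /andP[]; rewrite le_eqVlt => /predU1P[<- _|d0 d2].
  by rewrite addr0 set_itvoo0 integral_set0 logG0.
pose u n := a + d * n.+1%:R^-1 ^+ 2.
have u1 n : 0 < (n.+1%:R^-1 ^+ 2 : R) <= 1.
  by rewrite exprn_gt0 ?invr_gt0 ?ltr0n//= exprn_ile1// ?invr_le1 ?invr_ge0// ?ler1n ?unitfE ?ltr0n.
have un n : a < u n <= a + d.
  have /andP[h1 h2] := u1 n; rewrite /u ltrDl mulr_gt0//= lerD2l.
  by rewrite ler_piMr// ltW.
have xa n x : u n <= x <= a + d -> 0 < x - a <= 2.
  by move=> /andP[h1 h2]; have /andP[h3 h4] := un n; apply/andP; split; lra.
have mf : measurable_fun (`]a, (a + d)[%classic : set (measurableTypeR R)) (fun x => logk (x - a)).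
  apply: measurable_funB => //; apply: measurableT_comp; first exact: measurable_ln.
  exact: measurable_funB.
rewrite integral_itv_bndo_bndc; last exact/measurable_EFinP.
rewrite [X in integral _ X _](_ : _ = \bigcup_n `[u n, (a + d)%R]%classic); last first.
  apply/seteqP; split => x /=.
    rewrite in_itv/= => /andP[ax xd].
    have : d * n.+1%:R^-1 @[n --> \oo] --> (0 : R).
      by rewrite -(mulr0 d); apply: cvgMr; exact: cvg_harmonic.
    move=> /cvgr0_norm_lt /(_ _ (_ : 0 < x - a)); rewrite subr_gt0 => /(_ ax)[n _ /(_ n (leqnn n))/=].
    rewrite gtr0_norm ?mulr_gt0 ?invr_gt0 ?ltr0n// => h; exists n => //=.
    rewrite in_itv/= xd andbT /u -lerBrDl (le_trans _ (ltW h))//.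
    rewrite ler_wpM2l ?(ltW d0)// expr2 ler_piMr ?invr_ge0//.
    by rewrite invr_le1 ?unitfE ?ltr0n ?ler1n.
  move=> [n _] /=; rewrite !in_itv/= => /andP[h1 ->]; rewrite andbT.
  by apply: lt_le_trans h1; have /andP[] := un n.
rewrite -[logG d]subr0.
refine (@FTC_ge0_bigcup R (fun x => logk (x - a)) (fun x => logG (x - a)) u (fun=> a + d) 0 (logG d) _ _ _ _ _ _ _ _).
- move=> n m nm; rewrite /u lerD2l ler_wpM2l ?(ltW d0)//.
  rewrite ler_pXn2r ?nnegrE ?invr_ge0//.
  by rewrite lef_pV2 ?posrE ?ltr0n// ler_nat.
- by move=> n m nm.
- by move=> n; have /andP[] := un n.
- move=> n x /xa/andP[h _].
  have := @is_derive1_comp _ logG (fun x => x - a) x _ _ (is_derive_logG h) _.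
  move=> /(_ 1); rewrite mulr1; apply.
  by have := is_deriveB (is_derive_id x 1) (is_derive_cst a x 1); rewrite subr0.
- move=> n x /xa/andP[h _].
  apply: continuous_comp; last exact: continuous_logk.
  by apply: cvgB; [exact: cvg_id|exact: cvg_cst].
- by move=> n x /xa/andP[h1 h2]; rewrite logk_ge0// ltW.
- rewrite /u; under eq_fun do rewrite addrAC subrr add0r.
  exact: logG_harmonic.
- rewrite addrAC subrr add0r; exact: cvg_cst.
Qed.

Lemma ge0_integral_opp (D : set (measurableTypeR R)) (f : R -> \bar R) :
  measurable D -> measurable_fun D f -> (forall x, D x -> 0 <= f x)%E ->
  (\int[mu]_(x in D) f x =
   \int[mu]_(x in (-%R : R -> measurableTypeR R) @^-1` D) f (- x)%R)%E.
Proof.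
move=> mD mf f0.
rewrite -(@ge0_integral_pushforward _ _ (measurableTypeR R) (measurableTypeR R) R -%R)//=.
- by apply: eq_measure_integral => //= A mA AS; exact/esym/lebesgue_measureN.
- by move=> x /set_mem; exact: f0.
Qed.

Lemma measurable_logk : measurable_fun setT logk.
Proof. by apply: measurable_funB => //; exact: measurable_ln. Qed.

Lemma measurable_logk_abs a (D : set R) :
  measurable_fun D (fun x => logk `|x - a|).
Proof.
apply: measurable_funTS; apply: measurableT_comp; first exact: measurable_logk.
by apply: measurableT_comp => //; exact: measurable_funB.
Qed.

Lemma logk_abs_integral_right a d : 0 <= d <= 2 ->
  (\int[mu]_(x in `]a, (a + d)%R]) (logk `|x - a|)%:E = (logG d)%:E)%E.
Proof.
move=> d2; rewrite -(logk_integral_right a d2) -integral_itv_bndo_bndc.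
  apply: eq_integral => x /set_mem/=; rewrite in_itv/= => /andP[ax _].
  by rewrite gtr0_norm// subr_gt0.
by apply/measurable_EFinP; exact: measurable_logk_abs.
Qed.

Lemma logk_abs_integral_left a d : 0 <= d <= 2 ->
  (\int[mu]_(x in `](a - d)%R, a]) (logk `|x - a|)%:E = (logG d)%:E)%E.
Proof.
move=> /[dup] /andP[d0 dle] d2; rewrite ge0_integral_opp//; last 2 first.
- by apply/measurable_EFinP; exact: measurable_logk_abs.
- move=> x /=; rewrite in_itv/= => /andP[h1 h2]; rewrite lee_fin logk_ge0//.
  by rewrite normr_ge0 ler_norml; apply/andP; split; lra.
rewrite (_ : _ @^-1` _ = `[- a, (- a + d)%R[%classic); last first.
  by apply/seteqP; split => x /=; rewrite !in_itv/= => /andP[h1 h2]; apply/andP; split; lra.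
rewrite -integral_itv_obnd_cbnd; last first.
  apply/measurable_EFinP; apply: measurable_funTS; apply: measurableT_comp; first exact: measurable_logk.
  by apply: measurableT_comp => //; exact: measurable_funB.
rewrite -(logk_integral_right (- a) d2).
apply: eq_integral => x /set_mem/=; rewrite in_itv/= => /andP[ax _].
by rewrite -opprD normrN gtr0_norm ?opprK//; lra.
Qed.

Lemma integrable_logk_abs a :
  mu.-integrable (`](a - 2), (a + 2)] : set (measurableTypeR R)) (EFin \o (fun x => logk `|x - a|)).
Proof.
have t2 : 0 <= (2 : R) <= 2 by rewrite lexx ler0n.
have E (D : set R) : D `<=` `](a - 2), (a + 2)]%classic ->
    (\int[mu]_(x in D) `|(logk `|x - a|)%:E| = \int[mu]_(x in D) (logk `|x - a|)%:E)%E.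
  move=> Dsub; apply: eq_integral => x /set_mem/Dsub/=; rewrite in_itv/= => /andP[h1 h2].
  by rewrite ger0_norm// logk_ge0// normr_ge0 ler_norml; apply/andP; split; lra.
apply/integrableP; split; first by apply/measurable_EFinP; exact: measurable_logk_abs.
rewrite (@itv_bndbnd_setU _ _ _ (BRight a)) ?bnd_simp; [|lra..].
rewrite ge0_integral_setU//=.
- rewrite !E => [|x /=|x /=]; rewrite ?in_itv/=; last 2 first.
    by move=> /andP[h1 h2]; apply/andP; split; lra.
    by move=> /andP[h1 h2]; apply/andP; split; lra.
  by rewrite logk_abs_integral_left// logk_abs_integral_right// -EFinD ltry.
- by apply/measurable_EFinP; apply: measurableT_comp => //; exact: measurable_logk_abs.
- apply/disj_setPS => y [/=]; rewrite 2!in_itv/= => /andP[_ yx] /andP[].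
  by rewrite ltNge yx.
Qed.

(* The odd primitive of [logk `|y|] on [[-2, 2]]. *)
Definition logF y : R := y * logk `|y| + y.

Lemma logFN y : logF (- y) = - logF y.
Proof. by rewrite /logF normrN mulNr opprD. Qed.

Lemma logF_ge0 y : 0 <= y -> logF y = logG y.
Proof. by move=> y0; rewrite /logF ger0_norm. Qed.

(** All integrals starting at [a - 2] follow from the two one-sided ones at the singularity; the
    oddness of [logF] unites the cases left and right of [a]. *)
Lemma logk_abs_Rintegral a c d : a - 2 <= c <= d -> d <= a + 2 ->
  \int[mu]_(x in `]c, d]) logk `|x - a| = logF (d - a) - logF (c - a).
Proof.
move=> /andP[ac cd] da.
have t2 : 0 <= (2 : R) <= 2 by rewrite lexx ler0n.
pose H y := \int[mu]_(x in `](a - 2), y]) logk `|x - a|.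
have iH c' d' : a - 2 <= c' -> d' <= a + 2 ->
    mu.-integrable (`]c', d'] : set (measurableTypeR R)) (EFin \o (fun x => logk `|x - a|)).
  move=> h1 h2; apply: integrableS (integrable_logk_abs a) => //.
  by move=> x /=; rewrite !in_itv/= => /andP[h3 h4]; apply/andP; split; lra.
have HB y z : a - 2 <= y <= z -> z <= a + 2 ->
    \int[mu]_(x in `]y, z]) logk `|x - a| = H z - H y.
  move=> /andP[h1 h2] h3; rewrite /H.
  rewrite -(@Rintegral_itvB _ _ (BRight (a - 2)) (BRight z) y)//.
  exact: iH.
have HE y : a - 2 <= y <= a + 2 -> H y = logG 2 + logF (y - a).
  move=> /andP[h1 h2].
  have Ha : H a = logG 2 by rewrite /H /Rintegral logk_abs_integral_left.
  have [ya|ya] := leP a y.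
    have := HB a y; rewrite ya h2 => /(_ _ isT).
    have -> : a - 2 <= a by lra.
    move=> /(_ isT); rewrite /Rintegral -[in LHS](subrKC a y) logk_abs_integral_right; last first.
      by rewrite -opprB; apply/andP; split; lra.
    rewrite /= Ha logF_ge0 ?subr_ge0// -opprB; lra.
  have := HB y a; rewrite h1 (ltW ya) => /(_ isT).
  have -> : a <= a + 2 by lra.
  move=> /(_ isT); rewrite /Rintegral -[in `]y, a]](subKr a y) logk_abs_integral_left; last first.
    by apply/andP; split; lra.
  by rewrite /= Ha -(opprB a y) logFN logF_ge0 ?subr_ge0 ?(ltW ya)//; lra.
rewrite HB ?ac ?cd// !HE; [|apply/andP; split; lra|apply/andP; split; lra].
by rewrite opprD addrACA subrr add0r.
Qed.

End LogIntegrals.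

(** * Distribution functions and the functional of [L log L] *)

Section Distribution.
Variable R : realType.
Local Notation mu := (@lebesgue_measure R).
Implicit Types (f g : R -> R) (l d : R).

Lemma mu_I11 : mu I11 = 2%:E.
Proof.
rewrite /I11 lebesgue_measure_itv/= lte_fin ifT; last lra.
by rewrite -EFinB opprK.
Qed.

(** [fine] loses nothing, since subsets of [I11] have outer measure at most 2; [f] may be any
    function. *)
Definition dist f l : R := fine (mu (I11 `&` [set x | l < f x])).

Lemma mu_I11_le2 (A : set R) : (mu (I11 `&` A) <= 2%:E)%E.
Proof. by rewrite -mu_I11; apply: le_mu => x []. Qed.

Lemma mu_I11_fin (A : set R) : (mu (I11 `&` A) \is a fin_num)%E.
Proof.
by rewrite ge0_fin_numE ?mu_ge0// (le_lt_trans (mu_I11_le2 A))// ltry.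
Qed.

Lemma distE f l : mu (I11 `&` [set x | l < f x]) = (dist f l)%:E.
Proof. by rewrite fineK// mu_I11_fin. Qed.

Lemma dist_ge0 f l : 0 <= dist f l.
Proof. by rewrite fine_ge0// mu_ge0. Qed.

Lemma dist_le2 f l : dist f l <= 2.
Proof. by rewrite -lee_fin -distE mu_I11_le2. Qed.

Lemma dist_noninc f : nonincreasing_fun (dist f).
Proof.
move=> l l' ll'; rewrite -lee_fin -!distE; apply: le_mu => x [Ix /= h].
by split => //=; exact: le_lt_trans h.
Qed.

(* The error set is only required to be null for the outer measure. *)
Lemma dist_le_ae f g l l' : mu (I11 `&` [set x | (l < f x) && (g x <= l')]) = 0%E ->
  dist f l <= dist g l'.
Proof.
move=> N0; rewrite -lee_fin -!distE.
rewrite -[leRHS]add0e -N0; apply: (le_trans _ (mu_setU _ _)).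
apply: le_mu => x [Ix /= h]; have [gl|gl] := leP (g x) l'; [left|right]; split => //=.
by rewrite h.
Qed.

(** This is [d ln (2e/d) + d], the integral of [ln (2e/t)] over [0 < t < d]; hence its role as
    weight of the distribution function. *)
Definition Wf d : R := d + logG d.

Lemma Wf0 : Wf 0 = 0. Proof. by rewrite /Wf logG0 addr0. Qed.

Lemma logG_le d d' : 0 <= d -> d <= d' -> d' <= 2 -> logG d <= logG d'.
Proof.
move=> d0 dd' d2; rewrite -lee_fin.
have h1 : 0 <= d <= 2 by rewrite d0 (le_trans dd').
have h2 : 0 <= d' <= 2 by rewrite (le_trans d0).
rewrite -(logk_integral_right 0 h1) -(logk_integral_right 0 h2) !add0r.
apply: ge0_subset_integral => //.
- apply/measurable_EFinP; apply: measurable_funTS; apply: measurableT_comp.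
    exact: measurable_logk.
  exact: measurable_funB.
- move=> x /=; rewrite ?in_itv/= => /andP[x0 xd]; rewrite lee_fin logk_ge0// subr0.
  by rewrite (ltW x0) (le_trans (ltW xd)).
- by move=> x /=; rewrite !in_itv/= => /andP[-> h] /=; exact: lt_le_trans dd'.
Qed.

Lemma Wf_le d d' : 0 <= d -> d <= d' -> d' <= 2 -> Wf d <= Wf d'.
Proof. by move=> d0 dd' d2; rewrite lerD// logG_le. Qed.

Lemma Wf_ge0 d : 0 <= d -> d <= 2 -> 0 <= Wf d.
Proof. by move=> d0 d2; rewrite -Wf0 Wf_le. Qed.

Lemma Wf_ge d : 0 <= d -> d <= 2 -> 2 * d <= Wf d.
Proof.
move=> d0 d2; have : 0 <= d * logk d by rewrite mulr_ge0// logk_ge0// d0.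
by rewrite /Wf /logG; lra.
Qed.

Lemma Wf_dist_ge0 f l : 0 <= Wf (dist f l).
Proof. by rewrite Wf_ge0// ?dist_ge0 ?dist_le2. Qed.

Lemma measurable_dist f (D : set R) : measurable_fun D (dist f).
Proof. by apply: measurable_funTS; apply: nonincreasing_measurable => //; exact: dist_noninc. Qed.

Lemma measurable_Wf_dist f (D : set R) : measurable_fun D (fun l => (Wf (dist f l))%:E).
Proof.
apply/measurable_EFinP; apply: measurable_funTS.
apply: nonincreasing_measurable => // x y xy.
by apply: Wf_le; [exact: dist_ge0|exact: dist_noninc|exact: dist_le2].
Qed.

Definition Phi f : \bar R := (\int[mu]_(l in `]0%R, +oo[) (Wf (dist f l))%:E)%E.

Lemma Phi_ge0 f : (0 <= Phi f)%E.
Proof. by apply: integral_ge0 => l _; rewrite lee_fin Wf_dist_ge0. Qed.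

Lemma Phi_le f g : (forall l, 0 < l -> dist f l <= dist g l) -> (Phi f <= Phi g)%E.
Proof.
move=> fg; apply: ge0_le_integral => //.
- by move=> l _; rewrite lee_fin Wf_dist_ge0.
- exact: measurable_Wf_dist.
- exact: measurable_Wf_dist.
- move=> l /=; rewrite ?in_itv/= andbT => l0.
  by rewrite lee_fin Wf_le ?dist_ge0 ?dist_le2 ?fg.
Qed.

(* Stein and Weiss' tail bound, integrated over the levels [(0, E]], [(E, 2]]
   and [(2, oo)], where it is used through [2], [4 E / l] and [8 E exp (- l)]. *)
Lemma integral_tail_bound (D : R -> R) (E : R) : 0 < E -> E <= 2 ->
  nonincreasing_fun D -> (forall l, 0 < l -> 0 <= D l <= 2) ->
  (forall l, 0 < l -> D l <= 4 * E / (expR l - 1)) ->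
  (\int[mu]_(l in `]0%R, +oo[) (D l)%:E <= (5 * Wf E)%:E)%E.
Proof.
move=> E0 E2 Dni D02 DE.
have mD (A : set R) : measurable_fun A (fun l => (D l)%:E).
  by apply/measurable_EFinP; apply: measurable_funTS; exact: nonincreasing_measurable.
have D0 x : 0 < x -> (0 <= (D x)%:E)%E by move=> /D02/andP[].
rewrite (@itv_bndbnd_setU _ _ _ (BRight E)) ?bnd_simp//; last exact: ltW.
rewrite ge0_integral_setU//=; last 2 first.
- move=> x [|]; rewrite /= ?in_itv/= ?andbT; first by move=> /andP[h _]; exact: D0.
  by move=> h; apply: D0; exact: lt_trans h.
- apply/disj_setPS => y [/=]; rewrite ?in_itv/= => /andP[_ yx] /andP[].
  by rewrite ltNge yx.
rewrite (@itv_bndbnd_setU _ _ (BRight E) (BRight 2)) ?bnd_simp//.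
rewrite ge0_integral_setU//=; last 2 first.
- move=> x [|]; rewrite /= ?in_itv/= ?andbT.
    by move=> /andP[h _]; apply: D0; exact: lt_trans h.
  by move=> h; apply: D0; apply: lt_trans h.
- apply/disj_setPS => y [/=]; rewrite ?in_itv/= => /andP[_ yx] /andP[].
  by rewrite ltNge yx.
have b1 : (\int[mu]_(l in `]0%R, E]) (D l)%:E <= (2 * E)%:E)%E.
  apply: (@le_trans _ _ (\int[mu]_(l in `]0%R, E]) (2 : R)%:E)%E).
    apply: ge0_le_integral => //.
    - by move=> x /=; rewrite ?in_itv/= => /andP[/D02/andP[+ _] _]; rewrite lee_fin.
    - exact: mD.
    - by move=> x /=; rewrite ?in_itv/= => /andP[/D02/andP[_ +] _]; rewrite lee_fin.
  by rewrite integral_cst//= lebesgue_measure_itv/= lte_fin E0 -EFinB subr0 -EFinM.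
have b2 : (\int[mu]_(l in `]E, 2%R]) (D l)%:E <= (4 * E * logk E)%:E)%E.
  have FTC : (\int[mu]_(l in `[E, 2%R]) (4 * E * l^-1)%:E = (4 * E * logk E)%:E)%E.
    apply: (etrans (@FTC_closed _ (fun l => 4 * E * l^-1) (fun l => 4 * E * ln l) E 2 E2 _ _));
      last by rewrite /logk mulrBr.
    - move=> x /andP[Ex _]; have x0 : 0 < x by exact: lt_le_trans Ex.
      have := is_deriveZ (4 * E) (is_derive1_ln x0).
      exact.
    - move=> x /andP[Ex _]; have x0 : 0 < x by exact: lt_le_trans Ex.
      by apply: cvgMr; apply: cvgV; rewrite ?gt_eqF//; exact: cvg_id.
  rewrite -FTC integral_itv_obnd_cbnd//.
  have mI : measurable_fun (`[E, 2]%classic : set (measurableTypeR R)) (fun l : R => (4 * E * l^-1)%:E).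
    apply/measurable_EFinP; apply: subspace_continuous_measurable_fun => //.
    apply: continuous_in_subspaceT => x; rewrite inE/= in_itv/= => /andP[Ex _].
    have x0 : 0 < x by exact: lt_le_trans Ex.
    by apply: cvgMr; apply: cvgV; rewrite ?gt_eqF//; exact: cvg_id.
  apply: ge0_le_integral => //.
  - move=> x /=; rewrite ?in_itv/= => /andP[h _].
    by have /andP[] := D02 _ (lt_le_trans E0 h); rewrite lee_fin.
  - exact: mD.
  - move=> x /=; rewrite ?in_itv/= => /andP[h _]; have x0 := lt_le_trans E0 h.
    rewrite lee_fin (le_trans (DE _ x0))// ler_wpM2l ?mulr_ge0 ?(ltW E0)//.
    have := expR_ge1Dx x.
    by rewrite lef_pV2 ?posrE// ?subr_gt0 ?expR_gt1//; lra.
have b3 : (\int[mu]_(l in `]2%R, +oo[) (D l)%:E <= (8 * E)%:E)%E.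
  apply: (@le_trans _ _ (\int[mu]_(l in `[0%R, +oo[) (8 * E * expR (- l))%:E)%E).
    have mX (A : set R) : measurable_fun A (fun l => (8 * E * expR (- l))%:E).
      apply/measurable_EFinP; apply: measurable_funTS; apply: measurable_funM => //.
      by apply: measurableT_comp.
    apply: (@le_trans _ _ (\int[mu]_(l in `]2%R, +oo[) (8 * E * expR (- l))%:E)%E).
      apply: ge0_le_integral => //.
      - move=> x /=; rewrite ?in_itv/= andbT => h.
        by apply: D0; apply: lt_trans h.
      - exact: mD.
      - exact: mX.
      - move=> x /=; rewrite ?in_itv/= andbT => h; have x0 : 0 < x by apply: lt_trans h.
        rewrite lee_fin (le_trans (DE _ x0))//.
        have h1 : expR x / 2 <= expR x - 1 by have := expR_ge1Dx x; lra.
        have -> : 8 * E * expR (- x) = 4 * E / (expR x / 2).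
          by rewrite expRN invfM invrK; ring.
        rewrite ler_wpM2l ?mulr_ge0 ?(ltW E0)// lef_pV2// ?posrE ?divr_gt0 ?expR_gt0//.
        by rewrite subr_gt0 expR_gt1.
    apply: ge0_subset_integral => //.
    - exact: mX.
    - by move=> x _; rewrite lee_fin mulr_ge0 ?expR_ge0// mulr_ge0// ltW.
    - by move=> x /=; rewrite !in_itv/= !andbT => h; rewrite ltW// (lt_trans _ h).
  have hd (x : R) : is_derive x 1 (fun l : R => - (8 * E * expR (- l))) (8 * E * expR (- x)).
    have h := @is_derive1_comp _ (@expR R) (fun x => - x) x _ _ (is_derive_expR _) (is_deriveNid x 1).
    have := is_deriveN (is_deriveZ (8 * E) h).
    by move/is_derive_eq; apply; rewrite /GRing.scale/= mulrN1 mulrN opprK.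
  rewrite (@ge0_continuous_FTC2y _ _ (fun l => - (8 * E * expR (- l))) _ 0)//.
  - by rewrite oppr0 expR0 mulr1 sub0e -EFinN opprK.
  - by move=> x _; rewrite mulr_ge0 ?expR_ge0// mulr_ge0// ltW.
  - apply: continuous_subspaceT => x; apply: cvgMr.
    by apply: continuous_comp; [exact: continuousN|exact: continuous_expR].
  - by rewrite -oppr0; apply: cvgN; rewrite -(mulr0 (8 * E)); apply: cvgMr; exact: cvgr_expR.
  - apply: cvg_at_right_filter; apply: cvgN; apply: cvgMr.
    by apply: continuous_comp; [exact: continuousN|exact: continuous_expR].
  - by move=> x _; rewrite derive1E; case: (hd x).
(* The three ranges give [10 E + 4 E logk E], while [Wf E] is [2 E + E logk E]. *)
have : (2 * E + (4 * E * logk E + 8 * E)) <= 5 * Wf E.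
  have k0 : 0 <= E * logk E by rewrite mulr_ge0 ?(ltW E0)// logk_ge0// (ltW E0).
  by rewrite /Wf /logG -[4 * E * logk E]mulrA; lra.
rewrite -lee_fin; apply: le_trans; rewrite !EFinD; apply: leeD => //.
- exact: leeD.
- exact: mD.
- exact: mD.
Qed.

Lemma integral_dist f : measurable_fun I11 f -> (forall x, 0 <= f x) ->
  (\int[mu]_(x in I11) (f x)%:E = \int[mu]_(l in `]0%R, +oo[) (dist f l)%:E)%E.
Proof.
move=> mf f0.
transitivity (\int[mu]_(x in I11) (Num.max (f x - 0) 0)%:E)%E.
  by apply: eq_integral => x _; rewrite subr0; congr _%:E; apply/esym/max_idPl.
rewrite (@layer_cake _ (measurableTypeR R) R mu I11 f 0 (measurable_itv _) mf).
by apply: eq_integral => l _; exact: distE.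
Qed.

Lemma measurable_logsum s (D : set R) : measurable_fun D (logsum s).
Proof.
apply: measurable_funTS; apply: measurable_sum => p; apply: measurable_funB;
  by apply: measurableT_comp => //; apply: measurableT_comp => //; apply: measurable_funB.
Qed.

Lemma logsum_L1 s : intervals s -> \sum_(p <- s) (p.2 - p.1) <= 2 ->
  (\int[mu]_(x in I11) `|logsum s x|%:E <=
    (5 * Wf (\sum_(p <- s) (p.2 - p.1))%R)%:E)%E.
Proof.
move=> si s2.
have [->|s0] := eqVneq s [::].
  rewrite big_nil Wf0 mulr0 integral0_eq// => x _.
  by rewrite /logsum big_nil normr0.
have Epos : 0 < \sum_(p <- s) (p.2 - p.1).
  case: s s0 si {s2} => // p s _ /intervals_cons[pp _ ps _].
  rewrite big_cons ltr_pwDl ?subr_gt0// big_seq sumr_ge0// => q /ps.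
  by rewrite subr_ge0 => /ltW.
have mL : measurable_fun I11 (fun x => `|logsum s x|).
  by apply: measurableT_comp => //; exact: measurable_logsum.
rewrite (_ : (\int[mu]_(x in I11) _)%E =
    (\int[mu]_(l in `]0%R, +oo[) (dist (fun x => `|logsum s x|) l)%:E)%E); last first.
  exact: integral_dist.
apply: integral_tail_bound => //.
- exact: dist_noninc.
- by move=> l _; rewrite dist_ge0 dist_le2.
- move=> l l0; rewrite -lee_fin -distE; apply: le_trans (stein_weiss si l0).
  by apply: le_mu => x [].
Qed.

End Distribution.

(** * Step functions *)

Section StepFunctions.
Variable R : realType.
Local Notation mu := (@lebesgue_measure R).
Implicit Types (s : seq (R * R * R)) (x t l : R).

Lemma measurable_inv (D : set R) : measurable_fun D (@GRing.inv R).
Proof.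
apply: measurable_funTS; rewrite -(setvU [set (0 : R)]).
apply/measurable_funU => //; first exact: measurableC.
split; last exact: measurable_fun_set1.
apply: open_continuous_measurable_fun.
  by apply: closed_openC; apply: accessible_closed_set1; apply: hausdorff_accessible; exact: Rhausdorff.
by move=> x /set_mem/= x0; apply: cvgV; [exact/eqP|exact: cvg_id].
Qed.

Definition stepf s x : R := \sum_(p <- s) p.2 * (p.1.1 < x <= p.1.2)%R%:R.
(** The transform of [stepf s] without the factor [1/pi]: the principal value of the integral of
    [1/(y - x)] over a cell is the difference of the logarithms of the distances to its ends. *)
Definition stepH s x : R := \sum_(p <- s) p.2 * (ln `|p.1.2 - x| - ln `|p.1.1 - x|).
Definition mass s : R := \sum_(p <- s) `|p.2| * (p.1.2 - p.1.1).
Definition wf s : bool := intervals [seq p.1 | p <- s].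
(** Cells of length [d <= 1] keep the distances up to [2 * d] in the range where [logk] is
    nonnegative. *)
Definition narrow s : bool := all (fun p => p.1.2 - p.1.1 <= 1) s.

Lemma measurable_stepH s (D : set R) : measurable_fun D (stepH s).
Proof.
apply: measurable_funTS; apply: measurable_sum => p; apply: measurable_funM => //.
by apply: measurable_funB; apply: measurableT_comp => //; apply: measurableT_comp => //; apply: measurable_funB.
Qed.

Lemma wf_cons p s : wf (p :: s) ->
  [/\ p.1.1 < p.1.2, forall q : R * R * R, q \in s -> p.1.2 <= q.1.1,
      forall q : R * R * R, q \in s -> q.1.1 < q.1.2 & wf s].
Proof.
rewrite /wf /= => /intervals_cons[h1 h2 h3 h4]; split => //.
  by move=> q qs; apply: h2; apply/mapP; exists q.
by move=> q qs; apply: h3; apply/mapP; exists q.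
Qed.

Lemma wf_lt s (p : R * R * R) : wf s -> p \in s -> p.1.1 < p.1.2.
Proof.
by case: s => // q s /wf_cons[h _ h' _]; rewrite inE => /predU1P[->|/h'].
Qed.

Lemma wf_overlap s (p q : R * R * R) x : wf s -> p \in s -> q \in s ->
  p.1.1 < x < p.1.2 -> q.1.1 < x < q.1.2 -> p.1 = q.1.
Proof.
elim: s => // r s IH /wf_cons[h1 h2 h3 /IH{}IH].
rewrite !inE => /predU1P[->|ps] /predU1P[->|qs]//.
- by move=> /andP[_ h4] /andP[h5 _]; have h6 := h2 _ qs; exfalso; lra.
- by move=> /andP[h5 _] /andP[_ h4]; have h6 := h2 _ ps; exfalso; lra.
- exact: IH.
Qed.

Definition pole (th : R) (p : R * R) : R := p.1 + th * (p.2 - p.1).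

(** The error made by concentrating a cell in one point mass, cut off where the point mass is not
    integrable. The two terms are added because the transform of the cell is close to minus
    [(p.2 - p.1) / (x - pole th p)]. *)
Definition pole_err th (p : R * R) x : R :=
  `|ln `|p.2 - x| - ln `|p.1 - x| + (p.2 - p.1) / (x - pole th p)|
    * ((p.2 - p.1) / 4 <= `|x - pole th p|)%R%:R.

Lemma pole_err_ge0 th p x : 0 <= pole_err th p x.
Proof. by rewrite /pole_err mulr_ge0. Qed.

Lemma measurable_pole_err th p (D : set R) : measurable_fun D (pole_err th p).
Proof.
apply: measurable_funTS; apply: measurable_funM.
  apply: measurableT_comp => //; apply: measurable_funD.
    by apply: measurable_funB; apply: measurableT_comp => //; apply: measurableT_comp => //; apply: measurable_funB.
  apply: measurable_funM => //; apply: measurableT_comp; first exact: measurable_inv.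
  exact: measurable_funB.
rewrite (_ : (fun x => _) = (fun x => if (p.2 - p.1) / 4 <= `|x - pole th p| then 1 else 0)); last first.
  by apply/funext => x; case: ifPn.
apply: measurable_fun_ifT => //; apply: measurable_fun_ler => //.
by apply: measurableT_comp => //; exact: measurable_funB.
Qed.

(** The integrand is at most [logk |x - m| - logk (2 d) + ln 2], and the integral of this bound over
    each half is [2 d (1 + ln 2)], at most [4 d]. *)
Lemma integral_logratio m d : 0 < d -> d <= 1 ->
  (\int[mu]_(x in `](m - 2 * d)%R, (m + 2 * d)%R]) `|ln `|m - x| - ln d|%:E <= (8 * d)%:E)%E.
Proof.
move=> d0 d1; pose f x := `|ln `|m - x| - ln d|.
have mf (D : set R) : measurable_fun D (fun x => (f x)%:E).
  apply/measurable_EFinP; apply: measurable_funTS; apply: measurableT_comp => //.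
  by apply: measurable_funB => //; apply: measurableT_comp => //; apply: measurableT_comp => //; apply: measurable_funB.
have d2 : 0 <= 2 * d <= 2 by apply/andP; split; lra.
have ld : ln (2 * d) = ln 2 + ln d by rewrite lnM ?posrE.
have fb x : x != m -> `|x - m| <= 2 * d -> f x <= logk `|x - m| - logk (2 * d) + ln 2.
  move=> xm xd; rewrite /f (distrC m) /logk.
  have x0 : 0 < `|x - m| by rewrite normr_gt0 subr_eq0.
  have h1 : ln `|x - m| <= ln (2 * d) by rewrite ler_ln ?posrE// mulr_gt0.
  have h2 : 0 <= ln 2 :> R by rewrite ln_ge0// ler1n.
  by rewrite ler_norml; apply/andP; split; lra.
have ln2 : ln 2 <= 1 :> R.
  by have := @le_ln1Dx R 1; rewrite -[1 + 1]/(2 : R); apply; lra.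
have ln0 : 0 <= ln 2 :> R by rewrite ln_ge0// ler1n.
have half (D : set (measurableTypeR R)) : measurable D ->
    (forall x, D x -> x != m /\ `|x - m| <= 2 * d) ->
    mu D = (2 * d)%:E ->
    (\int[mu]_(x in D) (logk `|x - m|)%:E = (logG (2 * d))%:E)%E ->
    (\int[mu]_(x in D) (f x)%:E <= (4 * d)%:E)%E.
  move=> mD Dx muD kD.
  have k0 x : D x -> 0 <= logk `|x - m| - logk (2 * d).
    move=> /Dx[xm xd]; rewrite /logk; have x0 : 0 < `|x - m| by rewrite normr_gt0 subr_eq0.
    have : ln `|x - m| <= ln (2 * d) by rewrite ler_ln ?posrE// mulr_gt0.
    lra.
  have mk (D' : set R) : measurable_fun D' (fun x => (logk `|x - m|)%:E).
    by apply/measurable_EFinP; exact: measurable_logk_abs.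
  (* The constant [logk (2 * d)] stands on the left because the comparison is between integrals in
     [\bar R], not yet known to be finite. *)
  have E1 : (\int[mu]_(x in D) (f x)%:E + (2 * d * (logk (2 * d)))%:E <=
      (logG (2 * d))%:E + (2 * d * ln 2)%:E)%E.
    have lk : 0 <= logk (2 * d) by rewrite logk_ge0.
    rewrite -kD [X in (_ + X <= _)%E](_ : _ = \int[mu]_(x in D) (logk (2 * d))%:E)%E; last first.
      by rewrite integral_cst//= muD -EFinM mulrC.
    rewrite [X in (_ <= _ + X)%E](_ : _ = \int[mu]_(x in D) (ln 2)%:E)%E; last first.
      by rewrite integral_cst//= muD -EFinM mulrC.
    have f0 x : D x -> (0 <= (f x)%:E)%E by rewrite lee_fin /f.
    have kk0 x : D x -> (0 <= (logk `|x - m|)%:E)%E.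
      by move=> /Dx[_ h]; rewrite lee_fin logk_ge0// normr_ge0 (le_trans h)//; have /andP[] := d2.
    have mfD := mf D; have mkD := mk D.
    rewrite -!ge0_integralD//.
    apply: ge0_le_integral => //.
    - by move=> x Dx'; rewrite adde_ge0// ?f0// lee_fin.
    - exact: emeasurable_funD.
    - exact: emeasurable_funD.
    - move=> x /Dx[xm xd]; rewrite -!EFinD lee_fin.
      by have := fb x xm xd; lra.
  move: E1; rewrite /logG.
  have [-> //|Ffin] := eqVneq (\int[mu]_(x in D) (f x)%:E)%E +oo%E.
  have : (\int[mu]_(x in D) (f x)%:E)%E \is a fin_num.
    rewrite ge0_fin_numE; first by rewrite lt_neqAle Ffin leey.
    by apply: integral_ge0 => x _; rewrite lee_fin /f.
  move=> /fineK <-; rewrite -!EFinD !lee_fin.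
  have : 2 * d * ln 2 <= 2 * d * 1 by rewrite ler_wpM2l//; lra.
  move: (fine _) => I; lra.
rewrite (@itv_bndbnd_setU _ _ _ (BLeft m)) ?bnd_simp; [|lra..].
rewrite ge0_integral_setU//=; last first.
- apply/disj_setPS => y [/=]; rewrite ?in_itv/= => /andP[_ yx] /andP[].
  by rewrite leNgt yx.
- exact: mf.
rewrite -integral_itv_obnd_cbnd; last exact: mf.
have -> : 8 * d = 4 * d + 4 * d by lra.
rewrite EFinD; apply: leeD; apply: half => //.
- by move=> x /=; rewrite in_itv/= => /andP[h1 h2]; rewrite lt_eqF// ler_norml; split => //; apply/andP; split; lra.
- rewrite lebesgue_measure_itv/= lte_fin ifT -?EFinB; last lra.
  by congr _%:E; lra.
- rewrite -(logk_abs_integral_left m d2) integral_itv_bndo_bndc//.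
  by apply/measurable_EFinP; exact: measurable_logk_abs.
- by move=> x /=; rewrite in_itv/= => /andP[h1 h2]; rewrite gt_eqF// ler_norml; split => //; apply/andP; split; lra.
- rewrite lebesgue_measure_itv/= lte_fin ifT -?EFinB; last lra.
  by congr _%:E; lra.
- exact: logk_abs_integral_right.
Qed.

Lemma integral_inv_sqr (b d : R) : 0 < d ->
  (\int[mu]_(x in `[(b + d)%R, +oo[) (d ^+ 2 * (x - b) ^- 2)%:E = d%:E)%E.
Proof.
move=> d0.
have hd (x : R) : b + d <= x ->
    is_derive x 1 (fun x : R => - (d ^+ 2 * (x - b)^-1)) (d ^+ 2 * (x - b) ^- 2).
  move=> bx; have xb : x - b != 0 by rewrite gt_eqF// subr_gt0; lra.
  have h1 : is_derive x 1 (fun x : R => x - b) 1.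
    by have := is_deriveB (is_derive_id x 1) (is_derive_cst b x 1); rewrite subr0.
  have h2 := @is_deriveV _ (fun x => x - b) x 1 _ xb h1.
  have := is_deriveN (is_deriveZ (d ^+ 2) h2).
  by move/is_derive_eq; apply; rewrite /GRing.scale/= mulr1 mulrN opprK.
have ci (x : R) : b + d <= x -> {for x, continuous (fun x => (x - b)^-1)}.
  move=> bx; apply: cvgV; first by rewrite gt_eqF// subr_gt0; lra.
  by apply: cvgB; [exact: cvg_id|exact: cvg_cst].
rewrite (@ge0_continuous_FTC2y _ _ (fun x => - (d ^+ 2 * (x - b)^-1)) _ 0).
- have -> : b + d - b = d by lra.
  by rewrite expr2 mulfK ?gt_eqF// sub0e -EFinN opprK.
- by move=> x _; rewrite mulr_ge0// ?invr_ge0 ?sqr_ge0.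
- apply: continuous_in_subspaceT => x; rewrite inE/= in_itv/= andbT => bx.
  apply: cvgMr; rewrite -exprVn; under eq_fun do rewrite -exprVn expr2.
  by rewrite expr2; apply: cvgM; exact: ci.
- rewrite -oppr0; apply: cvgN; rewrite -(mulr0 (d ^+ 2)); apply: cvgMr.
  apply/gtr0_cvgV0; first by near=> x; rewrite subr_gt0; near: x; apply: nbhs_pinfty_gt; rewrite num_real.
  apply/cvgryPge => A; near=> x; rewrite lerBrDr; near: x; apply: nbhs_pinfty_ge; exact: num_real.
- by move=> x bx; case: (hd x (ltW bx)).
- by apply: cvg_at_right_filter; apply: cvgN; apply: cvgMr; exact: ci.
- by move=> x; rewrite in_itv/= andbT => bx; rewrite derive1E; case: (hd x (ltW bx)).
Unshelve. all: by end_near. Qed.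

(** With [u = x - p.2] and [d] the length of the cell, the logarithm of [(u + d)/u] and the pole
    term both lie between [d/(u + d)] and [d/u], two numbers that differ by at most [d^2/u^2]. *)
Lemma pole_err_far th p x : 0 <= th <= 1 -> p.1 < p.2 -> p.2 + (p.2 - p.1) <= x ->
  pole_err th p x <= (p.2 - p.1) ^+ 2 * (x - p.2) ^- 2.
Proof.
case: p => a b /= /andP[th0 th1] ab; set d := b - a => bx.
have d0 : 0 < d by rewrite subr_gt0.
set u := x - b; have u0 : 0 < u by rewrite /u; lra.
have bxE : `|b - x| = u by rewrite distrC gtr0_norm.
have axE : `|a - x| = u + d by rewrite distrC gtr0_norm ?/u ?/d; lra.
have thd : 0 <= th * d <= d by rewrite mulr_ge0 ?(ltW d0)//= ler_piMl// ltW.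
have v0 : u <= x - pole th (a, b) <= u + d.
  by rewrite /pole/= -/d; move: thd => /andP[h1 h2]; apply/andP; split; rewrite /u; move: h1 h2; rewrite /d; lra.
have /andP[v1 v2] := v0; set v := x - pole th (a, b) in v1 v2 *.
have v00 : 0 < v by exact: lt_le_trans v1.
have ud : 0 < u + d by lra.
have L1 : ln u - ln (u + d) <= - (d / (u + d)).
  rewrite -ln_div ?posrE//.
  have -> : u / (u + d) = 1 + - (d / (u + d)) by field; rewrite gt_eqF.
  apply: le_ln1Dx; rewrite ltrN2 ltr_pdivrMr//; lra.
have L2 : ln (u + d) - ln u <= d / u.
  rewrite -ln_div ?posrE//.
  have -> : (u + d) / u = 1 + d / u by field; rewrite gt_eqF.
  by apply: le_ln1Dx; apply: (@lt_le_trans _ _ 0); [lra|rewrite divr_ge0 ?ltW].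
have D1 : d / v <= d / u by rewrite ler_wpM2l ?(ltW d0)// lef_pV2 ?posrE.
have D2 : d / (u + d) <= d / v by rewrite ler_wpM2l ?(ltW d0)// lef_pV2 ?posrE.
have D3 : d / u - d / (u + d) <= d ^+ 2 * u ^- 2.
  have -> : d / u - d / (u + d) = d ^+ 2 * (u^-1 * (u + d)^-1) by field; rewrite !gt_eqF.
  rewrite ler_wpM2l ?sqr_ge0// expr2 invfM ler_wpM2l ?invr_ge0 ?(ltW u0)//.
  by rewrite lef_pV2 ?posrE//; lra.
rewrite /pole_err /= bxE axE -/d -/v.
apply: le_trans D3; rewrite -[leRHS]mulr1.
apply: ler_pM => //; last by rewrite -[leRHS]/(1%:R) ler_nat leq_b1.
by rewrite ler_norml; apply/andP; split; lra.
Qed.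

Lemma pole_errN th (p : R * R) x :
  pole_err th p (- x) = pole_err (1 - th) (- p.2, - p.1) x.
Proof.
case: p => a b; rewrite /pole_err /=.
have -> : pole (1 - th) (- b, - a) = - pole th (a, b) by rewrite /pole/=; ring.
have -> : - a - - b = b - a by ring.
rewrite !opprK -normrN; congr (_ * _).
  rewrite [X in `|X|](_ : _ = ln `|- a - x| - ln `|- b - x| + (b - a) / (x + pole th (a, b)))//.
  have -> : `|b + x| = `|- b - x| by rewrite -normrN; congr `|_|; ring.
  have -> : `|a + x| = `|- a - x| by rewrite -normrN; congr `|_|; ring.
  by rewrite -[- x - _]opprD invrN mulrN; ring.
by rewrite -[- x - _]opprD normrN.
Qed.

(** 30 is 1 + 28 + 1. Each far side contributes [d]. The middle stretch has length [3 d]; there each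
    endpoint logarithm, compared with [ln d], contributes [8 d], and the pole term is at most 4
    thanks to the cut-off, which gives [12 d]. *)
Lemma pole_err_L1 th p : 0 <= th <= 1 -> p.1 < p.2 -> p.2 - p.1 <= 1 ->
  (\int[mu]_x (pole_err th p x)%:E <= (30 * (p.2 - p.1))%:E)%E.
Proof.
move=> th01 ab d1; set d := p.2 - p.1; have d0 : 0 < d by rewrite subr_gt0.
have far th' q : 0 <= th' <= 1 -> q.1 < q.2 ->
    (\int[mu]_(x in `[(q.2 + (q.2 - q.1))%R, +oo[) (pole_err th' q x)%:E <= (q.2 - q.1)%:E)%E.
  move=> th'01 q12; rewrite -(integral_inv_sqr q.2 (_ : 0 < q.2 - q.1)) ?subr_gt0//.
  apply: ge0_le_integral => //.
  - by move=> x _; rewrite lee_fin pole_err_ge0.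
  - by apply/measurable_EFinP; exact: measurable_pole_err.
  - apply/measurable_EFinP; apply: measurable_funM => //.
    apply: measurableT_comp; first exact: measurable_inv.
    by apply: measurable_funX; exact: measurable_funB.
  - by move=> x /=; rewrite in_itv/= andbT lee_fin => h; exact: pole_err_far.
have mP th' q (D : set R) : measurable_fun D (fun x => (pole_err th' q x)%:E).
  by apply/measurable_EFinP; exact: measurable_pole_err.
have P0 th' q x : (0 <= (pole_err th' q x)%:E)%E by rewrite lee_fin pole_err_ge0.
have -> : [set: R] = `]-oo, (p.1 - d)[%classic `|` (`[(p.1 - d), (p.2 + d)[%classic `|` `[(p.2 + d), +oo[%classic).
  apply/seteqP; split => // x _ /=; rewrite !in_itv/= andbT.
  have [h1|h1] := ltP x (p.1 - d); first by left.
  by right; have [h2|h2] := ltP x (p.2 + d); [left|right].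
rewrite ge0_integral_setU//=; [|exact: measurableU|exact: mP|]; last first.
  apply/disj_setPS => y [/=]; rewrite ?in_itv/= => h [/andP[h' _]|]; first by move: h; rewrite ltNge h'.
  by rewrite andbT /d => h'; exfalso; move: h h'; rewrite /d; lra.
rewrite ge0_integral_setU//=; [|exact: mP|]; last first.
  apply/disj_setPS => y [/=]; rewrite ?in_itv/= => /andP[_ h]; rewrite andbT => h'.
  by move: h; rewrite ltNge h'.
have -> : 30 * d = d + (28 * d + d) by ring.
rewrite !EFinD; apply: leeD; last apply: leeD; last exact: far.
  rewrite ge0_integral_opp//; last exact: mP.
  rewrite (_ : _ @^-1` _ = `]- p.1 + d, +oo[%classic); last first.
    by apply/seteqP; split => x /=; rewrite !in_itv/= ?andbT; lra.
  rewrite (_ : (\int[mu]_(x in _) _)%E = (\int[mu]_(x in `](- p.1 + d)%R, +oo[)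
      (pole_err (1 - th) (- p.2, - p.1) x)%:E)%E); last first.
    by apply: eq_integral => x _; rewrite pole_errN.
  rewrite integral_itv_obnd_cbnd; last exact: mP.
  have := far (1 - th) (- p.2, - p.1); rewrite /=.
  have -> : - p.1 - - p.2 = d by rewrite /d; ring.
  by apply; [move: th01 => /andP[h1 h2]; apply/andP; split; lra|rewrite ltrN2].
pose g x := (`|ln `|p.2 - x| - ln d|%:E + (`|ln `|p.1 - x| - ln d|%:E + 4%:E))%E.
have mln m (D : set R) : measurable_fun D (fun x => (`|ln `|m - x| - ln d|)%:E).
  apply/measurable_EFinP; apply: measurable_funTS; apply: measurableT_comp => //.
  by apply: measurable_funB => //; apply: measurableT_comp => //; apply: measurableT_comp => //; apply: measurable_funB.
apply: (@le_trans _ _ (\int[mu]_(x in `[(p.1 - d)%R, (p.2 + d)%R[) g x)%E).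
  apply: ge0_le_integral => //.
  - exact: mP.
  - apply: emeasurable_funD; first exact: mln.
    by apply: emeasurable_funD; first exact: mln.
  - move=> x _; rewrite /g -!EFinD lee_fin /pole_err.
    have [h|h] := leP ((p.2 - p.1) / 4) (`|x - pole th p|); last by rewrite mulr0 addr_ge0// addr_ge0.
    rewrite mulr1 (le_trans (ler_normD _ _))// addrA; apply: lerD.
      have -> : ln `|p.2 - x| - ln `|p.1 - x| = (ln `|p.2 - x| - ln d) - (ln `|p.1 - x| - ln d) by ring.
      exact: ler_normB.
    rewrite normrM normfV (gtr0_norm d0) ler_pdivrMr; first by move: h; rewrite -/d; lra.
    by apply: lt_le_trans h; rewrite divr_gt0.
have nearb m : p.1 <= m <= p.2 -> (\int[mu]_(x in `[(p.1 - d)%R, (p.2 + d)%R[) `|ln `|m - x| - ln d|%:E <= (8 * d)%:E)%E.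
  move=> /andP[m1 m2]; apply: le_trans (integral_logratio m d0 d1).
  rewrite -integral_itv_obnd_cbnd; last exact: mln.
  apply: ge0_subset_integral => //.
  - exact: mln.
  - by move=> x /=; rewrite !in_itv/= => /andP[h1 h2]; apply/andP; split; move: h1 h2; rewrite /d; lra.
rewrite /g ge0_integralD//; last 3 first.
- exact: mln.
- by move=> x _; rewrite adde_ge0.
- by apply: emeasurable_funD; first exact: mln.
rewrite ge0_integralD//; last exact: mln.
have -> : (28 * d)%:E = ((8 * d)%:E + ((8 * d)%:E + (12 * d)%:E))%E.
  by rewrite -!EFinD; congr _%:E; ring.
apply: leeD; first by apply: nearb; rewrite lexx ltW.
apply: leeD; first by apply: nearb; rewrite lexx ltW.
rewrite integral_cst//= lebesgue_measure_itv/= lte_fin ifT; last by rewrite /d; lra.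
by rewrite -EFinB -EFinM lee_fin /d; lra.
Qed.

End StepFunctions.

(** * Weak type (1,1) on step functions *)

Section WeakType.
Variable R : realType.
Local Notation mu := (@lebesgue_measure R).
Implicit Types (s : seq (R * R * R)) (x t l : R).

Lemma measurable_stepf s (D : set R) : measurable_fun D (stepf s).
Proof.
apply: measurable_funTS; apply: measurable_sum => p; apply: measurable_funM => //.
rewrite (_ : (fun x => _) = \1_(`]p.1.1, p.1.2]%classic : set R)); last first.
  apply/funext => x; rewrite indicE; congr ((nat_of_bool _)%:R).
  by apply/idP/idP => [h|/set_mem/=]; rewrite ?inE/= ?in_itv.
exact: measurable_indic.
Qed.

Lemma normr_stepf s x : wf s ->
  `|stepf s x| = \sum_(p <- s) `|p.2| * (p.1.1 < x <= p.1.2)%R%:R.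
Proof.
elim: s => [|p s IH]; first by rewrite /stepf !big_nil normr0.
move=> /wf_cons[h1 h2 h3 /IH{}IH]; rewrite /stepf !big_cons.
case xp : (p.1.1 < x <= p.1.2).
  have z q : q \in s -> (q.1.1 < x <= q.1.2) = false.
    by move=> /h2 h; move: xp => /andP[_ h4]; apply/negbTE; rewrite negb_and -leNgt (le_trans h4 h).
  rewrite [X in _ + X]big_seq big1 ?addr0; last by move=> q /z ->; rewrite mulr0.
  rewrite [X in _ = _ + X]big_seq big1 ?addr0; last by move=> q /z ->; rewrite mulr0.
  by rewrite !mulr1.
by rewrite !mulr0 !add0r IH.
Qed.

Lemma integral_stepf_norm s : wf s ->
  (\int[mu]_x `|stepf s x|%:E = (mass s)%:E)%E.
Proof.
move=> ws; under eq_integral do rewrite normr_stepf// -sumEFin.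
have mI (p : R * R * R) (D : set R) : measurable_fun D (fun x => (`|p.2| * (p.1.1 < x <= p.1.2)%R%:R)%:E : \bar R).
  rewrite (_ : (fun x => _) = EFin \o stepf [:: (p.1, `|p.2|)]); last first.
    by apply/funext => x; rewrite /stepf /= big_seq1.
  by apply/measurable_EFinP; exact: measurable_stepf.
rewrite ge0_integral_sum//; last by move=> p; exact: mI.
rewrite /mass -sumEFin; apply: eq_big_seq => p /(wf_lt ws) ab.
transitivity (\int[mu]_x (`|p.2|%:E * (\1_(`]p.1.1, p.1.2]%classic : set R) x)%:E))%E.
  apply: eq_integral => x _; rewrite -EFinM indicE; congr (_ * (nat_of_bool _)%:R)%:E.
  by apply/idP/idP => [h|/set_mem/=]; rewrite ?inE/= ?in_itv.
rewrite ge0_integralZl//; last by apply/measurable_EFinP; exact: measurable_indic.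
rewrite integral_indic// setIT /= lebesgue_measure_itv/= lte_fin ab -EFinB -EFinM.
by [].
Qed.

Definition pole_weights th s := [seq (pole th p.1, p.2 * (p.1.2 - p.1.1)) | p <- s].

Lemma sorted_pole_weights th s : 0 <= th -> th < 1 -> wf s ->
  sorted (fun p q => p.1 < q.1) (pole_weights th s).
Proof.
move=> th0 th1; elim: s => // p [|q s] IH // /wf_cons[h1 h2 h3 ws] /=.
rewrite [path _ _ _](IH ws) andbT /pole.
have h4 := h2 _ (mem_head q s); have h5 := h3 _ (mem_head q s).
have h6 : th * (p.1.2 - p.1.1) < p.1.2 - p.1.1 by rewrite gtr_pMl ?subr_gt0.
have h7 : 0 <= th * (q.1.2 - q.1.1) by rewrite mulr_ge0// subr_ge0 ltW.
lra.
Qed.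

Lemma stepH_le_pole th s x : (forall p, p \in s -> 0 <= p.2) ->
  (forall p : R * R * R, p \in s -> (p.1.2 - p.1.1) / 4 <= `|x - pole th p.1|) ->
  `|stepH s x| <= `|\sum_(p <- pole_weights th s) p.2 / (x - p.1)| +
     \sum_(p <- s) p.2 * pole_err th p.1 x.
Proof.
move=> c0 good; rewrite /pole_weights big_map/=.
set r := \sum_(p <- s) _.
have -> : stepH s x = (stepH s x + r) - r by rewrite addrK.
apply: (le_trans (ler_normB _ _)); rewrite [leRHS]addrC lerD2r.
rewrite /stepH /r -big_split/= (le_trans (ler_norm_sum _ _ _))//.
rewrite big_seq [leRHS]big_seq ler_sum// => p ps.
rewrite /pole_err good// mulr1 -mulrA -mulrDr normrM ger0_norm//.
exact: c0.
Qed.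

(** A point closer than a quarter of the cell to the pole at [1/4] is inside the left half of that
    cell; for [3/4] it is inside the right half. Since [x] is interior to at most one cell, both
    cannot happen, even in different cells, so one of the two positions is good for all cells at
    once. *)
Lemma good_pole s x : wf s -> exists2 th, (th = 1/4 \/ th = 3/4) &
  forall p : R * R * R, p \in s -> (p.1.2 - p.1.1) / 4 <= `|x - pole th p.1|.
Proof.
move=> ws; have [h|/existsNP[p /not_implyP[ps /negP]]] := pselect
  (forall p : R * R * R, p \in s -> (p.1.2 - p.1.1) / 4 <= `|x - pole (1/4) p.1|).
  by exists (1/4) => //; left.
rewrite -ltNge => hp; exists (3/4); first by right.
move=> q qs; rewrite leNgt; apply/negP => hq.
have pab := wf_lt ws ps; have qab := wf_lt ws qs.
move: hp hq; rewrite /pole !ltr_norml => /andP[p1 p2] /andP[q1 q2].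
have E : p.1 = q.1 by apply: (@wf_overlap _ s p q x) => //; apply/andP; split; lra.
by move: p1 p2 q1 q2 qab; rewrite -E; lra.
Qed.

Lemma weak_stepH_ge0 s l : wf s -> narrow s -> (forall p, p \in s -> 0 <= p.2) ->
  0 < l -> (mu [set x | (l < `|stepH s x|)%R] <= (128 * mass s / l)%:E)%E.
Proof.
move=> ws /allP ns c0 l0.
pose M := mass s.
have ME : \sum_(p <- s) p.2 * (p.1.2 - p.1.1) = M.
  by rewrite /M /mass; apply: eq_big_seq => p /c0 h; rewrite ger0_norm.
pose A th := [set x | l / 2 < `|\sum_(p <- pole_weights th s) p.2 / (x - p.1)|].
pose E th x := \sum_(p <- s) p.2 * pole_err th p.1 x.
pose B th := [set x | l / 2 <= E th x].
have E0 th x : 0 <= E th x.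
  by rewrite /E big_seq sumr_ge0// => p /c0 h; rewrite mulr_ge0// pole_err_ge0.
have mE th (D : set R) : measurable_fun D (E th).
  by apply: measurable_funTS; apply: measurable_sum => p; apply: measurable_funM => //; exact: measurable_pole_err.
have AB th : 0 <= th -> th < 1 -> (mu (A th `|` B th) <= (64 * M / l)%:E)%E.
  move=> th0 th1; apply: (le_trans (mu_setU _ _)).
  (* At level [l / 2], Boole's inequality gives [4 M / l] for the poles and Chebyshev's gives
     [60 M / l] for the errors. *)
  have -> : 64 * M / l = 2 * M / (l / 2) + (30 * M) / (l / 2) by field; rewrite gt_eqF.
  rewrite EFinD; apply: leeD.
    have := @boole_ineq _ (pole_weights th s) (l / 2).
    rewrite big_map/= ME; apply; first by rewrite divr_gt0.
      exact: sorted_pole_weights.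
    move=> _ /mapP[p ps ->]/=; rewrite mulr_ge0 ?c0// subr_ge0 ltW//; exact: wf_lt ps.
  have mEE : measurable_fun [set: R] (fun x => (E th x)%:E) by apply/measurable_EFinP.
  have l20 : 0 < l / 2 by rewrite divr_gt0.
  have := @le_integral_abse _ (measurableTypeR R) R mu setT measurableT _ _ mEE l20.
  rewrite setTI.
  have -> : [set x | (l / 2)%:E <= `|(E th x)%:E|]%E = B th.
    by apply/seteqP; split => x /=; rewrite lee_fin ger0_norm.
  move=> h; have h2 : (\int[mu]_x `|(E th x)%:E| <= (30 * M)%:E)%E.
    under eq_integral do rewrite /= ger0_norm//.
    under eq_integral do rewrite /E -sumEFin.
    have pI (th' : R) : 0 <= th' <= 1 -> (\int[mu]_x (\sum_(p <- s) (p.2 * pole_err th' p.1 x)%:E) <= (30 * M)%:E)%E.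
      move=> th'01; have c0' : all (fun p => 0 <= p.2) s by apply/allP.
      rewrite -ME mulr_sumr -sumEFin.
      (* Values are replaced by their positive parts because the exchange of sum and integral asks
         for nonnegative terms at all indices, not only at those in [s]. *)
      rewrite (_ : (\int[mu]_x _ = \int[mu]_x \sum_(p <- s) ((Num.max p.2 0) * pole_err th' p.1 x)%:E)%E); last first.
        apply: eq_integral => x _; apply: eq_big_seq => p /c0 h'.
        by congr (_ * _)%:E; apply/esym/max_idPl.
      rewrite ge0_integral_sum//; last 2 first.
      - by move=> p; apply/measurable_EFinP; apply: measurable_funM => //; exact: measurable_pole_err.
      - by move=> p x _; rewrite lee_fin mulr_ge0 ?pole_err_ge0// le_max lexx orbT.
      rewrite big_seq [leRHS]big_seq; apply: lee_sum => p ps.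
      under eq_integral do rewrite EFinM.
      have cp := c0 _ ps.
      rewrite (_ : Num.max p.2 0 = p.2); last by apply/max_idPl.
      rewrite ge0_integralZl//; last 2 first.
      - by apply/measurable_EFinP; exact: measurable_pole_err.
      - by move=> x _; rewrite lee_fin pole_err_ge0.
      rewrite mulrCA EFinM; apply: lee_wpmul2l; first by rewrite lee_fin.
      apply: pole_err_L1 => //; first exact: wf_lt ps.
      exact: ns.
    by apply: pI; rewrite th0 ltW.
  have := le_trans h h2; rewrite -lee_pdivlMl// => /le_trans; apply.
  by rewrite -EFinM mulrC.
have sub : [set x | (l < `|stepH s x|)%R] `<=` (A (1/4) `|` B (1/4)) `|` (A (3/4) `|` B (3/4)).
  move=> x /= lx; have [th thE good] := good_pole x ws.
  have h := stepH_le_pole c0 good.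
  have : (A th `|` B th) x.
    have [h1|h1] := ltP (l / 2) `|\sum_(p <- pole_weights th s) p.2 / (x - p.1)|; [by left|right].
    by rewrite /B/= /E; lra.
  by case: thE => ->; [left|right].
apply: (le_trans (le_mu sub)); apply: (le_trans (mu_setU _ _)).
have -> : 128 * mass s / l = 64 * M / l + 64 * M / l by rewrite /M; field; rewrite gt_eqF.
by rewrite EFinD; apply: leeD; apply: AB; lra.
Qed.

Lemma weak_stepH s l : wf s -> narrow s -> 0 < l ->
  (mu [set x | (l < `|stepH s x|)%R] <= (256 * mass s / l)%:E)%E.
Proof.
move=> ws ns l0.
pose sp (f : R -> R) := [seq (p.1, f p.2) | p <- s].
have wsp f : wf (sp f) by rewrite /wf /sp -map_comp.
have nsp f : narrow (sp f) by rewrite /narrow /sp all_map.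
pose f1 c : R := Num.max c 0; pose f2 c : R := Num.max (- c) 0.
have f10 c : 0 <= f1 c by rewrite le_max lexx orbT.
have f20 c : 0 <= f2 c by rewrite le_max lexx orbT.
have f12 c : f1 c - f2 c = c by rewrite /f1 /f2; have [h|h] := leP c 0; have [h'|h'] := leP (- c) 0; lra.
have f12n c : f1 c + f2 c = `|c|.
  rewrite /f1 /f2; have [h|h] := leP c 0; [rewrite ler0_norm//|rewrite gtr0_norm//];
  by have [h'|h'] := leP (- c) 0; lra.
have HE x : stepH s x = stepH (sp f1) x - stepH (sp f2) x.
  rewrite /stepH !big_map -sumrB; apply: eq_bigr => p _ /=.
  by rewrite -mulrBl f12.
have ME : mass s = mass (sp f1) + mass (sp f2).
  rewrite /mass !big_map -big_split/=; apply: eq_bigr => p _.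
  by rewrite -mulrDl (ger0_norm (f10 _)) (ger0_norm (f20 _)) f12n.
have sub : [set x | (l < `|stepH s x|)%R] `<=`
   [set x | (l / 2 < `|stepH (sp f1) x|)%R] `|` [set x | (l / 2 < `|stepH (sp f2) x|)%R].
  move=> x /=; rewrite HE => h.
  have [h1|h1] := ltP (l / 2) `|stepH (sp f1) x|; [by left|right].
  by have := ler_normB (stepH (sp f1) x) (stepH (sp f2) x); lra.
apply: (le_trans (le_mu sub)); apply: (le_trans (mu_setU _ _)).
have -> : 256 * mass s / l = 128 * mass (sp f1) / (l / 2) + 128 * mass (sp f2) / (l / 2).
  by rewrite ME; field; rewrite gt_eqF.
rewrite EFinD; apply: leeD; apply: weak_stepH_ge0 => //; try by rewrite divr_gt0.
- by move=> _ /mapP[p _ ->] /=.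
- by move=> _ /mapP[p _ ->] /=.
Qed.

End WeakType.

(** * Truncated Hilbert transforms of step functions *)

Section Truncation.
Variable R : realType.
Local Notation mu := (@lebesgue_measure R).
Implicit Types (s : seq (R * R * R)) (f : R -> R) (x t u l e : R).

Lemma measurable_div_sub f t (D : set R) : measurable_fun D f ->
  measurable_fun D (fun x => f x / (x - t)).
Proof.
move=> mf; apply: measurable_funM => //; apply: measurable_funTS.
by apply: measurableT_comp; [exact: measurable_inv|exact: measurable_funB].
Qed.

Lemma integrable_div_sub (D : set (measurableTypeR R)) f t (d : R) :
  measurable D -> mu.-integrable D (EFin \o f) -> 0 < d ->
  (forall x, D x -> d <= `|x - t|) ->
  mu.-integrable D (EFin \o (fun x => f x / (x - t))).
Proof.
move=> mD fi d0 Dd.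
apply: (le_integrable mD _ _ (integrableZl mD d^-1 fi)).
  apply/measurable_EFinP; apply: measurable_div_sub.
  by apply/measurable_EFinP; exact: (measurable_int mu).
move=> x Dx /=; rewrite lee_fin !normrM normfV [leRHS]mulrC ler_wpM2l//.
rewrite (ger0_norm (_ : 0 <= d^-1)) ?invr_ge0 ?(ltW d0)// lef_pV2 ?posrE ?Dd//.
exact: lt_le_trans (Dd _ Dx).
Qed.

Lemma integrable_stepf s (D : set (measurableTypeR R)) : measurable D ->
  wf s -> mu.-integrable D (EFin \o stepf s).
Proof.
move=> mD ws; apply: (@integrableS _ _ _ mu setT) => //.
apply/integrableP; split; first by apply/measurable_EFinP; exact: measurable_stepf.
by rewrite /= (integral_stepf_norm ws) ltry.
Qed.

Definition clamp (u v x : R) : R := Num.max u (Num.min x v).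

Lemma clamp_le u v x y : x <= y -> clamp u v x <= clamp u v y.
Proof.
move=> xy; rewrite /clamp ge_max le_max lexx/= le_max; apply/orP; right.
by rewrite le_min !ge_min lexx orbT xy.
Qed.

Lemma clamp_between u v x : u <= v -> u <= clamp u v x <= v.
Proof. by move=> uv; rewrite /clamp le_max lexx/= ge_max uv ge_min lexx orbT. Qed.

Lemma lt_clampP u v a x : u < x -> x <= v -> (clamp u v a < x) = (a < x).
Proof.
move=> ux xv; rewrite /clamp gt_max ux/= gt_min.
by rewrite [v < x]ltNge xv orbF.
Qed.

Lemma le_clampP u v b x : u < x -> x <= v -> (x <= clamp u v b) = (x <= b).
Proof.
move=> ux xv; rewrite /clamp le_max leNgt ux/= le_min xv andbT.
by [].
Qed.

Lemma integral_inv_sub (a b t : R) : a <= b -> (t < a \/ b < t) ->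
  (\int[mu]_(x in `[a, b]) (x - t)^-1%:E = (ln `|b - t| - ln `|a - t|)%:E)%E.
Proof.
move=> ab tab.
have c x : a <= x <= b -> {for x, continuous (fun x => (x - t)^-1)}.
  move=> /andP[h1 h2]; apply: cvgV; first by rewrite subr_eq0; case: tab => h; [rewrite gt_eqF|rewrite lt_eqF]; lra.
  by apply: cvgB; [exact: cvg_id|exact: cvg_cst].
case: tab => tab.
  have -> : ln `|b - t| - ln `|a - t| = ln (b - t) - ln (a - t).
    by rewrite !gtr0_norm//; lra.
  apply: (@FTC_closed _ (fun x => (x - t)^-1) (fun x => ln (x - t)) a b) => // x /andP[h1 h2].
  have xt : 0 < x - t by lra.
  have := @is_derive1_comp _ (@ln R) (fun x => x - t) x _ 1 (is_derive1_ln xt).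
  rewrite mulr1; apply.
  by have := is_deriveB (is_derive_id x 1) (is_derive_cst t x 1); rewrite subr0.
have -> : ln `|b - t| - ln `|a - t| = ln (t - b) - ln (t - a).
  by rewrite !ltr0_norm ?opprB//; lra.
apply: (@FTC_closed _ (fun x => (x - t)^-1) (fun x => ln (t - x)) a b) => // x /andP[h1 h2].
have xt : 0 < t - x by lra.
have := @is_derive1_comp _ (@ln R) (fun x => t - x) x _ (-1) (is_derive1_ln xt).
rewrite mulrN1 -invrN opprB; apply.
by have := is_deriveB (is_derive_cst t x 1) (is_derive_id x 1); rewrite sub0r.
Qed.

Lemma integral_clamped_inv_sub (a b c d t : R) : a <= b -> c <= d ->
  (t < c \/ d < t) ->
  (\int[mu]_(x in `]c, d[) ((a < x <= b)%R%:R / (x - t))%:E =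
    (ln `|clamp c d b - t| - ln `|clamp c d a - t|)%:E)%E.
Proof.
move=> ab cd tcd; set A := clamp c d a; set B := clamp c d b.
have /andP[cA Ad] := clamp_between a cd; have /andP[cB Bd] := clamp_between b cd.
have AB : A <= B by exact: clamp_le.
have tAB : t < A \/ B < t.
  by case: tcd => h; [left; exact: lt_le_trans cA|right; exact: le_lt_trans Bd h].
have mI (D : set R) : measurable_fun D (fun x => (x - t)^-1%:E).
  apply/measurable_EFinP; apply: measurable_funTS.
  by apply: measurableT_comp; [exact: measurable_inv|exact: measurable_funB].
have -> : (\int[mu]_(x in `]c, d[) ((a < x <= b)%R%:R / (x - t))%:E =
    \int[mu]_(x in `]c, d[ `&` `]a, b]) (x - t)^-1%:E)%E.
  rewrite integral_mkcondr; apply: eq_integral => x _; rewrite patchE.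
  case: ifPn => [/set_mem/=|/negP h]; first by rewrite in_itv/= => ->; rewrite mul1r.
  rewrite (_ : (_ < _ <= _) = false) ?mul0r//; apply/negP => h'; apply: h.
  by apply: mem_set; rewrite /= in_itv.
rewrite -integral_inv_sub//.
have [ABe|ABl] := eqVneq A B.
  rewrite ABe set_itv1 integral_set1 (_ : _ `&` _ = set0) ?integral_set0//.
  apply/seteqP; split => // x /= []; rewrite ?in_itv/= => /andP[cx xd] /andP[ax xb].
  have : A < x by rewrite /A lt_clampP// ltW.
  have : x <= B by rewrite /B le_clampP// ltW.
  by rewrite ABe; lra.
have {ABl}AB' : A < B by rewrite lt_neqAle ABl.
rewrite (_ : `]c, d[ `&` `]a, b] = [set` Interval (BRight A) (BSide (d <= b) B)])%classic.
  rewrite (@integral_itv_bndoo _ A B _ false (d <= b)); last exact: mI.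
  by rewrite [RHS](@integral_itv_bndoo _ A B _ true false)//; exact: mI.
apply/seteqP; split => x /=; rewrite ?in_itv/=.
  move=> [/andP[cx xd] /andP[ax xb]].
  rewrite lt_clampP ?ax ?(ltW xd)//=.
  have xB : x <= B by rewrite /B le_clampP// ltW.
  case: (leP d b) => //= db; rewrite (lt_le_trans xd)// /B /clamp le_max le_min db lexx/=.
  by rewrite orbT.
move=> /andP[Ax]; case: (leP d b) => db /= xB.
  have cx : c < x by exact: le_lt_trans cA Ax.
  have xd : x < d by exact: lt_le_trans xB Bd.
  rewrite cx xd; split => //; rewrite (le_trans (ltW xd))// andbT.
  by rewrite -(@lt_clampP c d)// ltW.
have cx : c < x by exact: le_lt_trans cA Ax.
have xd : x <= d by exact: le_trans xB Bd.
have xb : x <= b by rewrite -(@le_clampP c d).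
split; last by rewrite xb andbT -(@lt_clampP c d).
by rewrite cx (le_lt_trans xb).
Qed.

(** For [u <= v] this is [stepH] of the restriction to []u, v]]: clamping its ends cuts a cell to
    that interval, and a cell outside collapses to a point and contributes 0. *)
Definition clampH s u v t : R :=
  \sum_(p <- s) p.2 * (ln `|clamp u v p.1.2 - t| - ln `|clamp u v p.1.1 - t|).

Lemma Rintegral_stepf_div s (c d t : R) : wf s -> c <= d -> (t < c \/ d < t) ->
  \int[mu]_(x in `]c, d[) (stepf s x / (x - t)) = clampH s c d t.
Proof.
move=> ws cd tcd.
have [e0 e0d] : exists2 e0, 0 < e0 & forall x, `]c, d[%classic x -> e0 <= `|x - t|.
  case: tcd => h.
    exists (c - t); first by rewrite subr_gt0.
    move=> x /=; rewrite ?in_itv/= => /andP[h1 h2]; rewrite ger0_norm; lra.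
  exists (t - d); first by rewrite subr_gt0.
  move=> x /=; rewrite ?in_itv/= => /andP[h1 h2]; rewrite distrC ger0_norm; lra.
move=> He; elim: s ws => [|p s IH] ws.
  rewrite /clampH big_nil /Rintegral integral0_eq// => x _.
  by rewrite /stepf big_nil mul0r.
have /wf_cons[h1 _ _ ws'] := ws.
have i1 : mu.-integrable (`]c, d[ : set (measurableTypeR R)) (EFin \o (fun x => (p.1.1 < x <= p.1.2)%R%:R / (x - t))).
  have w1 : wf [:: (p.1, 1 : R)] by rewrite /wf /intervals /= h1.
  have := @integrable_div_sub `]c, d[%classic _ t e0 (measurable_itv _) (integrable_stepf (measurable_itv _) w1) e0d He.
  apply: eq_integrable => // x _ /=.
  by rewrite /stepf big_seq1 mul1r.
rewrite (_ : (fun x => _) = (fun x => p.2 * ((p.1.1 < x <= p.1.2)%R%:R / (x - t)) + stepf s x / (x - t))); last first.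
  by apply/funext => x; rewrite /stepf big_cons mulrDl mulrA.
rewrite RintegralD//; last 2 first.
- by apply: (@integrableZl _ _ _ mu _ _ p.2 _ i1).
- exact: (integrable_div_sub (measurable_itv _) (integrable_stepf (measurable_itv _) ws') e0d He).
rewrite RintegralZl// IH// /clampH big_cons; congr (_ * _ + _).
by rewrite /Rintegral integral_clamped_inv_sub// ltW.
Qed.

(* [stepH] of the part of the step function outside [(t - e, t + e)], at [t']. *)
Definition hout s t e t' : R := clampH s (Num.min (-1) (t - e)) (t - e) t' +
  clampH s (t + e) (Num.max 1 (t + e)) t'.

Definition inI s : bool := all (fun p => (-1 <= p.1.1) && (p.1.2 <= 1)) s.

Definition inner s u v : seq (R * R * R) :=
  [seq q <- [seq ((clamp u v p.1.1, clamp u v p.1.2), p.2) | p <- s] | q.1.1 < q.1.2].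

Lemma mem_inner s u v q : wf s -> q \in inner s u v ->
  exists2 p : R * R * R, p \in s & q = ((clamp u v p.1.1, clamp u v p.1.2), p.2).
Proof. by move=> _; rewrite mem_filter => /andP[_ /mapP[p ps ->]]; exists p. Qed.

Lemma inner_wf s u v : wf s -> wf (inner s u v).
Proof.
elim: s => // p s IH /wf_cons[h1 h2 h3 ws]; rewrite /inner /=.
case: ifPn => [h|_]; last exact: IH.
move: (IH ws); rewrite /wf /intervals /= h /= => /andP[-> ->]; rewrite andbT.
apply/allP => _ /mapP[q + ->]; rewrite mem_filter => /andP[_ /mapP[r rs ->]]/=.
by apply: clamp_le; exact: h2.
Qed.

Lemma clamp_dist u v a b : a <= b -> clamp u v b - clamp u v a <= b - a.
Proof.
by move=> ab; rewrite /clamp; have [h1|h1] := leP a v; have [h2|h2] := leP b v;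
  rewrite /Order.max; repeat case: ifP; lra.
Qed.

Lemma inner_narrow s u v : wf s -> narrow s -> narrow (inner s u v).
Proof.
move=> ws /allP ns; apply/allP => q /(mem_inner ws)[p ps ->] /=.
apply: le_trans (ns _ ps); apply: clamp_dist; apply: ltW; exact: wf_lt ps.
Qed.

Lemma stepH_inner s u v t : wf s -> stepH (inner s u v) t = clampH s u v t.
Proof.
move=> ws; rewrite /stepH /inner big_filter big_map /clampH big_mkcond/=.
apply: eq_big_seq => p ps; case: ifPn => //; rewrite -leNgt => h.
have : clamp u v p.1.1 <= clamp u v p.1.2 by apply: clamp_le; apply: ltW; exact: wf_lt ps.
by move=> h'; rewrite (_ : clamp u v p.1.2 = clamp u v p.1.1) ?subrr ?mulr0//; apply/eqP; rewrite eq_le h h'.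
Qed.

Lemma stepf_inner s u v x : stepf (inner s u v) x = stepf s x * (u < x <= v)%R%:R.
Proof.
rewrite /stepf /inner big_filter big_map big_mkcond/= mulr_suml.
apply: eq_bigr => p _; case: (boolP (u < x <= v)) => [/andP[ux xv]|uxv].
  rewrite mulr1 -(@lt_clampP u v p.1.1 x)// -(@le_clampP u v p.1.2 x)//.
  case: ifPn => // h; rewrite (_ : (_ && _) = false) ?mulr0//.
  by apply/negP => /andP[h1 h2]; move: h; rewrite (lt_le_trans h1 h2).
rewrite mulr0; case: ifPn => // h; rewrite (_ : (_ && _) = false) ?mulr0//.
apply/negP => /andP[h1 h2]; move/negP: uxv; apply.
have uv : u <= v.
  rewrite leNgt; apply/negP => vu; move: h; rewrite /clamp.
  by rewrite !max_l ?ltxx// ge_min (ltW vu) orbT.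
have /andP[h3 _] := clamp_between p.1.1 uv; have /andP[_ h4] := clamp_between p.1.2 uv.
by rewrite (le_lt_trans h3 h1) (le_trans h2 h4).
Qed.

Lemma stepH_split s t e t' : wf s -> inI s -> 0 < e ->
  stepH s t' = hout s t e t' + stepH (inner s (t - e) (t + e)) t'.
Proof.
move=> ws /allP si e0; rewrite stepH_inner// /hout /stepH /clampH -!big_split/=.
apply: eq_big_seq => p ps; rewrite -!mulrDr; congr (_ * _).
have /andP[pa pb] := si _ ps; have pab := wf_lt ws ps.
have H y : -1 <= y <= 1 -> ln `|y - t'| + ln `|t - e - t'| + ln `|t + e - t'| =
  ln `|clamp (Num.min (-1) (t - e)) (t - e) y - t'| +
  ln `|clamp (t + e) (Num.max 1 (t + e)) y - t'| + ln `|clamp (t - e) (t + e) y - t'|.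
  move=> /andP[y1 y2]; rewrite /clamp.
  have -> : Num.max (Num.min (-1) (t - e)) (Num.min y (t - e)) = Num.min y (t - e).
    by apply/max_idPr; rewrite le_min !ge_min y1/= lexx orbT.
  have -> : Num.max (t + e) (Num.min y (Num.max 1 (t + e))) = Num.max (t + e) y.
    by rewrite (_ : Num.min _ _ = y)//; apply/min_idPl; rewrite le_max y2.
  have [h1|h1] := leP y (t - e).
    have -> : Num.max (t + e) y = t + e by apply/max_idPl; lra.
    have -> : Num.max (t - e) (Num.min y (t + e)) = t - e by apply/max_idPl; rewrite ge_min h1.
    lra.
  have [h2|h2] := leP (t + e) y.
    have -> : Num.max (t - e) (t + e) = t + e by apply/max_idPr; lra.
    lra.
  have -> : Num.max (t - e) y = y by apply/max_idPr; rewrite ltW.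
  lra.
have := H p.1.1; rewrite pa (le_trans (ltW pab) pb) => /(_ isT).
have := H p.1.2; rewrite pb (le_trans pa (ltW pab)) => /(_ isT).
lra.
Qed.

End Truncation.

(** * The maximal truncation of step functions *)

Section Maximal.
Variable R : realType.
Local Notation mu := (@lebesgue_measure R).
Implicit Types (s : seq (R * R * R)) (f : R -> R) (x t u l e m : R).

Lemma HL_maximal_le f t m r : ~~ (m%:E < HL_maximal f t)%E -> 0 < r ->
  (\int[mu]_(y in ball t r) `|(f y)%:E| <= (2 * r * m)%:E)%E.
Proof.
rewrite -leNgt => h r0.
have : (iavg f (ball t r) <= m%:E)%E.
  apply: le_trans h; apply: ereal_sup_ubound; exists r => //=.
  by rewrite in_itv/= r0.
rewrite /iavg lebesgue_measure_ball ?(ltW r0)// inver.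
rewrite ifF; last by rewrite mulrn_eq0/= gt_eqF.
rewrite lee_pdivrMl; last by rewrite pmulrn_lgt0.
by rewrite -EFinM mulr_natl.
Qed.

(** On the annulus from [2^k e] to [2^(k+1) e] the kernel is at most [1/(4^k e)], and the ball
    around it has mass at most [4 * 2^k e m]. The contributions [4 m / 2^k] form a geometric
    series. *)
Lemma annulus_bound f t e m n : measurable_fun setT f -> 0 < e -> 0 <= m ->
  (forall r, 0 < r -> (\int[mu]_(y in ball t r) `|f y|%:E <= (2 * r * m)%:E)%E) ->
  (\int[mu]_(x in [set x | (e <= `|x - t| < 2 ^+ n * e)%R]) (`|f x| * (e / (x - t) ^+ 2))%:E
    <= (8 * m * (1 - 2 ^- n))%:E)%E.
Proof.
move=> mf e0 m0 H.
have mA a b : measurable ([set x | a <= `|x - t| < b] : set (measurableTypeR R)).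
  have mn : measurable_fun [set: R] (fun x => `|x - t|).
    by apply: measurableT_comp => //; exact: measurable_funB.
  have := mn measurableT _ (measurable_itv `[a, b[); rewrite setTI.
  by congr measurable; apply/seteqP; split => x /=; rewrite in_itv/=.
have mk (D : set R) : measurable_fun D (fun x => (`|f x| * (e / (x - t) ^+ 2))%:E).
  apply/measurable_EFinP; apply: measurable_funTS; apply: measurable_funM.
    by apply: measurableT_comp.
  apply: measurable_funM => //; apply: measurableT_comp; first exact: measurable_inv.
  by apply: measurable_funX; exact: measurable_funB.
have k0 x : (0 <= (`|f x| * (e / (x - t) ^+ 2))%:E)%E.
  by rewrite lee_fin mulr_ge0// divr_ge0 ?sqr_ge0// ltW.
elim: n => [|n IH].
  rewrite (_ : [set x | _] = set0) ?integral_set0 ?expr0 ?invr1 ?subrr ?mulr0//.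
  by apply/seteqP; split => // x /= /andP[h1]; rewrite mul1r ltNge h1.
rewrite (_ : [set x | _] = [set x | e <= `|x - t| < 2 ^+ n * e] `|`
    [set x | 2 ^+ n * e <= `|x - t| < 2 ^+ n.+1 * e]); last first.
  have h1 : 1 <= 2 ^+ n :> R by rewrite exprn_ege1// ler1n.
  have h2 : 2 ^+ n.+1 * e = 2 * (2 ^+ n * e) by rewrite exprS mulrA.
  have h3 : e <= 2 ^+ n * e by rewrite ler_peMl// ltW.
  apply/seteqP; split => x /=.
    move=> /andP[-> h]; have [h'|h'] := ltP `|x - t| (2 ^+ n * e); [by left|right].
    by rewrite h.
  by case=> /andP[h4 h5]; apply/andP; split; lra.
rewrite ge0_integral_setU//; last 2 first.
- exact: mk.
- apply/disj_setPS => x /= [/andP[_ h1] /andP[h2 _]].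
  by move: h1; rewrite ltNge h2.
have -> : 8 * m * (1 - 2 ^- n.+1) = 8 * m * (1 - 2 ^- n) + 4 * m * 2 ^- n.
  by rewrite exprS invfM; field.
rewrite EFinD; apply: leeD => //.
have pn0 : 0 < 2 ^+ n :> R by rewrite exprn_gt0.
have c0 : 0 <= (4 ^+ n * e)^-1 by rewrite invr_ge0 mulr_ge0 ?exprn_ge0// ltW.
apply: (@le_trans _ _ (\int[mu]_(x in ball t (2 ^+ n.+1 * e)) ((4 ^+ n * e)^-1%:E * `|f x|%:E))%E).
  have mf' (D : set R) : measurable_fun D (fun x => ((4 ^+ n * e)^-1%:E * `|f x|%:E))%E.
    under eq_fun do rewrite -EFinM.
    apply/measurable_EFinP; apply: measurable_funTS; apply: measurable_funM => //.
    exact: measurableT_comp.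
  apply: (@le_trans _ _ (\int[mu]_(x in [set x | (2 ^+ n * e <= `|x - t| < 2 ^+ n.+1 * e)%R])
      ((4 ^+ n * e)^-1%:E * `|f x|%:E))%E).
    apply: ge0_le_integral => //.
    - exact: mk.
    - exact: mf'.
    - move=> x /= /andP[h1 h2]; rewrite -EFinM lee_fin mulrC ler_wpM2r//.
      have h3 : (2 ^+ n * e) ^+ 2 <= (x - t) ^+ 2.
        by rewrite -[leRHS]real_normK ?num_real// ler_pXn2r ?nnegrE// mulr_ge0 ?(ltW pn0) ?(ltW e0).
      have h4 : 0 < (2 ^+ n * e) ^+ 2 by rewrite exprn_gt0// mulr_gt0.
      have -> : (4 ^+ n * e)^-1 = e / (2 ^+ n * e) ^+ 2.
        rewrite exprMn -exprM mulnC exprM.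
        have -> : 2 ^+ 2 = 4 :> R by lra.
        by field; rewrite gt_eqF//= gt_eqF// exprn_gt0.
      by rewrite ler_wpM2l ?(ltW e0)// lef_pV2 ?posrE// (lt_le_trans h4).
  apply: ge0_subset_integral => //.
  - exact: measurable_ball.
  - exact: mf'.
  - by move=> x _; rewrite -EFinM lee_fin mulr_ge0.
  - by move=> x /= /andP[_ h]; rewrite /ball/= distrC.
rewrite ge0_integralZl//; last 2 first.
- exact: measurable_ball.
- by apply/measurable_EFinP; apply: measurable_funTS; exact: measurableT_comp.
apply: (@le_trans _ _ ((4 ^+ n * e)^-1%:E * (2 * (2 ^+ n.+1 * e) * m)%:E)%E).
  by apply: lee_wpmul2l; [rewrite lee_fin|apply: H; rewrite mulr_gt0// exprn_gt0].
rewrite -EFinM lee_fin.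
have -> : 4 ^+ n = 2 ^+ n * 2 ^+ n :> R by rewrite -exprMn; congr (_ ^+ _); lra.
rewrite exprS le_eqVlt; apply/orP; left; apply/eqP; field.
by rewrite !gt_eqF.
Qed.

(** For [|x - t| >= e] the point [t'] is at least half as far from [x] as [t] is, so the two kernels
    differ by at most [e/(x - t)^2]. The bound [8 m] of [annulus_bound] is used once on each side of
    [t]. *)
Lemma hout_diff s t e t' m : wf s -> inI s -> I11 t -> 0 < e -> 0 <= m ->
  `|t - t'| <= e / 2 ->
  (forall r, 0 < r -> (\int[mu]_(y in ball t r) `|stepf s y|%:E <= (2 * r * m)%:E)%E) ->
  `|hout s t e t - hout s t e t'| <= 16 * m.
Proof.
move=> ws si It e0 m0 tt' H.
(* Finitely many annuli suffice, all points of [(-1, 1)] being at distance less than 2 from [t]. *)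
have [n ne] : exists n, 2 <= 2 ^+ n * e.
  exists (Num.bound (2 / e)).
  have h := @archi_boundP R (2 / e) (divr_ge0 (ler0n _ _) (ltW e0)).
  rewrite -ler_pdivrMr// (le_trans (ltW h))//.
  by rewrite -natrX ler_nat ltnW// ltn_expl.
pose k x := (x - t)^-1 - (x - t')^-1.
have kb x : e <= `|x - t| -> `|k x| <= e / (x - t) ^+ 2.
  move=> h; have xt0 : 0 < `|x - t| by exact: lt_le_trans h.
  have h2 : `|x - t| / 2 <= `|x - t'|.
    have : `|x - t| <= `|x - t'| + `|t - t'|.
      have -> : x - t = (x - t') + (t' - t) by ring.
      by rewrite (distrC t) ler_normD.
    lra.
  have xt'0 : 0 < `|x - t'| by lra.
  have n1 : x - t != 0 by rewrite -normr_gt0.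
  have n2 : x - t' != 0 by rewrite -normr_gt0.
  have -> : k x = (t - t') / ((x - t) * (x - t')) by rewrite /k; field; rewrite n1 n2.
  rewrite normrM normfV normrM.
  rewrite -[(x - t) ^+ 2]real_normK ?num_real//.
  have -> : e / `|x - t| ^+ 2 = (e / 2) * (`|x - t| * (`|x - t| / 2))^-1 by field; rewrite gt_eqF.
  apply: ler_pM => //.
  by rewrite lef_pV2 ?posrE ?mulr_gt0// ler_wpM2l// ltW.
have piece c d : c <= d -> (d <= t - e \/ t + e <= c) ->
    (forall x, c < x < d -> `|x - t| < 2) ->
    `|clampH s c d t - clampH s c d t'| <= 8 * m.
  move=> cd cde cd2.
  have De x : `]c, d[%classic x -> e <= `|x - t|.
    move=> /=; rewrite in_itv/= => /andP[h1 h2]; case: cde => h.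
      by rewrite distrC ger0_norm; lra.
    by rewrite ger0_norm; lra.
  have /ler_normlP[t1 t2] := tt'.
  rewrite -!Rintegral_stepf_div//; last 2 first.
  - by case: cde => h; [right|left]; lra.
  - by case: cde => h; [right|left]; lra.
  have iS := integrable_stepf (measurable_itv `]c, d[) ws.
  have i1 : mu.-integrable (`]c, d[ : set (measurableTypeR R)) (EFin \o (fun x => stepf s x / (x - t))).
    exact: (integrable_div_sub (measurable_itv _) iS e0 De).
  have De' x : `]c, d[%classic x -> e / 2 <= `|x - t'|.
    move=> /De h; have : `|x - t| <= `|x - t'| + `|t - t'|.
      have -> : x - t = (x - t') + (t' - t) by ring.
      by rewrite (distrC t) ler_normD.
    lra.
  have i2 : mu.-integrable (`]c, d[ : set (measurableTypeR R)) (EFin \o (fun x => stepf s x / (x - t'))).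
    apply: (integrable_div_sub (measurable_itv _) iS _ De').
    by rewrite divr_gt0.
  rewrite -RintegralB// -lee_fin.
  have i3 : mu.-integrable (`]c, d[ : set (measurableTypeR R))
      (EFin \o (fun x => stepf s x / (x - t) - stepf s x / (x - t'))).
    have i4 := @integrableB _ _ _ mu _ (measurable_itv `]c, d[) _ _ i1 i2.
    exact: (@eq_integrable _ _ _ mu _ (measurable_itv `]c, d[) _ _ _ i4).
  rewrite EFin_normr_Rintegral//.
  apply: (le_trans (le_abse_integral mu (measurable_itv _) (measurable_int mu i3))).
  apply: (@le_trans _ _ (\int[mu]_(x in [set x | (e <= `|x - t| < 2 ^+ n * e)%R]) (`|stepf s x| * (e / (x - t) ^+ 2))%:E)%E).
    have mk (D : set R) : measurable_fun D (fun x => (`|stepf s x| * (e / (x - t) ^+ 2))%:E).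
      apply/measurable_EFinP; apply: measurable_funTS; apply: measurable_funM.
        by apply: measurableT_comp => //; exact: measurable_stepf.
      apply: measurable_funM => //; apply: measurableT_comp; first exact: measurable_inv.
      by apply: measurable_funX; exact: measurable_funB.
    have k0 x : (0 <= (`|stepf s x| * (e / (x - t) ^+ 2))%:E)%E.
      by rewrite lee_fin mulr_ge0// divr_ge0 ?sqr_ge0// ltW.
    apply: (@le_trans _ _ (\int[mu]_(x in `]c, d[) (`|stepf s x| * (e / (x - t) ^+ 2))%:E)%E).
      apply: ge0_le_integral => //.
      - by apply: measurableT_comp => //; exact: (measurable_int mu i3).
      - exact: mk.
      - move=> x /De h /=; rewrite lee_fin -mulrBr normrM ler_wpM2l//.
        exact: kb.
    apply: ge0_subset_integral => //.
    - have mn : measurable_fun [set: R] (fun x => `|x - t|).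
        by apply: measurableT_comp => //; exact: measurable_funB.
      have := mn measurableT _ (measurable_itv `[e, 2 ^+ n * e[); rewrite setTI.
      by congr measurable; apply/seteqP; split => x /=; rewrite in_itv/=.
    - exact: mk.
    - move=> x /[dup] /De h /=; rewrite in_itv/= => /cd2 h2.
      by rewrite h (lt_le_trans h2 ne).
  apply: (le_trans (annulus_bound n (@measurable_stepf _ s setT) e0 m0 H)).
  have p0 : 0 <= 2 ^- n :> R by rewrite invr_ge0 exprn_ge0.
  by rewrite lee_fin; apply: ler_piMr; [rewrite mulr_ge0|rewrite gerBl].
move: It; rewrite /I11/= in_itv/= => /andP[It1 It2].
rewrite /hout opprD addrACA (le_trans (ler_normD _ _))//.
have -> : 16 * m = 8 * m + 8 * m by ring.
apply: lerD; apply: piece.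
- by rewrite ge_min lexx orbT.
- by left.
- move=> x /andP[]; have [h|h] := leP (-1) (t - e) => h1 h2; rewrite ltr_norml; apply/andP; split; lra.
- by rewrite le_max lexx orbT.
- by right.
- move=> x /andP[]; have [h|h] := leP 1 (t + e) => h1 h2; rewrite ltr_norml; apply/andP; split; lra.
Qed.

(* Cotlar's inequality: the truncation at [t] is compared with [stepH] at a
   point [t'] of [ball t (e / 2)] where neither [stepH s] nor [stepH] of the
   inner part is large. *)
Lemma weak_Tstar s l : wf s -> narrow s -> inI s -> 0 < l ->
  (mu [set t | I11 t /\ (exists2 e, 0 < e & l < `|hout s t e t|)%R]
    <= ((3 * (128 * 128) + 12 * (32 * 32)) * mass s / l)%:E)%E.
Proof.
(* With this [m] the inner part, of mass at most [4 e m], exceeds [l / 4] on a set of measure at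
   most [256 * (4 e m) / (l / 4) = e / 4]; moreover the oscillation [16 m] is far below [l / 2]. *)
move=> ws ns si l0; pose m := l / (128 * 128).
have m0 : 0 < m by rewrite divr_gt0.
pose B := [set x | l / 4 < `|stepH s x|].
have mB : measurable (B : set (measurableTypeR R)).
  have mn : measurable_fun [set: R] (fun x => `|stepH s x|).
    by apply: measurableT_comp => //; exact: measurable_stepH.
  have := mn measurableT _ (measurable_itv `]l / 4, +oo[); rewrite setTI.
  by congr measurable; apply/seteqP; split => x /=; rewrite in_itv/= andbT.
pose A1 := [set x | (m%:E < HL_maximal (stepf s) x)%E].
pose A2 := [set x | ((4^-1)%:E < HL_maximal (\1_B : R -> R) x)%E].
have muB : (mu B <= ((32 * 32) * mass s / l)%:E)%E.
  apply: (le_trans (weak_stepH ws ns (_ : 0 < l / 4))); first by rewrite divr_gt0.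
  by rewrite lee_fin le_eqVlt; apply/orP; left; apply/eqP; field; rewrite gt_eqF.
have muA1 : (mu A1 <= (3 * (128 * 128) * mass s / l)%:E)%E.
  have li : locally_integrable [set: R] (stepf s).
    by apply: open_integrable_locally; [exact: openT|exact: integrable_stepf].
  apply: (le_trans (maximal_inequality li m0)).
  rewrite (_ : (\int[mu]_y `|(stepf s y)%:E|)%E = (mass s)%:E); last exact: integral_stepf_norm.
  by rewrite -EFinM lee_fin le_eqVlt; apply/orP; left; apply/eqP; rewrite /m; field; rewrite gt_eqF.
have muA2 : (mu A2 <= ((12 * (32 * 32)) * mass s / l)%:E)%E.
  have li : locally_integrable [set: R] (\1_B : R -> R) by apply: locally_integrable_indic; [exact: openT|].
  apply: (le_trans (maximal_inequality li (_ : 0 < 4^-1))) => //.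
  rewrite (_ : (\int[mu]_y `|(\1_B y)%:E|)%E = mu B); last first.
    have := @integral_indic _ (measurableTypeR R) R mu setT measurableT B mB.
    rewrite setIT => <-; apply: eq_integral => x _ /=.
    by rewrite ger0_norm.
  apply: (@le_trans _ _ ((3 / 4^-1)%:E * ((32 * 32) * mass s / l)%:E)%E).
    by apply: lee_wpmul2l => //; rewrite lee_fin.
  by rewrite -EFinM lee_fin le_eqVlt; apply/orP; left; apply/eqP; field; rewrite gt_eqF.
have sub : [set t | I11 t /\ (exists2 e, 0 < e & l < `|hout s t e t|)%R] `<=` A1 `|` A2.
  move=> t [It [e e0 lt]]; apply: contrapT => /not_orP[/negP nA1 /negP nA2].
  have H r : 0 < r -> (\int[mu]_(y in ball t r) `|stepf s y|%:E <= (2 * r * m)%:E)%E.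
    exact: HL_maximal_le.
  pose J : set R := ball t (e / 2).
  have e20 : 0 < e / 2 by rewrite divr_gt0.
  have muBJ : (mu (B `&` J) <= (e / 4)%:E)%E.
    have := HL_maximal_le nA2 e20.
    rewrite (_ : (\int[mu]_(y in ball t (e / 2)) `|(\1_B y)%:E|)%E = mu (B `&` J)).
      by move/le_trans; apply; rewrite lee_fin; lra.
    rewrite -[RHS](@integral_indic _ (measurableTypeR R) R mu J _ B mB).
      by apply: eq_integral => x _ /=; rewrite ger0_norm.
    exact: measurable_ball.
  pose D := [set x | l / 4 < `|stepH (inner s (t - e) (t + e)) x|].
  have wi := inner_wf (t - e) (t + e) ws.
  have muD : (mu D <= (e / 4)%:E)%E.
    apply: (le_trans (weak_stepH wi (inner_narrow _ _ ws ns) (_ : 0 < l / 4))); first by rewrite divr_gt0.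
    have : mass (inner s (t - e) (t + e)) <= 4 * e * m.
      rewrite -lee_fin -integral_stepf_norm//.
      apply: (@le_trans _ _ (\int[mu]_(x in ball t (2 * e)) `|stepf s x|%:E)%E); last first.
        have -> : 4 * e * m = 2 * (2 * e) * m by ring.
        by apply: H; rewrite mulr_gt0.
      rewrite [leRHS]integral_mkcond; apply: ge0_le_integral => //.
      - by apply/measurable_EFinP; apply: measurableT_comp => //; exact: measurable_stepf.
      - apply/(measurable_restrictT _ _).1; first exact: measurable_ball.
        by apply/measurable_EFinP; apply: measurableT_comp => //; exact: measurable_stepf.
      - move=> x _; rewrite patchE stepf_inner.
        case: (boolP (t - e < x <= t + e)) => [/andP[h1 h2]|_]; last first.
          by rewrite mulr0 normr0; case: ifPn => // _; rewrite lee_fin.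
        rewrite mulr1 ifT// inE /ball/= ltr_norml; apply/andP; split; lra.
    move=> h; rewrite lee_fin ler_pdivrMr ?divr_gt0//.
    have -> : e / 4 * (l / 4) = 256 * (4 * e * m) by rewrite /m; field.
    by apply: ler_wpM2l h; exact: ler0n.
  (* [J] has measure [e], while [B] and [D] take away at most [e / 4] each. *)
  have [t' t'J /not_orP[/negP nB /negP nD]] : exists2 t', J t' & ~ (B t' \/ D t').
    apply: contrapT => /forall2NP h.
    have JBD : J `<=` (B `&` J) `|` D.
      by move=> x Jx; have [//|/contrapT[Bx|Dx]] := h x; [left|right].
    have := le_trans (le_mu JBD) (mu_setU _ _).
    rewrite /J lebesgue_measure_ball ?(ltW e20)// => /(le_trans)/(_ (leeD muBJ muD)).
    by rewrite -EFinD lee_fin mulr2n; lra.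
  have tt' : `|t - t'| <= e / 2 by apply: ltW.
  have := hout_diff ws si It e0 (ltW m0) tt' H.
  have := stepH_split t t' ws si e0.
  move: nB nD; rewrite /B /D/= -!leNgt => nB nD E.
  have : `|hout s t e t'| <= l / 2.
    have -> : hout s t e t' = stepH s t' - stepH (inner s (t - e) (t + e)) t' by rewrite E addrK.
    by apply: (le_trans (ler_normB _ _)); lra.
  have := ler_normD (hout s t e t - hout s t e t') (hout s t e t').
  by rewrite subrK; move: lt; rewrite /m; lra.
apply: (le_trans (le_mu sub)); apply: (le_trans (mu_setU _ _)).
have -> : (3 * (128 * 128) + 12 * (32 * 32)) * mass s / l = 3 * (128 * 128) * mass s / l + (12 * (32 * 32)) * mass s / l by field; rewrite gt_eqF.
by rewrite EFinD; apply: leeD.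
Qed.

End Maximal.

(** * Principal values of integrable functions *)

Section Approx.
Variable R : realType.
Local Notation mu := (@lebesgue_measure R).
Implicit Types (s : seq (R * R * R)) (u v g : R -> R) (x t l e : R) (N : nat).

Lemma cvge0_le (w : nat -> \bar R) e : w n @[n --> \oo] --> 0%E -> 0 < e ->
  exists N, forall n, (N <= n)%N -> (w n <= e%:E)%E.
Proof.
move=> /fine_cvgP[[N1 _ fin] /cvgrPdist_le/(_ _)] + e0 => /(_ _ e0)[N2 _ h].
exists (maxn N1 N2) => n; rewrite geq_max => /andP[n1 n2].
rewrite -(fineK (fin _ n1)) lee_fin; move: (h _ n2) => /=.
by rewrite sub0r normrN; apply: le_trans; exact: ler_norm.
Qed.

Lemma cvge0_ge (w : nat -> \bar R) : (forall n, (0 <= w n)%E) ->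
  (forall e, 0 < e -> exists N, forall n, (N <= n)%N -> (w n <= e%:E)%E) ->
  w n @[n --> \oo] --> 0%E.
Proof.
move=> w0 H; apply/fine_cvgP; have fin n e : (w n <= e%:E)%E -> w n \is a fin_num.
  by move=> h; rewrite ge0_fin_numE// (le_lt_trans h)// ltry.
split; first by have [N h] := H 1 ltr01; exists N => // n /= /h /fin.
apply/cvgrPdist_le => e e0; have [N h] := H _ e0; exists N => // n /= /h hn.
rewrite sub0r normrN ger0_norm ?fine_ge0//.
by rewrite -lee_fin fineK ?(fin _ _ hn).
Qed.

Definition node N k : R := -1 + 2 * k%:R / N%:R.

Definition cells N (G : nat -> R) : seq (R * R * R) :=
  [seq ((node N k, node N k.+1), G k) | k <- iota 0 N].

Lemma nodeS N k : node N k.+1 = node N k + 2 / N%:R.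
Proof. by rewrite /node -[k.+1%:R]natr1 mulrDr mulr1 mulrDl addrA. Qed.

Lemma node_le N k m : (k <= m)%N -> node N k <= node N m.
Proof. by move=> km; rewrite lerD2l ler_wpM2r ?invr_ge0// ler_wpM2l// ler_nat. Qed.

Lemma cells_wf N G : (1 < N)%N -> [/\ wf (cells N G), narrow (cells N G) & inI (cells N G)].
Proof.
move=> N1; have N0 : 0 < N%:R :> R by rewrite ltr0n ltnW.
have w0 : 0 < 2 / N%:R :> R by rewrite divr_gt0.
split.
- rewrite /wf /intervals -map_comp; apply/andP; split.
    by apply/allP => _ /mapP[k _ ->] /=; rewrite nodeS ltrDl.
  rewrite pairwise_map; apply: (sub_pairwise (r := ltn)) => [i j /= ij|].
    exact: node_le.
  by rewrite -sorted_pairwise ?iota_ltn_sorted//; exact: ltn_trans.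
- apply/allP => _ /mapP[k _ ->] /=; rewrite nodeS addrAC subrr add0r.
  by rewrite ler_pdivrMr// mul1r ler_nat.
- apply/allP => _ /mapP[k + ->] /=; rewrite mem_iota/= add0n => kN.
  apply/andP; split; first by rewrite lerDl divr_ge0// mulr_ge0.
  apply: le_trans (node_le N kN) _; rewrite /node mulfK ?gt_eqF//; lra.
Qed.

Lemma cell_mem N x : (0 < N)%N -> I11 x ->
  exists2 k, (k < N)%N & node N k < x <= node N k.+1.
Proof.
move=> N0; rewrite /I11/= in_itv/= => /andP[x1 x2].
have : x <= node N N by rewrite /node mulfK ?pnatr_eq0 -?lt0n//; lra.
have H n : x <= node N n -> exists2 k, (k < n)%N & node N k < x <= node N k.+1.
  elim: n => [|n IH]; first by rewrite /node mulr0 mul0r addr0; lra.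
  have [/IH[k kn h] _|h1 h2] := leP x (node N n); last by exists n => //; rewrite h1.
  by exists k => //; exact: ltn_trans kn _.
exact: H.
Qed.

Lemma stepf_cells N G k x : (k < N)%N -> node N k < x <= node N k.+1 ->
  stepf (cells N G) x = G k.
Proof.
move=> kN /andP[x1 x2]; rewrite /stepf /cells big_map/= (bigD1_seq k) ?iota_uniq ?mem_iota//=.
rewrite x1 x2/= mulr1 big1 ?addr0// => i ik.
rewrite (_ : (_ && _) = false) ?mulr0//; apply/negP => /andP[h1 h2].
have [ki|ik'] := ltnP k i.
  by have := node_le N ki; lra.
by have := @node_le N i.+1 k; rewrite ltn_neqAle ik ik' => /(_ isT); lra.
Qed.

Definition nrm u : \bar R := (\int[mu]_(x in I11) `|u x|%:E)%E.

Definition L1I u : Prop := measurable_fun setT u /\ (nrm u < +oo)%E.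

Lemma nrm_ge0 u : (0 <= nrm u)%E.
Proof. by apply: integral_ge0 => x _; rewrite lee_fin. Qed.

Lemma measurable_I11 : measurable (I11 : set (measurableTypeR R)).
Proof. exact: measurable_itv. Qed.

Lemma mu_I11_lty : (mu I11 < +oo)%E.
Proof. by rewrite mu_I11 ltry. Qed.

Lemma L1I_integrable u : L1I u -> mu.-integrable I11 (EFin \o u).
Proof.
move=> [mf uf]; apply/integrableP; split => //.
by apply/measurable_EFinP; exact: measurable_funTS.
Qed.

Lemma nrm_triangle u v : measurable_fun setT u -> measurable_fun setT v ->
  (nrm (fun x => u x + v x)%R <= nrm u + nrm v)%E.
Proof.
move=> mf mv.
have mn (w : R -> R) : measurable_fun setT w -> measurable_fun I11 (fun x => `|w x|%:E : \bar R).
  by move=> mw; apply/measurable_EFinP; apply: measurable_funTS; exact: measurableT_comp.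
rewrite /nrm -ge0_integralD//; [|exact: measurable_I11|exact: mn|exact: mn].
apply: ge0_le_integral => //; first exact: measurable_I11.
- by apply: mn; exact: measurable_funD.
- by apply: emeasurable_funD; exact: mn.
- by move=> x _; rewrite -EFinD lee_fin ler_normD.
Qed.

Lemma nrmN u : nrm (fun x => - u x) = nrm u.
Proof. by apply: eq_integral => x _; rewrite normrN. Qed.

Lemma nrmZ c u : measurable_fun setT u -> nrm (fun x => c * u x)%R = (`|c|%:E * nrm u)%E.
Proof.
move=> mf; rewrite /nrm -ge0_integralZl//; [|exact: measurable_I11|].
  by apply: eq_integral => x _; rewrite -EFinM normrM.
by apply/measurable_EFinP; apply: measurable_funTS; exact: measurableT_comp.
Qed.

Lemma nrm_le u v : measurable_fun setT u -> measurable_fun setT v ->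
  (forall x, I11 x -> `|u x| <= `|v x|) -> (nrm u <= nrm v)%E.
Proof.
move=> mf mv uv; apply: ge0_le_integral => //; first exact: measurable_I11.
- by apply/measurable_EFinP; apply: measurable_funTS; exact: measurableT_comp.
- by apply/measurable_EFinP; apply: measurable_funTS; exact: measurableT_comp.
Qed.

Lemma L1I_add u v : L1I u -> L1I v -> L1I (fun x => u x + v x).
Proof.
move=> [mf uf] [mv vf]; split; first exact: measurable_funD.
by apply: (le_lt_trans (nrm_triangle mf mv)); rewrite lte_add_pinfty.
Qed.

Lemma L1I_scale c u : L1I u -> L1I (fun x => c * u x).
Proof.
move=> [mf uf]; split; first exact: measurable_funM.
by rewrite nrmZ// lte_mul_pinfty.
Qed.

Lemma L1I_opp u : L1I u -> L1I (fun x => - u x).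
Proof. by move=> [mf uf]; split; [exact: measurableT_comp|rewrite nrmN]. Qed.

Lemma L1I_sub u v : L1I u -> L1I v -> L1I (fun x => u x - v x).
Proof. by move=> Lu Lv; apply: L1I_add => //; exact: L1I_opp. Qed.

Lemma nrm_stepf s : wf s -> (nrm (stepf s) <= (mass s)%:E)%E.
Proof.
move=> ws; rewrite -integral_stepf_norm//; apply: ge0_subset_integral => //.
  exact: measurable_I11.
by apply/measurable_EFinP; apply: measurableT_comp => //; exact: measurable_stepf.
Qed.

Lemma L1I_stepf s : wf s -> L1I (stepf s).
Proof.
move=> ws; split; first exact: measurable_stepf.
by apply: (le_lt_trans (nrm_stepf ws)); rewrite ltry.
Qed.

Lemma nrm_stepf_inI s : wf s -> inI s -> nrm (stepf s) = (mass s)%:E.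
Proof.
move=> ws /allP si; rewrite -integral_stepf_norm//.
have m1 (D : set R) : measurable_fun D (fun x => `|stepf s x|%:E).
  by apply/measurable_EFinP; apply: measurableT_comp => //; exact: measurable_stepf.
have -> : nrm (stepf s) = (\int[mu]_(x in `](-1)%R, 1%R]) `|stepf s x|%:E)%E.
  by rewrite [RHS]integral_itv_bndoo.
rewrite [LHS]integral_mkcond; apply: eq_integral => x _; rewrite patchE.
case: ifPn => //; rewrite notin_setE/= in_itv/= => h.
rewrite /stepf big_seq big1 ?normr0// => p ps.
rewrite (_ : (_ && _) = false) ?mulr0//; apply/negP => h1; apply: h.
by move: (si _ ps) h1; lra.
Qed.

(** [g] is sampled at the nodes, so the values of the step function are values of [g] and inherit
    its bounds. At least two cells are used, which makes them narrow. *)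
Lemma step_approx_continuous g e : continuous g -> 0 < e ->
  exists s, [/\ [/\ wf s, narrow s & inI s], forall p, p \in s -> exists y, p.2 = g y
    & (nrm (fun x => g x - stepf s x)%R <= e%:E)%E].
Proof.
move=> cg e0; have ab : (-1 : R) <= 1 by lra.
have [M gM] : exists M, forall x, -1 <= x <= 1 -> `|g x| <= M.
  have [c _ h] := @EVT_max R (fun x => `|g x|) _ _ ab
    (continuous_subspaceT (fun x => continuous_comp (cg x) (@norm_continuous _ _ (g x)))).
  by exists `|g c| => x xI; apply: h; rewrite in_itv.
pose s n := cells n.+2 (fun k => g (node n.+2 k.+1)).
have ws n : wf (s n) by have [] := @cells_wf n.+2 (fun k => g (node n.+2 k.+1)) isT.
have near_ n x : I11 x -> exists y, [/\ stepf (s n) x = g y, x <= y <= 1 & y - x <= 2 / n.+2%:R].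
  move=> Ix; have [k kn /andP[h1 h2]] := @cell_mem n.+2 x isT Ix.
  exists (node n.+2 k.+1); split; first by rewrite (stepf_cells _ kn)// h1.
    rewrite h2 (le_trans (node_le _ kn))// /node mulfK ?pnatr_eq0//; lra.
  by move: h1; rewrite nodeS; move: (2 / n.+2%:R) (node _ _) => q r; lra.
have [_ + _] : [/\ mu.-integrable I11 (EFin \o g),
    [sequence (\int[mu]_(x in I11) `|(stepf (s n) x)%:E - (g x)%:E|)%E]_n @ \oo --> 0%E &
    [sequence (\int[mu]_(x in I11) (stepf (s n) x)%:E)%E]_n @ \oo --> (\int[mu]_(x in I11) (g x)%:E)%E].
  apply: (@dominated_convergence _ (measurableTypeR R) R mu I11 measurable_I11
     (fun n x => (stepf (s n) x)%:E) (EFin \o g) (EFin \o cst M)).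
  - by move=> n; apply/measurable_EFinP; exact: measurable_stepf.
  - apply/measurable_EFinP; apply: measurable_funTS; exact: continuous_measurable_fun.
  - apply: aeW => x Ix; apply: cvg_EFin; first by near=> n.
    apply/cvgrPdist_le => d d0.
    have /cvgrPdist_le/(_ _ d0) := cg x; rewrite near_simpl => /nbhs_ballP[r /= r0 rd].
    near=> n; have [y [-> /andP[h1 h2] h3]] := near_ n _ Ix.
    apply: rd; rewrite /ball/= distrC ger0_norm ?subr_ge0//; apply: (le_lt_trans h3).
    rewrite ltr_pdivrMr// -ltr_pdivrMl// mulrC.
    near: n; exists (Num.bound (2 / r)) => // n /= hn.
    apply: (lt_le_trans (archi_boundP _)); first by rewrite divr_ge0// ltW.
    by rewrite ler_nat (leq_trans hn)// ltnW.
  - apply/integrableP; split; first by apply/measurable_EFinP; exact: measurable_cst.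
    rewrite /= (@integral_cst _ (measurableTypeR R) R mu I11 measurable_I11 `|M|%:E).
    by rewrite [X in (_ * X)%E]mu_I11 -EFinM ltry.
  - apply: aeW => x n Ix; have [y [-> /andP[h1 h2] h3]] := near_ n _ Ix.
    rewrite lee_fin; apply: gM; move: Ix; rewrite /I11/= in_itv/=; lra.
move=> /cvge0_le/(_ e0)[N hN]; exists (s N); split.
- by apply: cells_wf.
- by move=> p /mapP[k _ ->]; exists (node N.+2 k.+1).
- apply: le_trans (hN _ (leqnn N)); rewrite /nrm le_eqVlt; apply/orP; left; apply/eqP.
  by apply: eq_integral => x _; rewrite -EFinB/= distrC.
Unshelve. all: by end_near.
Qed.

Lemma step_approx u e : L1I u -> 0 < e ->
  exists s, [/\ wf s, narrow s, inI s & (nrm (fun x => u x - stepf s x)%R <= e%:E)%E].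
Proof.
move=> Lu e0; have [g [cg ig h]] := @approximation_continuous_integrable R I11 u
  measurable_I11 mu_I11_lty (L1I_integrable Lu).
have e20 : 0 < e / 2 by rewrite divr_gt0.
have [N /(_ _ (leqnn N)) hN] := cvge0_le h e20.
have [s [[ws ns si] _ hs]] := step_approx_continuous (cg N) e20.
exists s; split => //.
have mg : measurable_fun [set: R] (g N) by exact: continuous_measurable_fun.
have := @nrm_triangle (fun x => u x - g N x) (fun x => g N x - stepf s x).
rewrite (_ : (fun x => (u x - g N x) + (g N x - stepf s x)) = (fun x => u x - stepf s x)); last by apply/funext => x; rewrite addrA subrK.
move=> /(_ (measurable_funB Lu.1 mg) (measurable_funB mg (@measurable_stepf R s setT))) /le_trans; apply.
by rewrite (splitr e) EFinD; apply: leeD.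
Qed.

Lemma clamp_lip (lo hi x y : R) : lo <= hi -> `|clamp lo hi x - clamp lo hi y| <= `|x - y|.
Proof.
wlog xy : x y / x <= y.
  by move=> W lh; have [/W|/ltW/W] := leP x y => /(_ lh)//; rewrite distrC (distrC y).
move=> lh; rewrite !(distrC _ (_ _ _ y)) (distrC _ y) !ger0_norm ?subr_ge0 ?clamp_le//.
exact: clamp_dist.
Qed.

(** Clamping the continuous approximants into [[lo, hi]] is 1-Lipschitz and leaves [u] fixed, so it
    does not increase the distance to [u]. *)
Lemma step_approx_bounded u e lo hi : L1I u -> 0 < e -> lo <= hi ->
  (forall x, I11 x -> lo <= u x <= hi) ->
  exists s, [/\ [/\ wf s, narrow s & inI s], forall p, p \in s -> lo <= p.2 <= hi
    & (nrm (fun x => u x - stepf s x)%R <= e%:E)%E].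
Proof.
move=> Lu e0 lh uB; have [g [cg ig h]] := @approximation_continuous_integrable R I11 u
  measurable_I11 mu_I11_lty (L1I_integrable Lu).
have e20 : 0 < e / 2 by rewrite divr_gt0.
have [N /(_ _ (leqnn N)) hN] := cvge0_le h e20.
have cG : continuous (fun x => clamp lo hi (g N x)).
  move=> x; apply/cvgrPdist_le => d d0; have /cvgrPdist_le/(_ _ d0) := cg N x.
  by apply: filterS => y; apply: le_trans; exact: clamp_lip.
have [s [ws sv hs]] := step_approx_continuous cG e20.
exists s; split => //; first by move=> p /sv[y ->]; exact: clamp_between.
have mg : measurable_fun [set: R] (g N) by exact: continuous_measurable_fun.
have mG : measurable_fun [set: R] (fun x => clamp lo hi (g N x)) by exact: continuous_measurable_fun.
have := @nrm_triangle (fun x => u x - clamp lo hi (g N x)) (fun x => clamp lo hi (g N x) - stepf s x).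
rewrite (_ : (fun x => (u x - clamp lo hi (g N x)) + (clamp lo hi (g N x) - stepf s x)) = (fun x => u x - stepf s x)); last by apply/funext => x; rewrite addrA subrK.
move=> /(_ (measurable_funB Lu.1 mG) (measurable_funB mG (@measurable_stepf R s setT))) /le_trans; apply.
rewrite (splitr e) EFinD; apply: leeD => //; apply: le_trans hN.
apply: nrm_le; [exact: measurable_funB Lu.1 mG|exact: measurable_funB Lu.1 mg|].
move=> x /uB /andP[u1 u2]; rewrite -[X in `|X - _|](_ : clamp lo hi (u x) = _).
  exact: clamp_lip.
by rewrite /clamp (min_idPl u2) (max_idPr u1).
Qed.
End Approx.

(** * Truncated transforms of integrable functions *)

Section Truncations.
Variable R : realType.
Local Notation mu := (@lebesgue_measure R).
Implicit Types (s : seq (R * R * R)) (u v : R -> R) (x t l e M : R).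

(** A set of outer measure 0 is Caratheodory measurable, hence a Borel set up to part of a Borel
    null set; it is then contained in a Borel null set. *)
Lemma mu0_negligible (Z : set R) : mu Z = 0%E -> mu.-negligible Z.
Proof.
move=> Z0.
have mZ : ((@wlength R idfun)^*)%mu.-cara.-measurable Z.
  apply: le_caratheodory_measurable => X.
  have h1 : (((@wlength R idfun)^*)%mu (X `&` Z) <= 0)%E.
    by rewrite -Z0; apply: (le_outer_measure ((@wlength R idfun)^*)%mu); exact: subIsetr.
  apply: (le_trans (leeD2r _ h1)).
  by rewrite add0e; apply: le_outer_measure; exact: subIsetl.
move: mZ; rewrite -completed_caratheodory_measurable g_sigma_completed_algebra_genE.
move=> -[X mX] [N [B [mB B0 NB]] XNZ]; exists (X `|` B); split.
- exact: measurableU.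
- apply/eqP; rewrite eq_le mu_ge0 andbT; apply: (le_trans (mu_setU _ _)).
  rewrite B0 adde0 -Z0; apply: le_mu; rewrite -XNZ; exact: subsetUl.
- by rewrite -XNZ; apply: setUS.
Qed.

Lemma mu_setU0 (A B : set R) : mu A = 0%E -> mu B = 0%E -> mu (A `|` B) = 0%E.
Proof.
move=> A0 B0; apply/eqP; rewrite eq_le mu_ge0 andbT.
by apply: (le_trans (mu_setU _ _)); rewrite A0 B0 adde0.
Qed.

Lemma mu_sub0 (A B : set R) : A `<=` B -> mu B = 0%E -> mu A = 0%E.
Proof. by move=> AB B0; apply/eqP; rewrite eq_le mu_ge0 andbT -B0 le_mu. Qed.

Lemma mu_bigcup_geom (E : nat -> set R) M : 0 <= M ->
  (forall n, (mu (E n) <= (M / (2 ^ n.+1)%:R)%:E)%E) ->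
  (mu (\bigcup_n E n) <= M%:E)%E.
Proof.
move=> M0 EM; apply: (le_trans (mu_bigcup _)).
apply: (le_trans _ (epsilon_trick0 xpredT M0)).
by apply: lee_nneseries => // n _; exact: mu_ge0.
Qed.

Lemma borel_cantelli (E : nat -> set R) M : 0 <= M ->
  (forall n, (mu (E n) <= (M / (2 ^ n)%:R)%:E)%E) ->
  mu [set x | forall N, exists2 n, (N <= n)%N & E n x] = 0%E.
Proof.
move=> M0 EM; apply/eqP; rewrite eq_le mu_ge0 andbT; apply/lee_addgt0Pr => e e0.
rewrite add0e; pose N := Num.bound (2 * M / e).
apply: (@le_trans _ _ (mu (\bigcup_n E (N + n)%N))).
  apply: le_mu => x /(_ N)[n Nn En]; exists (n - N)%N => //; by rewrite subnKC.
apply: (le_trans (@mu_bigcup_geom _ (2 * M / (2 ^ N)%:R) _ _)).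
- by rewrite divr_ge0// mulr_ge0.
- move=> n; apply: (le_trans (EM _)); rewrite lee_fin expnD expnS !natrM le_eqVlt.
  by apply/orP; left; apply/eqP; field; rewrite !pnatr_eq0 -!lt0n !expn_gt0.
- rewrite lee_fin ler_pdivrMr ?ltr0n ?expn_gt0//.
  rewrite -ler_pdivrMl// mulrC; apply: (@le_trans _ _ N%:R).
    by apply/ltW/archi_boundP; rewrite divr_ge0// ?mulr_ge0// ltW.
  by rewrite ler_nat ltnW// ltn_expl.
Qed.

Definition htr u t e : R := \int[mu]_(x in `]-1, t - e[) (u x / (x - t)) +
  \int[mu]_(x in `]t + e, 1[) (u x / (x - t)).

Lemma itv_sub_I11 t e : I11 t -> 0 < e ->
  [/\ `]-1, t - e[%classic `<=` I11, `]t + e, 1[%classic `<=` I11,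
   forall x, `]-1, t - e[%classic x -> e <= `|x - t| &
   forall x, `]t + e, 1[%classic x -> e <= `|x - t|].
Proof.
rewrite /I11/= in_itv/= => /andP[t1 t2] e0; split=> x /=; rewrite ?in_itv/= => /andP[h1 h2].
- by apply/andP; split; lra.
- by apply/andP; split; lra.
- by rewrite distrC ger0_norm; lra.
- by rewrite ger0_norm; lra.
Qed.

Lemma htr_integrable u t e : L1I u -> I11 t -> 0 < e ->
  mu.-integrable `]-1, t - e[ (EFin \o (fun x => u x / (x - t))) /\
  mu.-integrable `]t + e, 1[ (EFin \o (fun x => u x / (x - t))).
Proof.
move=> Lu It e0; have [s1 s2 d1 d2] := itv_sub_I11 It e0.
have iu := L1I_integrable Lu.
split; apply: (integrable_div_sub _ _ e0) => //.
  by apply: (@integrableS _ _ _ mu I11) => //; exact: measurable_I11.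
by apply: (@integrableS _ _ _ mu I11) => //; exact: measurable_I11.
Qed.

Lemma htrD u v t e : L1I u -> L1I v -> I11 t -> 0 < e ->
  htr (fun x => u x + v x) t e = htr u t e + htr v t e.
Proof.
move=> Lu Lv It e0; have [iu1 iu2] := htr_integrable Lu It e0.
have [iv1 iv2] := htr_integrable Lv It e0.
rewrite /htr addrACA -!RintegralD//.
by congr (_ + _); apply: eq_Rintegral => x _; rewrite mulrDl.
Qed.

Lemma htrZ c u t e : L1I u -> I11 t -> 0 < e ->
  htr (fun x => c * u x) t e = c * htr u t e.
Proof.
move=> Lu It e0; have [iu1 iu2] := htr_integrable Lu It e0.
rewrite /htr mulrDr -!RintegralZl//.
by congr (_ + _); apply: eq_Rintegral => x _; rewrite mulrA.
Qed.

Lemma htrB u v t e : L1I u -> L1I v -> I11 t -> 0 < e ->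
  htr (fun x => u x - v x) t e = htr u t e - htr v t e.
Proof.
move=> Lu Lv It e0.
have -> : (fun x => u x - v x) = (fun x => u x + (-1) * v x) by apply/funext => x; rewrite mulN1r.
by rewrite htrD ?htrZ ?mulN1r//; exact: L1I_scale.
Qed.

(** For a fixed [e] the truncation is continuous on [L1]. The bad constant does no harm: it serves
    only to let a remainder vanish at fixed [e]. *)
Lemma htr_le u t e : L1I u -> I11 t -> 0 < e ->
  (`|htr u t e|%:E <= (2 / e)%:E * nrm u)%E.
Proof.
move=> Lu It e0; have [iu1 iu2] := htr_integrable Lu It e0.
have [s1 s2 d1 d2] := itv_sub_I11 It e0.
have mabs (D : set (measurableTypeR R)) : measurable_fun D (fun x => `|u x|%:E).
  by apply/measurable_EFinP; apply: measurable_funTS; apply: measurableT_comp => //; exact: Lu.1.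
have B (D : set (measurableTypeR R)) : measurable D -> D `<=` I11 ->
    (forall x, D x -> e <= `|x - t|) ->
    mu.-integrable D (EFin \o (fun x => u x / (x - t))) ->
    (`|\int[mu]_(x in D) (u x / (x - t))|%:E <= (e^-1)%:E * nrm u)%E.
  move=> mD DI De i; apply: (le_trans (y := (\int[mu]_(x in D) `|u x / (x - t)|%:E)%E)).
    rewrite /Rintegral -abse_EFin fineK; last exact: (integrable_fin_num mD i).
    by apply: (@le_abse_integral _ _ _ mu) => //; case/integrableP : i.
  apply: (@le_trans _ _ (\int[mu]_(x in D) ((e^-1)%:E * `|u x|%:E))%E).
    apply: ge0_le_integral => //.
    - by move/integrableP : i => [/(measurableT_comp (@abse_measurable _ setT))].
    - by apply: emeasurable_funM; [exact: measurable_cst|exact: mabs].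
    - move=> x Dx; rewrite -EFinM lee_fin normrM normfV mulrC ler_wpM2r//.
      by rewrite lef_pV2 ?posrE// ?De// (lt_le_trans e0)// De.
  rewrite (@ge0_integralZl _ _ _ mu D mD (fun x => `|u x|%:E) (mabs D) e^-1%:E)//; last first.
    by rewrite lee_fin invr_ge0 ltW.
  apply: lee_wpmul2l; first by rewrite lee_fin invr_ge0 ltW.
  have u0 x : I11 x -> (0 <= `|u x|%:E)%E by rewrite lee_fin.
  exact: (@ge0_subset_integral _ (measurableTypeR R) R mu D I11 mD (@measurable_I11 R) _ (mabs I11) u0 DI).
apply: (@le_trans _ _ ((e^-1)%:E * nrm u + (e^-1)%:E * nrm u)%E).
  apply: (@le_trans _ _ (`|\int[mu]_(x in `]-1, t - e[) (u x / (x - t))|%:E +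
     `|\int[mu]_(x in `]t + e, 1[) (u x / (x - t))|%:E)%E).
    by rewrite -EFinD lee_fin ler_normD.
  by apply: leeD; apply: B.
rewrite -ge0_muleDl ?lee_fin ?invr_ge0 ?(ltW e0)//.
by rewrite -EFinD (_ : e^-1 + e^-1 = 2 / e)// -mulr2n mulr_natl.
Qed.

Lemma htr_stepf s t e : wf s -> inI s -> I11 t -> 0 < e ->
  htr (stepf s) t e = hout s t e t.
Proof.
move=> ws si It e0; rewrite /htr /hout; congr (_ + _).
  have [h|h] := leP (-1) (t - e).
    by rewrite (@Rintegral_stepf_div _ s)//; right; lra.
  rewrite set_itv_ge; last by rewrite bnd_simp -leNgt ltW.
  rewrite /Rintegral integral_set0/= /clampH big1// => p _.
  have c x : clamp (t - e) (t - e) x = t - e.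
    by apply/eqP; rewrite eq_le andbC; apply: clamp_between.
  by rewrite !c subrr mulr0.
have [h|h] := leP (t + e) 1.
  by rewrite (@Rintegral_stepf_div _ s)//; left; lra.
rewrite set_itv_ge; last by rewrite bnd_simp -leNgt ltW.
rewrite /Rintegral integral_set0/= /clampH big1// => p _.
have c x : clamp (t + e) (t + e) x = t + e.
  by apply/eqP; rewrite eq_le andbC; apply: clamp_between.
by rewrite !c subrr mulr0.
Qed.

Definition ends s : seq R := [seq p.1.1 | p <- s] ++ [seq p.1.2 | p <- s].

Lemma hout_small s t : wf s -> inI s -> t \notin ends s ->
  exists2 d, 0 < d & forall e, 0 < e -> e < d -> hout s t e t = stepH s t.
Proof.
move=> ws si ts.
have [d d0 dP] : exists2 d, 0 < d & forall x, x \in ends s -> d <= `|x - t|.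
  elim: (ends s) ts => [|x r IH]; first by exists 1.
  rewrite inE negb_or => /andP[tx /IH[d d0 dP]].
  have x0 : 0 < `|x - t| by rewrite normr_gt0 subr_eq0 eq_sym.
  exists (Num.min d `|x - t|); first by rewrite lt_min d0.
  by move=> y; rewrite inE => /predU1P[->|/dP]; rewrite ge_min ?lexx ?orbT// => ->.
exists d => // e e0 ed; rewrite (stepH_split t t ws si e0) stepH_inner// /clampH.
rewrite big_seq big1 ?addr0// => p ps.
have /dP d1 : p.1.1 \in ends s by rewrite mem_cat; apply/orP; left; apply/mapP; exists p.
have /dP d2 : p.1.2 \in ends s.
  by rewrite mem_cat; apply/orP; right; apply/mapP; exists p.
suff N x : d <= `|x - t| -> `|clamp (t - e) (t + e) x - t| = e by rewrite !N// subrr mulr0.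
rewrite /clamp; have [h|h] := leP t x.
  rewrite ger0_norm ?subr_ge0// => h1.
  have -> : Num.min x (t + e) = t + e by apply/min_idPr; lra.
  have -> : Num.max (t - e) (t + e) = t + e by apply/max_idPr; lra.
  by rewrite addrAC subrr add0r gtr0_norm.
rewrite ltr0_norm ?subr_lt0// => h1.
have -> : Num.min x (t + e) = x by apply/min_idPl; lra.
have -> : Num.max (t - e) x = t - e by apply/max_idPl; lra.
by rewrite addrAC subrr add0r normrN gtr0_norm.
Qed.

Definition Kw : R := 3 * (128 * 128) + 12 * (32 * 32).

Lemma Kw_ge0 : 0 <= Kw. Proof. by rewrite /Kw addr_ge0// mulr_ge0// mulr_ge0. Qed.

(* The function is decomposed into step functions [d_n] of mass
   [<= 2 M / 4 ^ n], and the maximal truncation of [d_n] is compared with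
   [l / 2 ^ (n + 1)]. *)
Lemma weak_Tstar_L1 u M l : L1I u -> 0 < M -> (nrm u <= M%:E)%E -> 0 < l ->
  (mu [set t | I11 t /\ (exists2 e, 0 < e & l < `|htr u t e|)%R]
    <= (8 * Kw * M / l)%:E)%E.
Proof.
move=> Lu M0 uM l0.
pose P (w : R -> R) (e : R) s := [/\ wf s, narrow s, inI s &
  (nrm (fun x => w x - stepf s x)%R <= e%:E)%E].
pose D w e := xget [::] [set s | P w e s].
have DP w e : L1I w -> 0 < e -> P w e (D w e).
  by move=> Lw e0; apply: xgetPex; exact: step_approx.
pose eps n : R := M / 4 ^+ n.
have eps0 n : 0 < eps n by rewrite divr_gt0// exprn_gt0.
have epsS n : 4 * eps n.+1 = eps n.
  by rewrite /eps exprS; field; rewrite expf_neq0.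
pose r := nat_rect (fun _ => R -> R) u (fun n w => fun x => w x - stepf (D w (eps n.+1)) x).
pose d n := D (r n) (eps n.+1).
have Lr n : L1I (r n).
  elim: n => [//|n IH] /=; apply: L1I_sub => //.
  by have [w1 _ _ _] := DP _ _ IH (eps0 n.+1); exact: L1I_stepf.
have dP n : P (r n) (eps n.+1) (d n) by exact: DP.
have rE n x : r n.+1 x = r n x - stepf (d n) x by [].
have rn n : (nrm (r n) <= (eps n)%:E)%E.
  by case: n => [|n]; [rewrite /eps expr0 divr1|have [] := dP n].
have dm n : mass (d n) <= 2 * eps n.
  have [w1 _ w3 w4] := dP n; rewrite -lee_fin -nrm_stepf_inI//.
  have := @nrm_triangle _ (r n) (fun x => - (r n x - stepf (d n) x)) (Lr n).1.
  rewrite nrmN (_ : (fun x => r n x + - (r n x - stepf (d n) x)) = stepf (d n)); last by apply/funext => x; rewrite opprB addrC subrK.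
  have mo : measurable_fun setT (fun x => - (r n x - stepf (d n) x)).
    apply: measurableT_comp => //; apply: measurable_funB; first exact: (Lr n).1.
    exact: measurable_stepf.
  move=> /(_ mo)/le_trans; apply; apply: (le_trans (leeD (rn n) w4)).
  by rewrite -EFinD lee_fin; have := epsS n; have := eps0 n.+1; lra.
have sub : [set t | I11 t /\ (exists2 e, 0 < e & l < `|htr u t e|)%R] `<=`
   \bigcup_n [set t | I11 t /\ (exists2 e, 0 < e & l / (2 ^ n.+1)%:R < `|hout (d n) t e t|)%R].
  (* If no [d n] exceeds its share [l / 2 ^ n.+1], the shares add up to at most [l], and the
     truncation of the remainder [r n] at this fixed [e] tends to 0. *)
  move=> t [It [e e0 le]]; apply: contrapT => nb.
  have hd n : `|hout (d n) t e t| <= l / (2 ^ n.+1)%:R.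
    rewrite leNgt; apply/negP => h; apply: nb; exists n => //; split => //; by exists e.
  have hu n : `|htr u t e| <= l * (1 - (2 ^ n)%:R^-1) + `|htr (r n) t e|.
    elim: n => [|n IH]; first by rewrite expn0 invr1 subrr mulr0 add0r.
    apply: (le_trans IH).
    have -> : htr (r n) t e = htr (r n.+1) t e + hout (d n) t e t.
      have [w1 _ w3 _] := dP n.
      rewrite -htr_stepf// -htrD//; last exact: L1I_stepf.
      by congr (htr _ t e); apply/funext => x; rewrite rE subrK.
    have := ler_normD (htr (r n.+1) t e) (hout (d n) t e t).
    move: (hd n); have -> : l / (2 ^ n.+1)%:R = l * (2 ^ n)%:R^-1 - l * (2 ^ n.+1)%:R^-1.
      by rewrite expnS natrM; field; rewrite pnatr_eq0 -lt0n expn_gt0.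
    by lra.
  have : `|htr u t e| <= l.
    apply/ler_addgt0Pr => q q0.
    pose n := Num.bound (2 / e * M / q).
    apply: (le_trans (hu n)); apply: lerD.
      by rewrite ler_piMr// ?(ltW l0)// gerBl invr_ge0.
    rewrite -lee_fin; apply: (le_trans (htr_le (Lr n) It e0)).
    apply: (le_trans (lee_wpmul2l _ (rn n))); first by rewrite lee_fin divr_ge0// ltW.
    rewrite -EFinM lee_fin /eps mulrA ler_pdivrMr ?exprn_gt0//.
    rewrite -ler_pdivrMl// mulrC; apply: (@le_trans _ _ n%:R).
      by apply/ltW/archi_boundP; rewrite !mulr_ge0// ?invr_ge0 ?ltW.
    by rewrite -natrX ler_nat ltnW// ltn_expl.
  by move: le; lra.
apply: (le_trans (le_mu sub)); apply: mu_bigcup_geom.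
  by rewrite !mulr_ge0 ?Kw_ge0 ?invr_ge0 ?ltW.
move=> n; have [w1 w2 w3 _] := dP n.
have p2 : 0 < (2 ^ n.+1)%:R :> R by rewrite ltr0n expn_gt0.
apply: (le_trans (weak_Tstar w1 w2 w3 (divr_gt0 l0 p2))).
rewrite -/Kw lee_fin invf_div mulrA -mulrA [leRHS](_ : _ = Kw * (8 * M / (2 ^ n.+1)%:R / l)); last first.
  by field; rewrite !gt_eqF.
rewrite -[leLHS]mulrA; apply: ler_wpM2l; first exact: Kw_ge0.
rewrite mulrA ler_pM2r ?invr_gt0// ler_pdivlMr//.
apply: (@le_trans _ _ (2 * eps n * (2 ^ n.+1)%:R * (2 ^ n.+1)%:R)).
  by rewrite !ler_pM2r.
rewrite /eps expnS natrM -(natrX _ 4) (_ : 4 = 2 * 2)%N// expnMn natrM le_eqVlt.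
by apply/orP; left; apply/eqP; field; rewrite pnatr_eq0 -lt0n expn_gt0.
Qed.
End Truncations.

(** * Existence of principal values and closedness of the transform *)

Section PrincipalValue.
Variable R : realType.
Local Notation mu := (@lebesgue_measure R).
Implicit Types (s : seq (R * R * R)) (u v : R -> R) (x t l e M : R).

(** Almost everywhere on [(-1, 1)], with an exceptional set that is null for the outer measure and
    otherwise arbitrary. *)
Definition offnull (P : R -> Prop) : Prop :=
  exists2 Z : set R, mu Z = 0%E & forall t, I11 t -> ~ Z t -> P t.

Lemma offnull_and (P Q : R -> Prop) : offnull P -> offnull Q ->
  offnull (fun t => P t /\ Q t).
Proof.
move=> [Z Z0 ZP] [Y Y0 YQ]; exists (Z `|` Y); first exact: mu_setU0.
by move=> t It /not_orP[h1 h2]; split; [exact: ZP|exact: YQ].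
Qed.

Lemma offnull_imp (P Q : R -> Prop) : (forall t, I11 t -> P t -> Q t) ->
  offnull P -> offnull Q.
Proof. by move=> PQ [Z Z0 ZP]; exists Z => // t It Zt; apply: PQ => //; exact: ZP. Qed.

Lemma offnull_all (P : R -> Prop) : (forall t, I11 t -> P t) -> offnull P.
Proof. by move=> AP; exists set0; [rewrite measure0|move=> t It _; exact: AP]. Qed.

Lemma mu_bigcup0 (Z : nat -> set R) : (forall n, mu (Z n) = 0%E) -> mu (\bigcup_n Z n) = 0%E.
Proof.
move=> Z0; apply/eqP; rewrite eq_le mu_ge0 andbT; apply: (le_trans (mu_bigcup _)).
by rewrite eseries0// => n _ _; exact: Z0.
Qed.

Lemma offnull_forall (P : nat -> R -> Prop) : (forall n, offnull (P n)) ->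
  offnull (fun t => forall n, P n t).
Proof.
move=> H; have /choice[Z hZ] : forall n, exists Z : set R, mu Z = 0%E /\
    forall t, I11 t -> ~ Z t -> P n t by move=> n; have [Z h1 h2] := H n; exists Z.
exists (\bigcup_n Z n); first by apply: mu_bigcup0 => n; have [] := hZ n.
by move=> t It nZ n; apply: (hZ n).2 => // Zt; apply: nZ; exists n.
Qed.

Lemma offnull_ae (P : R -> Prop) : offnull P -> {ae mu, forall t, I11 t -> P t}.
Proof.
move=> [Z /mu0_negligible[A [mA A0 ZA]] ZP]; exists A; split => // t /= nP.
by apply: ZA; apply: contrapT => nZ; apply: nP => It; exact: ZP.
Qed.

Lemma cauchy_seq_cvg (a : nat -> R) :
  (forall e, 0 < e -> exists N, forall n, (N <= n)%N -> `|a N - a n| < e) -> cvgn a.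
Proof.
move=> H; apply: cauchy_cvg; apply: cauchy_exP => e e0 /=.
by have [N hN] := H e e0; exists (a N); exists N => // n /= /hN.
Qed.

Lemma nrm_ae u v : measurable_fun setT u -> measurable_fun setT v ->
  offnull (fun t => u t = v t) -> nrm u = nrm v.
Proof.
move=> mf mv uv; have mn (w : R -> R) : measurable_fun setT w ->
    measurable_fun I11 (fun x => `|w x|%:E : \bar R).
  by move=> mw; apply/measurable_EFinP; apply: measurable_funTS; exact: measurableT_comp.
apply: (@ge0_ae_eq_integral _ (measurableTypeR R) R mu I11 _ _ (@measurable_I11 R) (mn _ mf) (mn _ mv)).
- by move=> x _; rewrite lee_fin.
- by move=> x _; rewrite lee_fin.
- by apply: offnull_ae; apply: offnull_imp uv => x _ ->.
Qed.

Lemma limn_einf_le (w : nat -> \bar R) (M : \bar R) : (forall n, (w n <= M)%E) -> (limn_einf w <= M)%E.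
Proof.
move=> wM; rewrite limn_einf_lim; apply: lime_le; first exact: is_cvg_einfs.
by apply: nearW => n; apply: le_trans (wM n); apply: ereal_inf_lbound; exists n => /=.
Qed.

Lemma nrm_fatou (vn : nat -> R -> R) v (M : \bar R) : (forall n, measurable_fun setT (vn n)) ->
  measurable_fun setT v -> offnull (fun t => vn n t @[n --> \oo] --> v t) ->
  (forall n, (nrm (vn n) <= M)%E) -> (nrm v <= M)%E.
Proof.
move=> mvn mv cv vM.
have mn (w : R -> R) : measurable_fun setT w ->
    measurable_fun I11 (fun x => `|w x|%:E : \bar R).
  by move=> mw; apply/measurable_EFinP; apply: measurable_funTS; exact: measurableT_comp.
have f0 n x : I11 x -> (0 <= `|vn n x|%:E)%E by rewrite lee_fin.
have := @fatou _ (measurableTypeR R) R mu I11 (@measurable_I11 R) (fun n x => `|vn n x|%:E)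
  (fun n => mn _ (mvn n)) f0.
move=> /le_trans/(_ (limn_einf_le vM)); apply: le_trans.
apply: (@ae_ge0_le_integral _ (measurableTypeR R) R mu I11 (@measurable_I11 R)).
- by move=> x _; rewrite lee_fin.
- exact: mn.
- move=> x Ix; rewrite limn_einf_lim; apply: lime_ge; first exact: is_cvg_einfs.
  by apply: nearW => n; apply: le_ereal_inf_tmp => _ [k _ <-]; exact: f0.
- rewrite /limn_einf; apply: measurableT_comp => //; apply: measurable_fun_limn_esup => n.
  by apply: measurableT_comp => //; exact: mn.
- apply: offnull_ae; apply: offnull_imp cv => x Ix h.
  have /cvg_limn_einf_sup[-> _] : `|vn n x|%:E @[n --> \oo] --> `|v x|%:E.
    by apply: cvg_EFin; [near=> n|exact: (cvg_norm h)].
  by [].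
Unshelve. all: by end_near. Qed.

Lemma cvg_le_near (T : Type) (F : set_system T) (FF : ProperFilter F) (f : T -> R) y c :
  f @ F --> y -> (\forall e \near F, f e <= c) -> y <= c.
Proof. by move=> cf h; rewrite -(cvg_lim _ cf)//; apply: limr_le => //; apply: cvgP cf. Qed.

(** The weak type bound at level [2^-n] for mass [4^-n] is summable, so Borel-Cantelli applies. The
    conclusion is uniform in the truncation parameter, which is what makes limits in [n] and in [e]
    interchangeable. *)
Lemma fast_small (w : nat -> R -> R) : (forall n, L1I (w n)) ->
  (forall n, (nrm (w n) <= (4 ^- n)%:E)%E) ->
  offnull (fun t => exists N, forall n, (N <= n)%N -> forall e, 0 < e -> `|htr (w n) t e| <= 2 ^- n).
Proof.
move=> Lw wn.
pose E n := [set t | I11 t /\ (exists2 e, 0 < e & 2 ^- n < `|htr (w n) t e|)%R].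
exists [set t | forall N, exists2 n, (N <= n)%N & E n t].
  apply: (@borel_cantelli _ _ (8 * Kw R)); first by rewrite mulr_ge0 ?Kw_ge0.
  move=> n; have p4 : 0 < 4 ^- n :> R by rewrite invr_gt0 exprn_gt0.
  have p2 : 0 < 2 ^- n :> R by rewrite invr_gt0 exprn_gt0.
  apply: (le_trans (weak_Tstar_L1 (Lw n) p4 (wn n) p2)).
  rewrite lee_fin invrK natrX -mulrA ler_wpM2l ?mulr_ge0 ?Kw_ge0//.
  rewrite (_ : 4 = 2 * 2 :> R); last by rewrite -natrM.
  by rewrite exprMn invfM -mulrA mulVf ?mulr1// expf_neq0.
move=> t It /existsNP[N h]; exists N => n Nn e e0; rewrite leNgt; apply/negP => lt.
by apply: h; exists n => //; split => //; exists e.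
Qed.

(** [v] is a Borel version of [pi] times the transform of [u]. A relation is used rather than a
    function since [v] is determined only up to null sets. *)
Definition is_hilb u v : Prop :=
  measurable_fun setT v /\ offnull (fun t => htr u t e @[e --> (0 : R)^'+] --> v t).

Lemma is_hilb_unique u v v' : is_hilb u v -> is_hilb u v' -> offnull (fun t => v t = v' t).
Proof.
move=> [_ h] [_ h']; apply: offnull_imp (offnull_and h h') => t _ [c c'].
exact: cvg_unique c c'.
Qed.

Lemma near_htr (f g : R -> R) (y : R) : (forall e, 0 < e -> f e = g e) ->
  f e @[e --> (0 : R)^'+] --> y -> g e @[e --> (0 : R)^'+] --> y.
Proof.
move=> fg; apply: cvg_trans; apply: near_eq_cvg; near=> e; apply: fg.
near: e; exact: nbhs_right_gt.
Unshelve. all: by end_near. Qed.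

Lemma is_hilb_add u u' v v' : L1I u -> L1I u' -> is_hilb u v -> is_hilb u' v' ->
  is_hilb (fun x => u x + u' x) (fun t => v t + v' t).
Proof.
move=> Lu Lu' [mv h] [mv' h']; split; first exact: measurable_funD.
apply: offnull_imp (offnull_and h h') => t It [c c'].
apply: near_htr (cvgD c c') => e e0; by rewrite /= htrD.
Qed.

Lemma is_hilb_scale c u v : L1I u -> is_hilb u v -> is_hilb (fun x => c * u x) (fun t => c * v t).
Proof.
move=> Lu [mv h]; split; first exact: measurable_funM.
apply: offnull_imp h => t It h.
by apply: (@near_htr (fun e => c * htr u t e) _ _ _ (cvgM (cvg_cst c) h)) => e e0; rewrite htrZ.
Qed.

Lemma is_hilb_sub u u' v v' : L1I u -> L1I u' -> is_hilb u v -> is_hilb u' v' ->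
  is_hilb (fun x => u x - u' x) (fun t => v t - v' t).
Proof.
move=> Lu Lu' [mv h] [mv' h']; split; first exact: measurable_funB.
apply: offnull_imp (offnull_and h h') => t It [c c'].
by apply: near_htr (cvgB c c') => e e0; rewrite /= htrB.
Qed.

Lemma is_hilb_stepf s : wf s -> inI s -> is_hilb (stepf s) (stepH s).
Proof.
move=> ws si; split; first exact: measurable_stepH.
exists [set x | x \in ends s]; first exact: mu_seq0.
move=> t It /= /negP ts; have [d d0 dP] := hout_small ws si ts.
apply/cvgrPdist_le => q q0; near=> e.
have e0 : 0 < e by near: e; exact: nbhs_right_gt.
have ed : e < d by near: e; exact: nbhs_right_lt.
by rewrite htr_stepf// dP// subrr normr0 ltW.
Unshelve. all: by end_near. Qed.

(** Almost everywhere the truncations of [u] and of its [n]-th step approximation differ by at most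
    [2^-n], uniformly in [e], and the latter are equal to [stepH (s n) t] for small [e]. So these
    values are Cauchy, and their limit is the principal value. Writing it as an upper limit gives a
    function that is measurable on the whole line. *)
Lemma is_hilb_exists u : L1I u -> exists v, is_hilb u v.
Proof.
move=> Lu; have p4 n : 0 < 4 ^- n :> R by rewrite invr_gt0 exprn_gt0.
have /choice[s sP] : forall n, exists s, [/\ wf s, narrow s, inI s &
    (nrm (fun x => u x - stepf s x)%R <= (4 ^- n)%:E)%E].
  by move=> n; exact: step_approx.
have Ls n : L1I (stepf (s n)) by apply: L1I_stepf; have [] := sP n.
exists (fun t => fine (limn_esup (fun n => (stepH (s n) t)%:E))); split.
  apply: measurableT_comp => //; apply: measurable_fun_limn_esup => n.
  by apply/measurable_EFinP; exact: measurable_stepH.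
have H1 := @fast_small (fun n x => u x - stepf (s n) x) (fun n => L1I_sub Lu (Ls n))
  (fun n => let: And4 _ _ _ h := sP n in h).
have H2 : offnull (fun t => forall n, exists2 d, 0 < d & forall e, 0 < e -> e < d ->
    htr (stepf (s n)) t e = stepH (s n) t).
  apply: offnull_forall => n; have [ws ns si _] := sP n.
  exists [set x | x \in ends (s n)]; first exact: mu_seq0.
  move=> t It /= /negP ts; have [d d0 dP] := hout_small ws si ts.
  by exists d => // e e0 ed; rewrite htr_stepf// dP.
apply: offnull_imp (offnull_and H1 H2) => t It [[N hN] h].
have h' n : (N <= n)%N -> exists2 d, 0 < d & forall e, 0 < e -> e < d ->
    `|htr u t e - stepH (s n) t| <= 2 ^- n.
  move=> /hN hn; have [d d0 dP] := h n; exists d => // e e0 ed.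
  by rewrite -(dP _ e0 ed) -htrB//; exact: hn.
have p2 n : 0 < 2 ^- n :> R by rewrite invr_gt0 exprn_gt0.
have mono n m : (n <= m)%N -> 2 ^- m <= 2 ^- n :> R.
  by move=> nm; rewrite lef_pV2 ?posrE ?exprn_gt0// ler_eXn2l// ltr1n.
have small e : 0 < e -> exists2 n, (N <= n)%N & 2 * 2 ^- n < e.
  move=> e0; exists (maxn N (Num.bound (2 / e))); first exact: leq_maxl.
  set m := maxn _ _; rewrite ltr_pdivrMr ?exprn_gt0// -ltr_pdivrMl// mulrC.
  apply: (lt_le_trans (archi_boundP _)); first by rewrite divr_ge0// ltW.
  apply: (@le_trans _ _ m%:R); first by rewrite ler_nat leq_maxr.
  by rewrite -natrX ler_nat ltnW// ltn_expl.
have cau n m : (N <= n)%N -> (n <= m)%N -> `|stepH (s n) t - stepH (s m) t| <= 2 * 2 ^- n.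
  move=> Nn nm; have [d d0 dP] := h' n Nn; have [d' d0' dP'] := h' m (leq_trans Nn nm).
  pose e := Num.min d d' / 2.
  have e0 : 0 < e by rewrite divr_gt0// lt_min d0.
  have e1 : e < Num.min d d' by rewrite /e ltr_pdivrMr// ltr_pMr ?ltr1n// lt_min d0.
  move: e1; rewrite lt_min => /andP[/(dP _ e0) g1 /(dP' _ e0) g2].
  have := ler_distD (htr u t e) (stepH (s n) t) (stepH (s m) t).
  by rewrite (distrC (stepH (s n) t) (htr _ _ _)); have := mono _ _ nm; lra.
have /cvg_ex[y cy] : cvgn (fun n => stepH (s n) t).
  apply: cauchy_seq_cvg => e e0; have [n Nn hn] := small _ e0.
  by exists n => m nm; apply: le_lt_trans hn; exact: cau.
have -> : fine (limn_esup (fun n => (stepH (s n) t)%:E)) = y.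
  suff /cvg_limn_einf_sup[_ ->] : (stepH (s n) t)%:E @[n --> \oo] --> y%:E by [].
  by apply: cvg_EFin => //; near=> n.
apply/cvgrPdist_le => e e0.
have [n Nn hn] := small _ (divr_gt0 e0 (ltr0n R 2)).
have yn : `|y - stepH (s n) t| <= 2 * 2 ^- n.
  have : stepH (s n) t - stepH (s m) t @[m --> \oo] --> stepH (s n) t - y.
    by apply: cvgB => //; exact: cvg_cst.
  rewrite distrC => /cvg_norm c; apply: (cvg_le_near _ c).
  by exists n => // m /= nm; exact: cau.
have [d d0 dP] := h' _ Nn.
near=> r; have := dP r; rewrite (_ : 0 < r) 1?(_ : r < d).
  move=> /(_ isT isT); have := ler_distD (stepH (s n) t) y (htr u t r).
  by rewrite (distrC (stepH _ _) (htr _ _ _)); have := p2 n; lra.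
  by near: r; exact: nbhs_right_lt.
by near: r; exact: nbhs_right_gt.
Unshelve. all: by end_near. Qed.

Lemma is_hilb_fast u v (un vn : nat -> R -> R) : L1I u -> (forall n, L1I (un n)) ->
  is_hilb u v -> (forall n, is_hilb (un n) (vn n)) ->
  (forall n, (nrm (fun x => u x - un n x)%R <= (4 ^- n)%:E)%E) ->
  offnull (fun t => vn n t @[n --> \oo] --> v t).
Proof.
move=> Lu Ln [_ hu] hn un4.
have H1 := @fast_small (fun n x => u x - un n x) (fun n => L1I_sub Lu (Ln n)) un4.
have H2 := offnull_forall (fun n => (hn n).2).
apply: offnull_imp (offnull_and hu (offnull_and H1 H2)) => t It [cu [[N hN] cn]].
have vN n : (N <= n)%N -> `|v t - vn n t| <= 2 ^- n.
  move=> /hN h; have c : `|htr (fun x => u x - un n x) t e| @[e --> 0^'+] --> `|v t - vn n t|.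
    by apply: cvg_norm; apply: (@near_htr (fun e => htr u t e - htr (un n) t e) _ _ _ (cvgB cu (cn n))) => e e0; exact: (esym (htrB Lu (Ln n) It e0)).
  apply: (cvg_le_near _ c); near=> e; apply: h; near: e; exact: nbhs_right_gt.
apply/cvgrPdist_le => e e0; exists (maxn N (Num.bound (1 / e))) => // n /=.
rewrite geq_max => /andP[/vN h1 h2]; apply: (le_trans h1).
rewrite -[leLHS]mul1r ler_pdivrMr ?exprn_gt0// -ler_pdivrMl// mulrC.
apply: ltW; apply: (lt_le_trans (archi_boundP _)); first by rewrite divr_ge0// ltW.
apply: (@le_trans _ _ n%:R); first by rewrite ler_nat.
by rewrite -natrX ler_nat ltnW// ltn_expl.
Unshelve. all: by end_near. Qed.

(** A subsequence converges at rate [4^-n], so its transforms converge a.e., and Fatou's lemma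
    concludes. *)
Lemma is_hilb_lsc u v (un vn : nat -> R -> R) (M : \bar R) : L1I u -> (forall n, L1I (un n)) ->
  is_hilb u v -> (forall n, is_hilb (un n) (vn n)) ->
  nrm (fun x => u x - un n x)%R @[n --> \oo] --> 0%E ->
  (forall n, (nrm (vn n) <= M)%E) -> (nrm v <= M)%E.
Proof.
move=> Lu Ln hu hn cv vM; have p4 n : 0 < 4 ^- n :> R by rewrite invr_gt0 exprn_gt0.
have /choice[k kP] : forall n, exists k, (nrm (fun x => u x - un k x)%R <= (4 ^- n)%:E)%E.
  by move=> n; have [N /(_ N (leqnn N))] := cvge0_le cv (p4 n); exists N.
apply: (@nrm_fatou (fun n => vn (k n))) => //; last first.
- exact: (@is_hilb_fast u v (fun n => un (k n)) (fun n => vn (k n))).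
- exact: hu.1.
- by move=> n; exact: (hn _).1.
Qed.

End PrincipalValue.

Lemma measurable_tonelli d1 d2 (T1 : measurableType d1) (T2 : measurableType d2)
    (R : realType) (m2 : {sigma_finite_measure set T2 -> \bar R}) (D : set T1) (E : set T2)
    (F : T1 -> T2 -> \bar R) : measurable D -> measurable E ->
  measurable_fun (D `*` E) (fun z : T1 * T2 => F z.1 z.2 : \bar R) ->
  (forall x y, D x -> E y -> (0 <= F x y)%E) ->
  measurable_fun D (fun x => (\int[m2]_(y in E) F x y)%E).
Proof.
move=> mD mE mF F0; pose G := (fun z : T1 * T2 => F z.1 z.2) \_ (D `*` E).
have G0 z : (0 <= G z)%E.
  by rewrite /G patchE; case: ifPn => // /set_mem[]; exact: F0.
have mG : measurable_fun setT G.
  by apply/(measurable_restrictT _ _).1 => //; exact: measurableX.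
have mFG : measurable_fun setT (fubini_F m2 G) by exact: measurable_fun_fubini_tonelli_F.
have := measurable_funTS (D := D) mFG.
apply: eq_measurable_fun => x /set_mem Dx; rewrite [RHS]integral_mkcond.
apply: eq_integral => y _; rewrite /G !patchE.
case: ifPn => [/set_mem[_ Ey]|/negP h]; first by rewrite ifT// inE.
by rewrite ifF//; apply/negP => /set_mem Ey; apply: h; rewrite inE.
Qed.

(** * Semicontinuity and subadditivity of the functional [Phi] *)

Section Functional.
Variable R : realType.
Local Notation mu := (@lebesgue_measure R).
Implicit Types (f g : R -> R) (x t l a b d s e : R).

Lemma Wf_pos d : 0 < d -> Wf d = d * (2 + ln 2 - ln d).
Proof. by move=> d0; rewrite /Wf /logG /logk; ring. Qed.

(** Lines above the concave function [Wf], coming from [d ln (q/d) <= q]. The parameter [q] is free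
    and will be adapted to each use. *)
Lemma Wf_affine d q : 0 <= d -> 0 < q -> Wf d <= q + (2 + ln 2 + `|ln q|) * d.
Proof.
rewrite le_eqVlt => /predU1P[<- q0|d0 q0]; first by rewrite Wf0 mulr0 addr0 ltW.
rewrite Wf_pos//.
have h : d * (ln q - ln d) <= q.
  rewrite -ln_div ?posrE//; have h1 : ln (q / d) <= q / d.
    by apply/ltW/ln_sublinear; rewrite divr_gt0.
  by apply: (le_trans (ler_wpM2l (ltW d0) h1)); rewrite mulrC divfK ?gt_eqF.
have : - (d * ln q) <= `|ln q| * d.
  by rewrite -mulrN mulrC; apply: ler_wpM2r; [exact: ltW|rewrite -normrN ler_norm].
lra.
Qed.

(** Concavity together with [Wf 0 = 0]. In [Phi_fatou] it takes the place of the continuity of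
    [Wf]. *)
Lemma Wf_scale d e : 0 <= d -> 0 < e <= 1 -> e * Wf d <= Wf (e * d).
Proof.
rewrite le_eqVlt => /predU1P[<- _|d0 /andP[e0 e1]]; first by rewrite mulr0 Wf0 mulr0.
rewrite !Wf_pos ?mulr_gt0// lnM ?posrE// mulrA ler_pM2l ?mulr_gt0//.
by have := ln_le0 e1; lra.
Qed.

Lemma dist_gt f l : (forall x, I11 x -> f x <= l) -> dist f l = 0.
Proof.
move=> fl; apply/eqP; rewrite eq_le dist_ge0 andbT -lee_fin -distE.
rewrite [X in mu X](_ : _ = set0) ?measure0//; apply/seteqP; split => // x [Ix /=].
by rewrite ltNge fl.
Qed.

Lemma nrm_dist f : measurable_fun setT f ->
  nrm f = (\int[mu]_(l in `]0%R, +oo[) (dist (fun x => `|f x|) l)%:E)%E.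
Proof.
move=> mf; rewrite /nrm integral_dist//.
by apply: measurable_funTS; exact: measurableT_comp.
Qed.

Lemma dist_norm_Phi f : (\int[mu]_(l in `]0%R, +oo[) (dist f l)%:E <= Phi f)%E.
Proof.
apply: ge0_le_integral => //.
- by move=> l _; rewrite lee_fin dist_ge0.
- by apply/measurable_EFinP; exact: measurable_dist.
- exact: measurable_Wf_dist.
- move=> l _; rewrite lee_fin; have := Wf_ge (dist_ge0 f l) (dist_le2 f l).
  by have := dist_ge0 f l; lra.
Qed.

Lemma nrm_le_Phi f : measurable_fun setT f -> (nrm f <= Phi (fun x => `|f x|%R))%E.
Proof. by move=> mf; rewrite nrm_dist//; exact: dist_norm_Phi. Qed.

(** [Wf_affine] on the levels below [M], the only ones that occur. Choosing first [q] and then a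
    small [nrm f] shows that bounded [L1] convergence implies convergence in [Phi]. *)
Lemma Phi_small f (M q : R) : measurable_fun setT f -> 0 < M ->
  (forall x, I11 x -> `|f x| <= M) -> 0 < q ->
  (Phi (fun x => `|f x|%R) <= (q * M)%:E + (2 + ln 2 + `|ln q|)%R%:E * nrm f)%E.
Proof.
move=> mf M0 fM q0; set D := dist (fun x => `|f x|).
set C := 2 + ln 2 + `|ln q|.
have C0 : 0 <= C.
  by rewrite addr_ge0// addr_ge0// ln_ge0// ler1n.
have m1 (A : set (measurableTypeR R)) : measurable_fun A (fun l => (l < M)%R%:R%:E : \bar R).
  by apply: measurable_funTS; apply: (@measurable_fun_lt_indic _ (measurableTypeR R)).
have m2 (A : set (measurableTypeR R)) : measurable_fun A (fun l => (D l)%:E : \bar R).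
  by apply/measurable_EFinP; exact: measurable_dist.
apply: (@le_trans _ _ (\int[mu]_(l in `]0%R, +oo[) (q%:E * (l < M)%R%:R%:E + C%:E * (D l)%:E))%E).
  apply: ge0_le_integral => //.
  - by move=> l _; rewrite lee_fin Wf_dist_ge0.
  - exact: measurable_Wf_dist.
  - by apply: emeasurable_funD; apply: emeasurable_funM => //; exact: measurable_cst.
  - move=> l _; rewrite -!EFinM -EFinD lee_fin.
    have [lM|Ml] := ltP l M; first by rewrite mulr1; apply: Wf_affine => //; exact: dist_ge0.
    rewrite dist_gt ?Wf0 ?mulr0 ?add0r ?mulr_ge0 ?dist_ge0// => x Ix.
    by apply: le_trans Ml; exact: fM.
have n1 (l : R) : `]0%R, +oo[%classic l -> (0 <= q%:E * (l < M)%R%:R%:E)%E.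
  by move=> _; rewrite -EFinM lee_fin; apply: mulr_ge0 => //; exact: ltW.
have n2 (l : R) : `]0%R, +oo[%classic l -> (0 <= C%:E * (D l)%:E)%E.
  by move=> _; rewrite -EFinM lee_fin; apply: mulr_ge0 => //; exact: dist_ge0.
have n3 : measurable_fun (`]0%R, +oo[%classic : set (measurableTypeR R)) (fun l => q%:E * (l < M)%R%:R%:E)%E.
  by apply: emeasurable_funM => //; exact: measurable_cst.
have n4 : measurable_fun (`]0%R, +oo[%classic : set (measurableTypeR R)) (fun l => C%:E * (D l)%:E)%E.
  by apply: emeasurable_funM => //; exact: measurable_cst.
rewrite (ge0_integralD mu _ n1 n3 n2 n4)//.
apply: leeD.
  rewrite ge0_integralZl//; last by rewrite lee_fin ltW.
  rewrite EFinM; apply: lee_wpmul2l; first by rewrite lee_fin ltW.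
  rewrite (@integral_lt_indic _ (measurableTypeR R))//.
  apply: (@le_trans _ _ (mu `]0%R, M[%classic)).
    by apply: le_mu => x []/=; rewrite !in_itv/= andbT => -> ->.
  by rewrite lebesgue_measure_itv/= lte_fin M0 -EFinB subr0.
rewrite ge0_integralZl ?lee_fin//; last by move=> l _; rewrite lee_fin dist_ge0.
by rewrite nrm_dist.
Qed.

Lemma dist_lsc (fn : nat -> R -> R) f l d : (forall n, measurable_fun setT (fn n)) ->
  offnull (fun x => fn n x @[n --> \oo] --> f x) -> d < dist f l ->
  exists N, forall n, (N <= n)%N -> d <= dist (fn n) l.
Proof.
move=> mfn [Z Z0 cv] dd.
pose G N : set (measurableTypeR R) := I11 `&` \bigcap_(n in [set n | (N <= n)%N]) [set x | l < fn n x].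
have mG N : measurable (G N).
  apply: measurableI; first exact: measurable_I11.
  apply: bigcap_measurable; first by exists N => /=.
  move=> n _; have := mfn n measurableT _ (measurable_itv `]l, +oo[); rewrite setTI.
  by congr measurable; apply/seteqP; split => x /=; rewrite in_itv/= andbT.
have sub : I11 `&` [set x | l < f x] `<=` (\bigcup_N G N) `|` Z.
  move=> x [Ix /= lx]; have [|nZ] := pselect (Z x); first by right.
  left; have /cvgrPdist_lt/(_ (f x - l)) := cv _ Ix nZ; rewrite subr_gt0 => /(_ lx)[N _ h].
  exists N => //; split => // n /= /h /=; rewrite ltr_norml; lra.
have cG : mu (G N) @[N --> \oo] --> mu (\bigcup_N G N).
  apply: nondecreasing_cvg_mu => //; first exact: bigcupT_measurable.
  apply/nondecreasing_seqP => N; apply/subsetPset => x [Ix h]; split => // n /= Nn.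
  by apply: h => /=; exact: ltnW.
have [N hN] : exists N, (d%:E <= mu (G N))%E.
  apply: contrapT => /forallNP h; suff : ((dist f l)%:E <= d%:E)%E.
    by rewrite lee_fin leNgt dd.
  rewrite -distE; apply: (le_trans (le_mu sub)); apply: (le_trans (mu_setU _ _)).
  rewrite Z0 adde0 -(cvg_lim _ cG)//; apply: lime_le; first exact: cvgP cG.
  by apply: nearW => N; rewrite leNgt; apply/negP => /ltW; exact: h.
exists N => n Nn; rewrite -lee_fin -distE; apply: (le_trans hN); apply: le_mu => x [Ix h].
by split => //; exact: h.
Qed.

Lemma limn_einf_ge (w : nat -> \bar R) (M : \bar R) N :
  (forall n, (N <= n)%N -> (M <= w n)%E) -> (M <= limn_einf w)%E.
Proof.
move=> wM; rewrite limn_einf_lim; apply: lime_ge; first exact: is_cvg_einfs.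
exists N => // n /= Nn; apply: le_ereal_inf_tmp => _ [k /= nk <-].
by apply: wM; exact: leq_trans nk.
Qed.

(** For every [r < 1], eventually [r * dist f l <= dist (fn n) l]; [Wf_scale] turns this loss into a
    factor [r] outside [Wf], and [r] tends to 1. *)
Lemma Phi_fatou (fn : nat -> R -> R) f (M : \bar R) : (forall n, measurable_fun setT (fn n)) ->
  offnull (fun x => fn n x @[n --> \oo] --> f x) ->
  (forall n, (Phi (fn n) <= M)%E) -> (Phi f <= M)%E.
Proof.
move=> mfn cv fM.
have f0 n l : `]0%R, +oo[%classic l -> (0 <= (Wf (dist (fn n) l))%:E)%E by rewrite lee_fin Wf_dist_ge0.
have := @fatou _ (measurableTypeR R) R mu `]0%R, +oo[%classic (measurable_itv _)
  (fun n l => (Wf (dist (fn n) l))%:E) (fun n => @measurable_Wf_dist R (fn n) _) f0.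
move=> /le_trans/(_ (limn_einf_le fM)); apply: le_trans.
apply: ge0_le_integral => //.
- by move=> l _; rewrite lee_fin Wf_dist_ge0.
- exact: measurable_Wf_dist.
- rewrite /limn_einf; apply: measurableT_comp => //; apply: measurable_fun_limn_esup => n.
  by apply: measurableT_comp => //; exact: measurable_Wf_dist.
- move=> l _; apply/lee_mul01Pr; first by rewrite lee_fin Wf_dist_ge0.
  move=> r /andP[r0 r1]; rewrite -EFinM.
  have [d0|d0] := eqVneq (dist f l) 0.
    rewrite d0 Wf0 mulr0; apply: (@limn_einf_ge _ _ 0%N) => n _.
    by rewrite lee_fin Wf_dist_ge0.
  have dp : 0 < dist f l by rewrite lt_neqAle eq_sym d0 dist_ge0.
  have [|N hN] := @dist_lsc fn f l (r * dist f l) mfn cv; first by rewrite gtr_pMl.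
  apply: (@limn_einf_ge _ _ N) => n /hN h; rewrite lee_fin.
  apply: (@le_trans _ _ (Wf (r * dist f l))); first by rewrite Wf_scale ?dist_ge0 ?r0 ?ltW.
  by apply: Wf_le => //; [rewrite mulr_ge0 ?dist_ge0 ?ltW|exact: dist_le2].
Qed.

(** It writes [Wf] as its linear part plus a superposition of the functions [min s]. The
    subadditivity of [Phi] is thereby reduced to that of [Kf]. *)
Lemma Wf_integral d : 0 <= d <= 2 ->
  (\int[mu]_(s in `]0%R, 2%R[) (Num.min s d / s)%:E = (Wf d - d)%:E)%E.
Proof.
move=> /andP[]; rewrite le_eqVlt => /predU1P[<- _|d0 d2].
  rewrite Wf0 subrr integral0_eq// => s /=; rewrite in_itv/= => /andP[s0 s2].
  by rewrite (min_idPr (ltW s0)) mul0r.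
have mm (A : set (measurableTypeR R)) : measurable_fun A (fun s => (Num.min s d / s)%:E : \bar R).
  apply/measurable_EFinP; apply: measurable_funM; last by apply: measurable_funTS; exact: measurable_inv.
  by apply: measurable_funTS; apply: measurable_minr.
have -> : `]0%R, 2%R[%classic = `]0%R, d[%classic `|` `[d, 2[%classic :> set R.
  apply/seteqP; split => x /=; rewrite !in_itv/=.
    by move=> /andP[x0 x2]; have [h|h] := ltP x d; [left|right]; rewrite ?x0 ?x2 ?h.
  by case=> /andP[h1 h2]; apply/andP; split; lra.
rewrite ge0_integral_setU//=; last 2 first.
- move=> s; case=> /=; rewrite in_itv/= => /andP[h1 h2]; rewrite lee_fin divr_ge0 ?le_min//; lra.
- apply/disj_setPS => x [] /=; rewrite !in_itv/= => /andP[h1 h2] /andP[h3 h4]; lra.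
have -> : (\int[mu]_(s in `]0%R, d[) (Num.min s d / s)%:E = d%:E)%E.
  transitivity (\int[mu]_(s in `]0%R, d[) cst 1%E s)%E.
    apply: eq_integral => s; rewrite inE/= in_itv/= => /andP[s0 sd].
    by rewrite (min_idPl (ltW sd)) mulfV ?gt_eqF.
  by rewrite integral_cst//= lebesgue_measure_itv/= lte_fin d0 mul1e -EFinB subr0.
have -> : (\int[mu]_(s in `[d, 2%R[) (Num.min s d / s)%:E = (d * (ln 2 - ln d))%:E)%E.
  rewrite integral_itv_bndo_bndc; last exact: mm.
  transitivity (\int[mu]_(s in `[d, 2%R]) (d / s)%:E)%E.
    apply: eq_integral => s; rewrite inE/= in_itv/= => /andP[ds _].
    by rewrite (min_idPr ds).
  rewrite mulrBr; apply: (@FTC_closed R (fun s => d / s) (fun s => d * ln s)) => //.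
  - move=> x /andP[dx _]; have x0 : 0 < x by exact: lt_le_trans dx.
    have -> : d / x = d *: x^-1 by [].
    by apply: is_deriveZ; exact: is_derive1_ln.
  - move=> x /andP[dx _]; apply: cvgM; first exact: cvg_cst.
    by apply: cvgV => //; rewrite gt_eqF// (lt_le_trans d0).
by rewrite -EFinD Wf_pos//; congr _%:E; ring.
Qed.

(** For [f >= 0] this is the K-functional of the couple [L1], [L^oo]: the integral of the decreasing
    rearrangement over []0, s[]. *)
Definition Kf f s : \bar R := (\int[mu]_(l in `]0%R, +oo[) (Num.min s (dist f l))%:E)%E.

Lemma measurable_min_dist f s (A : set (measurableTypeR R)) :
  measurable_fun A (fun l => (Num.min s (dist f l))%:E : \bar R).
Proof. by apply/measurable_EFinP; apply: measurable_minr => //; exact: measurable_dist. Qed.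

Lemma measurable_min_dist2 f (A : set (measurableTypeR R * measurableTypeR R)) :
  measurable_fun A (fun z => (Num.min z.1 (dist f z.2) / z.1)%:E : \bar R).
Proof.
apply: measurable_funTS; apply/measurable_EFinP; apply: measurable_funM.
  apply: measurable_minr; first exact: measurable_fst.
  by apply: (measurableT_comp (@measurable_dist R f setT)); exact: measurable_snd.
by apply: (@measurableT_comp _ _ _ _ _ _ (fun x : R => x^-1)); [exact: measurable_inv|exact: measurable_fst].
Qed.

Lemma min_dist_ge0 f s l : 0 <= s -> 0 <= Num.min s (dist f l).
Proof. by move=> s0; rewrite le_min s0 dist_ge0. Qed.

Lemma Phi_Kf f : Phi f = (\int[mu]_(l in `]0%R, +oo[) (dist f l)%:E +
  \int[mu]_(s in `]0%R, 2%R[) ((s^-1)%:E * Kf f s))%E.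
Proof.
have -> : (\int[mu]_(s in `]0%R, 2%R[) ((s^-1)%:E * Kf f s) =
    \int[mu]_(s in `]0%R, 2%R[) \int[mu]_(l in `]0%R, +oo[) (Num.min s (dist f l) / s)%:E)%E.
  apply: eq_integral => s; rewrite inE/= in_itv/= => /andP[s0 _].
  rewrite /Kf -ge0_integralZl//; last 3 first.
  - exact: measurable_min_dist.
  - by move=> l _; rewrite lee_fin min_dist_ge0// ltW.
  - by rewrite lee_fin invr_ge0 ltW.
  by apply: eq_integral => l _; rewrite -EFinM mulrC.
rewrite (@tonelli_on _ _ (measurableTypeR R) (measurableTypeR R) R mu mu _ _
  (fun s l => (Num.min s (dist f l) / s)%:E))//; last 2 first.
- exact: measurable_min_dist2.
- by move=> s l /=; rewrite in_itv/= => /andP[s0 _] _; rewrite lee_fin divr_ge0 ?min_dist_ge0 ?ltW.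
have E l : (\int[mu]_(s in `]0%R, 2%R[) (Num.min s (dist f l) / s)%:E = (Wf (dist f l) - dist f l)%:E)%E.
  by apply: Wf_integral; rewrite dist_ge0 dist_le2.
under [X in (_ + X)%E]eq_integral do rewrite E.
rewrite -ge0_integralD//; last 4 first.
- by move=> l _; rewrite lee_fin dist_ge0.
- by apply/measurable_EFinP; exact: measurable_dist.
- move=> l _; rewrite lee_fin subr_ge0; have := Wf_ge (dist_ge0 f l) (dist_le2 f l).
  by have := dist_ge0 f l; lra.
- apply/measurable_EFinP; apply: measurable_funB; last exact: measurable_dist.
  by apply/measurable_EFinP; exact: measurable_Wf_dist.
by apply: eq_integral => l _; rewrite -EFinD addrC subrK.
Qed.

Lemma Kf_le f a s : measurable_fun setT f -> 0 <= a -> 0 <= s ->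
  (Kf f s <= (a * s)%:E + \int[mu]_(x in I11) (Num.max (f x - a) 0)%:E)%E.
Proof.
move=> mf a0 s0; rewrite (@layer_cake _ (measurableTypeR R) R mu I11 f a (measurable_itv _)); last exact: measurable_funTS.
have -> : (\int[mu]_(l in `]a, +oo[) mu (I11 `&` [set x | (l < f x)%R]) = \int[mu]_(l in `]a, +oo[) (dist f l)%:E)%E.
  by apply: eq_integral => l _; rewrite distE.
rewrite /Kf.
have -> : `]0%R, +oo[%classic = `]0%R, a]%classic `|` `]a, +oo[%classic :> set R.
  apply/seteqP; split => x /=; rewrite !in_itv/= ?andbT.
    by move=> x0; have [h|h] := leP x a; [left|right]; rewrite ?x0 ?h.
  by case=> [/andP[]//|]; exact: le_lt_trans.
rewrite ge0_integral_setU//=; last 3 first.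
- exact: measurable_min_dist.
- by move=> l _; rewrite lee_fin min_dist_ge0.
- by apply/disj_setPS => x [] /=; rewrite !in_itv/= andbT => /andP[h1 h2] h3; lra.
apply: leeD.
  apply: (@le_trans _ _ (\int[mu]_(l in `]0%R, a]) cst s%:E l)%E).
    apply: ge0_le_integral => //.
    - by move=> l _; rewrite lee_fin min_dist_ge0.
    - exact: measurable_min_dist.
    - by move=> l _; rewrite lee_fin ge_min lexx.
  rewrite integral_cst//= lebesgue_measure_itv/= lte_fin; case: ifPn => h.
    by rewrite -EFinB subr0 -EFinM mulrC.
  by rewrite mule0 lee_fin mulr_ge0.
apply: ge0_le_integral => //.
- by move=> l _; rewrite lee_fin min_dist_ge0.
- exact: measurable_min_dist.
- by apply/measurable_EFinP; exact: measurable_dist.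
- by move=> l _; rewrite lee_fin ge_min lexx orbT.
Qed.

Lemma dist_vanish f s : (\int[mu]_(l in `]0%R, +oo[) (dist f l)%:E < +oo)%E -> 0 < s ->
  exists2 l, 0 <= l & dist f l <= s.
Proof.
move=> fi s0; apply: contrapT => /forall2NP h.
have big l : 0 <= l -> s < dist f l by move=> l0; have [//|/negP] := h l; rewrite -ltNge.
suff : (\int[mu]_(l in `]0%R, +oo[) (dist f l)%:E = +oo)%E by move=> E; rewrite E in fi.
apply/eqP; rewrite -leye_eq.
apply: (@le_trans _ _ (\int[mu]_(l in `]0%R, +oo[) cst s%:E l)%E).
  by rewrite integral_cst//= lebesgue_measure_itv/= ltry gt0_muley ?lte_fin.
apply: ge0_le_integral => //.
- by move=> l _; rewrite lee_fin ltW.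
- by apply/measurable_EFinP; exact: measurable_dist.
- by move=> l /=; rewrite in_itv/= andbT => l0; rewrite lee_fin ltW// big// ltW.
Qed.

(** The optimal [a] is the rearrangement of [f] at [s]: below it the minimum is [s], above it the
    minimum is [dist f l]. Together with [Kf_le] this makes [Kf] a minimum over [a], hence
    subadditive, because the part of [f + g] above [a + b] is at most the part of [f] above [a] plus
    that of [g] above [b]. *)
Lemma Kf_attained f s : measurable_fun setT f -> 0 < s ->
  (\int[mu]_(l in `]0%R, +oo[) (dist f l)%:E < +oo)%E ->
  exists2 a, 0 <= a & (Kf f s = (a * s)%:E + \int[mu]_(x in I11) (Num.max (f x - a) 0)%:E)%E.
Proof.
move=> mf s0 fi; have [l0 l00 dl0] := dist_vanish fi s0.
pose S := [set l | 0 <= l /\ dist f l <= s]; pose a := inf S.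
have S0 : has_inf S by split; [exists l0|exists 0 => x []].
have a0 : 0 <= a by apply: lb_le_inf; [exists l0|move=> x []].
have below l : 0 <= l -> l < a -> s < dist f l.
  move=> h0 la; rewrite ltNge; apply/negP => h.
  by move: la; rewrite ltNge; apply/negP/negPn; apply: ge_inf => //; exact: S0.2.
have above l : a < l -> dist f l <= s.
  move=> al; have [r [_ dr] rl] := inf_lt S0.1 al.
  by apply: le_trans dr; apply: dist_noninc; exact: ltW.
exists a => //; apply/eqP; rewrite eq_le (Kf_le mf a0 (ltW s0))/=.
rewrite (@layer_cake _ (measurableTypeR R) R mu I11 f a (measurable_itv _)); last exact: measurable_funTS.
have -> : (\int[mu]_(l in `]a, +oo[) mu (I11 `&` [set x | (l < f x)%R]) = \int[mu]_(l in `]a, +oo[) (dist f l)%:E)%E.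
  by apply: eq_integral => l _; rewrite distE.
rewrite /Kf.
have -> : `]0%R, +oo[%classic = `]0%R, a]%classic `|` `]a, +oo[%classic :> set R.
  apply/seteqP; split => x /=; rewrite !in_itv/= ?andbT.
    by move=> x0; have [h|h] := leP x a; [left|right]; rewrite ?x0 ?h.
  by case=> [/andP[]//|]; exact: le_lt_trans.
rewrite ge0_integral_setU//=; last 3 first.
- exact: measurable_min_dist.
- by move=> l _; rewrite lee_fin min_dist_ge0// ltW.
- by apply/disj_setPS => x [] /=; rewrite !in_itv/= andbT => /andP[h1 h2] h3; lra.
apply: leeD.
  rewrite integral_itv_bndoo; last exact: measurable_min_dist.
  rewrite (eq_integral (cst s%:E)); last first.
    move=> l; rewrite inE/= in_itv/= => /andP[h1 h2].
    by rewrite (min_idPl (ltW (below _ (ltW h1) h2))).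
  rewrite integral_cst//= lebesgue_measure_itv/= lte_fin; case: ifPn => h.
    by rewrite -EFinB subr0 -EFinM mulrC.
  by rewrite mule0 lee_fin; move: h; rewrite -leNgt => h; rewrite mulr_le0_ge0// ltW.
apply: ge0_le_integral => //.
- by move=> l _; rewrite lee_fin dist_ge0.
- by apply/measurable_EFinP; exact: measurable_dist.
- exact: measurable_min_dist.
- move=> l /=; rewrite in_itv/= andbT => h.
  by rewrite lee_fin (min_idPr (above _ h)).
Qed.

Lemma Kf_add f g s : measurable_fun setT f -> measurable_fun setT g -> 0 < s ->
  (\int[mu]_(l in `]0%R, +oo[) (dist f l)%:E < +oo)%E ->
  (\int[mu]_(l in `]0%R, +oo[) (dist g l)%:E < +oo)%E ->
  (Kf (fun x => f x + g x)%R s <= Kf f s + Kf g s)%E.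
Proof.
move=> mf mg s0 fi gi; have [a a0 ->] := Kf_attained mf s0 fi.
have [b b0 ->] := Kf_attained mg s0 gi.
have mm (h : R -> R) c : measurable_fun setT h -> measurable_fun I11 (fun x => (Num.max (h x - c) 0)%:E : \bar R).
  by move=> mh; apply/measurable_EFinP; apply: measurable_maxr => //; apply: measurable_funTS; exact: measurable_funB.
apply: (le_trans (Kf_le (measurable_funD mf mg) (addr_ge0 a0 b0) (ltW s0))).
rewrite mulrDl EFinD [leRHS]addeACA; apply: leeD => //.
rewrite -ge0_integralD//; last 5 first.
- exact: measurable_I11.
- by move=> x _; rewrite lee_fin le_max lexx orbT.
- exact: mm.
- by move=> x _; rewrite lee_fin le_max lexx orbT.
- exact: mm.
apply: ge0_le_integral => //.
- exact: measurable_I11.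
- by move=> x _; rewrite lee_fin le_max lexx orbT.
- by apply: mm; exact: measurable_funD.
- by apply: emeasurable_funD; exact: mm.
- move=> x _; rewrite -EFinD lee_fin ge_max; apply/andP; split.
    rewrite /= (_ : f x + g x - (a + b) = (f x - a) + (g x - b)); last by ring.
    by apply: lerD; rewrite le_max lexx.
  by rewrite addr_ge0// le_max lexx orbT.
Qed.

Lemma measurable_Kf f : measurable_fun (`]0%R, 2%R[%classic : set (measurableTypeR R)) (Kf f).
Proof.
apply: (@measurable_tonelli _ _ (measurableTypeR R) (measurableTypeR R) R mu _ _ (fun s l => (Num.min s (dist f l))%:E)) => //.
- apply: measurable_funTS; apply/measurable_EFinP; apply: measurable_minr; first exact: measurable_fst.
  by apply: (measurableT_comp (@measurable_dist R f setT)); exact: measurable_snd.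
- by move=> s l /=; rewrite in_itv/= => /andP[s0 _] _; rewrite lee_fin min_dist_ge0 ?ltW.
Qed.

Lemma Phi_add f g : measurable_fun setT f -> measurable_fun setT g ->
  (forall x, 0 <= f x) -> (forall x, 0 <= g x) ->
  (Phi (fun x => f x + g x)%R <= Phi f + Phi g)%E.
Proof.
move=> mf mg f0 g0.
(* [Kf_attained] needs levels with a small distribution function, which finiteness of [Phi]
   provides. *)
have [->|Pf] := eqVneq (Phi f) +oo%E; first by rewrite addye ?leey// gt_eqF// (lt_le_trans _ (Phi_ge0 _)).
have [->|Pg] := eqVneq (Phi g) +oo%E; first by rewrite addey ?leey// gt_eqF// (lt_le_trans _ (Phi_ge0 _)).
have fi : (\int[mu]_(l in `]0%R, +oo[) (dist f l)%:E < +oo)%E.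
  by apply: (le_lt_trans (dist_norm_Phi f)); rewrite ltey.
have gi : (\int[mu]_(l in `]0%R, +oo[) (dist g l)%:E < +oo)%E.
  by apply: (le_lt_trans (dist_norm_Phi g)); rewrite ltey.
rewrite !Phi_Kf [leRHS]addeACA; apply: leeD.
  have mI (h : R -> R) : measurable_fun setT h -> measurable_fun I11 h by exact: measurable_funTS.
  rewrite -(integral_dist (mI _ mf) f0) -(integral_dist (mI _ mg) g0).
  rewrite -(integral_dist (mI _ (measurable_funD mf mg)) (fun x => addr_ge0 (f0 x) (g0 x))).
  rewrite -ge0_integralD//.
  - exact: measurable_I11.
  - by move=> x _; rewrite lee_fin.
  - by apply/measurable_EFinP; exact: measurable_funTS.
  - by move=> x _; rewrite lee_fin.
  - by apply/measurable_EFinP; exact: measurable_funTS.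
have K0 (h : R -> R) s : `]0%R, 2%R[%classic s -> (0 <= (s^-1)%:E * Kf h s)%E.
  rewrite /= in_itv/= => /andP[s0 _]; apply: mule_ge0; first by rewrite lee_fin invr_ge0 ltW.
  by apply: integral_ge0 => l _; rewrite lee_fin min_dist_ge0// ltW.
have mK (h : R -> R) : measurable_fun (`]0%R, 2%R[%classic : set (measurableTypeR R)) (fun s => (s^-1)%:E * Kf h s)%E.
  apply: emeasurable_funM.
    by apply/measurable_EFinP; apply: measurable_funTS; exact: measurable_inv.
  exact: measurable_Kf.
rewrite -ge0_integralD//; last 2 first.
- exact: K0.
- exact: K0.
apply: ge0_le_integral => //; first exact: K0.
- by apply: emeasurable_funD; exact: mK.
- move=> s; rewrite /= in_itv/= => /andP[s0 _].
  rewrite -ge0_muleDr; last 2 first.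
  + by apply: integral_ge0 => l _; rewrite lee_fin min_dist_ge0// ltW.
  + by apply: integral_ge0 => l _; rewrite lee_fin min_dist_ge0// ltW.
  by apply: lee_wpmul2l; [rewrite lee_fin invr_ge0 ltW|exact: Kf_add].
Qed.

End Functional.

(** * The upper bound *)

Section Upper.
Variable R : realType.
Local Notation mu := (@lebesgue_measure R).
Implicit Types (s : seq (R * R * R)) (u v : R -> R) (x t l r e M : R).

(** Dominated convergence in terms of [nrm], with the limit taken off an arbitrary outer null
    set. *)
Lemma nrm_dct (w : nat -> R -> R) u : L1I u -> (forall n, measurable_fun setT (w n)) ->
  (forall n x, I11 x -> `|w n x| <= `|u x|) ->
  offnull (fun x => w n x @[n --> \oo] --> 0) -> nrm (w n) @[n --> \oo] --> 0%E.
Proof.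
move=> Lu mw wu cw.
have mE (g : R -> R) : measurable_fun setT g -> measurable_fun I11 (fun x => (g x)%:E : \bar R).
  by move=> mg; apply/measurable_EFinP; exact: measurable_funTS.
have cw' : {ae mu, forall x, I11 x -> (w n x)%:E @[n --> \oo] --> 0%E}.
  by apply: offnull_ae; apply: offnull_imp cw => x _ h; apply: cvg_EFin => //; exact: nearW.
have ub : {ae mu, forall x (n : nat), I11 x -> (`|(w n x)%:E| <= (EFin \o (fun x => `|u x|%R)) x)%E}.
  by apply: aeW => x n Ix; rewrite /= lee_fin; exact: wu.
have [_ + _] := @dominated_convergence _ (measurableTypeR R) R mu I11 (@measurable_I11 R)
  (fun n x => (w n x)%:E) (fun=> 0%E) (EFin \o (fun x => `|u x|)) (fun n => mE _ (mw n)) (measurable_cst _)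
  cw'
  (integrable_abse (L1I_integrable Lu)) ub.
by under eq_fun do under eq_integral do rewrite sube0.
Qed.

Definition trunc (n : nat) u x : R := clamp (- n%:R) n%:R (u x).

Lemma clamp_measurable (a b : R) u : measurable_fun setT u ->
  measurable_fun setT (fun x => clamp a b (u x)).
Proof.
by move=> mf; apply: measurable_maxr => //; apply: measurable_minr.
Qed.

Lemma clamp_norm (M x : R) : 0 <= M -> `|clamp (- M) M x| <= M /\ `|x - clamp (- M) M x| <= `|x|
  /\ (`|x| <= M -> clamp (- M) M x = x) /\ `|clamp (- M) M x| <= `|x|.
Proof.
move=> M0; rewrite /clamp; have [h1|h1] := leP x M; have [h2|h2] := leP (- M) x;
  rewrite /Order.min /Order.max; repeat case: ifP;
  have [h3|h3] := ger0P x; rewrite ?ler_norml ?ger0_norm ?ler0_norm; try lra; intros; repeat split; intros; lra.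
Qed.

Lemma trunc_cvg u : L1I u -> nrm (fun x => u x - trunc n u x) @[n --> \oo] --> 0%E.
Proof.
move=> Lu; apply: (nrm_dct Lu).
- by move=> n; apply: measurable_funB; [exact: Lu.1|apply: clamp_measurable; exact: Lu.1].
- by move=> n x _; have [_ [h _]] := clamp_norm (u x) (ler0n R n).
- apply: offnull_all => x _; apply/cvgrPdist_le => e e0.
  exists (Num.bound `|u x|) => // n /= hn; have [_ [_ [h _]]] := clamp_norm (u x) (ler0n R n).
  rewrite /trunc h ?subrr ?subr0 ?normr0 ?(ltW e0)//.
  by apply: (le_trans (ltW (archi_boundP (normr_ge0 (u x))))); rewrite ler_nat.
Qed.

Lemma stepf_out s x : (forall p : R * R * R, p \in s -> (p.1.1 < x <= p.1.2) = false) -> stepf s x = 0.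
Proof. by move=> h; rewrite /stepf big_seq big1// => p /h ->; rewrite mulr0. Qed.

Lemma stepf_in s (p : R * R * R) x : wf s -> p \in s -> p.1.1 < x <= p.1.2 -> stepf s x = p.2.
Proof.
elim: s => // q s IH /wf_cons[h1 h2 h3 ws]; rewrite inE => /predU1P[->|ps] xp; rewrite /stepf big_cons.
  rewrite xp mulr1 [X in _ + X](_ : _ = stepf s x)// stepf_out ?addr0// => r rs.
  by apply/negP => /andP[h4 _]; have h5 := h2 _ rs; move: xp; lra.
rewrite (_ : (_ && _) = false) ?mulr0 ?add0r; first exact: IH.
by apply/negP => /andP[_ h4]; have h5 := h2 _ ps; move: xp; lra.
Qed.

Definition level s r : seq (R * R) := [seq p.1 | p <- s & r < p.2].

Lemma level_sum s r : wf s -> inI s -> (forall p, p \in s -> 0 <= p.2) -> 0 <= r ->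
  \sum_(p <- level s r) (p.2 - p.1) = dist (stepf s) r.
Proof.
move=> ws si s0 r0; pose sr : seq (R * R * R) := [seq (p.1, 1) | p <- s & r < p.2].
have sub p : p \in sr -> exists2 q : R * R * R, q \in s & p = (q.1, 1) /\ r < q.2.
  by case/mapP => q; rewrite mem_filter => /andP[h qs] ->; exists q.
have wl : intervals (level s r).
  move: ws; rewrite /wf /intervals /level => /andP[a1 a2]; apply/andP; split.
    by apply/allP => _ /mapP[q + ->]; rewrite mem_filter => /andP[_ qs]; apply: (allP a1); apply: map_f.
  move: a2; rewrite !pairwise_map; exact: pairwise_filter.
have wsr : wf sr by rewrite /wf /sr -map_comp.
have isr : inI sr.
  by apply/allP => p /sub[q qs [-> _]]; exact: (allP si _ qs).
have E x : (r < stepf s x)%R%:R = stepf sr x.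
  have [[p ps xp]|/forall2NP h] := pselect (exists2 p : R * R * R, p \in s & p.1.1 < x <= p.1.2).
    rewrite (stepf_in ws ps xp); case: (boolP (r < p.2)) => h.
      by rewrite (@stepf_in sr (p.1, 1))//; apply/mapP; exists p => //; rewrite mem_filter h.
    rewrite stepf_out// => _ /sub[q qs [-> rq]] /=; apply/negP => xq.
    by move: rq; rewrite -(stepf_in ws qs xq) (stepf_in ws ps xp) (negbTE h).
  rewrite stepf_out; last by move=> p ps; have [//|/negP/negbTE] := h p.
  by rewrite ltNge r0 stepf_out// => _ /sub[q qs [-> _]]/=; have [//|/negP/negbTE] := h q.
apply/EFin_inj; rewrite -distE.
rewrite -(@integral_lt_indic _ (measurableTypeR R) R mu I11 (cst r) (stepf s) (@measurable_I11 R) (measurable_cst _)); last exact: measurable_stepf.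
transitivity (nrm (stepf sr)).
  rewrite nrm_stepf_inI// /mass /level /sr !big_map; congr _%:E.
  by apply: eq_bigr => p _; rewrite normr1 mul1r.
by apply: eq_integral => x _; rewrite -E normr_nat.
Qed.

Lemma intervals_level s r : wf s -> intervals (level s r).
Proof.
rewrite /wf /intervals /level => /andP[a1 a2]; apply/andP; split.
  by apply/allP => _ /mapP[q + ->]; rewrite mem_filter => /andP[_ qs]; apply: (allP a1); apply: map_f.
by move: a2; rewrite !pairwise_map; exact: pairwise_filter.
Qed.

Definition wlog_ (p : R * R) x : R := ln `|p.2 - x| - ln `|p.1 - x|.

Lemma logsum_level s r x : logsum (level s r) x = \sum_(p <- s) (r < p.2)%R%:R * wlog_ p.1 x.
Proof.
rewrite /logsum /level big_map big_filter [LHS]big_mkcond/=; apply: eq_bigr => p _.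
by case: ifP; rewrite ?mul1r ?mul0r.
Qed.

Lemma level_integral s (w : R * R * R -> R) : (forall p, p \in s -> 0 <= p.2) ->
  mu.-integrable `]0%R, +oo[ (fun r => (\sum_(p <- s) (r < p.2)%R%:R * w p)%:E) /\
  (\int[mu]_(r in `]0%R, +oo[) (\sum_(p <- s) (r < p.2)%R%:R * w p)%:E =
    (\sum_(p <- s) p.2 * w p)%:E)%E.
Proof.
elim: s => [_|p s IH s0].
  rewrite big_nil (_ : (fun r => _) = cst 0%E); last by apply/funext => r; rewrite big_nil.
  by split; [exact: integrable0|rewrite integral0].
have [i1 e1] := IH (fun q qs => s0 q (mem_behead (s := p :: s) qs)).
have p0 : 0 <= p.2 by apply: s0; exact: mem_head.
have m0 : measurable_fun (`]0%R, +oo[%classic : set (measurableTypeR R)) (fun r => (r < p.2)%R%:R%:E : \bar R).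
  by apply: (@measurable_fun_lt_indic _ (measurableTypeR R)).
have e0 : (\int[mu]_(r in `]0%R, +oo[) (r < p.2)%R%:R%:E = p.2%:E)%E.
  rewrite (@integral_lt_indic _ (measurableTypeR R))//.
  transitivity (mu `]0%R, p.2[%classic).
    congr (mu _); apply/seteqP; split => x /=; rewrite !in_itv/= ?andbT.
      by move=> [-> ->].
    by move=> /andP[-> ->].
  rewrite lebesgue_measure_itv/= lte_fin; case: ifPn => h.
    by rewrite -EFinB subr0.
  by congr _%:E; apply/eqP; rewrite eq_le p0 leNgt h.
have i0 : mu.-integrable `]0%R, +oo[ (fun r => (r < p.2)%R%:R%:E : \bar R).
  apply/integrableP; split => //; under eq_integral do rewrite /= normr_nat.
  by rewrite e0 ltry.
have i2 : mu.-integrable `]0%R, +oo[ (fun r => (w p)%:E * (r < p.2)%R%:R%:E)%E by exact: integrableZl.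
have E : (fun r => (\sum_(q <- p :: s) (r < q.2)%R%:R * w q)%:E) =
   (fun r => (w p)%:E * (r < p.2)%R%:R%:E + (\sum_(q <- s) (r < q.2)%R%:R * w q)%:E)%E.
  by apply/funext => r; rewrite big_cons EFinD -EFinM mulrC.
split; first by rewrite E; exact: integrableD.
rewrite E integralD// e1 integralZl// e0 big_cons -EFinM -EFinD mulrC.
by [].
Qed.

(** A nonnegative step function is the integral over [r > 0] of the indicators of its level sets,
    and so is its transform. Tonelli reduces the bound to [logsum_L1] at each level, where the total
    length of the cells is [dist (stepf s) r]. *)
Lemma stepH_L1 s : wf s -> inI s -> (forall p, p \in s -> 0 <= p.2) ->
  (nrm (stepH s) <= 5%:E * Phi (stepf s))%E.
Proof.
move=> ws si s0.
have ml2 (A : set (measurableTypeR R * measurableTypeR R)) : measurable_fun A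
    (fun z => `|logsum (level s z.2) z.1|%:E : \bar R).
  apply: measurable_funTS; apply/measurable_EFinP; apply: measurableT_comp => //.
  rewrite (_ : (fun z => _) = (fun z : measurableTypeR R * measurableTypeR R =>
     \sum_(p <- s) (z.2 < p.2)%R%:R * wlog_ p.1 z.1)); last first.
    by apply/funext => z; rewrite logsum_level.
  apply: measurable_sum => p; apply: measurable_funM.
    apply/measurable_EFinP; apply: (@measurable_fun_lt_indic _ _ R setT (fun z => z.2) (cst p.2)) => //; exact: measurable_snd.
  have m1 : measurable_fun [set: measurableTypeR R] (wlog_ p.1).
    by apply: measurable_funB; apply: measurableT_comp => //; apply: measurableT_comp => //; apply: measurable_funB.
  by apply: (@measurableT_comp _ _ _ _ _ _ (wlog_ p.1)); [exact: m1|exact: measurable_fst].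
apply: (@le_trans _ _ (\int[mu]_(x in I11) \int[mu]_(r in `]0%R, +oo[) `|logsum (level s r) x|%:E)%E).
  apply: ge0_le_integral => //.
  - exact: measurable_I11.
  - by apply/measurable_EFinP; apply: measurableT_comp => //; exact: measurable_stepH.
  - apply: (@measurable_tonelli _ _ (measurableTypeR R) (measurableTypeR R) R mu _ _ (fun x r => `|logsum (level s r) x|%:E)) => //.
    exact: measurable_I11.
  - move=> x _; have [i e] := level_integral (fun p => wlog_ p.1 x) s0.
    rewrite -abse_EFin (_ : (stepH s x)%:E = (\sum_(p <- s) p.2 * wlog_ p.1 x)%:E)// -e.
    apply: (le_trans (le_abse_integral _ _ _)) => //; first by case/integrableP : i.
    by under eq_integral do rewrite -logsum_level.
rewrite (@tonelli_on _ _ (measurableTypeR R) (measurableTypeR R) R mu mu _ _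
  (fun x r => `|logsum (level s r) x|%:E))//; last exact: measurable_I11.
rewrite /Phi -ge0_integralZl//; last 2 first.
- exact: measurable_Wf_dist.
- by move=> r _; rewrite lee_fin Wf_dist_ge0.
apply: ge0_le_integral => //.
- by move=> r _; apply: integral_ge0 => x _; rewrite lee_fin.
- apply: (@measurable_tonelli _ _ (measurableTypeR R) (measurableTypeR R) R mu _ _ (fun r x => `|logsum (level s r) x|%:E)) => //.
    exact: measurable_I11.
  by apply: measurable_funTS; apply: (measurableT_comp (ml2 setT) (@measurable_swap _ _ _ _)).
- by apply: emeasurable_funM; [exact: measurable_cst|exact: measurable_Wf_dist].
- move=> r; rewrite /= in_itv/= andbT => r0.
  rewrite -EFinM -(level_sum ws si s0 (ltW r0)); apply: logsum_L1; first exact: intervals_level.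
  by rewrite (level_sum ws si s0 (ltW r0)); exact: dist_le2.
Qed.

Lemma hilb_upper_bounded u v M : measurable_fun setT u -> L1I u -> 0 < M ->
  (forall x, I11 x -> 0 <= u x <= M) -> is_hilb u v ->
  (nrm v <= 5%:E * Phi (fun x => `|u x|%R))%E.
Proof.
move=> mf Lu M0 uM hu; apply/lee_addgt0Pr => e e0.
(* [q] and [d n] make the two terms of [Phi_small] at most [e / 10] each, which the factor 5 turns
   into [e]. The other entry of the minimum in [d n] makes the approximations converge. *)
pose q := e / (10 * M); have q0 : 0 < q by rewrite divr_gt0// mulr_gt0.
pose C := 2 + ln 2 + `|ln q|; have C0 : 0 < C.
  by rewrite ltr_wpDr// ltr_wpDr// ln_ge0// ler1n.
pose d n := Num.min (e / (10 * C)) n.+1%:R^-1.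
have d0 n : 0 < d n by rewrite lt_min invr_gt0 ltr0n divr_gt0// mulr_gt0.
have /choice[s sP] : forall n, exists s, [/\ [/\ wf s, narrow s & inI s],
   forall p, p \in s -> 0 <= p.2 <= M & (nrm (fun x => u x - stepf s x)%R <= (d n)%:E)%E].
  by move=> n; apply: step_approx_bounded => //; exact: ltW.
have ws n : wf (s n) by have [[]] := sP n.
have si n : inI (s n) by have [[]] := sP n.
have s0 n p : p \in s n -> 0 <= p.2 by move=> ps; have [_ /(_ _ ps)/andP[]] := sP n.
have sM n x : 0 <= stepf (s n) x <= M.
  have [[p ps xp]|/forall2NP h] := pselect (exists2 p : R * R * R, p \in s n & p.1.1 < x <= p.1.2).
    by rewrite (stepf_in (ws n) ps xp); have [_ /(_ _ ps)] := sP n.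
  rewrite stepf_out; last by move=> p ps; have [//|/negP/negbTE] := h p.
  by rewrite lexx ltW.
have mB n : measurable_fun setT (fun x => u x - stepf (s n) x).
  by apply: measurable_funB => //; exact: measurable_stepf.
apply: (@is_hilb_lsc R u v (fun n => stepf (s n)) (fun n => stepH (s n)) _ Lu) => //.
- by move=> n; exact: L1I_stepf.
- by move=> n; exact: is_hilb_stepf.
- apply: cvge0_ge => [n|r r0]; first exact: nrm_ge0.
  exists (Num.bound r^-1) => n hn; have [_ _ h] := sP n; apply: (le_trans h).
  rewrite lee_fin ge_min; apply/orP; right.
  rewrite -(invrK r) lef_pV2 ?posrE ?invr_gt0 ?ltr0n//.
  apply: le_trans (ltW (archi_boundP _)) _; first by rewrite invr_ge0 ltW.
  by rewrite ler_nat (leq_trans hn).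
- move=> n; apply: (le_trans (stepH_L1 (ws n) (si n) (@s0 n))).
  have h1 : (Phi (stepf (s n)) <= Phi (fun x => `|u x|%R + `|u x - stepf (s n) x|)%R)%E.
    apply: Phi_le => l _; apply: dist_le_ae.
    rewrite (_ : _ `&` _ = set0) ?measure0//; apply/seteqP; split => // x [_ /= /andP[g1 g2]].
    have := ler_norm (u x); have := ler_norm (stepf (s n) x - u x); rewrite distrC; lra.
  have h2 := @Phi_add R (fun x => `|u x|) (fun x => `|u x - stepf (s n) x|).
  have h3 := Phi_small (mB n) M0 _ q0.
  apply: (@le_trans _ _ (5%:E * (Phi (fun x => `|u x|%R) + ((q * M)%:E + C%:E * nrm (fun x => u x - stepf (s n) x)%R)))%E).
    apply: lee_wpmul2l => //; apply: (le_trans h1); apply: (le_trans (h2 _ _ _ _)) => //.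
    + exact: measurableT_comp.
    + exact: measurableT_comp.
    + apply: leeD => //; apply: h3 => x Ix.
      by rewrite ler_norml; have := uM _ Ix; have := sM n x; lra.
  rewrite ge0_muleDr ?Phi_ge0//; last first.
    apply: adde_ge0; first by rewrite lee_fin mulr_ge0// ltW.
    by apply: mule_ge0; [rewrite lee_fin ltW|exact: nrm_ge0].
  apply: leeD => //.
  have hq : q * M = e / 10 by rewrite /q; field; rewrite gt_eqF.
  apply: (@le_trans _ _ (5%:E * ((e / 10)%:E + C%:E * (e / (10 * C))%:E))%E).
    apply: lee_wpmul2l => //; rewrite hq; apply: leeD => //; apply: lee_wpmul2l; first by rewrite lee_fin ltW.
    have [_ _ h] := sP n; apply: (le_trans h).
    by rewrite lee_fin ge_min lexx.
  rewrite -(EFinM C) -EFinD -EFinM lee_fin le_eqVlt; apply/orP; left; apply/eqP.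
  by field; rewrite gt_eqF.
Qed.

Lemma Phi_mono u v : (forall x, I11 x -> u x <= v x) -> (Phi u <= Phi v)%E.
Proof.
move=> uv; apply: Phi_le => l _; apply: dist_le_ae.
rewrite (_ : _ `&` _ = set0) ?measure0//; apply/seteqP; split => // x [Ix /= /andP[g1 g2]].
by have := uv _ Ix; lra.
Qed.

Lemma hilb_upper_ge0 u v : L1I u -> (forall x, 0 <= u x) -> is_hilb u v ->
  (nrm v <= 5%:E * Phi (fun x => `|u x|%R))%E.
Proof.
move=> Lu u0 hu.
have Lt n : L1I (trunc n u).
  split; first by apply: clamp_measurable; exact: Lu.1.
  apply: le_lt_trans Lu.2; apply: nrm_le; [apply: clamp_measurable; exact: Lu.1|exact: Lu.1|].
  by move=> x _; have [_ [_ [_]]] := clamp_norm (u x) (ler0n R n).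
have /choice[vn vP] : forall n, exists vn, is_hilb (trunc n u) vn.
  by move=> n; exact: is_hilb_exists.
apply: (is_hilb_lsc Lu Lt hu vP (trunc_cvg Lu)) => n.
have tn x : 0 <= trunc n u x <= n.+1%:R.
  rewrite /trunc /clamp le_max le_min u0 ler0n orbT/= ge_max ge_min ler_nat leqnSn orbT andbT.
  by rewrite (@le_trans _ _ 0)// oppr_le0.
apply: (le_trans (@hilb_upper_bounded (trunc n u) (vn n) n.+1%:R _ (Lt n) _ _ (vP n))) => //.
  exact: (Lt n).1.
apply: lee_wpmul2l => //; apply: Phi_mono => x _.
by have [_ [_ [_]]] := clamp_norm (u x) (ler0n R n).
Qed.

Theorem hilb_upper u v : L1I u -> is_hilb u v -> (nrm v <= 10%:E * Phi (fun x => `|u x|%R))%E.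
Proof.
move=> Lu hu; pose up x := Num.max (u x) 0; pose un x := Num.max (- u x) 0.
have mp : measurable_fun setT up by apply: measurable_maxr => //; exact: Lu.1.
have mn : measurable_fun setT un by apply: measurable_maxr => //; apply: measurableT_comp => //; exact: Lu.1.
have upu x : 0 <= up x /\ `|up x| <= `|u x|.
  by rewrite /up; case: (leP (u x) 0) => h; rewrite ?normr0//= ltW.
have unu x : 0 <= un x /\ `|un x| <= `|u x|.
  by rewrite /un; case: (leP (- u x) 0) => h; rewrite ?normr0//= normrN ltW.
have Lp : L1I up.
  by split => //; apply: le_lt_trans Lu.2; apply: nrm_le => //; [exact: Lu.1|move=> x _; exact: (upu x).2].
have Ln : L1I un.
  by split => //; apply: le_lt_trans Lu.2; apply: nrm_le => //; [exact: Lu.1|move=> x _; exact: (unu x).2].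
have [vp hp] := is_hilb_exists Lp; have [vn hn] := is_hilb_exists Ln.
have h := is_hilb_sub Lp Ln hp hn.
have E : (fun x => up x - un x) = u.
  by apply/funext => x; rewrite /up /un; case: (leP (u x) 0); case: (leP (- u x) 0); lra.
rewrite E in h; rewrite (nrm_ae hu.1 h.1 (is_hilb_unique hu h)).
have mo : measurable_fun setT (fun x => - vn x) by apply: measurableT_comp => //; exact: hn.1.
have := @nrm_triangle R vp (fun x => - vn x) hp.1 mo.
rewrite nrmN => /le_trans; apply.
apply: (@le_trans _ _ (5%:E * Phi (fun x => `|u x|%R) + 5%:E * Phi (fun x => `|u x|%R))%E).
  apply: leeD.
    apply: (le_trans (hilb_upper_ge0 Lp (fun x => (upu x).1) hp)).
    by apply: lee_wpmul2l => //; apply: Phi_mono => x _; exact: (upu x).2.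
  apply: (le_trans (hilb_upper_ge0 Ln (fun x => (unu x).1) hn)).
  by apply: lee_wpmul2l => //; apply: Phi_mono => x _; exact: (unu x).2.
rewrite -ge0_muleDl// -EFinD; apply: lee_wpmul2r; first exact: Phi_ge0.
by rewrite lee_fin; lra.
Qed.

End Upper.

(** * Duality and the lower bound *)

Section Parseval.
Variable R : realType.
Local Notation mu := (@lebesgue_measure R).
Implicit Types (s phi : seq (R * R * R)) (u v h w : R -> R) (x t l r e M a b c d : R).

Lemma chebyshev w l : measurable_fun setT w -> 0 <= l ->
  (l%:E * mu (I11 `&` [set x | (l < `|w x|)%R]) <= nrm w)%E.
Proof.
move=> mw l0; have mn : measurable_fun I11 (fun x => `|w x|) by apply: measurable_funTS; exact: measurableT_comp.
rewrite -(@integral_lt_indic _ (measurableTypeR R) R mu I11 (cst l) (fun x => `|w x|) (@measurable_I11 R))//.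
have mi := @measurable_fun_lt_indic _ (measurableTypeR R) R I11 (cst l) (fun x => `|w x|) (@measurable_I11 R) (measurable_cst _) mn.
rewrite -ge0_integralZl//; last exact: measurable_I11.
apply: ge0_le_integral => //; first exact: measurable_I11; last first.
  move=> x _; rewrite -EFinM lee_fin; case: (ltP l `|w x|) => h; first by rewrite mulr1 ltW.
  by rewrite mulr0.
all: first [by move=> x _; rewrite -EFinM lee_fin mulr_ge0 | by apply/measurable_EFinP; exact: mn | exact: measurable_funeM].
Qed.

Lemma fast_cvg0 (w : nat -> R -> R) : (forall n, measurable_fun setT (w n)) ->
  (forall n, (nrm (w n) <= (4 ^- n)%:E)%E) ->
  offnull (fun x => exists N, forall n, (N <= n)%N -> `|w n x| <= 2 ^- n).
Proof.
move=> mw wn; pose E n := I11 `&` [set x | (2 ^- n < `|w n x|)%R].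
exists [set t | forall N, exists2 n, (N <= n)%N & E n t].
  apply: (@borel_cantelli _ _ 1) => // n.
  have p2 : 0 < 2 ^- n :> R by rewrite invr_gt0 exprn_gt0.
  have := le_trans (chebyshev (mw n) (ltW p2)) (wn n).
  rewrite lee_pdivrMl ?exprn_gt0// => /le_trans; apply.
  rewrite -EFinM lee_fin div1r natrX le_eqVlt; apply/orP; left; apply/eqP.
  rewrite (_ : 4 = 2 * 2 :> R); last by rewrite -natrM.
  by rewrite exprMn invfM mulrA mulfV ?mul1r// expf_neq0.
move=> t It /existsNP[N h]; exists N => n Nn; rewrite leNgt; apply/negP => lt.
by apply: h; exists n.
Qed.

Lemma pow2_cvg0 : (2 ^- n : R) @[n --> \oo] --> (0 : R).
Proof.
apply/cvgrPdist_le => e e0; exists (Num.bound (1 / e)) => // n /= hn.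
rewrite sub0r normrN ger0_norm ?invr_ge0 ?exprn_ge0//.
rewrite -[leLHS]mul1r ler_pdivrMr ?exprn_gt0// -ler_pdivrMl// mulrC.
apply: ltW; apply: (lt_le_trans (archi_boundP _)); first by rewrite divr_ge0// ltW.
apply: (@le_trans _ _ n%:R); first by rewrite ler_nat.
by rewrite -natrX ler_nat ltnW// ltn_expl.
Qed.

Lemma fast_cvg (w : nat -> R -> R) : (forall n, measurable_fun setT (w n)) ->
  (forall n, (nrm (w n) <= (4 ^- n)%:E)%E) -> offnull (fun x => w n x @[n --> \oo] --> 0).
Proof.
move=> mw wn; apply: offnull_imp (fast_cvg0 mw wn) => x _ [N h].
apply/norm_cvg0P; apply: (@squeeze_cvgr _ _ _ _ (cst 0) (fun n => 2 ^- n)); last 2 first.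
- exact: cvg_cst.
- exact: pow2_cvg0.
by exists N => // n /= /h ->; rewrite normr_ge0.
Qed.

Definition intI w : R := \int[mu]_(x in I11) w x.

Lemma intID u v : L1I u -> L1I v -> intI (fun x => u x + v x) = intI u + intI v.
Proof.
move=> Lu Lv; rewrite /intI RintegralD//; [exact: measurable_I11|exact: L1I_integrable|exact: L1I_integrable].
Qed.

Lemma intIZ c u : L1I u -> intI (fun x => c * u x) = c * intI u.
Proof.
by move=> Lu; rewrite /intI RintegralZl//; [exact: measurable_I11|exact: L1I_integrable].
Qed.

Lemma intI_le u : L1I u -> (`|intI u|%:E <= nrm u)%E.
Proof.
move=> Lu; rewrite /intI /Rintegral -abse_EFin fineK; last exact: (integrable_fin_num (@measurable_I11 R) (L1I_integrable Lu)).
apply: (@le_abse_integral _ _ _ mu) => //; first exact: measurable_I11.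
by case/integrableP : (L1I_integrable Lu).
Qed.

Lemma L1I_le u v : measurable_fun setT u -> L1I v -> (forall x, I11 x -> `|u x| <= `|v x|) -> L1I u.
Proof. by move=> mf Lv uv; split => //; apply: le_lt_trans Lv.2; apply: nrm_le => //; exact: Lv.1. Qed.

Lemma L1I_mul_bounded u v M : 0 <= M -> L1I u -> measurable_fun setT v ->
  (forall x, I11 x -> `|v x| <= M) -> L1I (fun x => u x * v x).
Proof.
move=> M0 Lu mv vM; apply: (L1I_le _ (L1I_scale M Lu)); first by apply: measurable_funM => //; exact: Lu.1.
by move=> x Ix; rewrite !normrM mulrC (ger0_norm M0) ler_wpM2r// vM.
Qed.

Lemma integrable_log_cd a c d : -1 <= a -> a <= 1 -> -1 <= c -> d <= 1 ->
  mu.-integrable `]c, d] (EFin \o (fun x => logk `|x - a|)).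
Proof.
move=> a1 a2 c1 d1; apply: (@integrableS _ _ _ mu `]a - 2, a + 2]) => //; last exact: integrable_logk_abs.
by move=> x /=; rewrite !in_itv/= => /andP[h1 h2]; apply/andP; split; lra.
Qed.

Lemma wlogE (p : R * R) x : wlog_ p x = logk `|x - p.1| - logk `|x - p.2|.
Proof. by rewrite /wlog_ /logk (distrC x) (distrC x); ring. Qed.

Lemma measurable_wlog (p : R * R) (D : set R) : measurable_fun D (wlog_ p).
Proof.
apply: measurable_funTS; apply: measurable_funB; apply: measurableT_comp => //;
  by apply: measurableT_comp => //; apply: measurable_funB.
Qed.

Lemma I11_closed_right (f : R -> \bar R) : measurable_fun setT f ->
  (\int[mu]_(x in I11) f x = \int[mu]_(x in `](-1)%R, 1%R]) f x)%E.
Proof. by move=> mf; rewrite [RHS]integral_itv_bndoo//; exact: measurable_funTS. Qed.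

Lemma L1I_wlog (p : R * R) : -1 <= p.1 <= 1 -> -1 <= p.2 <= 1 -> L1I (wlog_ p).
Proof.
move=> /andP[p1 p2] /andP[p3 p4]; split; first exact: measurable_wlog.
rewrite /nrm I11_closed_right; last by apply/measurable_EFinP; apply: measurableT_comp => //; exact: measurable_wlog.
have i1 := @integrable_log_cd p.1 (-1) 1 p1 p2 (lexx _) (lexx _).
have i2 := @integrable_log_cd p.2 (-1) 1 p3 p4 (lexx _) (lexx _).
have /integrableP[_] := @integrableB _ _ _ mu _ (measurable_itv _) _ _ i1 i2.
by under eq_integral do rewrite /= -wlogE.
Qed.

Lemma intI_wlog_cell (p q : R * R) : -1 <= p.1 <= 1 -> -1 <= p.2 <= 1 ->
  -1 <= q.1 -> q.1 <= q.2 -> q.2 <= 1 ->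
  intI (fun x => wlog_ p x * (q.1 < x <= q.2)%R%:R) =
    (logF (q.2 - p.1) - logF (q.1 - p.1)) - (logF (q.2 - p.2) - logF (q.1 - p.2)).
Proof.
move=> /andP[p1 p2] /andP[p3 p4] q1 q12 q2.
have i1 := @integrable_log_cd p.1 q.1 q.2 p1 p2 q1 q2.
have i2 := @integrable_log_cd p.2 q.1 q.2 p3 p4 q1 q2.
rewrite -!logk_abs_Rintegral; try lra.
rewrite -RintegralB// /intI /Rintegral; congr fine.
rewrite I11_closed_right; last first.
  apply/measurable_EFinP; apply: measurable_funM; first exact: measurable_wlog.
  have := @measurable_stepf R [:: (q, 1)] setT; apply: eq_measurable_fun => x _.
  by rewrite /stepf big_seq1 mul1r.
rewrite [LHS]integral_mkcond [RHS]integral_mkcond.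
apply: eq_integral => x _; rewrite !patchE.
rewrite -wlogE; case: ifPn => h1; case: ifPn => h2 //.
- by move: h2; rewrite inE/= in_itv/= => ->; rewrite mulr1.
- by move: h2; rewrite notin_setE/= in_itv/= => /negP/negbTE ->; rewrite mulr0.
- exfalso; move: h1 h2; rewrite notin_setE inE/= !in_itv/= => h1 /andP[h2 h3]; apply: h1.
  by apply/andP; split; lra.
Qed.

Definition cell_ok (p : R * R * R) := [&& -1 <= p.1.1, p.1.1 < p.1.2 & p.1.2 <= 1].

Lemma all_cell_ok s : wf s -> inI s -> all cell_ok s.
Proof.
move=> ws /allP si; apply/allP => p ps; have /andP[h1 h2] := si _ ps.
by rewrite /cell_ok h1 h2 (wf_lt ws ps).
Qed.

Lemma L1I_stepH s : all cell_ok s -> L1I (stepH s).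
Proof.
elim: s => [_|p s IH /= /andP[/and3P[p1 p2 p3] /IH L]].
  rewrite (_ : stepH [::] = fun x => 0 * 0); last by apply/funext => x; rewrite /stepH big_nil mul0r.
  apply: L1I_scale; split; first exact: measurable_cst.
  by rewrite /nrm integral0_eq ?ltry// => x _; rewrite normr0.
rewrite (_ : stepH (p :: s) = fun x => p.2 * wlog_ p.1 x + stepH s x); last first.
  by apply/funext => x; rewrite /stepH big_cons.
apply: L1I_add => //; apply: L1I_scale; apply: L1I_wlog; apply/andP; split; lra.
Qed.

Definition cellf (q : R * R) x : R := (q.1 < x <= q.2)%R%:R.

Lemma measurable_cellf q (D : set R) : measurable_fun D (cellf q).
Proof.
apply: measurable_funTS; have := @measurable_stepf R [:: (q, 1)] setT.
by apply: eq_measurable_fun => x _; rewrite /stepf big_seq1 mul1r.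
Qed.

Lemma cellf_le1 q x : `|cellf q x| <= 1.
Proof. by rewrite /cellf normr_nat; case: (_ && _). Qed.

Lemma stepf_cons p s x : stepf (p :: s) x = p.2 * cellf p.1 x + stepf s x.
Proof. by rewrite /stepf big_cons. Qed.

Lemma stepH_cons p s x : stepH (p :: s) x = p.2 * wlog_ p.1 x + stepH s x.
Proof. by rewrite /stepH big_cons. Qed.

Lemma stepf_bounded s : exists2 M, 0 <= M & forall x, `|stepf s x| <= M.
Proof.
elim: s => [|p s [M M0 h]]; first by exists 0 => // x; rewrite /stepf big_nil normr0.
exists (`|p.2| + M) => [|x]; first by rewrite addr_ge0.
rewrite stepf_cons; apply: (le_trans (ler_normD _ _)); apply: lerD => //.
by rewrite normrM ler_piMr// cellf_le1.
Qed.

Lemma L1I_wlog_cellf (p q : R * R) : -1 <= p.1 <= 1 -> -1 <= p.2 <= 1 -> L1I (fun x => wlog_ p x * cellf q x).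
Proof.
move=> h1 h2; apply: (L1I_mul_bounded (M := 1)) => //; first exact: L1I_wlog.
  exact: measurable_cellf.
by move=> x _; exact: cellf_le1.
Qed.

(** For two cells both sides are explicit in terms of [logF], and exchanging the cells changes the
    sign because [logF] is odd. *)
Lemma parseval_cell_step (p : R * R * R) phi : cell_ok p -> all cell_ok phi ->
  intI (fun x => wlog_ p.1 x * stepf phi x) = - intI (fun x => cellf p.1 x * stepH phi x).
Proof.
move=> /and3P[p1 p2 p3].
have P1 : -1 <= p.1.1 <= 1 by apply/andP; split; lra.
have P2 : -1 <= p.1.2 <= 1 by apply/andP; split; lra.
elim: phi => [_|q phi IH /= /andP[/and3P[q1 q2 q3] aq]].
  rewrite (_ : (fun x => _) = fun=> 0); last by apply/funext => x; rewrite /stepf big_nil mulr0.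
  rewrite [X in - intI X](_ : (fun x => _) = fun=> 0); last by apply/funext => x; rewrite /stepH big_nil mulr0.
  by rewrite /intI /Rintegral integral0 oppr0.
have Q1 : -1 <= q.1.1 <= 1 by apply/andP; split; lra.
have Q2 : -1 <= q.1.2 <= 1 by apply/andP; split; lra.
have [M M0 hM] := stepf_bounded phi.
have L1 : L1I (fun x => wlog_ p.1 x * stepf phi x).
  by apply: (L1I_mul_bounded M0) => //; [exact: L1I_wlog|exact: measurable_stepf].
have L2 : L1I (fun x => stepH phi x * cellf p.1 x).
  by apply: (L1I_mul_bounded (M := 1)) => //; [exact: L1I_stepH|exact: measurable_cellf|move=> x _; exact: cellf_le1].
have L3 := L1I_wlog_cellf q.1 P1 P2; have L4 := L1I_wlog_cellf p.1 Q1 Q2.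
have -> : (fun x => wlog_ p.1 x * stepf (q :: phi) x) =
   (fun x => q.2 * (wlog_ p.1 x * cellf q.1 x) + wlog_ p.1 x * stepf phi x).
  by apply/funext => x; rewrite stepf_cons; ring.
have -> : (fun x => cellf p.1 x * stepH (q :: phi) x) =
   (fun x => q.2 * (wlog_ q.1 x * cellf p.1 x) + stepH phi x * cellf p.1 x).
  by apply/funext => x; rewrite stepH_cons; ring.
rewrite intID//; last exact: L1I_scale.
rewrite intID//; last exact: L1I_scale.
rewrite !intIZ// IH// opprD.
rewrite [in RHS](_ : (fun x => stepH phi x * cellf p.1 x) = (fun x => cellf p.1 x * stepH phi x)); last first.
  by apply/funext => x; rewrite mulrC.
congr (_ - _); rewrite -mulrN; congr (_ * _).
rewrite /cellf !intI_wlog_cell ?(ltW p2) ?(ltW q2)//.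
rewrite -(opprB q.1.1 p.1.1) -(opprB q.1.2 p.1.1) -(opprB q.1.1 p.1.2) -(opprB q.1.2 p.1.2) !logFN.
ring.
Qed.

Lemma parseval_step s phi : all cell_ok s -> all cell_ok phi ->
  intI (fun x => stepH s x * stepf phi x) = - intI (fun x => stepf s x * stepH phi x).
Proof.
move=> + ap; elim: s => [_|p s IH /= /andP[op os]].
  rewrite (_ : (fun x => _) = fun=> 0); last by apply/funext => x; rewrite /stepH big_nil mul0r.
  rewrite [X in - intI X](_ : (fun x => _) = fun=> 0); last by apply/funext => x; rewrite /stepf big_nil mul0r.
  by rewrite /intI /Rintegral integral0 oppr0.
have [M M0 hM] := stepf_bounded phi; have [M' M0' hM'] := stepf_bounded s.
have /and3P[p1 p2 p3] := op.
have P1 : -1 <= p.1.1 <= 1 by apply/andP; split; lra.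
have P2 : -1 <= p.1.2 <= 1 by apply/andP; split; lra.
have L1 : L1I (fun x => wlog_ p.1 x * stepf phi x).
  by apply: (L1I_mul_bounded M0) => //; [exact: L1I_wlog|exact: measurable_stepf].
have L2 : L1I (fun x => stepH s x * stepf phi x).
  by apply: (L1I_mul_bounded M0) => //; [exact: L1I_stepH|exact: measurable_stepf].
have L3 : L1I (fun x => cellf p.1 x * stepH phi x).
  rewrite (_ : (fun x => _) = (fun x => stepH phi x * cellf p.1 x)); last by apply/funext => x; rewrite mulrC.
  by apply: (L1I_mul_bounded (M := 1)) => //; [exact: L1I_stepH|exact: measurable_cellf|move=> x _; exact: cellf_le1].
have L4 : L1I (fun x => stepf s x * stepH phi x).
  rewrite (_ : (fun x => _) = (fun x => stepH phi x * stepf s x)); last by apply/funext => x; rewrite mulrC.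
  by apply: (L1I_mul_bounded M0') => //; [exact: L1I_stepH|exact: measurable_stepf].
have -> : (fun x => stepH (p :: s) x * stepf phi x) =
   (fun x => p.2 * (wlog_ p.1 x * stepf phi x) + stepH s x * stepf phi x).
  by apply/funext => x; rewrite stepH_cons; ring.
have -> : (fun x => stepf (p :: s) x * stepH phi x) =
   (fun x => p.2 * (cellf p.1 x * stepH phi x) + stepf s x * stepH phi x).
  by apply/funext => x; rewrite stepf_cons; ring.
rewrite intID//; last exact: L1I_scale.
rewrite intID//; last exact: L1I_scale.
by rewrite !intIZ// IH// parseval_cell_step// opprD mulrN.
Qed.

Lemma Phi_small_cvg (w : nat -> R -> R) M : 0 < M -> (forall n, measurable_fun setT (w n)) ->
  (forall n x, I11 x -> `|w n x| <= M) -> nrm (w n) @[n --> \oo] --> 0%E ->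
  Phi (fun x => `|w n x|) @[n --> \oo] --> 0%E.
Proof.
move=> M0 mw wM cw; apply: cvge0_ge => [n|e e0]; first exact: Phi_ge0.
pose q := e / 2 / M; have q0 : 0 < q by rewrite !divr_gt0.
pose C := 2 + ln 2 + `|ln q|; have C0 : 0 < C.
  by rewrite ltr_wpDr// ltr_wpDr// ln_ge0// ler1n.
have q1 : 0 < e / 2 / C by rewrite !divr_gt0.
have [N hN] := cvge0_le cw q1.
exists N => n /hN hn; apply: (le_trans (Phi_small (mw n) M0 (wM n) q0)).
apply: (@le_trans _ _ ((q * M)%:E + C%:E * (e / 2 / C)%:E)%E).
  by apply: leeD => //; apply: lee_wpmul2l => //; rewrite lee_fin ltW.
rewrite -EFinM -EFinD lee_fin /q divfK ?gt_eqF// (mulrC C) divfK ?gt_eqF//.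
by rewrite -splitr.
Qed.

(** The step approximations are uniformly bounded, so the error is small in [Phi] and its transform
    is small in [L1] by [hilb_upper]. On the other side [stepH phi] is unbounded but integrable;
    there the error is taken fast enough to vanish a.e., and dominated convergence applies. *)
Theorem parseval h v phi M : measurable_fun setT h -> 0 < M -> (forall x, I11 x -> `|h x| <= M) ->
  is_hilb h v -> all cell_ok phi ->
  intI (fun x => v x * stepf phi x) = - intI (fun x => h x * stepH phi x).
Proof.
move=> mh M0 hM hv ap.
have Lh : L1I h.
  apply: (@L1I_le h (stepf [:: ((-1, 1), M)])) => //.
    by apply: L1I_stepf; rewrite /wf /intervals/= !andbT; lra.
  move=> x Ix; rewrite /stepf big_seq1/=; move: (Ix); rewrite /I11/= in_itv/= => /andP[h1 h2].
  by rewrite h1 (ltW h2) mulr1 (ger0_norm (ltW M0)) hM.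
have p4 n : 0 < 4 ^- n :> R by rewrite invr_gt0 exprn_gt0.
have /choice[s sP] : forall n, exists s, [/\ [/\ wf s, narrow s & inI s],
   forall p, p \in s -> - M <= p.2 <= M & (nrm (fun x => h x - stepf s x)%R <= (4 ^- n)%:E)%E].
  move=> n; apply: step_approx_bounded => //; first by rewrite ge0_cp ?ltW.
  by move=> x Ix; rewrite -ler_norml hM.
have ws n : wf (s n) by have [[]] := sP n.
have si n : inI (s n) by have [[]] := sP n.
have os n : all cell_ok (s n) by exact: all_cell_ok.
have sM n x : `|stepf (s n) x| <= M.
  have [[p ps xp]|/forall2NP H] := pselect (exists2 p : R * R * R, p \in s n & p.1.1 < x <= p.1.2).
    by rewrite (stepf_in (ws n) ps xp) ler_norml; have [_ /(_ _ ps)] := sP n.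
  rewrite stepf_out; last by move=> p ps; have [//|/negP/negbTE] := H p.
  by rewrite normr0 ltW.
pose w n x := h x - stepf (s n) x.
have mw n : measurable_fun setT (w n) by apply: measurable_funB => //; exact: measurable_stepf.
have w4 n : (nrm (w n) <= (4 ^- n)%:E)%E by have [] := sP n.
have cw : nrm (w n) @[n --> \oo] --> 0%E.
  apply: cvge0_ge => [n|e e0]; first exact: nrm_ge0.
  have /cvgrPdist_le/(_ _ e0)[N _ H] := pow2_cvg0; exists N => n /= /H hn; apply: (le_trans (w4 n)).
  rewrite lee_fin; apply: le_trans hn; rewrite sub0r normrN ger0_norm ?invr_ge0 ?exprn_ge0//.
  by rewrite lef_pV2 ?posrE ?exprn_gt0// lerXn2r ?nnegrE// ler_nat.
have wM n x : I11 x -> `|w n x| <= 2 * M.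
  by move=> Ix; apply: (le_trans (ler_normB _ _)); have := hM _ Ix; have := sM n x; lra.
have M20 : 0 < 2 * M by rewrite mulr_gt0.
have cP := Phi_small_cvg M20 mw wM cw.
have LH : L1I (stepH phi) by exact: L1I_stepH.
have [B B0 hB] := stepf_bounded phi.
have c1 : nrm (fun x => w n x * stepH phi x) @[n --> \oo] --> 0%E.
  apply: (@nrm_dct R _ (fun x => 2 * M * stepH phi x)).
  - exact: L1I_scale.
  - by move=> n; apply: measurable_funM => //; exact: measurable_stepH.
  - by move=> n x Ix; rewrite !normrM (ger0_norm (ltW M0)) normr_nat ler_wpM2r// wM.
  - apply: offnull_imp (fast_cvg mw w4) => x _ H.
    by rewrite -(mul0r (stepH phi x)); apply: cvgM => //; exact: cvg_cst.
pose dv n x := v x - stepH (s n) x.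
have Ls n : L1I (stepf (s n)) by exact: L1I_stepf.
have hw n : is_hilb (w n) (dv n) by apply: is_hilb_sub => //; exact: is_hilb_stepf.
have Lw n : L1I (w n) by exact: L1I_sub.
have Ldv n : L1I (dv n).
  split; first exact: (hw n).1.
  apply: (le_lt_trans (hilb_upper (Lw n) (hw n))).
  apply: lte_mul_pinfty => //; apply: (le_lt_trans (Phi_small (mw n) M20 (wM n) ltr01)).
  by rewrite lte_add_pinfty ?ltry// lte_mul_pinfty ?lee_fin ?addr_ge0 ?ln_ge0 ?ler1n//; exact: (Lw n).2.
have Lv : L1I v.
  have := L1I_add (Ldv 0%N) (L1I_stepH (os 0%N)).
  by rewrite (_ : (fun x => _) = v)//; apply/funext => x; rewrite /dv subrK.
have key n : (`|intI (fun x => v x * stepf phi x) + intI (fun x => h x * stepH phi x)|%:E <=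
    B%:E * (10%:E * Phi (fun x => `|w n x|%R)) + nrm (fun x => w n x * stepH phi x)%R)%E.
  have L1 : L1I (fun x => dv n x * stepf phi x).
    by apply: (L1I_mul_bounded B0) => //; exact: measurable_stepf.
  have L2 : L1I (fun x => stepH (s n) x * stepf phi x).
    by apply: (L1I_mul_bounded B0) => //; [exact: L1I_stepH|exact: measurable_stepf].
  have L3 : L1I (fun x => w n x * stepH phi x).
    rewrite (_ : (fun x => _) = (fun x => stepH phi x * w n x)); last by apply/funext => x; rewrite mulrC.
    by apply: (L1I_mul_bounded (ltW M20)) => //; exact: wM.
  have L4 : L1I (fun x => stepf (s n) x * stepH phi x).
    rewrite (_ : (fun x => _) = (fun x => stepH phi x * stepf (s n) x)); last by apply/funext => x; rewrite mulrC.
    by apply: (L1I_mul_bounded (ltW M0)) => //; exact: measurable_stepf.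
  have -> : (fun x => v x * stepf phi x) = (fun x => dv n x * stepf phi x + stepH (s n) x * stepf phi x).
    by apply/funext => x; rewrite /dv; ring.
  have -> : (fun x => h x * stepH phi x) = (fun x => w n x * stepH phi x + stepf (s n) x * stepH phi x).
    by apply/funext => x; rewrite /w; ring.
  rewrite !intID// (parseval_step (os n) ap).
  rewrite (_ : _ + _ = intI (fun x => dv n x * stepf phi x) + intI (fun x => w n x * stepH phi x)); last by ring.
  apply: (@le_trans _ _ (`|intI (fun x => dv n x * stepf phi x)|%:E + `|intI (fun x => w n x * stepH phi x)|%:E)%E).
    by rewrite -EFinD lee_fin ler_normD.
  apply: leeD; last exact: intI_le.
  apply: (le_trans (intI_le L1)).
  apply: (@le_trans _ _ (nrm (fun x => B * dv n x)%R)).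
    apply: nrm_le; [exact: L1.1|by apply: measurable_funM => //; exact: (Ldv n).1|].
    by move=> x _; rewrite !normrM mulrC (ger0_norm B0) ler_wpM2r.
  rewrite nrmZ; last exact: (Ldv n).1.
  by rewrite (ger0_norm B0); apply: lee_wpmul2l; [rewrite lee_fin|exact: hilb_upper].
apply/eqP; rewrite -subr_eq0 opprK -normr_le0; apply/ler_addgt0Pr => e e0; rewrite add0r.
have q0 : 0 < e / 2 / (10 * (B + 1)) by rewrite !divr_gt0// mulr_gt0// ltr_pwDr.
have [N1 h1] := cvge0_le cP q0; have [N2 h2] := cvge0_le c1 (divr_gt0 e0 (ltr0n R 2)).
pose n := maxn N1 N2; rewrite -lee_fin; apply: (le_trans (key n)).
apply: (@le_trans _ _ (B%:E * (10%:E * (e / 2 / (10 * (B + 1)))%:E) + (e / 2)%:E)%E).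
  apply: leeD; last by apply: h2; exact: leq_maxr.
  by do 2! apply: lee_wpmul2l => //; apply: h1; exact: leq_maxl.
rewrite -EFinM -?EFinM -EFinD lee_fin [leRHS]splitr lerD2r.
have -> : B * (10 * (e / 2 / (10 * (B + 1)))) = e / 2 * (B / (B + 1)) by field; rewrite gt_eqF// ltr_pwDr.
by rewrite ler_piMr ?divr_ge0 ?(ltW e0)// ler_pdivrMr ?mul1r ?lerDl// ltr_pwDr.
Qed.

End Parseval.

(** * Testing the transform by duality *)

Section Tests.
Variable R : realType.
Local Notation mu := (@lebesgue_measure R).
Implicit Types (s phi : seq (R * R * R)) (g h u v w : R -> R) (x y t l r M N : R).

Lemma mu_diam (B : set R) (d : R) : 0 <= d -> (forall x y, B x -> B y -> x < y -> y - x <= d) ->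
  (mu B <= d%:E)%E.
Proof.
move=> d0 Bd; have [->|/set0P[z Bz]] := eqVneq B set0; first by rewrite measure0 lee_fin.
have lb : has_lbound B.
  exists (z - d) => y By; have [zy|yz] := leP z y; first by lra.
  by have := Bd _ _ By Bz yz; lra.
have hi : has_inf B by split => //; exists z.
apply: (@le_trans _ _ (mu `[inf B, inf B + d]%classic)).
  apply: le_mu => y By; rewrite /= in_itv/=; apply/andP; split; first exact: ge_inf.
  rewrite leNgt; apply/negP => h.
  have [|w Bw wh] := @inf_lt R B (y - d) hi.1; first by lra.
  have wy : w < y by lra.
  by have := Bd _ _ Bw By wy; lra.
rewrite lebesgue_measure_itv/= lte_fin; case: ifPn => // _.
by rewrite -EFinB lee_fin; lra.
Qed.

(** The real counterpart of a bound on the optimal norm; the factor [1/pi] is missing on both sides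
    of the theory until complex functions return. *)
Definition hilb_bound g N := forall h v, measurable_fun setT h ->
  (forall x, I11 x -> `|h x| <= g x) -> is_hilb h v -> (nrm v <= N%:E)%E.

Definition sgn y : R := (0 < y)%R%:R - (y < 0)%R%:R.

Lemma sgnM y : y * sgn y = `|y|.
Proof.
rewrite /sgn; have [h|h|->] := ltrgtP y 0.
- by rewrite sub0r mulrN1 ltr0_norm.
- by rewrite subr0 mulr1 gtr0_norm.
- by rewrite mul0r normr0.
Qed.

Lemma sgn_le1 y : `|sgn y| <= 1.
Proof. by rewrite /sgn; case: (ltrgtP y 0) => _; rewrite ?subr0 ?sub0r ?normrN ?normr1 ?normr0. Qed.

Lemma measurable_sgn w : measurable_fun setT w -> measurable_fun setT (fun x => sgn (w x)).
Proof.
move=> mw; apply: measurable_funB; apply/measurable_EFinP.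
  exact: (@measurable_fun_lt_indic _ (measurableTypeR R) R setT (cst 0) w).
exact: (@measurable_fun_lt_indic _ (measurableTypeR R) R setT w (cst 0)).
Qed.

Lemma nrm_intI w : L1I w -> nrm w = (intI (fun x => `|w x|))%:E.
Proof.
move=> Lw; rewrite /intI /Rintegral fineK//.
have := integrable_fin_num (@measurable_I11 R) (integrable_abse (L1I_integrable Lw)).
by [].
Qed.

Lemma bounded_L1I g M : measurable_fun setT g -> 0 <= M -> (forall x, I11 x -> `|g x| <= M) -> L1I g.
Proof.
move=> mg M0 gM; apply: (@L1I_le R g (stepf [:: ((-1, 1), M)])) => //.
  by apply: L1I_stepf; rewrite /wf /intervals/= !andbT; lra.
move=> x Ix; rewrite /stepf big_seq1/=; move: (Ix); rewrite /I11/= in_itv/= => /andP[h1 h2].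
by rewrite h1 (ltW h2) mulr1 (ger0_norm M0) gM.
Qed.

(** The competitor [h = - g sgn (stepH phi)] turns the left side into the integral of
    [v * stepf phi], at most the [L1] norm of [v] since [stepf phi] is bounded by 1. *)
Lemma test_bound g M N phi : measurable_fun setT g -> 0 < M -> (forall x, I11 x -> 0 <= g x <= M) ->
  hilb_bound g N -> all (@cell_ok R) phi -> (forall x, `|stepf phi x| <= 1) ->
  (nrm (fun x => g x * stepH phi x)%R <= N%:E)%E.
Proof.
move=> mg M0 gM gN ap phi1.
pose h x := g x * (- sgn (stepH phi x)).
have ms := measurable_sgn (@measurable_stepH R phi setT).
have mh : measurable_fun setT h by apply: measurable_funM => //; exact: measurableT_comp.
have hg x : I11 x -> `|h x| <= g x.
  move=> Ix; have /andP[g0 _] := gM _ Ix; rewrite /h normrM normrN (ger0_norm g0).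
  by rewrite ler_piMr// sgn_le1.
have hM x : I11 x -> `|h x| <= M.
  by move=> Ix; apply: (le_trans (hg _ Ix)); have /andP[] := gM _ Ix.
have Lg : L1I g.
  by apply: (@bounded_L1I g M) => //; [exact: ltW|move=> x /gM /andP[g0 gm]; rewrite ger0_norm].
have Lh : L1I h by apply: (@bounded_L1I h M) => //; exact: ltW.
have [v hv] := is_hilb_exists Lh.
have vN := gN _ _ mh hg hv.
have Lv : L1I v by split; [exact: hv.1|apply: (le_lt_trans vN); rewrite ltry].
have LH : L1I (stepH phi) by exact: L1I_stepH.
have Lp : L1I (fun x => g x * stepH phi x).
  rewrite (_ : (fun x => _) = (fun x => stepH phi x * g x)); last by apply/funext => x; rewrite mulrC.
  apply: (@L1I_mul_bounded _ _ _ M) => //; first exact: ltW.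
  by move=> x /gM/andP[g0 gm]; rewrite ger0_norm.
rewrite nrm_intI//.
have -> : intI (fun x => `|g x * stepH phi x|) = - intI (fun x => h x * stepH phi x).
  have -> : intI (fun x => `|g x * stepH phi x|) = intI (fun x => (-1) * (h x * stepH phi x)).
    apply: eq_Rintegral => x /set_mem Ix; have /andP[g0 _] := gM _ Ix.
    by rewrite normrM (ger0_norm g0) -sgnM /h; ring.
  rewrite intIZ ?mulN1r//.
  rewrite (_ : (fun x => _) = (fun x => stepH phi x * h x)); last by apply/funext => x; rewrite mulrC.
  by apply: (@L1I_mul_bounded _ _ _ M) => //; exact: ltW.
rewrite -(parseval mh M0 hM hv ap).
have L1 : L1I (fun x => v x * stepf phi x).
  by apply: (@L1I_mul_bounded _ _ _ 1) => //; exact: measurable_stepf.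
apply: (@le_trans _ _ (`|intI (fun x => v x * stepf phi x)|%:E)); first by rewrite lee_fin ler_norm.
apply: (le_trans (intI_le L1)); apply: le_trans vN; apply: nrm_le; [exact: L1.1|exact: Lv.1|].
by move=> x _; rewrite normrM ler_piMr.
Qed.

Lemma stepf1_le1 phi : wf phi -> (forall p, p \in phi -> p.2 = 1) -> forall x, `|stepf phi x| <= 1.
Proof.
move=> wp p1 x.
have [[p ps xp]|/forall2NP H] := pselect (exists2 p : R * R * R, p \in phi & p.1.1 < x <= p.1.2).
  by rewrite (stepf_in wp ps xp) (p1 _ ps) normr1.
rewrite stepf_out; last by move=> p ps; have [//|/negP/negbTE] := H p.
by rewrite normr0.
Qed.

Lemma ln_ge_1subV y : 0 < y -> 1 - y^-1 <= ln y.
Proof.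
move=> y0; have y1 : 0 < y^-1 by rewrite invr_gt0.
have y2 : -1 < y^-1 - 1 by lra.
have := @le_ln1Dx R _ y2; rewrite (_ : 1 + (y^-1 - 1) = y^-1); last by ring.
by rewrite lnV ?posrE//; lra.
Qed.

(** The right side consists of the transforms of the indicators of [(-1, 1)] and of [(0, 1)]. Both
    are singular at 1, and their zeros 0 and 1/2 are different, so together they dominate the
    constant 1 as well. *)
Lemma end_test x : I11 x -> x != 0 -> 1 + `|ln `|1 - x| | <=
  4 * (`|ln `|1 - x| - ln `|- 1 - x| | + `|ln `|1 - x| - ln `|0 - x| |).
Proof.
rewrite /I11/= in_itv/= => /andP[x1 x2] x0.
have -> : `|-1 - x| = 1 + x by rewrite -opprD normrN ger0_norm//; lra.
have -> : `|1 - x| = 1 - x by rewrite ger0_norm//; lra.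
have p1 : 0 < 1 - x by lra.
have p2 : 0 < 1 + x by lra.
have ln2h : 1/2 <= ln 2 :> R.
  by have := @ln_ge_1subV 2 (ltr0n R 2); lra.
have lnle1 y : 0 < y -> y <= 2 -> ln y <= 1.
  move=> y0 y2; have y3 : -1 < y - 1 by lra.
  by have := @le_ln1Dx R _ y3; rewrite (_ : 1 + (y - 1) = y); [lra|ring].
have [h|h] := leP x (1/4).
  have b : 1/2 <= `|ln (1 - x) - ln `|0 - x| |.
    rewrite sub0r normrN.
    have ax : 0 < `|x| by rewrite normr_gt0.
    rewrite -ln_div ?posrE// (le_trans _ (ler_norm _))// (le_trans ln2h)//.
    rewrite ler_ln ?posrE ?divr_gt0// ler_pdivlMr//.
    by have [h3|h3] := ger0P x; lra.
  have c : `|ln (1 - x)| <= 1.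
    rewrite ler_norml; apply/andP; split; last by apply: lnle1 => //; lra.
    have := ln_ge_1subV p1; have : (1 - x)^-1 <= 4/3.
      rewrite -(invrK (4/3)) lef_pV2 ?posrE ?invr_gt0//; lra.
    lra.
  have := normr_ge0 (ln (1 - x) - ln (1 + x)); lra.
have a1 : 0 <= ln (1 + x) by apply: ln_ge0; lra.
have a2 : ln (1 - x) <= 0 by apply: ln_le0; lra.
have a3 : 2/5 <= ln (1 + x) - ln (1 - x).
  rewrite -ln_div ?posrE//.
  have q : 0 < (1 + x) / (1 - x) by rewrite divr_gt0.
  have := ln_ge_1subV q; rewrite invf_div => h1.
  have : (1 - x) / (1 + x) <= 3/5 by rewrite ler_pdivrMr//; lra.
  lra.
rewrite (ler0_norm a2) distrC (ger0_norm (_ : 0 <= ln (1 + x) - ln (1 - x))); last lra.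
have := normr_ge0 (ln (1 - x) - ln `|0 - x|); lra.
Qed.

Lemma nrm_le_ae u v : measurable_fun setT u -> measurable_fun setT v ->
  offnull (fun x => `|u x| <= `|v x|) -> (nrm u <= nrm v)%E.
Proof.
move=> mf mv uv; have mn (w : R -> R) : measurable_fun setT w ->
    measurable_fun I11 (fun x => `|w x|%:E : \bar R).
  by move=> mw; apply/measurable_EFinP; apply: measurable_funTS; exact: measurableT_comp.
apply: (@ae_ge0_le_integral _ (measurableTypeR R) R mu I11 (@measurable_I11 R)).
- by move=> x _; rewrite lee_fin.
- exact: mn.
- by move=> x _; rewrite lee_fin.
- exact: mn.
- by apply: offnull_ae; apply: offnull_imp uv => x _; rewrite lee_fin.
Qed.

Lemma end_bound g M N : measurable_fun setT g -> 0 < M -> (forall x, I11 x -> 0 <= g x <= M) ->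
  hilb_bound g N -> (nrm (fun x => g x * (1 + `|ln `|1 - x| |))%R <= (8 * N)%:E)%E.
Proof.
move=> mg M0 gM gN.
pose f1 : seq (R * R * R) := [:: ((-1, 1), 1)]; pose f2 : seq (R * R * R) := [:: ((0, 1), 1)].
have w1 : wf f1 by rewrite /wf /intervals/= !andbT; lra.
have w2 : wf f2 by rewrite /wf /intervals/= !andbT; lra.
have o1 : all (@cell_ok R) f1 by rewrite /= /cell_ok /= andbT; apply/and3P; split; lra.
have o2 : all (@cell_ok R) f2 by rewrite /= /cell_ok /= andbT; apply/and3P; split; lra.
have b1 := test_bound mg M0 gM gN o1 (stepf1_le1 w1 _).
have b2 := test_bound mg M0 gM gN o2 (stepf1_le1 w2 _).
have m1 : measurable_fun setT (fun x => `|g x * stepH f1 x|).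
  by apply: measurableT_comp => //; apply: measurable_funM => //; exact: measurable_stepH.
have m2 : measurable_fun setT (fun x => `|g x * stepH f2 x|).
  by apply: measurableT_comp => //; apply: measurable_funM => //; exact: measurable_stepH.
have n12 := nrm_triangle m1 m2.
have nn (w : R -> R) : nrm (fun x => `|w x|) = nrm w by apply: eq_integral => x _; rewrite normr_id.
rewrite !nn in n12.
apply: (@le_trans _ _ (nrm (fun x => 4 * (`|g x * stepH f1 x| + `|g x * stepH f2 x|))%R)); last first.
  rewrite nrmZ; last exact: measurable_funD.
  rewrite ger0_norm//.
  apply: (@le_trans _ _ (4%:E * (N%:E + N%:E))%E); last by rewrite -EFinD -EFinM lee_fin; lra.
  apply: lee_wpmul2l => //; apply: (le_trans n12); apply: leeD.
    by apply: b1 => p; rewrite inE => /eqP ->.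
  by apply: b2 => p; rewrite inE => /eqP ->.
have ml : measurable_fun setT (fun x => ln `|1 - x| : R).
  by apply: measurableT_comp => //; apply: measurableT_comp => //; apply: measurable_funB.
apply: nrm_le_ae.
- by apply: measurable_funM => //; apply: measurable_funD => //; apply: measurableT_comp.
- by apply: measurable_funM => //; exact: measurable_funD.
- exists [set x | x \in [:: 0]]; first exact: mu_seq0.
  move=> x Ix /=; rewrite inE => /negP x0; have /andP[g0 _] := gM _ Ix.
  rewrite /stepH !big_seq1/= !mul1r.
  set A := ln `|1 - x| - ln `|-1 - x|; set B := ln `|1 - x| - ln `|0 - x|.
  have -> : 4 * (`|g x * A| + `|g x * B|) = g x * (4 * (`|A| + `|B|)).
    by rewrite !normrM (ger0_norm g0); ring.
  rewrite normrM [leRHS]normrM; apply: ler_wpM2l => //.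
  rewrite ger0_norm ?addr_ge0// ger0_norm ?mulr_ge0 ?addr_ge0//.
  exact: end_test.
Qed.

End Tests.

(** * The lower bound for step functions *)

Section LowerStep.
Variable R : realType.
Local Notation mu := (@lebesgue_measure R).
Implicit Types (s phi : seq (R * R * R)) (p q : R * R * R) (g h u v w : R -> R) (x y t l r M N : R).

(** Each cell gets a point mass at its left end, in proportion to its share of the integral of
    [stepf s]; the total is 1. *)
Definition weight s p : R := p.2 * (p.1.2 - p.1.1) / mass s.
Definition cauchy_sum s x : R := \sum_(p <- s) weight s p / (x - p.1.1).

Lemma mass_gt0 s : wf s -> (forall p, p \in s -> 0 < p.2) -> s != [::] -> 0 < mass s.
Proof.
case: s => // p s ws s0 _; rewrite /mass big_cons; apply: ltr_pwDl.
  rewrite mulr_gt0 ?normr_gt0 ?gt_eqF ?s0 ?mem_head// subr_gt0.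
  by apply: (wf_lt ws); exact: mem_head.
rewrite big_seq sumr_ge0// => q qs; rewrite mulr_ge0// subr_ge0 ltW//.
by apply: (wf_lt ws); rewrite inE qs orbT.
Qed.

Lemma weight_gt0 s p : wf s -> (forall p, p \in s -> 0 < p.2) -> p \in s -> 0 < weight s p.
Proof.
move=> ws s0 ps; rewrite /weight divr_gt0 ?mulr_gt0 ?s0 ?subr_gt0 ?(wf_lt ws)//.
by apply: mass_gt0 => //; case: (s) ps.
Qed.

Lemma sum_weight s : wf s -> (forall p, p \in s -> 0 < p.2) -> s != [::] ->
  \sum_(p <- s) weight s p = 1.
Proof.
move=> ws s0 sn; have m0 := mass_gt0 ws s0 sn.
rewrite /weight -mulr_suml (_ : \sum_(p <- s) _ = mass s) ?mulfV ?gt_eqF//.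
by rewrite /mass; apply: eq_big_seq => p ps; rewrite gtr0_norm// s0.
Qed.

Lemma sumr_delta_bound (t x : R) : I11 x -> t <= 2 ->
  `|ln `|t - x| - ln `|Num.min t 1 - x| | <= 2 + `|ln `|1 - x| |.
Proof.
rewrite /I11/= in_itv/= => /andP[x1 x2] t2; have [h|h] := leP t 1.
  by rewrite subrr normr0 addr_ge0.
have p1 : 0 < 1 - x by lra.
have p2 : 0 < t - x by lra.
have -> : `|t - x| = t - x by rewrite gtr0_norm.
have -> : `|1 - x| = 1 - x by rewrite gtr0_norm.
have a1 : ln (1 - x) <= ln (t - x) by rewrite ler_ln ?posrE//; lra.
have a2 : ln (t - x) <= 2.
  have y3 : -1 < t - x - 1 by lra.
  by have := @le_ln1Dx R _ y3; rewrite (_ : 1 + (t - x - 1) = t - x); [lra|ring].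
rewrite ger0_norm ?subr_ge0//; apply: lerD => //.
by rewrite -normrN ler_norm.
Qed.

(** The intervals from each pole to the next root of [1 - cauchy_sum s] are disjoint, and the
    transform of their union is [ln |1 - cauchy_sum s x|]. Only the last one can leave [(-1, 1)]; it
    is cut at 1, and [sumr_delta_bound] measures the change. *)
Lemma poles_intervals s : wf s -> inI s -> (forall p, p \in s -> 0 < p.2) -> s != [::] ->
  exists phi, [/\ wf phi, inI phi, forall p, p \in phi -> p.2 = 1 &
    forall x, I11 x -> x \notin [seq p.1.1 | p <- s] ->
      `|ln `|1 - cauchy_sum s x| | <= `|stepH phi x| + (2 + `|ln `|1 - x| |)].
Proof.
move=> ws si s0 sn.
pose d : R * R * R := ((0, 0), 0); pose n := size s.
pose a i := (nth d s i).1.1; pose b i := (nth d s i).1.2; pose c i := weight s (nth d s i).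
have mems i : (i < n)%N -> nth d s i \in s by exact: mem_nth.
have ab i : (i < n)%N -> a i < b i by move=> /mems/(wf_lt ws).
have ba i j : (i < j < n)%N -> b i <= a j.
  move=> /andP[ij jn]; move: ws; rewrite /wf /intervals => /andP[_].
  rewrite pairwise_map => /(pairwiseP d); apply=> //; rewrite inE//.
  exact: ltn_trans jn.
have a1 i : (i < n)%N -> -1 <= a i /\ b i <= 1.
  by move=> /mems/(allP si)/andP[].
have aI i j : (i < j < n)%N -> a i < a j.
  by move=> h; apply: (lt_le_trans _ (ba _ _ h)); apply: ab; case/andP: h => h1; exact: ltn_trans.
have c0 i : (i < n)%N -> 0 < c i by move=> /mems; exact: weight_gt0.
have [t [at_ ta st rt]] := boole_roots aI c0.
have tle1 i : (i.+1 < n)%N -> t i <= 1.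
  by move=> h; apply: (le_trans (ltW (ta _ h))); have := ab _ h; have [] := a1 _ h; lra.
pose phi : seq (R * R * R) := [seq ((a i, Num.min (t i) 1), 1) | i <- iota 0 n].
exists phi; split.
- rewrite /wf /intervals -map_comp; apply/andP; split.
    apply/allP => _ /mapP[i + ->] /=; rewrite mem_iota/= add0n => h.
    by rewrite lt_min at_//; have := ab _ h; have [] := a1 _ h; lra.
  rewrite pairwise_map; apply: (@sub_in_pairwise _ [pred i | (i < n)%N] ltn) => [i j|  |].
  + rewrite !inE => hi hj /= ij; have h : (i.+1 < n)%N by exact: leq_ltn_trans hj.
    rewrite ge_min; apply/orP; left; apply: (le_trans (ltW (ta _ h))).
    move: ij; rewrite leq_eqVlt => /predU1P[->//|ij]; apply/ltW/aI.
    by rewrite ij.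
  + by apply/allP => i; rewrite mem_iota.
  + by rewrite -sorted_pairwise ?iota_ltn_sorted//; exact: ltn_trans.
- apply/allP => _ /mapP[i + ->] /=; rewrite mem_iota/= add0n => h.
  by rewrite (a1 _ h).1 ge_min lexx orbT.
- by move=> p /mapP[i _ ->].
move=> x Ix xs.
have rE : cauchy_sum s x = \sum_(i < n) c i / (x - a i).
  by rewrite /cauchy_sum (big_nth d) big_mkord.
have xa i : (i < n)%N -> x != a i.
  move=> h; apply/negP => /eqP xe; move/negP: xs; apply; apply/mapP.
  by exists (nth d s i) => //; exact: mems.
have E := rt x xa; rewrite rE.
(* At a root the left side is [ln 0], which is 0. *)
have [z|nz] := eqVneq (1 - \sum_(i < n) c i / (x - a i)) 0.
  by rewrite z normr0 ln0// normr0 addr_ge0// addr_ge0.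
pose I := [seq (a i, t i) | i <- iota 0 n].
have xt i : (i < n)%N -> x != t i.
  move=> h; apply/negP => /eqP xe; move/negP: nz; apply; rewrite E; apply/eqP.
  by rewrite (bigD1 (Ordinal h))//= -xe subrr !mul0r.
have LI : ln `|1 - \sum_(i < n) c i / (x - a i)| = logsum I x.
  rewrite E -(expRK (logsum I x)) expR_logsum.
    by congr (ln `| _ |); rewrite big_map_iota.
  move=> p /mapP[i + ->] /=; rewrite mem_iota/= add0n => h.
  by split; [exact: xa|exact: xt].
rewrite LI.
have D : `|logsum I x - stepH phi x| <= 2 + `|ln `|1 - x| |.
  rewrite /logsum /stepH !big_map_iota/= -sumrB.
  have [n' nn'] : exists n', n = n'.+1.
    by exists n.-1; rewrite prednK// lt0n size_eq0.
  (* The roots exceed the poles by 1 in total and none lies below its pole, so the last root is at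
     most the last pole plus 1. *)
  have tl : t n' <= 2.
    have : \sum_(i < n'.+1) t i = \sum_(i < n'.+1) a i + \sum_(i < n'.+1) c i by rewrite -nn'.
    rewrite big_ord_recr [X in _ = X + _]big_ord_recr/=.
    have -> : \sum_(i < n'.+1) c i = 1.
      rewrite -nn' -(sum_weight ws s0 sn) [RHS](big_nth d) big_mkord.
      by [].
    have : \sum_(i < n') a i <= \sum_(i < n') t i.
      by apply: ler_sum => i _; apply/ltW/at_; rewrite nn' (ltn_trans (ltn_ord i)).
    have h : (n' < n)%N by rewrite nn'.
    by have := ab _ h; have [] := a1 _ h; lra.
  rewrite nn' big_ord_recr/= big1 ?add0r; last first.
    move=> i _; have h : (i.+1 < n)%N by rewrite nn' ltnS.
    by rewrite (min_idPl (tle1 _ h)) mul1r subrr.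
  rewrite mul1r (_ : _ - _ = ln `|t n' - x| - ln `|Num.min (t n') 1 - x|); last by ring.
  exact: sumr_delta_bound.
have := ler_normD (logsum I x - stepH phi x) (stepH phi x); rewrite subrK.
lra.
Qed.

Lemma cell_pole s p q : wf s -> p \in s -> q \in s -> q.1.1 <= p.1.1 \/ p.1.2 <= q.1.1.
Proof.
move=> ws ps qs; have [h|h] := leP q.1.1 p.1.1; first by left.
right; rewrite leNgt; apply/negP => h2.
have pp := wf_lt ws ps; have qq := wf_lt ws qs.
pose y := (q.1.1 + Num.min p.1.2 q.1.2) / 2.
have m1 : q.1.1 < Num.min p.1.2 q.1.2 by rewrite lt_min h2.
have m2 : Num.min p.1.2 q.1.2 <= p.1.2 by rewrite ge_min lexx.
have m3 : Num.min p.1.2 q.1.2 <= q.1.2 by rewrite ge_min lexx orbT.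
have : p.1 = q.1.
  apply: (wf_overlap (x := y) ws ps qs); rewrite /y; apply/andP; split; lra.
by move=> e; rewrite e ltxx in h.
Qed.

(** Every term decreases between poles, and no pole lies inside a cell. The term of the cell itself
    already gives the rate, because [x] and [y] are within the length of the cell from its pole. *)
Lemma cauchy_sum_decr s p x y : wf s -> (forall p, p \in s -> 0 < p.2) -> p \in s ->
  p.1.1 < x -> x < y -> y < p.1.2 ->
  p.2 / mass s * ((y - x) / (p.1.2 - p.1.1)) <= cauchy_sum s x - cauchy_sum s y.
Proof.
move=> ws s0 ps px xy yp; rewrite /cauchy_sum -sumrB.
have T q : q \in s -> 0 <= weight s q / (x - q.1.1) - weight s q / (y - q.1.1).
  move=> qs; rewrite -mulrBr; apply: mulr_ge0; first exact/ltW/weight_gt0.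
  rewrite subr_ge0; have [h|h] := cell_pole ws ps qs.
    by rewrite lef_pV2 ?posrE; lra.
  by rewrite lef_nV2 ?negrE; lra.
rewrite (big_rem p)//=.
have rest : 0 <= \sum_(q <- rem p s) (weight s q / (x - q.1.1) - weight s q / (y - q.1.1)).
  by rewrite big_seq sumr_ge0// => q /mem_rem; exact: T.
apply: (@le_trans _ _ (weight s p / (x - p.1.1) - weight s p / (y - p.1.1))); last by rewrite lerDl.
have m0 : 0 < mass s by apply: mass_gt0 => //; case: (s) ps.
have x0 : 0 < x - p.1.1 by lra.
have y0 : 0 < y - p.1.1 by lra.
have d0 : 0 < p.1.2 - p.1.1 by lra.
have -> : weight s p / (x - p.1.1) - weight s p / (y - p.1.1) =
   p.2 / mass s * ((y - x) * ((p.1.2 - p.1.1) / ((x - p.1.1) * (y - p.1.1)))).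
  by rewrite /weight; field; rewrite !gt_eqF.
apply: ler_wpM2l; first by rewrite divr_ge0// ltW// s0.
apply: ler_wpM2l; first lra.
rewrite ler_pdivlMr ?mulr_gt0// mulrC ler_pdivrMr//.
by apply: ler_pM; lra.
Qed.

Definition lnp y : R := Num.max 0 (ln y).

Lemma lnp_ge0 y : 0 <= lnp y. Proof. by rewrite le_max lexx. Qed.

Lemma measurable_cauchy_sum s (D : set R) : measurable_fun D (cauchy_sum s).
Proof.
apply: measurable_funTS; apply: measurable_sum => p; apply: measurable_funM => //.
by apply: measurableT_comp; [exact: measurable_inv|exact: measurable_funB].
Qed.

(** On the exceptional set the Cauchy sum varies by less than [p.2 / (4 * mass s)], so by
    [cauchy_sum_decr] the diameter of this set is at most a quarter of the cell. *)
Lemma good_cell s p : wf s -> inI s -> (forall p, p \in s -> 0 < p.2) -> p \in s ->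
  let G := `]p.1.1, p.1.2[%classic `&` [set x | p.2 / (8 * mass s) <= `|cauchy_sum s x|] in
  measurable (G : set (measurableTypeR R)) /\ ((3 / 4 * (p.1.2 - p.1.1))%:E <= mu G)%E.
Proof.
move=> ws si s0 ps G; have m0 : 0 < mass s by apply: mass_gt0 => //; case: (s) ps.
have ab := wf_lt ws ps; have p0 := s0 _ ps.
have d0 : 0 < p.1.2 - p.1.1 by rewrite subr_gt0.
split.
  apply: measurableI => //.
  have mn : measurable_fun [set: R] (fun x => `|cauchy_sum s x|).
    by apply: measurableT_comp => //; exact: measurable_cauchy_sum.
  have := mn measurableT _ (measurable_itv `[p.2 / (8 * mass s), +oo[); rewrite setTI.
  by congr measurable; apply/seteqP; split => x /=; rewrite in_itv/= andbT.
pose B := `]p.1.1, p.1.2[%classic `&` [set x | `|cauchy_sum s x| < p.2 / (8 * mass s)].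
have muB : (mu B <= ((p.1.2 - p.1.1) / 4)%:E)%E.
  apply: mu_diam; first by rewrite divr_ge0// ltW.
  move=> x y [/= + rx] [/= + ry] xy; rewrite !in_itv/= => /andP[x1 x2] /andP[y1 y2].
  have := cauchy_sum_decr ws s0 ps x1 xy y2.
  move: rx ry; rewrite !ltr_norml => /andP[_ rx] /andP[ry _].
  have q0 : 0 < p.2 / mass s by rewrite divr_gt0.
  have E : p.2 / (8 * mass s) = p.2 / mass s / 8 by field; rewrite gt_eqF.
  rewrite E in rx ry => h.
  have : p.2 / mass s * ((y - x) / (p.1.2 - p.1.1)) <= p.2 / mass s * (1 / 4) by lra.
  rewrite ler_pM2l// ler_pdivrMr//; lra.
have cov : `]p.1.1, p.1.2[%classic `<=` G `|` B.
  move=> x Jx; have [h|h] := leP (p.2 / (8 * mass s)) `|cauchy_sum s x|; [left|right]; split => //.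
have := le_trans (le_mu cov) (mu_setU _ _).
rewrite lebesgue_measure_itv/= lte_fin ab -EFinB => h.
have : ((p.1.2 - p.1.1)%:E <= mu G + ((p.1.2 - p.1.1) / 4)%:E)%E.
  by apply: (le_trans h); apply: leeD.
rewrite -leeBlDr// -EFinB; apply: le_trans; rewrite lee_fin; lra.
Qed.

(** The threshold goes from [8] to [16] because [|r| >= 2 y] with [y >= 1] gives [|1 - r| >= y]. The
    factor [3 / 4] is the good portion of the cell. *)
Lemma cell_lower s p : wf s -> inI s -> (forall p, p \in s -> 0 < p.2) -> p \in s ->
  ((3 / 4 * (p.2 * (p.1.2 - p.1.1) * lnp (p.2 / (16 * mass s))))%:E <=
   \int[mu]_(x in I11) (p.2 * cellf p.1 x * `|ln `|1 - cauchy_sum s x| |)%R%:E)%E.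
Proof.
move=> ws si s0 ps; have m0 : 0 < mass s by apply: mass_gt0 => //; case: (s) ps.
have ab := wf_lt ws ps; have p0 := s0 _ ps.
have [mG G34] := good_cell ws si s0 ps; set G := (_ `&` _) in mG G34.
have /andP[pa pb] := allP si _ ps.
have GI : G `<=` I11.
  by move=> x [/=]; rewrite /I11/= !in_itv/= => /andP[h1 h2] _; apply/andP; split; lra.
set L := lnp _; have L0 : 0 <= L by exact: lnp_ge0.
apply: (@le_trans _ _ (\int[mu]_(x in I11) ((p.2 * L)%:E * (\1_G x)%:E))%E).
  rewrite ge0_integralZl//; last 3 first.
  - exact: measurable_I11.
  - by apply/measurable_EFinP; exact: measurable_indic.
  - by rewrite lee_fin mulr_ge0// ltW.
  have -> : (\int[mu]_(x in I11) (\1_G x)%:E = mu G)%E.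
    rewrite (@integral_indic _ (measurableTypeR R) R mu I11 (@measurable_I11 R))//.
    by congr (mu _); apply/setIidPl.
  apply: (@le_trans _ _ ((p.2 * L)%:E * (3 / 4 * (p.1.2 - p.1.1))%:E)%E).
    by rewrite -EFinM lee_fin le_eqVlt; apply/orP; left; apply/eqP; ring.
  by apply: lee_wpmul2l => //; rewrite lee_fin mulr_ge0// ltW.
apply: ge0_le_integral => //.
- exact: measurable_I11.
- by move=> x _; rewrite -EFinM lee_fin !mulr_ge0 ?(ltW p0)//.
- by apply: emeasurable_funM; [exact: measurable_cst|apply/measurable_EFinP; exact: measurable_indic].
- apply/measurable_EFinP; apply: measurable_funM; first by apply: measurable_funM => //; exact: measurable_cellf.
  apply: measurableT_comp => //; apply: measurableT_comp => //; apply: measurableT_comp => //.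
  by apply: measurable_funB => //; exact: measurable_cauchy_sum.
- move=> x Ix; rewrite -EFinM lee_fin indicE; have [xG|xG] := boolP (x \in G); last first.
    by rewrite mulr0 !mulr_ge0 ?(ltW p0).
  move: xG; rewrite inE => -[/=]; rewrite in_itv/= => /andP[x1 x2] hr.
  rewrite /cellf x1 (ltW x2) !mulr1; apply: ler_wpM2l; first exact: ltW.
  rewrite /L /lnp ge_max normr_ge0/=.
  have q0 : 0 < p.2 / (16 * mass s) by rewrite divr_gt0// mulr_gt0.
  have [h|h] := leP (p.2 / (16 * mass s)) 1; first by apply: (le_trans (ln_le0 h)).
  apply: le_trans (ler_norm _).
  have E : p.2 / (8 * mass s) = 2 * (p.2 / (16 * mass s)) by field; rewrite gt_eqF.
  have : p.2 / (16 * mass s) <= `|1 - cauchy_sum s x|.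
    have := ler_normD (1 - cauchy_sum s x) (-1); rewrite addrAC subrr add0r !normrN normr1.
    by rewrite E in hr; lra.
  by move=> h3; rewrite ler_ln ?posrE//; exact: lt_le_trans h3.
Qed.

Lemma integral_inv_sq_le (lam : R) : 0 < lam ->
  (\int[mu]_(l in `]0%R, +oo[) (if (l <= lam)%R then 1 else (lam / l) ^+ 2)%:E <= (2 * lam)%:E)%E.
Proof.
move=> l0; pose Q (l : R) : R := if l <= lam then 1 else (lam / l) ^+ 2.
have Q0 l : 0 <= Q l by rewrite /Q; case: ifP => // _; rewrite sqr_ge0.
have mQ (D : set R) : measurable_fun D (fun l => (Q l)%:E).
  apply: measurable_funTS; apply/measurable_EFinP; apply: measurable_fun_ifT => //.
    by apply: measurable_fun_ler.
  by apply: measurable_funX; apply: measurable_funM => //; exact: measurable_inv.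
have -> : `]0%R, +oo[%classic = `]0%R, lam[%classic `|` `[lam, +oo[%classic :> set R.
  apply/seteqP; split => x /=; rewrite !in_itv/= ?andbT.
    by move=> x0; have [h|h] := ltP x lam; [left|right]; rewrite ?x0 ?h.
  by case=> [/andP[]//|]; exact: lt_le_trans.
rewrite ge0_integral_setU//=; last 3 first.
- exact: mQ.
- by move=> l _; rewrite lee_fin; exact: Q0.
- by apply/disj_setPS => x [] /=; rewrite !in_itv/= andbT => /andP[h1 h2] h3; lra.
rewrite (_ : (2 * lam)%:E = (lam%:E + lam%:E)%E); last by rewrite -EFinD; congr _%:E; ring.
apply: leeD.
  apply: (@le_trans _ _ (\int[mu]_(l in `]0%R, lam[) cst 1%E l)%E).
    apply: ge0_le_integral => //.
    - by move=> l _; rewrite lee_fin; exact: Q0.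
    - exact: mQ.
    - by move=> l; rewrite /= in_itv/= => /andP[_ /ltW ->].
  by rewrite integral_cst//= lebesgue_measure_itv/= lte_fin l0 mul1e -EFinB subr0.
have -> : `[lam, +oo[%classic = \bigcup_n `[lam, lam + n%:R]%classic :> set R.
  apply/seteqP; split => x /=; rewrite ?in_itv/= ?andbT.
    move=> h; exists (Num.bound (x - lam)) => //=; rewrite in_itv/= h/=.
    by rewrite -lerBlDl ltW// archi_boundP// subr_ge0.
  by case=> n _ /=; rewrite in_itv/= => /andP[].
rewrite (eq_integral (fun l : measurableTypeR R => (lam ^+ 2 / (l : R) ^+ 2)%R%:E)); last first.
  move=> l /set_mem[n _ /=]; rewrite in_itv/= => /andP[h _]; case: ifPn => h2.
    have -> : l = lam by apply/eqP; rewrite eq_le h2.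
    by rewrite mulfV// expf_neq0// gt_eqF.
  by rewrite expr_div_n.
have cv : - (lam ^+ 2 / (lam + n%:R)) @[n --> \oo] --> (0 : R).
  apply/cvgrPdist_le => e e0; exists (Num.bound (lam ^+ 2 / e)) => // n /= hn.
  rewrite sub0r opprK ger0_norm ?divr_ge0 ?sqr_ge0 ?addr_ge0 ?(ltW l0)//.
  rewrite ler_pdivrMr ?ltr_pwDl// -ler_pdivrMl// mulrC.
  apply: (le_trans (ltW (archi_boundP _))); first by rewrite divr_ge0 ?sqr_ge0 ?ltW.
  by apply: (@le_trans _ _ n%:R); rewrite ?ler_nat// lerDr ltW.
have pos n x : lam <= x <= lam + n%:R -> 0 < x by move=> /andP[h _]; exact: lt_le_trans h.
have F : (\int[mu]_(l in \bigcup_n `[lam, (lam + n%:R)%R]%classic) (lam ^+ 2 / (l : R) ^+ 2)%R%:E = (0 - - lam)%:E)%E; last first.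
  by rewrite F sub0r opprK.
apply: (@FTC_ge0_bigcup R (fun l => lam ^+ 2 / l ^+ 2) (fun l => - (lam ^+ 2 / l)) (fun=> lam) (fun n => lam + n%:R) (- lam) 0).
- by [].
- by move=> m n mn; rewrite lerD2l ler_nat.
- by move=> n; rewrite lerDl.
- move=> n x /pos x0; have xn : x != 0 by rewrite gt_eqF.
  have h := @is_deriveV R id x 1 1 xn (is_derive_id _ _).
  have h2 := is_deriveZ (- lam ^+ 2) h.
  have -> : (fun l => - (lam ^+ 2 / l)) = (- lam ^+ 2) \*: (fun y : R => (id y)^-1).
    by apply/funext => y; rewrite /= -mulNr.
  by apply: (is_derive_eq h2); rewrite /GRing.scale/=; field.
- move=> n x /pos x0; apply: cvgM; first exact: cvg_cst.
  by apply: cvgV; [rewrite expf_neq0// gt_eqF|exact: exprn_continuous].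
- by move=> n x _; rewrite divr_ge0 ?sqr_ge0.
- rewrite (_ : (fun _ => _) = cst (- lam)); first exact: cvg_cst.
  by apply/funext => n; rewrite expr2 mulfK// gt_eqF.
- exact: cv.
Qed.

(** [Wf] is linearised by [Wf_affine] with [q = Q l] depending on the level: [Q] has integral at
    most twice the mass, and [|ln (Q l)|] is at most [2 * lnp (p.2 / mass s)] for every cell that
    reaches above [l]. Replacing [mass s] by [16 * mass s] costs [ln 16 <= 4], so the constant is
    [2 + 3 + 8 = 13]. *)
Lemma choquet_step s : wf s -> inI s -> (forall p, p \in s -> 0 < p.2) -> s != [::] ->
  (Phi (stepf s) <= (13 * mass s +
    2 * \sum_(p <- s) p.2 * (p.1.2 - p.1.1) * lnp (p.2 / (16 * mass s)))%R%:E)%E.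
Proof.
move=> ws si s0 sn; have m0 := mass_gt0 ws s0 sn; set lam := mass s in m0 *.
have E : lam = \sum_(p <- s) p.2 * (p.1.2 - p.1.1).
  by rewrite /lam /mass; apply: eq_big_seq => p ps; rewrite gtr0_norm// s0.
clearbody lam.
have s0' p : p \in s -> 0 <= p.2 by move=> /s0/ltW.
pose w p : R := (p.1.2 - p.1.1) * (3 + 2 * lnp (p.2 / lam)).
have [iw ew] := level_integral w s0'.
pose Q (l : R) : R := if l <= lam then 1 else (lam / l) ^+ 2.
have Q0 l : 0 <= Q l by rewrite /Q; case: ifP => // _; rewrite sqr_ge0.
have mQ (D : set R) : measurable_fun D (fun l => (Q l)%:E).
  apply: measurable_funTS; apply/measurable_EFinP; apply: measurable_fun_ifT => //.
    by apply: measurable_fun_ler.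
  by apply: measurable_funX; apply: measurable_funM => //; exact: measurable_inv.
have w0 p : p \in s -> 0 <= w p.
  by move=> /(wf_lt ws) h; rewrite mulr_ge0 ?subr_ge0 ?addr_ge0 ?mulr_ge0 ?lnp_ge0// ltW.
have S0 l : 0 <= \sum_(p <- s) (l < p.2)%R%:R * w p.
  by rewrite big_seq sumr_ge0// => p ps; rewrite mulr_ge0// w0.
have ln21 : ln 2 <= 1 :> R.
  by have := @le_ln1Dx R 1; rewrite (_ : 1 + 1 = 2) => [h|//]; apply: h; lra.
have mS (D : set (measurableTypeR R)) : measurable_fun D (fun l => (\sum_(p <- s) (l < p.2)%R%:R * w p)%:E).
  apply: measurable_funTS; apply/measurable_EFinP; apply: measurable_sum => p; apply: measurable_funM => //.
  by apply/measurable_EFinP; apply: (@measurable_fun_lt_indic _ (measurableTypeR R)).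
apply: (@le_trans _ _ (\int[mu]_(l in `]0%R, +oo[) ((Q l)%:E + (\sum_(p <- s) (l < p.2)%R%:R * w p)%:E))%E).
  apply: ge0_le_integral => //.
  - by move=> l _; rewrite lee_fin Wf_dist_ge0.
  - exact: measurable_Wf_dist.
  - by apply: emeasurable_funD; [exact: mQ|exact: mS].
  - move=> l; rewrite /= in_itv/= andbT => l0; rewrite -EFinD lee_fin.
    have Qp : 0 < Q l by rewrite /Q; case: ifP => // _; rewrite exprn_gt0// divr_gt0.
    apply: (le_trans (Wf_affine (dist_ge0 _ _) Qp)); apply: lerD => //.
    rewrite -(level_sum ws si s0' (ltW l0)) /level big_map big_filter mulr_sumr.
    rewrite big_mkcond/= big_seq [leRHS]big_seq; apply: ler_sum => p ps.
    have d0 : 0 <= p.1.2 - p.1.1 by rewrite subr_ge0 ltW// (wf_lt ws).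
    case: ifPn => lp; last by rewrite mul0r.
    rewrite mul1r /w mulrC; apply: ler_wpM2l => //.
    have : `|ln (Q l)| <= 2 * lnp (p.2 / lam).
      rewrite /Q; case: ifPn => h; first by rewrite ln1 normr0 mulr_ge0 ?lnp_ge0.
      rewrite -ltNge in h; rewrite lnXn ?divr_gt0// normrMn mulr2n.
      suff : `|ln (lam / l)| <= lnp (p.2 / lam) by lra.
      have h1 : lam / l <= 1 by rewrite ler_pdivrMr// mul1r ltW.
      rewrite ler0_norm ?ln_le0// -lnV ?posrE ?divr_gt0// invf_div /lnp le_max; apply/orP; right.
      by rewrite ler_ln ?posrE ?divr_gt0 ?s0// ler_pM2r ?invr_gt0// ltW.
    lra.
have n1 (l : R) : `]0%R, +oo[%classic l -> (0 <= (Q l)%:E)%E by rewrite lee_fin Q0.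
have n2 (l : R) : `]0%R, +oo[%classic l -> (0 <= (\sum_(p <- s) (l < p.2)%R%:R * w p)%:E)%E by rewrite lee_fin S0.
rewrite (ge0_integralD mu _ n1 (mQ _) n2 (mS _))//.
rewrite ew; apply: (@le_trans _ _ ((2 * lam)%:E + (\sum_(p <- s) p.2 * w p)%:E)%E).
  by apply: leeD => //; exact: integral_inv_sq_le.
rewrite -EFinD lee_fin.
have ln16 : ln 16 <= 4 :> R.
  rewrite (_ : 16 = 2 ^+ 4 :> R); last by rewrite -natrX.
  by rewrite lnXn//; move: ln21; set L := ln 2 => hL; rewrite -(mulr_natl L 4); lra.
have lnpM y : 0 < y -> lnp (y / lam) <= 4 + lnp (y / (16 * lam)).
  move=> y0; rewrite {1}/lnp ge_max addr_ge0 ?lnp_ge0//=.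
  have -> : y / lam = 16 * (y / (16 * lam)) by field; rewrite gt_eqF.
  rewrite lnM ?posrE ?divr_gt0 ?mulr_gt0//; apply: lerD => //.
  by rewrite /lnp le_max lexx orbT.
have -> : 13 * lam = 2 * lam + 11 * lam by ring.
have -> : 11 * lam = \sum_(p <- s) 11 * (p.2 * (p.1.2 - p.1.1)) by rewrite E mulr_sumr.
rewrite -addrA lerD2l mulr_sumr -big_split/= big_seq [leRHS]big_seq.
apply: ler_sum => p ps; have d0 : 0 <= p.2 * (p.1.2 - p.1.1).
  by rewrite mulr_ge0 ?s0'// subr_ge0 ltW// (wf_lt ws).
have -> : p.2 * w p = p.2 * (p.1.2 - p.1.1) * (3 + 2 * lnp (p.2 / lam)) by rewrite /w mulrA.
have -> : 11 * (p.2 * (p.1.2 - p.1.1)) + 2 * (p.2 * (p.1.2 - p.1.1) * lnp (p.2 / (16 * lam))) =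
  p.2 * (p.1.2 - p.1.1) * (11 + 2 * lnp (p.2 / (16 * lam))) by ring.
by apply: ler_wpM2l => //; have := lnpM _ (s0 _ ps); lra.
Qed.

Lemma step_lower s M N : wf s -> inI s -> (forall p, p \in s -> 0 < p.2 <= M) -> s != [::] ->
  hilb_bound (stepf s) N -> (Phi (stepf s) <= (200 * N)%:E)%E.
Proof.
move=> ws si s0M sn hN.
have s0 p : p \in s -> 0 < p.2 by move=> /s0M/andP[].
have m0 := mass_gt0 ws s0 sn.
have M0 : 0 < M.
  have [p ps] : exists p, p \in s by case: (s) sn => // p s' _; exists p; exact: mem_head.
  by have /andP[] := s0M _ ps; exact: lt_le_trans.
have gM x : I11 x -> 0 <= stepf s x <= M.
  move=> _; have [[p ps xp]|/forall2NP H] := pselect (exists2 p : R * R * R, p \in s & p.1.1 < x <= p.1.2).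
    by rewrite (stepf_in ws ps xp); have /andP[/ltW -> ->] := s0M _ ps.
  rewrite stepf_out; last by move=> p ps; have [//|/negP/negbTE] := H p.
  by rewrite lexx ltW.
have mg := @measurable_stepf R s setT.
have eb := end_bound mg M0 gM hN.
have ml : measurable_fun setT (fun x => ln `|1 - x| : R).
  by apply: measurableT_comp => //; apply: measurableT_comp => //; apply: measurable_funB.
have me : measurable_fun setT (fun x => 1 + `|ln `|1 - x| | : R).
  by apply: measurable_funD => //; apply: measurableT_comp.
have mge : measurable_fun setT (fun x => stepf s x * (1 + `|ln `|1 - x| |)) by exact: measurable_funM.
have lamN : mass s <= 8 * N.
  rewrite -lee_fin -nrm_stepf_inI//; apply: le_trans eb; apply: nrm_le => //.
  move=> x _; rewrite normrM ler_peMr// ger0_norm ?addr_ge0// lerDl//.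
have [phi [wp pI p1 hphi]] := poles_intervals ws si s0 sn.
have tb := test_bound mg M0 gM hN (all_cell_ok wp pI) (stepf1_le1 wp p1).
have mF : measurable_fun setT (fun x => ln `|1 - cauchy_sum s x| : R).
  apply: measurableT_comp => //; apply: measurableT_comp => //.
  by apply: measurable_funB => //; exact: measurable_cauchy_sum.
have up : (nrm (fun x => stepf s x * ln `|1 - cauchy_sum s x|)%R <= (17 * N)%:E)%E.
  have m1 : measurable_fun setT (fun x => `|stepf s x * stepH phi x|).
    by apply: measurableT_comp => //; apply: measurable_funM => //; exact: measurable_stepH.
  have m2 : measurable_fun setT (fun x => 2 * (stepf s x * (1 + `|ln `|1 - x| |))).
    by exact: measurable_funM.
  apply: (@le_trans _ _ (nrm (fun x => `|stepf s x * stepH phi x| + 2 * (stepf s x * (1 + `|ln `|1 - x| |)))%R)).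
    apply: nrm_le_ae; [exact: measurable_funM|exact: measurable_funD|].
    exists [set x | x \in [seq p.1.1 | p <- s]]; first exact: mu_seq0.
    move=> x Ix /= /negP xs; have /andP[g0 _] := gM _ Ix.
    rewrite normrM [leRHS]ger0_norm; last by rewrite addr_ge0// !mulr_ge0// addr_ge0.
    rewrite normrM (ger0_norm g0) mulrCA -mulrDr; apply: ler_wpM2l => //.
    by apply: (le_trans (hphi _ Ix xs)); rewrite lerD2l; have := normr_ge0 (ln `|1 - x|); lra.
  apply: (le_trans (nrm_triangle m1 m2)); rewrite nrmZ// normr_nat.
  rewrite (_ : nrm (fun x => `|stepf s x * stepH phi x|) = nrm (fun x => stepf s x * stepH phi x)); last first.
    by apply: eq_integral => x _; rewrite normr_id.
  apply: (@le_trans _ _ (N%:E + 2%:E * (8 * N)%:E)%E).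
    by apply: leeD => //; apply: lee_wpmul2l.
  by rewrite -EFinM -EFinD lee_fin; lra.
have lo : ((3 / 4 * \sum_(p <- s) p.2 * (p.1.2 - p.1.1) * lnp (p.2 / (16 * mass s)))%:E <=
    nrm (fun x => stepf s x * ln `|1 - cauchy_sum s x|)%R)%E.
  have -> : nrm (fun x => stepf s x * ln `|1 - cauchy_sum s x|) =
    (\sum_(p <- s) \int[mu]_(x in I11) (Num.max p.2 0 * cellf p.1 x * `|ln `|1 - cauchy_sum s x| |)%R%:E)%E.
    rewrite -ge0_integral_sum//.
    - apply: eq_integral => x xI; have /andP[g0 _] := gM _ (set_mem xI).
      rewrite sumEFin normrM (ger0_norm g0) /stepf mulr_suml; congr _%:E.
      by apply: eq_big_seq => p ps; rewrite (max_idPl (ltW (s0 _ ps))).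
    - exact: measurable_I11.
    - move=> p; apply/measurable_EFinP; apply: measurable_funTS; apply: measurable_funM.
        by apply: measurable_funM => //; exact: measurable_cellf.
      exact: measurableT_comp.
    - by move=> p x _; rewrite lee_fin !mulr_ge0// le_max lexx orbT.
  rewrite mulr_sumr -sumEFin big_seq [leRHS]big_seq; apply: lee_sum => p ps.
  by rewrite (max_idPl (ltW (s0 _ ps))); exact: cell_lower.
have := le_trans lo up; rewrite lee_fin => S.
(* The mass is at most [8 N] and the logarithmic sum at most [(4/3) * 17 N], so the total is below
   [104 N + 46 N]. *)
apply: (le_trans (choquet_step ws si s0 sn)); rewrite lee_fin.
have N0 : 0 <= N by have := ltW m0; lra.
lra.
Qed.

End LowerStep.

(** * The lower bound for measurable functions *)

Section Lower.
Variable R : realType.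
Local Notation mu := (@lebesgue_measure R).
Implicit Types (s : seq (R * R * R)) (g h u v w : R -> R) (x y t M N e : R).

(** Only bounded competitors are tested, because these are known in advance to lie in L log L, where
    an extension of the operator agrees with it. *)
Definition weak_bound g N := forall h v M, measurable_fun setT h ->
  (forall x, I11 x -> `|h x| <= g x) -> (forall x, I11 x -> `|h x| <= M) ->
  is_hilb h v -> (nrm v <= N%:E)%E.

Lemma weak_bound_bounded g N M : (forall x, I11 x -> g x <= M) -> weak_bound g N -> hilb_bound g N.
Proof.
move=> gM gN h v mh hg hv; apply: (gN h v M) => // x Ix.
exact: le_trans (hg _ Ix) (gM _ Ix).
Qed.

Lemma stepf_filter s x : stepf [seq p <- s | p.2 != 0] x = stepf s x.
Proof.
rewrite /stepf big_filter [LHS]big_mkcond/=; apply: eq_bigr => p _.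
by case: eqP => //= ->; rewrite mul0r.
Qed.

Lemma wf_filter (P : pred (R * R * R)) s : wf s -> wf [seq p <- s | P p].
Proof.
rewrite /wf /intervals => /andP[a1 a2]; apply/andP; split.
  by apply/allP => _ /mapP[q + ->]; rewrite mem_filter => /andP[_ qs]; apply: (allP a1); apply: map_f.
by move: a2; rewrite !pairwise_map; exact: pairwise_filter.
Qed.

Lemma clamp_measurable2 g h : measurable_fun setT g -> measurable_fun setT h ->
  measurable_fun setT (fun x => clamp (- g x) (g x) (h x)).
Proof.
move=> mg mh; apply: measurable_maxr; first exact: measurableT_comp.
exact: measurable_minr.
Qed.

Lemma L1I_fin_Phi h M : 0 < M -> measurable_fun setT h -> (forall x, I11 x -> `|h x| <= M) ->
  (Phi (fun x => `|h x|%R) < +oo)%E.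
Proof.
move=> M0 mh hM; apply: (le_lt_trans (Phi_small mh M0 hM ltr01)).
have Lh := bounded_L1I mh (ltW M0) hM.
by rewrite lte_add_pinfty ?ltry// lte_mul_pinfty ?lee_fin ?addr_ge0 ?ln_ge0 ?ler1n//; exact: Lh.2.
Qed.

Lemma clamp_close (a b c : R) : 0 <= a -> `|b| <= c -> `|b - clamp (- a) a b| <= `|a - c|.
Proof.
move=> a0 bc; have [_ [_ [h _]]] := clamp_norm b a0.
have [/h ->|] := leP `|b| a; first by rewrite subrr normr0.
move=> ab; have c1 := ler_norm (c - a); rewrite distrC in c1.
apply: le_trans (le_trans (lerB bc (lexx a)) c1).
rewrite /clamp; have [b0|b0] := leP 0 b.
  rewrite ger0_norm// in ab bc *; rewrite (min_idPr (ltW ab)) (max_idPr _); last by lra.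
  by rewrite ger0_norm// subr_ge0 ltW.
rewrite ltr0_norm// in ab *; rewrite (min_idPl _); last by lra.
by rewrite (max_idPl _) ?opprK ?ler0_norm//; lra.
Qed.

(** A competitor [h] for the step approximation is clamped into [[- g, g]]. What is cut off is at
    most [|g - stepf s0|], with [Phi] at most [q], and costs [10 q] by [hilb_upper]. The total error
    [200 * 10 q + q] is below [e] by the choice of [q]. Cells of value 0 are removed, [step_lower]
    being about positive values. *)
Lemma lower_bounded g N M : measurable_fun setT g -> 0 < M -> (forall x, I11 x -> 0 <= g x <= M) ->
  hilb_bound g N -> (Phi (fun x => `|g x|%R) <= (200 * N)%:E)%E.
Proof.
move=> mg M0 gM hN.
have gM' x : I11 x -> `|g x| <= M by move=> /gM/andP[g0 g1]; rewrite ger0_norm.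
have Lg := bounded_L1I mg (ltW M0) gM'.
have N0 : 0 <= N.
  have L0 : L1I (fun=> 0 : R).
    by apply: (@bounded_L1I R _ M) => //; [exact: ltW|move=> x _; rewrite normr0 ltW].
  have [v hv] := is_hilb_exists L0.
  rewrite -lee_fin; apply: le_trans (nrm_ge0 v) _; apply: (hN _ _ _ _ hv); first exact: measurable_cst.
  move=> x /gM/andP[g0 _].
  by rewrite normr0.
apply/lee_addgt0Pr => e e0.
pose q := e / (10 * 201); have q0 : 0 < q := divr_gt0 e0 (mulr_gt0 (ltr0Sn R 9) (ltr0Sn R 200)).
have /choice[s sP] : forall n, exists s, [/\ [/\ wf s, narrow s & inI s],
   forall p, p \in s -> 0 <= p.2 <= M & (nrm (fun x => g x - stepf s x)%R <= (2 ^- n)%:E)%E].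
  move=> n; have p2 : 0 < 2 ^- n :> R by rewrite invr_gt0 exprn_gt0.
  by apply: step_approx_bounded => //; exact: ltW.
have sM n x : 0 <= stepf (s n) x <= M.
  have [[ws ns si] sv _] := sP n.
  have [[p ps xp]|/forall2NP H] := pselect (exists2 p : R * R * R, p \in s n & p.1.1 < x <= p.1.2).
    by rewrite (stepf_in ws ps xp); exact: sv.
  rewrite stepf_out; last by move=> p ps; have [//|/negP/negbTE] := H p.
  by rewrite lexx ltW.
have mw n : measurable_fun setT (fun x => g x - stepf (s n) x).
  by apply: measurable_funB => //; exact: measurable_stepf.
have wM n x : I11 x -> `|g x - stepf (s n) x| <= M.
  by move=> Ix; rewrite ler_norml; have := gM _ Ix; have := sM n x; lra.
have cw : nrm (fun x => g x - stepf (s n) x) @[n --> \oo] --> 0%E.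
  apply: cvge0_ge => [n|r r0]; first exact: nrm_ge0.
  have /cvgrPdist_le/(_ _ r0)[K _ H] := @pow2_cvg0 R; exists K => n /= /H hn.
  have [_ _ h] := sP n; apply: (le_trans h); rewrite lee_fin; apply: le_trans hn.
  by rewrite sub0r normrN ler_norm.
have [n0 /(_ n0 (leqnn _)) hn] := cvge0_le (Phi_small_cvg M0 mw wM cw) q0.
have := sP n0; set s0 := s n0 => -[[ws ns si] sv _].
pose s1 := [seq p <- s0 | p.2 != 0].
have E : stepf s1 = stepf s0 by apply/funext => x; exact: stepf_filter.
have PhiS : (Phi (stepf s1) <= (200 * (N + 10 * q))%:E)%E.
  have [z|nz] := eqVneq s1 [::].
    rewrite z /Phi integral0_eq.
      by rewrite lee_fin; move: (ltW q0) => ?; lra.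
    move=> l; rewrite /= in_itv/= andbT => l0; rewrite dist_gt ?Wf0// => x _.
    by rewrite /stepf big_nil ltW.
  apply: (@step_lower R s1 M) => //.
  - exact: wf_filter.
  - by apply/allP => p; rewrite mem_filter => /andP[_]; exact: (allP si).
  - by move=> p; rewrite mem_filter => /andP[p0 /sv/andP[p1 ->]]; rewrite lt_neqAle eq_sym p0 p1.
  move=> h v mh hg hv; pose h' x := clamp (- g x) (g x) (h x).
  have mh' : measurable_fun setT h' by exact: clamp_measurable2.
  have h'g x : I11 x -> `|h' x| <= g x.
    by move=> Ix; have /andP[g0 _] := gM _ Ix; have [] := clamp_norm (h x) g0.
  have hM x : I11 x -> `|h x| <= M.
    by move=> Ix; apply: (le_trans (hg _ Ix)); rewrite E; have /andP[] := sM n0 x.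
  have Lh := bounded_L1I mh (ltW M0) hM.
  have Lh' : L1I h'.
    by apply: (bounded_L1I mh' (ltW M0)) => x Ix; apply: (le_trans (h'g _ Ix)); have /andP[] := gM _ Ix.
  have [v' hv'] := is_hilb_exists Lh'.
  have b1 := hN _ _ mh' h'g hv'.
  have hd := is_hilb_sub Lh Lh' hv hv'.
  have b2 := hilb_upper (L1I_sub Lh Lh') hd.
  have mv' := hv'.1; have md := hd.1.
  have := nrm_triangle mv' md; rewrite (_ : (fun x => v' x + (v x - v' x)) = v); last first.
    by apply/funext => x; rewrite addrC subrK.
  move=> /le_trans; apply; rewrite EFinD; apply: leeD => //; apply: (le_trans b2).
  rewrite EFinM; apply: lee_wpmul2l; first by rewrite lee_fin ler0n.
  apply: le_trans hn; apply: Phi_mono => x Ix.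
  have /andP[g0 _] := gM _ Ix; have := hg _ Ix; rewrite E.
  exact: clamp_close.
have m1 : measurable_fun setT (fun x => `|stepf s0 x|) by apply: measurableT_comp => //; exact: measurable_stepf.
have m2 : measurable_fun setT (fun x => `|g x - stepf s0 x|) by apply: measurableT_comp => //; exact: mw.
have P2 := Phi_add m1 m2 (fun x => normr_ge0 _) (fun x => normr_ge0 _).
have P1 : (Phi (fun x => `|g x|%R) <= Phi (fun x => `|stepf s0 x| + `|g x - stepf s0 x|)%R)%E.
  apply: Phi_mono => x _; have := ler_normD (stepf s0 x) (g x - stepf s0 x).
  by rewrite (addrC _ (g x - _)) subrK.
apply: (le_trans P1); apply: (le_trans P2).
apply: (@le_trans _ _ ((200 * (N + 10 * q))%:E + q%:E)%E).
  apply: leeD; last exact: hn.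
  apply: le_trans PhiS; apply: Phi_mono => x Ix; rewrite E.
  by have /andP[h0 _] := sM n0 x; rewrite ger0_norm.
by rewrite -!EFinD lee_fin /q; lra.
Qed.

Theorem lower_bound g N : measurable_fun setT g -> (forall x, 0 <= g x) ->
  weak_bound g N -> (Phi g <= (200 * N)%:E)%E.
Proof.
move=> mg g0 hN.
pose gn n x := Num.min (g x) n.+1%:R.
have mgn n : measurable_fun setT (gn n) by exact: measurable_minr.
apply: (@Phi_fatou R (fun n x => gn n x)) => //.
  apply: offnull_all => x _; apply/cvgrPdist_le => e e0.
  exists (Num.bound (g x)) => // n /= hn; rewrite /gn (min_idPl _) ?subrr ?normr0 ?(ltW e0)//.
  by apply: (le_trans (ltW (archi_boundP (g0 x)))); rewrite ler_nat (leq_trans hn).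
move=> n; have gnM x : I11 x -> 0 <= gn n x <= n.+1%:R.
  by move=> _; rewrite /gn le_min g0 ler0n/= ge_min lexx orbT.
have := @lower_bounded (gn n) N n.+1%:R (mgn n) (ltr0Sn _ _) gnM.
rewrite (_ : (fun x => `|gn n x|) = gn n); last first.
  by apply/funext => x; rewrite ger0_norm// /gn le_min g0 ler0n.
apply; apply: (@weak_bound_bounded _ N n.+1%:R) => [x _|h v M mh hg hM hv].
  by rewrite /gn ge_min lexx orbT.
apply: (hN h v M) => // x Ix; apply: (le_trans (hg _ Ix)).
by rewrite /gn ge_min lexx.
Qed.

End Lower.

(** * From finiteness to a uniform bound *)

Section GlidingHump.
Variable R : realType.
Local Notation mu := (@lebesgue_measure R).
Implicit Types (g h u v w x y : R -> R) (t M N e d : R).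

(** Lower semicontinuity restated: the functions whose transform has norm above [K] form an open set
    in [L1]. *)
Lemma hilb_lsc_ball x v (K : \bar R) : L1I x -> is_hilb x v -> (K < nrm v)%E ->
  exists2 d : R, 0 < d & forall y w, L1I y -> (nrm (fun t => y t - x t)%R <= d%:E)%E ->
    is_hilb y w -> (K < nrm w)%E.
Proof.
move=> Lx hx Kv; apply: contrapT => /forall2NP H.
have /choice[y yP] : forall n, exists y, exists w, [/\ L1I y, (nrm (fun t => y t - x t)%R <= (2 ^- n)%:E)%E,
    is_hilb y w & (nrm w <= K)%E].
  move=> n; have [/negP|] := H (2 ^- n); first by rewrite invr_gt0 exprn_gt0.
  move=> /existsNP[y /existsNP[w /not_implyP[Ly /not_implyP[yx /not_implyP[hy /negP]]]]].
  by rewrite -leNgt => wK; exists y, w.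
have /choice[w wP] : forall n, exists w, [/\ L1I (y n), (nrm (fun t => y n t - x t)%R <= (2 ^- n)%:E)%E,
    is_hilb (y n) w & (nrm w <= K)%E] by [].
suff : (nrm v <= K)%E by rewrite leNgt Kv.
apply: (@is_hilb_lsc R x v y w K Lx _ hx) => //.
- by move=> n; have [] := wP n.
- by move=> n; have [] := wP n.
- apply: cvge0_ge => [n|r r0]; first exact: nrm_ge0.
  have /cvgrPdist_le/(_ _ r0)[k _ h] := @pow2_cvg0 R; exists k => n /= /h hn.
  have [_ h1 _ _] := wP n.
  rewrite -nrmN (_ : (fun t => - (x t - y n t)) = (fun t => y n t - x t)); last by apply/funext => t; rewrite opprB.
  by apply: (le_trans h1); rewrite lee_fin; apply: le_trans hn; rewrite sub0r normrN ler_norm.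
- by move=> n; have [] := wP n.
Qed.

(** Without a uniform bound one builds nested [L1] balls such that transforms of functions in the
    [n]-th ball have norm at least [n]. The centres converge to a function dominated by [g] that
    lies in all the balls, so its transform has infinite norm. *)
Theorem gliding_hump g : L1I g -> (forall t, 0 <= g t) ->
  (forall h v, measurable_fun setT h -> (forall t, I11 t -> `|h t| <= g t) -> is_hilb h v -> (nrm v < +oo)%E) ->
  exists N, weak_bound g N.
Proof.
move=> Lg g0 H; apply: contrapT => /forallNP nb.
have big N : exists h v M, [/\ measurable_fun setT h, forall t, I11 t -> `|h t| <= g t,
    forall t, I11 t -> `|h t| <= M, is_hilb h v & (N%:E < nrm v)%E].
  have /existsNP[h /existsNP[v /existsNP[M]]] := nb N.
  move=> /not_implyP[mh /not_implyP[hg /not_implyP[hM /not_implyP[hv /negP]]]].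
  by rewrite -ltNge => Nv; exists h, v, M.
have Lle h : measurable_fun setT h -> (forall t, I11 t -> `|h t| <= g t) -> L1I h.
  move=> mh hg; apply: (L1I_le mh Lg) => t It; apply: (le_trans (hg _ It)).
  by rewrite ger0_norm.
(* The pointwise bound [(1 - 2^-n) g] reserves room for all later humps, so that the limit is still
   a competitor. *)
pose inv n (xd : (R -> R) * R) := [/\ measurable_fun setT xd.1,
  forall t, I11 t -> `|xd.1 t| <= (1 - 2 ^- n) * g t, 0 < xd.2 &
  forall y w, L1I y -> (nrm (fun t => y t - xd.1 t)%R <= xd.2%:E)%E -> is_hilb y w ->
    (n%:R%:E <= nrm w)%E].
pose stp n (a b : (R -> R) * R) := [/\ forall t, I11 t -> `|b.1 t - a.1 t| <= 2 ^- n.+1 * g t,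
  (nrm (fun t => b.1 t - a.1 t)%R <= (a.2 / 2)%:E)%E & b.2 <= a.2 / 2].
have step n xd : inv n xd -> exists xd', inv n.+1 xd' /\ stp n xd xd'.
  case: xd => x d [/= mx xg d0 _].
  have p2 k : 0 < 2 ^- k :> R by rewrite invr_gt0 exprn_gt0.
  have xg' t : I11 t -> `|x t| <= g t.
    by move=> It; apply: (le_trans (xg _ It)); rewrite ler_piMl// gerBl ltW.
  have Lx := Lle _ mx xg'.
  have [vx hx] := is_hilb_exists Lx.
  have vxf := H _ _ mx xg' hx.
  pose A := fine (nrm vx); have AE : nrm vx = A%:E by rewrite fineK// ge0_fin_numE ?nrm_ge0.
  have A0 : 0 <= A by rewrite fine_ge0// nrm_ge0.
  pose G := fine (nrm g); have GE : nrm g = G%:E by rewrite fineK// ge0_fin_numE ?nrm_ge0//; exact: Lg.2.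
  have G0 : 0 <= G by rewrite fine_ge0// nrm_ge0.
  (* The first entry respects the pointwise budget; the second moves the centre by at most [d / 2]
     in [L1]. Adding 1 to [G] covers the case [G = 0]. *)
  pose eta := Num.min (2 ^- n.+1) (d / 2 / (G + 1)).
  have eta0 : 0 < eta by rewrite lt_min p2/= !divr_gt0// ltr_wpDl.
  have eta1 : eta <= 2 ^- n.+1 by rewrite ge_min lexx.
  have eta2 : eta * G <= d / 2.
    apply: (@le_trans _ _ (d / 2 / (G + 1) * G)).
      by rewrite ler_wpM2r// ge_min lexx orbT.
    have -> : d / 2 / (G + 1) * G = d / 2 * (G / (G + 1)) by field; rewrite gt_eqF// ltr_wpDl.
    rewrite ler_piMr ?divr_ge0 ?(ltW d0)// ler_pdivrMr ?mul1r ?lerDl// ltr_wpDl//.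
  (* The scaled hump must outweigh the transform of the old centre: after subtracting [A], more than
     [n.+1] remains. *)
  have [h [vh [M [mh hg _ hh Nv]]]] := big ((n.+1%:R + A + 1) / eta).
  have Lh := Lle _ mh hg.
  pose x' t := x t + eta * h t.
  have mx' : measurable_fun setT x' by apply: measurable_funD => //; exact: measurable_funM.
  have x'x t : I11 t -> `|x' t - x t| <= 2 ^- n.+1 * g t.
    move=> It; rewrite /x' addrAC subrr add0r normrM (gtr0_norm eta0).
    by apply: ler_pM => //; [exact: ltW|exact: hg].
  have x'g t : I11 t -> `|x' t| <= (1 - 2 ^- n.+1) * g t.
    move=> It; have := ler_normD (x t) (x' t - x t); rewrite addrC subrK => h1.
    apply: (le_trans h1); apply: (le_trans (lerD (xg _ It) (x'x _ It))).
    rewrite -mulrDl; apply: ler_wpM2r => //.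
    by rewrite (exprS 2 n) invfM; lra.
  have Lx' : L1I x'.
    apply: Lle => // t It; apply: (le_trans (x'g _ It)); rewrite ler_piMl// gerBl ltW//.
  have hx' := is_hilb_add Lx (L1I_scale eta Lh) hx (is_hilb_scale eta Lh hh).
  have big' : (n.+1%:R%:E < nrm (fun t => vx t + eta * vh t)%R)%E.
    have t1 := @nrm_triangle R (fun t => vx t + eta * vh t) (fun t => - vx t) hx'.1 (measurableT_comp (@oppr_measurable R setT) hx.1).
    rewrite nrmN AE in t1.
    rewrite (_ : (fun t => vx t + eta * vh t + - vx t) = (fun t => eta * vh t)) in t1; last first.
      by apply/funext => t; rewrite addrAC subrr add0r.
    rewrite nrmZ in t1; last exact: hh.1.
    rewrite gtr0_norm// in t1.
    rewrite ltNge; apply/negP => le; move: (le_trans t1 (leeD2r A%:E le)).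
    rewrite leNgt => /negP; apply; rewrite -EFinD.
    apply: (@lt_le_trans _ _ (eta%:E * ((n.+1%:R + A + 1) / eta)%:E)%E).
      by rewrite -EFinM lte_fin mulrCA mulfV ?gt_eqF// mulr1 ltrDl.
    by apply: lee_wpmul2l; [rewrite lee_fin ltW|exact: ltW].
  have [d' d'0 hd'] := hilb_lsc_ball Lx' hx' big'.
  exists (x', Num.min d' (d / 2)); split; split => //=.
  - by rewrite lt_min d'0 divr_gt0.
  - move=> y w Ly yx hw; apply/ltW/(hd' y w Ly) => //.
    by apply: (le_trans yx); rewrite lee_fin ge_min lexx.
  - apply: (@le_trans _ _ (nrm (fun t => eta * g t)%R)).
      apply: nrm_le; [exact: measurable_funB|by apply: measurable_funM => //; exact: Lg.1|].
      move=> t It; rewrite /x' addrAC subrr add0r !normrM ler_wpM2l//.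
      by rewrite (ger0_norm (g0 t)) hg.
    rewrite nrmZ; last exact: Lg.1.
    by rewrite gtr0_norm// GE -EFinM lee_fin.
  - by rewrite ge_min lexx orbT.
have init : inv 0%N (fun=> 0, 1).
  split => //=.
    by move=> t It; rewrite normr0 expr0 invr1 subrr mul0r.
  by move=> y w _ _ _; exact: nrm_ge0.
have [X XP] : {X : nat -> (R -> R) * R | X 0%N = (fun=> 0, 1) /\ forall n, inv n (X n) /\ stp n (X n) (X n.+1)}.
  apply: cid.
  have /choice[F FP] : forall a : nat * ((R -> R) * R), exists b, inv a.1 a.2 -> inv a.1.+1 b /\ stp a.1 a.2 b.
    move=> [n a] /=; have [i|ni] := pselect (inv n a); last by exists a.
    by have [b hb] := step n a i; exists b.
  pose X := nat_rect (fun _ => ((R -> R) * R)%type) (fun=> 0, 1) (fun n a => F (n, a)).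
  have iX n : inv n (X n).
    elim: n => [//|n IH]; exact: (FP (n, X n) IH).1.
  by exists X; split => // n; split => //; exact: (FP (n, X n) (iX n)).2.
have [_ XI] := XP.
pose x n := (X n).1; pose d n := (X n).2.
have mx n : measurable_fun setT (x n) by have [[]] := XI n.
have xg n t : I11 t -> `|x n t| <= g t.
  move=> It; have [[_ h _ _] _] := XI n; apply: (le_trans (h _ It)).
  by rewrite ler_piMl// gerBl invr_ge0 exprn_ge0.
have xx n j t : I11 t -> `|x (n + j)%N t - x n t| <= (2 ^- n - 2 ^- (n + j)) * g t.
  move=> It; elim: j => [|j IH]; first by rewrite addn0 !subrr normr0 mul0r.
  rewrite addnS; have [_ [/(_ _ It) h _ _]] := XI (n + j)%N.
  have := ler_normD (x (n + j).+1 t - x (n + j)%N t) (x (n + j)%N t - x n t).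
  rewrite addrA subrK => /le_trans; apply; apply: (le_trans (lerD h IH)).
  rewrite -mulrDl; apply: ler_wpM2r => //.
  by rewrite (exprS 2 (n + j)) invfM; lra.
pose y t := fine (limn_esup (fun n => (x n t)%:E)).
have my : measurable_fun setT y.
  apply: measurableT_comp => //; apply: measurable_fun_limn_esup => n.
  exact/measurable_EFinP.
have cy t : I11 t -> x n t @[n --> \oo] --> y t.
  move=> It; have /cvg_ex[l cl] : cvgn (fun n => x n t).
    apply: cauchy_seq_cvg => e e0.
    have e1 : 0 < e / (g t + 1) by rewrite divr_gt0// ltr_wpDl.
    have /cvgrPdist_le/(_ _ e1)[n _ /(_ n (leqnn n))] := @pow2_cvg0 R.
    rewrite /= sub0r normrN ger0_norm ?invr_ge0 ?exprn_ge0// ler_pdivlMr ?ltr_wpDl// => hn.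
    exists n => m nm; rewrite distrC -(subnKC nm); apply: (le_lt_trans (xx _ _ _ It)).
    apply: lt_le_trans hn; apply: (@le_lt_trans _ _ (2 ^- n * g t)).
      by rewrite ler_wpM2r// gerBl invr_ge0 exprn_ge0.
    by rewrite ltr_pM2l ?invr_gt0 ?exprn_gt0// ltrDl.
  suff -> : y t = l by [].
  rewrite /y; suff /cvg_limn_einf_sup[_ ->] : (x n t)%:E @[n --> \oo] --> l%:E by [].
  by apply: cvg_EFin => //; near=> n.
have yg t : I11 t -> `|y t| <= g t.
  move=> It; have c : `|x n t| @[n --> \oo] --> `|y t| by apply: cvg_norm; exact: cy.
  by apply: (@cvg_le_near R _ _ _ _ _ _ c); apply: nearW => n; exact: xg.
have [v hv] := is_hilb_exists (Lle _ my yg).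
have vf := H _ _ my yg hv.
have ball n j : forall z : R -> R, measurable_fun setT z -> (nrm (fun t => z t - x (n + j)%N t)%R <= (d (n + j)%N)%:E)%E ->
    (nrm (fun t => z t - x n t)%R <= (d n)%:E)%E.
  elim: j => [|j IH] z mz; first by rewrite addn0.
  rewrite addnS => h; apply: IH => //; have [_ [_ h1 h2]] := XI (n + j)%N.
  have m1 : measurable_fun setT (fun t => z t - x (n + j).+1 t) by exact: measurable_funB.
  have m2 : measurable_fun setT (fun t => x (n + j).+1 t - x (n + j)%N t) by exact: measurable_funB.
  have := nrm_triangle m1 m2.
  rewrite (_ : (fun t => (z t - x (n + j).+1 t) + (x (n + j).+1 t - x (n + j)%N t)) = (fun t => z t - x (n + j)%N t)); last first.
    by apply/funext => t; rewrite addrA subrK.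
  move=> /le_trans; apply; apply: (le_trans (leeD h h1)).
  by rewrite -EFinD lee_fin /d [leRHS]splitr lerD2r.
have close n : (nrm (fun t => y t - x n t)%R <= (d n)%:E)%E.
  apply: (@nrm_fatou R (fun j t => x (n + j)%N t - x n t)) => //.
  - by move=> j; exact: measurable_funB.
  - exact: measurable_funB.
  - apply: offnull_all => t It; apply: cvgB; last exact: cvg_cst.
    by have := cy _ It; rewrite -(cvg_shiftn n); apply: cvg_trans; apply: near_eq_cvg; near=> k; rewrite /= addnC.
  - move=> j; apply: (@ball n j) => //.
    rewrite (_ : (fun t => _) = fun=> 0); last by apply/funext => t; rewrite subrr.
    rewrite /nrm integral0_eq => [|t _]; last by rewrite normr0.
    by have [[_ _ h _] _] := XI (n + j)%N; rewrite lee_fin ltW.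
have [k hk] : exists k : nat, (nrm v < k%:R%:E)%E.
  have vE : nrm v = (fine (nrm v))%:E by rewrite fineK// ge0_fin_numE ?nrm_ge0.
  exists (Num.bound (fine (nrm v))); rewrite {1}vE lte_fin; apply: archi_boundP.
  by apply: fine_ge0; exact: nrm_ge0.
have [[_ _ _ h] _] := XI k; have := h _ _ (Lle _ my yg) (close k) hv.
by rewrite leNgt hk.
Unshelve. all: by end_near. Qed.

End GlidingHump.

(** * Passing between Lebesgue and Borel measurability *)

Section Transfer.
Variable R : realType.
Local Notation mu := (@lebesgue_measure R).
Implicit Types (u w g : R -> R) (x t : R).

Lemma mu0_cara (Z : set R) : mu Z = 0%E -> measurable (Z : set (lebType R)).
Proof.
move=> Z0; apply: le_caratheodory_measurable => X.
have h1 : (((@wlength R idfun)^*)%mu (X `&` Z) <= 0)%E.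
  by rewrite -Z0; apply: (le_outer_measure ((@wlength R idfun)^*)%mu); exact: subIsetr.
apply: (le_trans (leeD2r _ h1)).
by rewrite add0e; apply: le_outer_measure; exact: subIsetl.
Qed.

Lemma borel_cara (A : set R) : measurable (A : set (measurableTypeR R)) ->
  measurable (A : set (lebType R)).
Proof. exact: sub_caratheodory. Qed.

Lemma ae_leb_mu0 (P : R -> Prop) : mu [set x | ~ P x] = 0%E -> {ae leb R, forall x, P x}.
Proof. by move=> h; exists [set x | ~ P x]; split => //; exact: mu0_cara. Qed.

Lemma aeI_offnull (P : R -> Prop) : aeI P <-> offnull P.
Proof.
split=> [[A [_ A0 AP]]|[Z Z0 ZP]].
  exists A => // t It nA; apply: contrapT => nP; apply: nA; apply: AP => /= h.
  by apply: nP; exact: h.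
apply: ae_leb_mu0; apply: mu_sub0 Z0 => t /= /not_implyP[It nP].
by apply: contrapT => nZ; apply: nP; exact: ZP.
Qed.

Lemma borel_lebe (D : set R) (g : R -> \bar R) : measurable (D : set (measurableTypeR R)) ->
  measurable_fun (D : set (measurableTypeR R)) g -> measurable_fun (D : set (lebType R)) g.
Proof. by move=> mD mg _ Y mY; apply: borel_cara; exact: mg. Qed.

Lemma cara_borel (E : set R) : measurable (E : set (lebType R)) ->
  exists2 X : set R, measurable (X : set (measurableTypeR R)) & exists2 Z : set R, mu Z = 0%E &
    forall x, ~ Z x -> (E x <-> X x).
Proof.
move=> mE; have : ((@wlength R idfun)^*)%mu.-cara.-measurable E by [].
rewrite -completed_caratheodory_measurable g_sigma_completed_algebra_genE.
move=> -[X mX] [N [B [mB B0 NB]] XNE]; exists X => //; exists B => // x nB.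
rewrite -XNE; split; last by left.
by case=> // /NB.
Qed.

(** Each set [g > q] with [q] rational agrees with a Borel set off a null set; off the union of
    these null sets, [g x] is the supremum of the [q] whose Borel set contains [x]. *)
Lemma borel_rep g : measurable_fun (I11 : set (lebType R)) g ->
  exists2 u, measurable_fun setT u & offnull (fun x => g x = u x).
Proof.
move=> mg; have mI : measurable (I11 : set (lebType R)) by apply: borel_cara; exact: measurable_I11.
pose q n : R := ratr (odflt 0 (unpickle n : option rat)).
have /choice[X XP] : forall n, exists X : set R, measurable (X : set (measurableTypeR R)) /\
    offnull (fun x => q n < g x <-> X x).
  move=> n; have mE : measurable ((I11 `&` [set x | q n < g x]) : set (lebType R)).
    have := mg mI _ (measurable_itv `]q n, +oo[).
    by congr measurable; apply/seteqP; split => x [Ix] /=; rewrite in_itv/= andbT.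
  have [Y mY [Z Z0 h]] := cara_borel mE; exists Y; split => //; exists Z => // x Ix /h <-.
  by split => [|[]].
pose f n x : \bar R := if x \in X n then (q n)%:E else -oo%E.
have mf n : measurable_fun setT (f n).
  apply: measurable_fun_ifT => //; have [mX _] := XP n.
  apply: (measurable_fun_bool true); rewrite setTI.
  rewrite (_ : _ @^-1` _ = X n)//; apply/seteqP; split => x /=; first by move/set_mem.
  by move=> h; apply/mem_set.
exists (fun x => fine (esups (f ^~ x) 0%N)).
  by apply: measurableT_comp => //; exact: measurable_fun_esups.
apply: offnull_imp (offnull_forall (fun n => (XP n).2)) => x Ix h.
suff -> : esups (f ^~ x) 0%N = (g x)%:E by [].
apply/eqP; rewrite eq_le; apply/andP; split.
  apply: ge_ereal_sup => _ [n _ <-]; rewrite /f; case: ifPn => [/set_mem/h/ltW|_]; first by rewrite lee_fin.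
  by rewrite leNye.
apply/lee_subgt0Pr => e e0; have ge : g x - e < g x by rewrite gtrBl.
have [r /=] := rat_in_itvoo ge; rewrite in_itv/= => /andP[r1 r2].
have qr : q (pickle r) = ratr r by rewrite /q pickleK.
apply: (@le_trans _ _ (ratr r)%:E); first by rewrite -EFinB lee_fin ltW.
apply: ereal_sup_ubound; exists (pickle r) => //; rewrite /f qr ifT//.
by apply/mem_set; apply/h; rewrite qr.
Qed.

(** The identity, seen as a map from the Lebesgue to the Borel sigma-algebra, pushes the completed
    measure forward to [lebesgue_measure]. *)
Lemma ge0_integral_leb (D : set R) (g : R -> \bar R) : measurable (D : set (measurableTypeR R)) ->
  measurable_fun (D : set (measurableTypeR R)) g -> (forall x, D x -> (0 <= g x)%E) ->
  (\int[leb R]_(x in (D : set (lebType R))) g x = \int[mu]_(x in D) g x)%E.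
Proof.
move=> mD mg g0.
have mid : measurable_fun (setT : set (lebType R)) (idfun : lebType R -> measurableTypeR R).
  by move=> _ Y mY; rewrite setTI; exact: borel_cara.
have := ge0_integral_pushforward mid (leb R) mD mg.
move=> <-; last by move=> x /set_mem; exact: g0.
by apply: eq_measure_integral => A mA AD.
Qed.

Lemma ge0_integral_leb_ae (D : set R) (F g : R -> R) : measurable (D : set (measurableTypeR R)) ->
  D `<=` I11 -> measurable_fun (I11 : set (lebType R)) F -> measurable_fun setT g ->
  (forall x, 0 <= F x) -> (forall x, 0 <= g x) -> offnull (fun x => F x = g x) ->
  (\int[leb R]_(x in (D : set (lebType R))) (F x)%:E = \int[mu]_(x in D) (g x)%:E)%E.
Proof.
move=> mD DI mF mg F0 g0 [Z Z0 Fg].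
have mgE : measurable_fun (D : set (measurableTypeR R)) (fun x => (g x)%:E : \bar R).
  by apply/measurable_EFinP; exact: measurable_funTS.
rewrite -(ge0_integral_leb mD mgE); last by move=> x _; rewrite lee_fin.
have mD' := borel_cara mD.
have mI : measurable (I11 : set (lebType R)) by apply: borel_cara; exact: measurable_I11.
apply: (@ge0_ae_eq_integral _ (lebType R) R (leb R) D _ _ mD').
- by apply/measurable_EFinP; exact: (measurable_funS mI DI mF).
- exact: borel_lebe.
- by move=> x _; rewrite lee_fin.
- by move=> x _; rewrite lee_fin.
- apply: ae_leb_mu0; apply: mu_sub0 Z0 => x /= /not_implyP[Dx nF].
  by apply: contrapT => nZ; apply: nF; rewrite Fg//; exact: DI.
Qed.

Lemma measurable_maxr0 d (T : measurableType d) (D : set T) (k : T -> R) :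
  measurable_fun D k -> measurable_fun D (fun z => Num.max (k z) 0).
Proof. by move=> mk; apply: measurable_maxr. Qed.

Lemma integral_leb_ae (D : set R) (F g : R -> R) : measurable (D : set (measurableTypeR R)) ->
  D `<=` I11 -> measurable_fun (I11 : set (lebType R)) F -> measurable_fun setT g ->
  offnull (fun x => F x = g x) ->
  Rintegral (leb R) (D : set (lebType R)) F = \int[mu]_(x in D) g x.
Proof.
move=> mD DI mF mg Fg; rewrite /Rintegral; congr fine.
rewrite integralE [RHS]integralE; congr (_ - _)%E.
  transitivity (\int[leb R]_(x in (D : set (lebType R))) (Num.max (F x) 0)%:E)%E.
    by apply: eq_integral => x _; rewrite funeposE -EFin_max.
  rewrite (@ge0_integral_leb_ae D _ (fun x => Num.max (g x) 0) mD DI).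
  - by apply: eq_integral => x _; rewrite funeposE -EFin_max.
  - exact: measurable_maxr0.
  - exact: measurable_maxr0.
  - by move=> x; rewrite le_max lexx orbT.
  - by move=> x; rewrite le_max lexx orbT.
  - by apply: offnull_imp Fg => x _ ->.
transitivity (\int[leb R]_(x in (D : set (lebType R))) (Num.max (- F x) 0)%:E)%E.
  by apply: eq_integral => x _; rewrite funenegE -EFinN -EFin_max.
rewrite (@ge0_integral_leb_ae D _ (fun x => Num.max (- g x) 0) mD DI).
- by apply: eq_integral => x _; rewrite funenegE -EFinN -EFin_max.
- by apply: measurable_maxr0; exact: measurableT_comp.
- by apply: measurable_maxr0; exact: measurableT_comp.
- by move=> x; rewrite le_max lexx orbT.
- by move=> x; rewrite le_max lexx orbT.
- by apply: offnull_imp Fg => x _ ->.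
Qed.

Lemma leb_measurable_ae g u : measurable_fun setT u -> offnull (fun x => g x = u x) ->
  measurable_fun (I11 : set (lebType R)) g.
Proof.
move=> mu_ [Z Z0 gu] _ Y mY.
have mI : measurable (I11 : set (lebType R)) by apply: borel_cara; exact: measurable_I11.
have mZ := mu0_cara Z0.
have mU : measurable ((I11 `&` u @^-1` Y) : set (lebType R)).
  by apply: borel_cara; apply: (measurable_funTS mu_) => //; exact: measurable_I11.
have mN : measurable ((I11 `&` g @^-1` Y `&` Z) : set (lebType R)).
  by apply: mu0_cara; apply: mu_sub0 Z0; exact: subIsetr.
rewrite (_ : _ `&` _ = ((I11 `&` u @^-1` Y) `&` ~` Z) `|` (I11 `&` g @^-1` Y `&` Z)); last first.
  apply/seteqP; split => x.
    move=> [Ix gY]; have [Zx|nZx] := pselect (Z x); [by right|left; split => //; split => //=].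
    by rewrite /= -gu.
  by case=> [[[Ix /= uY] nZ]|[[Ix gY] _]]; split => //=; rewrite gu.
by apply: measurableU => //; apply: measurableI => //; exact: measurableC.
Qed.

End Transfer.

(** * Complex-valued functions *)

Section ComplexBasics.
Variable R : realType.
Implicit Types (z w : C R) (x y : R).

Lemma reD z w : re (z + w) = re z + re w. Proof. by case: z; case: w. Qed.
Lemma imD z w : im (z + w) = im z + im w. Proof. by case: z; case: w. Qed.
Lemma reN z : re (- z) = - re z. Proof. by case: z. Qed.
Lemma imN z : im (- z) = - im z. Proof. by case: z. Qed.
Lemma reM z w : re (z * w) = re z * re w - im z * im w. Proof. by case: z; case: w. Qed.
Lemma imM z w : im (z * w) = re z * im w + im z * re w. Proof. by case: z; case: w. Qed.
Lemma re_real x : re (real_complex R x) = x. Proof. by []. Qed.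
Lemma im_real x : im (real_complex R x) = 0. Proof. by []. Qed.

Lemma eq_re_im z w : re z = re w -> im z = im w -> z = w.
Proof. by case: z => a b; case: w => c d /= -> ->. Qed.

Lemma real_complexV x : (real_complex R x)^-1 = real_complex R x^-1 :> C R.
Proof. by rewrite -fmorphV. Qed.

Lemma re_div_real z x : re (z / real_complex R x) = re z / x.
Proof. by rewrite real_complexV reM im_real re_real mulr0 subr0. Qed.

Lemma im_div_real z x : im (z / real_complex R x) = im z / x.
Proof. by rewrite real_complexV imM im_real re_real mulr0 add0r. Qed.

Lemma modulusE z : modulus z = Num.sqrt (re z ^+ 2 + im z ^+ 2).
Proof. by case: z. Qed.

Lemma modulus_ge0 z : 0 <= modulus z.
Proof. by rewrite modulusE sqrtr_ge0. Qed.

Lemma re_le_modulus z : `|re z| <= modulus z.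
Proof. by rewrite modulusE -sqrtr_sqr ler_sqrt ?lerDl ?sqr_ge0// addr_ge0 ?sqr_ge0. Qed.

Lemma im_le_modulus z : `|im z| <= modulus z.
Proof. by rewrite modulusE -sqrtr_sqr ler_sqrt ?lerDr ?sqr_ge0// addr_ge0 ?sqr_ge0. Qed.

Lemma modulus_le z : modulus z <= `|re z| + `|im z|.
Proof.
rewrite modulusE -(ger0_norm (addr_ge0 (normr_ge0 (re z)) (normr_ge0 (im z)))) -sqrtr_sqr.
rewrite ler_sqrt ?sqr_ge0// sqrrD !real_normK ?num_real// lerD2r lerDl.
by rewrite mulrn_wge0// mulr_ge0.
Qed.

Lemma modulusD z w : modulus (z + w) <= modulus z + modulus w.
Proof. exact: le_normcD. Qed.

Lemma modulusM z w : modulus (z * w) = modulus z * modulus w.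
Proof. exact: ComplexField.Normc.normcM. Qed.

Lemma modulusN z : modulus (- z) = modulus z.
Proof. by rewrite !modulusE reN imN !sqrrN. Qed.

Lemma modulus0 : modulus (0 : C R) = 0.
Proof. exact: ComplexField.Normc.normc0. Qed.

Lemma modulus0_eq0 z : modulus z = 0 -> z = 0.
Proof. exact: ComplexField.Normc.eq0_normc. Qed.

Lemma modulus_real x : modulus (real_complex R x) = `|x|.
Proof. by rewrite modulusE re_real im_real expr0n addr0 sqrtr_sqr. Qed.

Lemma normC_modulus z : `|z| = real_complex R (modulus z).
Proof. by case: z. Qed.

Lemma C_gt0 z : 0 < z -> 0 < re z /\ z = real_complex R (re z).
Proof. by case: z => a b; rewrite ltcE/= => /andP[/eqP -> ->]. Qed.

Lemma ltC_real x y : (real_complex R x < real_complex R y :> C R) = (x < y).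
Proof. by rewrite ltcE/= eqxx. Qed.

Lemma C_cvg (T : Type) (F : set_system T) (FF : Filter F) (f : T -> C R) z :
  (re (f t) @[t --> F] --> re z) -> (im (f t) @[t --> F] --> im z) -> f t @[t --> F] --> z.
Proof.
move=> cr ci; apply/cvgrPdist_lt => e /C_gt0[e0 ->].
have e20 : 0 < re e / 2 by rewrite divr_gt0.
move/cvgrPdist_lt : cr => /(_ _ e20) cr; move/cvgrPdist_lt : ci => /(_ _ e20) ci.
near=> t; rewrite normC_modulus ltC_real; apply: (le_lt_trans (modulus_le _)).
rewrite reD imD reN imN (splitr (re e)); apply: ltrD; near: t; [exact: cr|exact: ci].
Unshelve. all: by end_near. Qed.

Lemma cvg_modulus_sub (T : Type) (F : set_system T) (FF : Filter F) (f : T -> C R) z :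
  f t @[t --> F] --> z -> modulus (f t - z) @[t --> F] --> (0 : R).
Proof.
move=> cf; apply/cvgrPdist_lt => e e0.
have e0' : 0 < (real_complex R e : C R) by rewrite ltC_real.
move/cvgrPdist_lt : cf => /(_ _ e0'); apply: filterS => t.
by rewrite normC_modulus ltC_real sub0r normrN ger0_norm ?modulus_ge0// -modulusN opprB.
Qed.

Lemma cvg_re (T : Type) (F : set_system T) (FF : Filter F) (f : T -> C R) z :
  f t @[t --> F] --> z -> re (f t) @[t --> F] --> re z.
Proof.
move=> /(cvg_modulus_sub FF)/cvgrPdist_lt cf; apply/cvgrPdist_lt => e /cf; apply: filterS => t.
rewrite sub0r normrN ger0_norm ?modulus_ge0//; apply: le_lt_trans.
by rewrite distrC -reN -reD; exact: re_le_modulus.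
Qed.

Lemma cvg_im (T : Type) (F : set_system T) (FF : Filter F) (f : T -> C R) z :
  f t @[t --> F] --> z -> im (f t) @[t --> F] --> im z.
Proof.
move=> /(cvg_modulus_sub FF)/cvgrPdist_lt cf; apply/cvgrPdist_lt => e /cf; apply: filterS => t.
rewrite sub0r normrN ger0_norm ?modulus_ge0//; apply: le_lt_trans.
by rewrite distrC -imN -imD; exact: im_le_modulus.
Qed.

Lemma lim_C (T : Type) (F : set_system T) (FF : ProperFilter F) (f : T -> C R) z :
  f t @[t --> F] --> z -> lim (f t @[t --> F]) = z.
Proof. by move=> cf; apply: cvg_lim. Qed.

End ComplexBasics.

(** * Borel representatives and the norm of L log L *)

Section Representatives.
Variable R : realType.
Local Notation mu := (@lebesgue_measure R).
Implicit Types (f g h : R -> C R) (u v w : R -> R) (x t : R).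

Definition mod2 u w x : R := Num.sqrt (u x ^+ 2 + w x ^+ 2).

Lemma mod2_ge0 u w x : 0 <= mod2 u w x. Proof. exact: sqrtr_ge0. Qed.

Lemma measurable_mod2 u w : measurable_fun setT u -> measurable_fun setT w ->
  measurable_fun setT (mod2 u w).
Proof.
move=> mf mw; apply: (measurableT_comp (continuous_measurable_fun (@sqrt_continuous R))).
by apply: measurable_funD; exact: measurable_funX.
Qed.

Lemma mod2_re u w x : `|u x| <= mod2 u w x.
Proof. exact: (@re_le_modulus R (Complex (u x) (w x))). Qed.

Lemma mod2_im u w x : `|w x| <= mod2 u w x.
Proof. exact: (@im_le_modulus R (Complex (u x) (w x))). Qed.

Lemma mod2_le u w x : mod2 u w x <= `|u x| + `|w x|.
Proof. exact: (@modulus_le R (Complex (u x) (w x))). Qed.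

(** The link with the real theory, where functions are Borel on the whole line; only values in
    [(-1, 1)] off a null set are compared. *)
Definition rep f u w : Prop := [/\ measurable_fun setT u, measurable_fun setT w &
  offnull (fun x => re (f x) = u x /\ im (f x) = w x)].

Lemma L0_rep f : L0 f <-> exists u w, rep f u w.
Proof.
split=> [[mr mi]|[u [w [mf mw h]]]].
  have [u mf hu] := borel_rep mr; have [w mw hw] := borel_rep mi.
  by exists u, w; split => //; exact: offnull_and hu hw.
split; [apply: (leb_measurable_ae mf)|apply: (leb_measurable_ae mw)].
  by apply: offnull_imp h => x _ [].
by apply: offnull_imp h => x _ [].
Qed.

Lemma rep_modulus f u w : rep f u w -> offnull (fun x => modulus (f x) = mod2 u w x).
Proof. by move=> [_ _]; apply: offnull_imp => x _ [h1 h2]; rewrite modulusE h1 h2. Qed.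

Lemma rep_add f g u w u' w' : rep f u w -> rep g u' w' ->
  rep (f \+ g) (fun x => u x + u' x) (fun x => w x + w' x).
Proof.
move=> [m1 m2 h] [m1' m2' h']; split; [exact: measurable_funD|exact: measurable_funD|].
by apply: offnull_imp (offnull_and h h') => x _ [[e1 e2] [e3 e4]]; rewrite /= reD imD e1 e2 e3 e4.
Qed.

Lemma rep_sub f g u w u' w' : rep f u w -> rep g u' w' ->
  rep (f \- g) (fun x => u x - u' x) (fun x => w x - w' x).
Proof.
move=> [m1 m2 h] [m1' m2' h']; split; [exact: measurable_funB|exact: measurable_funB|].
by apply: offnull_imp (offnull_and h h') => x _ [[e1 e2] [e3 e4]]; rewrite /= reD imD reN imN e1 e2 e3 e4.
Qed.

Lemma rep_scale (a : C R) f u w : rep f u w ->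
  rep (a \*o f) (fun x => re a * u x - im a * w x) (fun x => re a * w x + im a * u x).
Proof.
move=> [m1 m2 h]; split.
- by apply: measurable_funB; exact: measurable_funM.
- by apply: measurable_funD; exact: measurable_funM.
- by apply: offnull_imp h => x _ [e1 e2]; rewrite /= reM imM e1 e2.
Qed.

Lemma measurable_modulus f u w : rep f u w ->
  measurable_fun (I11 : set (lebType R)) (fun x => modulus (f x)).
Proof.
move=> r; have [m1 m2 _] := r.
exact: (leb_measurable_ae (measurable_mod2 m1 m2) (rep_modulus r)).
Qed.

Lemma L1norm_rep f u w : rep f u w -> L1norm f = nrm (mod2 u w).
Proof.
move=> r; have [m1 m2 _] := r; have mm := measurable_mod2 m1 m2.
rewrite /L1norm (@ge0_integral_leb_ae R I11 _ (mod2 u w) (@measurable_I11 R) (@subset_refl _ I11)).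
- by apply: eq_integral => x _; rewrite ger0_norm// mod2_ge0.
- exact: measurable_modulus r.
- exact: mm.
- by move=> x; exact: modulus_ge0.
- by move=> x; exact: mod2_ge0.
- exact: rep_modulus.
Qed.

Lemma Phi_le_ae u v : offnull (fun x => u x <= v x) -> (Phi u <= Phi v)%E.
Proof.
move=> [Z Z0 uv]; apply: Phi_le => l _; apply: dist_le_ae; apply: mu_sub0 Z0.
move=> x [Ix /= /andP[h1 h2]]; apply: contrapT => nZ.
by have := uv x Ix nZ; lra.
Qed.

Lemma Phi_ae u v : offnull (fun x => u x = v x) -> Phi u = Phi v.
Proof.
move=> h; apply/eqP; rewrite eq_le !Phi_le_ae//.
  by apply: offnull_imp h => x _ ->.
by apply: offnull_imp h => x _ ->.
Qed.

Lemma Phi_rep f u w : rep f u w -> Phi (fun x => modulus (f x)) = Phi (mod2 u w).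
Proof. by move=> /rep_modulus; exact: Phi_ae. Qed.

(** The levels [l > 0] with [t < dist l] form an interval starting at 0, whose length is the
    rearrangement at [t], possibly infinite. The integral form prepares Tonelli's theorem. *)
Lemma rearrangement_integral f t : 
  rearrangement f t =
  (\int[mu]_(l in `]0%R, +oo[) (t < dist (fun x => modulus (f x)) l)%R%:R%:E)%E.
Proof.
set D := dist _.
have DE l : distribution_fun f l = (D l)%:E by rewrite -distE.
rewrite (@integral_lt_indic _ (measurableTypeR R) R mu _ (cst t) D)//; last exact: measurable_dist.
pose S := [set l : R | 0 <= l /\ D l <= t].
have -> : rearrangement f t = ereal_inf (EFin @` S).
  congr ereal_inf; apply/seteqP; split => _ [l [l0 h] <-]; exists l => //; split => //.
    by move: h; rewrite DE lee_fin.
  by rewrite DE lee_fin.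
have [S0|/set0P[l0 Sl0]] := eqVneq S set0.
  rewrite S0 image_set0 ereal_inf0; apply/esym/eqP; rewrite -leye_eq.
  apply: (@le_trans _ _ (mu `]0%R, +oo[%classic)); first by rewrite lebesgue_measure_itv/= ltry.
  apply: le_mu => l /=; rewrite in_itv/= andbT => lp; split; first by rewrite /= ?in_itv/= ?andbT.
  rewrite ltNge; apply/negP => h; suff : S l by rewrite S0.
  by split => //; exact: ltW.
have hS : has_inf S by split; [exists l0|exists 0 => l []].
rewrite ereal_inf_EFin; [|exact: hS.2|exact: hS.1].
set a := inf S.
have a0 : 0 <= a by apply: lb_le_inf; [exists l0|move=> x []].
have muE (A : set R) (b : R) : 0 <= b -> A = `]0%R, b[%classic \/ A = `]0%R, b]%classic -> mu A = b%:E.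
  move=> b0 [->|->]; rewrite lebesgue_measure_itv/= lte_fin; case: ifPn => h; rewrite -?EFinB ?subr0//;
  by congr _%:E; apply/eqP; rewrite eq_le b0 leNgt h.
apply/eqP; rewrite eq_le; apply/andP; split.
  rewrite -(muE `]0%R, a[%classic a a0 (or_introl erefl)); apply: le_mu => l /=.
  rewrite in_itv/= => /andP[lp la]; split; first by rewrite in_itv/= lp.
  rewrite ltNge; apply/negP => h; move: la; rewrite ltNge; apply/negP/negPn.
  by apply: ge_inf; [exact: hS.2|split => //; exact: ltW].
rewrite -(muE `]0%R, a]%classic a a0 (or_intror erefl)); apply: le_mu => l [/=].
rewrite !in_itv/= andbT => lp h; rewrite lp/= leNgt; apply/negP => al.
have [r [_ Dr] rl] := inf_lt hS.1 al.
by have := dist_noninc (fun x => modulus (f x)) (ltW rl); rewrite -/D; lra.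
Qed.

Lemma Wf_log_integral d : 0 <= d <= 2 ->
  (\int[mu]_(t in `]0%R, 2%R[) ((t < d)%R%:R * ln (2 * expR 1 / t))%R%:E = (Wf d)%:E)%E.
Proof.
move=> /andP[d0 d2].
transitivity (\int[mu]_(t in `]0%R, d[) (logk (t - 0) + 1)%R%:E)%E.
  rewrite [LHS]integral_mkcond [RHS]integral_mkcond; apply: eq_integral => t _; rewrite !patchE.
  case: ifPn => h1; case: ifPn => h2 //.
  - move: h2; rewrite inE/= in_itv/= => /andP[t0 td]; rewrite td mul1r subr0 /logk.
    have e1 : 0 < expR 1 :> R by exact: expR_gt0.
    by rewrite ln_div ?posrE ?mulr_gt0// lnM ?posrE// expRK; congr _%:E; ring.
  - move: h1 h2; rewrite inE notin_setE/= !in_itv/= => /andP[t0 t2] h; rewrite (_ : (t < d) = false) ?mul0r//.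
    by apply/negP => td; apply: h; rewrite t0.
  - exfalso; move: h1 h2; rewrite inE notin_setE/= !in_itv/= => h /andP[t0 td]; apply: h.
    by rewrite t0 (lt_le_trans td).
under eq_integral do rewrite EFinD.
rewrite ge0_integralD//.
- have := @logk_integral_right R 0 d; rewrite add0r d0 d2 => /(_ isT) ->.
  rewrite (@integral_cst _ (measurableTypeR R) R mu _ _ 1%E)//.
  rewrite (_ : (1%:E * _ = d%:E)%E); last first.
    rewrite mul1e [LHS](_ : _ = mu `]0%R, d[%classic)// lebesgue_measure_itv/= lte_fin; case: ifPn => h; rewrite -?EFinB ?subr0//.
    by congr _%:E; apply/eqP; rewrite eq_le d0 leNgt h.
  by rewrite -EFinD addrC.
- move=> t; rewrite /= in_itv/= => /andP[t0 td]; rewrite lee_fin subr0 logk_ge0//.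
  by rewrite (ltW t0) (ltW (lt_le_trans td d2)).
- by apply/measurable_EFinP; apply: measurableT_comp; [exact: measurable_logk|exact: measurable_funB].
Qed.

(** After exchanging the integrals in [t] and [l], the inner one is that of [ln (2e/t)] over [t]
    below the distribution function, which is [Wf]. *)
Lemma LlogLnorm_Phi f : LlogLnorm f = Phi (fun x => modulus (f x)).
Proof.
rewrite /LlogLnorm; set D := dist (fun x => modulus (f x)).
have lnpos t : 0 < t -> t < 2 -> 0 <= ln (2 * expR 1 / t).
  move=> t0 t2; apply: ln_ge0; rewrite ler_pdivlMr// mul1r.
  have := @expR_ge1Dx R 1 => h; apply: (le_trans (ltW t2)); rewrite ler_peMr//.
  by lra.
have mk (A : set (measurableTypeR R)) : measurable_fun A (fun t => ln (2 * expR 1 / t) : R).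
  by apply: measurable_funTS; apply: measurableT_comp => //; apply: measurable_funM => //; exact: measurable_inv.
have mk2 (A : set (measurableTypeR R * measurableTypeR R)) : measurable_fun A
   (fun z => ((z.1 < D z.2)%R%:R * ln (2 * expR 1 / z.1))%R%:E : \bar R).
  apply: measurable_funTS; apply/measurable_EFinP; apply: measurable_funM.
    apply/measurable_EFinP; apply: (@measurable_fun_lt_indic _ _ R setT (fun z => z.1) (fun z => D z.2)) => //; first exact: measurable_fst.
    by apply: (measurableT_comp (@measurable_dist R (fun x => modulus (f x)) setT)); exact: measurable_snd.
  by apply: (measurableT_comp (mk setT)); exact: measurable_fst.
have E t : `]0%R, 2%R[%classic t -> (rearrangement f t * (ln (2 * expR 1 / t))%:E =
    \int[mu]_(l in `]0%R, +oo[) ((t < D l)%R%:R * ln (2 * expR 1 / t))%R%:E)%E.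
  rewrite /= in_itv/= => /andP[t0 t2]; rewrite rearrangement_integral.
  rewrite muleC -ge0_integralZl//; last 2 first.
  - by apply: (@measurable_fun_lt_indic _ (measurableTypeR R)) => //; exact: measurable_dist.
  - by rewrite lee_fin lnpos.
  by apply: eq_integral => l _; rewrite -EFinM mulrC.
transitivity (\int[leb R]_(t in (`]0%R, 2%R[%classic : set (lebType R)))
    \int[mu]_(l in `]0%R, +oo[) ((t < D l)%R%:R * ln (2 * expR 1 / t))%R%:E)%E.
  by apply: eq_integral => t /set_mem; exact: E.
have F0 t l : `]0%R, 2%R[%classic t -> `]0%R, +oo[%classic l -> (0 <= ((t < D l)%R%:R * ln (2 * expR 1 / t))%R%:E)%E.
  by rewrite /= in_itv/= => /andP[t0 t2] _; rewrite lee_fin mulr_ge0// lnpos.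
rewrite ge0_integral_leb//; last 2 first.
- apply: (@measurable_tonelli _ _ (measurableTypeR R) (measurableTypeR R) R mu _ _
    (fun t l => ((t < D l)%R%:R * ln (2 * expR 1 / t))%R%:E)) => //.
- by move=> t ht; apply: integral_ge0 => l hl; exact: F0.
rewrite (@tonelli_on _ _ (measurableTypeR R) (measurableTypeR R) R mu mu _ _
  (fun t l => ((t < D l)%R%:R * ln (2 * expR 1 / t))%R%:E))//.
by apply: eq_integral => l _; apply: Wf_log_integral; rewrite dist_ge0 dist_le2.
Qed.

Lemma dominated_offnull f g : dominated f g <-> offnull (fun x => modulus (f x) <= modulus (g x)).
Proof. exact: aeI_offnull. Qed.

Lemma truncated_hilbert_rep f u w t e : rep f u w -> I11 t -> 0 < e ->
  truncated_hilbert f t e = Complex (pi^-1 * htr u t e) (pi^-1 * htr w t e).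
Proof.
move=> [m1 m2 h] It e0; have [s1 s2 _ _] := itv_sub_I11 It e0.
have mq (k : R -> R) : measurable_fun setT k -> measurable_fun setT (fun x => k x / (x - t)).
  exact: measurable_div_sub.
have key (r : C R -> R) k (D : set R) : (forall z y, r (z / real_complex R y) = r z / y) ->
    measurable_fun setT k -> offnull (fun x => r (f x) = k x) ->
    measurable (D : set (measurableTypeR R)) -> D `<=` I11 ->
    Rintegral (leb R) (D : set (lebType R)) (r \o (fun x => f x / real_complex R (x - t))) =
    \int[mu]_(x in D) (k x / (x - t)).
  move=> rd mk rk mD DI.
  have rk' : offnull (fun x => (r \o (fun x => f x / real_complex R (x - t))) x = k x / (x - t)).
    by apply: offnull_imp rk => x _ /= <-; rewrite rd.
  apply: integral_leb_ae => //; last exact: mq.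
  exact: (leb_measurable_ae (mq _ mk) rk').
have hr : offnull (fun x => re (f x) = u x) by apply: offnull_imp h => x _ [].
have hi : offnull (fun x => im (f x) = w x) by apply: offnull_imp h => x _ [].
rewrite /truncated_hilbert /cintegral /htr.
rewrite !(key (@re R) u)//; try exact: re_div_real.
rewrite !(key (@im R) w)//; try exact: im_div_real.
by apply: eq_re_im; rewrite ?reM ?imM/= ?mul0r ?subr0 ?addr0.
Qed.

Lemma finite_hilbert_rep f u w v1 v2 : rep f u w -> is_hilb u v1 -> is_hilb w v2 ->
  rep (finite_hilbert f) (fun t => pi^-1 * v1 t) (fun t => pi^-1 * v2 t).
Proof.
move=> r [mv1 h1] [mv2 h2]; split; [exact: measurable_funM|exact: measurable_funM|].
apply: offnull_imp (offnull_and h1 h2) => t It [c1 c2].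
suff -> : finite_hilbert f t = Complex (pi^-1 * v1 t) (pi^-1 * v2 t) by [].
apply: lim_C; apply: C_cvg => /=.
  apply: (@near_htr R (fun e => pi^-1 * htr u t e) (fun e => re (truncated_hilbert f t e))); last exact: (cvgM (cvg_cst _) c1).
  by move=> e e0; rewrite (truncated_hilbert_rep r).
apply: (@near_htr R (fun e => pi^-1 * htr w t e) (fun e => im (truncated_hilbert f t e))); last exact: (cvgM (cvg_cst _) c2).
by move=> e e0; rewrite (truncated_hilbert_rep r).
Qed.

End Representatives.

(** * The transform on complex integrable functions *)

Section HilbertL1.
Variable R : realType.
Local Notation mu := (@lebesgue_measure R).
Local Notation T := (@finite_hilbert R).
Implicit Types (f g h : R -> C R) (u v w a b : R -> R) (x t : R).

Lemma mod2D u w u' w' x : mod2 (fun x => u x + u' x) (fun x => w x + w' x) x <= mod2 u w x + mod2 u' w' x.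
Proof. exact: (@modulusD R (Complex (u x) (w x)) (Complex (u' x) (w' x))). Qed.

Lemma nrm_mod2_le u w : measurable_fun setT u -> measurable_fun setT w ->
  (nrm (mod2 u w) <= nrm u + nrm w)%E.
Proof.
move=> mf mw; have mf' : measurable_fun setT (fun x => `|u x|) by exact: measurableT_comp.
have mw' : measurable_fun setT (fun x => `|w x|) by exact: measurableT_comp.
have nn (k : R -> R) : nrm (fun x => `|k x|) = nrm k by apply: eq_integral => x _; rewrite normr_id.
rewrite -(nn u) -(nn w); apply: le_trans (nrm_triangle mf' mw'); apply: nrm_le.
- exact: measurable_mod2.
- exact: measurable_funD.
- move=> x _; rewrite ger0_norm ?mod2_ge0//; apply: (le_trans (mod2_le _ _ _)).
  by rewrite [leRHS]ger0_norm ?addr_ge0.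
Qed.

Lemma nrm_re_le u w : measurable_fun setT u -> measurable_fun setT w -> (nrm u <= nrm (mod2 u w))%E.
Proof.
move=> mf mw; apply: nrm_le => //; first exact: measurable_mod2.
by move=> x _; rewrite [leRHS]ger0_norm ?mod2_ge0// mod2_re.
Qed.

Lemma nrm_im_le u w : measurable_fun setT u -> measurable_fun setT w -> (nrm w <= nrm (mod2 u w))%E.
Proof.
move=> mf mw; apply: nrm_le => //; first exact: measurable_mod2.
by move=> x _; rewrite [leRHS]ger0_norm ?mod2_ge0// mod2_im.
Qed.

Lemma rep_L1I f u w : rep f u w -> (L1norm f < +oo)%E -> L1I u /\ L1I w.
Proof.
move=> r; have [mf mw _] := r; rewrite (L1norm_rep r) => fi.
by split; split => //; apply: le_lt_trans fi; [exact: nrm_re_le|exact: nrm_im_le].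
Qed.

Lemma L1_hilb f : L1 f -> exists u w v1 v2, [/\ rep f u w, L1I u /\ L1I w, is_hilb u v1, is_hilb w v2 &
  rep (T f) (fun t => pi^-1 * v1 t) (fun t => pi^-1 * v2 t)].
Proof.
move=> [/L0_rep[u [w r]] fi]; have [Lu Lw] := rep_L1I r fi.
have [v1 h1] := is_hilb_exists Lu; have [v2 h2] := is_hilb_exists Lw.
by exists u, w, v1, v2; split => //; exact: finite_hilbert_rep r h1 h2.
Qed.

Lemma hilbert_L0 f : L1 f -> L0 (T f).
Proof. by move=> /L1_hilb[u [w [v1 [v2 [_ _ _ _ r]]]]]; apply/L0_rep; eexists; eexists; exact: r. Qed.

Lemma ipi_ge0 : 0 <= pi^-1 :> R. Proof. by rewrite invr_ge0 pi_ge0. Qed.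

Lemma L1norm_hilbert_le f u w v1 v2 : rep f u w -> is_hilb u v1 -> is_hilb w v2 ->
  (L1norm (T f) <= (pi^-1)%:E * (nrm v1 + nrm v2))%E.
Proof.
move=> r h1 h2; rewrite (L1norm_rep (finite_hilbert_rep r h1 h2)).
have m1 := h1.1; have m2 := h2.1.
apply: (le_trans (nrm_mod2_le _ _)); try exact: measurable_funM.
rewrite (nrmZ _ m1) (nrmZ _ m2) (ger0_norm ipi_ge0).
by rewrite [leRHS]ge0_muleDr ?nrm_ge0.
Qed.

Lemma hilbert_upper f : L1 f ->
  (L1norm (T f) <= (20 / pi)%:E * Phi (fun x => modulus (f x)))%E.
Proof.
move=> /L1_hilb[u [w [v1 [v2 [r [Lu Lw] h1 h2 _]]]]].
apply: (le_trans (L1norm_hilbert_le r h1 h2)).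
have [mf mw _] := r; rewrite (Phi_rep r).
apply: (@le_trans _ _ ((pi^-1)%:E * (10%:E * Phi (mod2 u w) + 10%:E * Phi (mod2 u w)))%E).
  apply: lee_wpmul2l; first by rewrite lee_fin ipi_ge0.
  apply: leeD.
    apply: (le_trans (hilb_upper Lu h1)); apply: lee_wpmul2l => //.
    by apply: Phi_mono => x _; exact: mod2_re.
  apply: (le_trans (hilb_upper Lw h2)); apply: lee_wpmul2l => //.
  by apply: Phi_mono => x _; exact: mod2_im.
rewrite -ge0_muleDl// -EFinD muleA -EFinM (_ : pi^-1 * (10 + 10) = 20 / pi)//.
by rewrite mulrC; congr (_ / _); ring.
Qed.

Lemma is_hilb0 : is_hilb (fun=> 0 : R) (fun=> 0 : R).
Proof.
have := @is_hilb_stepf R [::] isT isT.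
rewrite (_ : stepf [::] = fun=> 0); last by apply/funext => x; rewrite /stepf big_nil.
by rewrite (_ : stepH [::] = fun=> 0)//; apply/funext => x; rewrite /stepH big_nil.
Qed.

Lemma rep_real u : measurable_fun setT u -> rep (fun x => real_complex R (u x) : C R) u (fun=> 0).
Proof. by move=> mf; split => //; apply: offnull_all. Qed.

Lemma L1norm_hilbert_real u v : measurable_fun setT u -> is_hilb u v ->
  (nrm v <= pi%:E * L1norm (T (fun x => real_complex R (u x) : C R)))%E.
Proof.
move=> mf hv; rewrite (L1norm_rep (finite_hilbert_rep (rep_real mf) hv is_hilb0)).
have mv := hv.1.
apply: (@le_trans _ _ (pi%:E * nrm (fun t => pi^-1 * v t)%R)%E).
  rewrite nrmZ// (ger0_norm ipi_ge0) muleA -EFinM mulfV ?mul1e//.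
  by rewrite gt_eqF// pi_gt0.
apply: lee_wpmul2l; first by rewrite lee_fin pi_ge0.
by apply: nrm_re_le; exact: measurable_funM.
Qed.

(** The real lower bound is applied to the modulus of [f]: real bounded competitors are enough. The
    factor [pi] undoes the normalisation of [T]. *)
Lemma Phi_lower f N : L0 f ->
  (forall u (M : R), measurable_fun setT u -> (forall x, I11 x -> `|u x| <= M) ->
    dominated (fun x => real_complex R (u x) : C R) f ->
    (L1norm (T (fun x => real_complex R (u x) : C R)) <= N%:E)%E) ->
  (Phi (fun x => modulus (f x)) <= (200 * (pi * N))%:E)%E.
Proof.
move=> /L0_rep[a [b r]] H; have [ma mb _] := r; rewrite (Phi_rep r).
apply: lower_bound; [exact: measurable_mod2|exact: mod2_ge0|].
move=> u v M mf ug uM hv; apply: (le_trans (L1norm_hilbert_real mf hv)).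
rewrite EFinM; apply: lee_wpmul2l; first by rewrite lee_fin pi_ge0.
apply: (H u M) => //; apply/dominated_offnull.
apply: offnull_imp (rep_modulus r) => x Ix ->; rewrite modulus_real; exact: ug.
Qed.

Lemma L1norm_ae f g : L0 f -> aeI (fun x => f x = g x) -> L1norm f = L1norm g.
Proof.
move=> /L0_rep[u [w r]] /aeI_offnull fg; have [mf mw h] := r.
have r' : rep g u w by split => //; apply: offnull_imp (offnull_and h fg) => x _ [? <-].
by rewrite (L1norm_rep r) (L1norm_rep r').
Qed.

Lemma L0_add f g : L0 f -> L0 g -> L0 (f \+ g).
Proof.
move=> /L0_rep[u [w r]] /L0_rep[u' [w' r']]; apply/L0_rep.
by eexists; eexists; exact: rep_add r r'.
Qed.

Lemma L0_sub f g : L0 f -> L0 g -> L0 (f \- g).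
Proof.
move=> /L0_rep[u [w r]] /L0_rep[u' [w' r']]; apply/L0_rep.
by eexists; eexists; exact: rep_sub r r'.
Qed.

Lemma L0_scale (c : C R) f : L0 f -> L0 (c \*o f).
Proof. by move=> /L0_rep[u [w r]]; apply/L0_rep; eexists; eexists; exact: rep_scale r. Qed.

Lemma L0_real u : measurable_fun setT u -> L0 (fun x => real_complex R (u x) : C R).
Proof. by move=> mf; apply/L0_rep; eexists; eexists; exact: rep_real mf. Qed.

Lemma L0_zero : L0 (fun=> 0 : C R).
Proof. by apply/L0_rep; exists (fun=> 0), (fun=> 0); split => //; exact: offnull_all. Qed.

Lemma L1normD f g : L0 f -> L0 g -> (L1norm (f \+ g)%R <= L1norm f + L1norm g)%E.
Proof.
move=> /L0_rep[u [w r]] /L0_rep[u' [w' r']].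
have [m1 m2 _] := r; have [m3 m4 _] := r'.
rewrite (L1norm_rep r) (L1norm_rep r') (L1norm_rep (rep_add r r')).
have M1 := measurable_mod2 m1 m2; have M2 := measurable_mod2 m3 m4.
apply: le_trans (nrm_triangle M1 M2); apply: nrm_le.
- by apply: measurable_mod2; exact: measurable_funD.
- exact: measurable_funD.
- by move=> x _; rewrite !ger0_norm ?addr_ge0 ?mod2_ge0//; exact: mod2D.
Qed.

Lemma L1normZ (c : C R) f : L0 f -> L1norm (c \*o f)%R = ((modulus c)%:E * L1norm f)%E.
Proof.
move=> /L0_rep[u [w r]]; have [m1 m2 _] := r.
rewrite (L1norm_rep r) (L1norm_rep (rep_scale c r)).
rewrite -{1}(ger0_norm (modulus_ge0 c)) -nrmZ; last exact: measurable_mod2.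
apply: eq_integral => x _; congr (`| _ |%:E).
have := @modulusM R c (Complex (u x) (w x)); rewrite [modulus (_ * _)]modulusE reM imM/=.
by [].
Qed.

Lemma L1_add f g : L1 f -> L1 g -> L1 (f \+ g).
Proof.
move=> [f0 ff] [g0 gf]; split; first exact: L0_add.
by apply: (le_lt_trans (L1normD f0 g0)); rewrite lte_add_pinfty.
Qed.

Lemma L1_scale (c : C R) f : L1 f -> L1 (c \*o f).
Proof.
move=> [f0 ff]; split; first exact: L0_scale.
by rewrite L1normZ// lte_mul_pinfty// lee_fin modulus_ge0.
Qed.

Lemma hilbert_add f g : L1 f -> L1 g -> aeI (fun t => T (f \+ g) t = T f t + T g t).
Proof.
move=> /L1_hilb[u [w [v1 [v2 [r [Lu Lw] h1 h2 [_ _ rT]]]]]].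
move=> /L1_hilb[u' [w' [v1' [v2' [r' [Lu' Lw'] h1' h2' [_ _ rT']]]]]].
have [_ _ rs] := finite_hilbert_rep (rep_add r r') (is_hilb_add Lu Lu' h1 h1') (is_hilb_add Lw Lw' h2 h2').
apply/aeI_offnull; apply: offnull_imp (offnull_and rs (offnull_and rT rT')) => t _ [[e1 e2] [[e3 e4] [e5 e6]]].
apply: eq_re_im.
  exact: etrans e1 (etrans (mulrDr _ _ _) (etrans (f_equal2 +%R (esym e3) (esym e5)) (esym (reD _ _)))).
exact: etrans e2 (etrans (mulrDr _ _ _) (etrans (f_equal2 +%R (esym e4) (esym e6)) (esym (imD _ _)))).
Qed.

Lemma hilbert_scale (c : C R) f : L1 f -> aeI (fun t => T (c \*o f) t = c * T f t).
Proof.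
move=> /L1_hilb[u [w [v1 [v2 [r [Lu Lw] h1 h2 [_ _ rT]]]]]].
have H1 := is_hilb_sub (L1I_scale (re c) Lu) (L1I_scale (im c) Lw) (is_hilb_scale (re c) Lu h1) (is_hilb_scale (im c) Lw h2).
have H2 := is_hilb_add (L1I_scale (re c) Lw) (L1I_scale (im c) Lu) (is_hilb_scale (re c) Lw h2) (is_hilb_scale (im c) Lu h1).
have [_ _ rs] := finite_hilbert_rep (rep_scale c r) H1 H2.
apply/aeI_offnull; apply: offnull_imp (offnull_and rs rT) => t _ [[e1 e2] [e3 e4]].
by apply: eq_re_im; [rewrite e1 reM e3 e4; ring|rewrite e2 imM e3 e4; ring].
Qed.

Lemma cvg_mod2 (an bn : nat -> R) (la lb : R) : an n @[n --> \oo] --> la -> bn n @[n --> \oo] --> lb ->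
  Num.sqrt (an n ^+ 2 + bn n ^+ 2) @[n --> \oo] --> Num.sqrt (la ^+ 2 + lb ^+ 2).
Proof.
move=> ca cb; apply: (@cvg_comp _ _ _ (fun n => an n ^+ 2 + bn n ^+ 2) (@Num.sqrt R)); last exact: sqrt_continuous.
by apply: cvgD; apply: cvgM.
Qed.

(** Real and imaginary parts are used only for the a.e. convergence; Fatou's lemma is applied to the
    modulus, so no constant is lost. The Fatou property of the optimal norm needs exactly this. *)
Lemma hilbert_lsc f (fn : nat -> R -> C R) (M : \bar R) : L1 f -> (forall n, L1 (fn n)) ->
  L1norm (f \- fn n) @[n --> \oo] --> 0%E ->
  (forall n, (L1norm (T (fn n)) <= M)%E) -> (L1norm (T f) <= M)%E.
Proof.
move=> /L1_hilb[u [w [v1 [v2 [r [Lu Lw] h1 h2 rT]]]]] Lfn cf TM.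
have /choice[q qP] : forall n, exists q : (R -> R) * (R -> R) * (R -> R) * (R -> R),
    [/\ rep (fn n) q.1.1.1 q.1.1.2, L1I q.1.1.1 /\ L1I q.1.1.2, is_hilb q.1.1.1 q.1.2, is_hilb q.1.1.2 q.2 &
    rep (T (fn n)) (fun t => pi^-1 * q.1.2 t) (fun t => pi^-1 * q.2 t)].
  by move=> n; have [u' [w' [v1' [v2' H]]]] := L1_hilb (Lfn n); exists (u', w', v1', v2').
have p4 n : 0 < 4 ^- n :> R by rewrite invr_gt0 exprn_gt0.
have /choice[k kP] : forall n, exists k, (L1norm (f \- fn k)%R <= (4 ^- n)%:E)%E.
  by move=> n; have [N /(_ N (leqnn N))] := cvge0_le cf (p4 n); exists N.
pose un n := (q (k n)).1.1.1; pose wn n := (q (k n)).1.1.2; pose v1n n := (q (k n)).1.2; pose v2n n := (q (k n)).2.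
have dn n : (nrm (fun x => u x - un n x)%R <= (4 ^- n)%:E)%E /\ (nrm (fun x => w x - wn n x)%R <= (4 ^- n)%:E)%E.
  have [rn [[m1 _] [m2 _]] _ _ _] := qP (k n); have := kP n; rewrite (L1norm_rep (rep_sub r rn)) => h.
  have d1 : measurable_fun setT (fun x => u x - un n x) by apply: measurable_funB => //; exact: Lu.1.
  have d2 : measurable_fun setT (fun x => w x - wn n x) by apply: measurable_funB => //; exact: Lw.1.
  by split; apply: le_trans h; [exact: nrm_re_le d1 d2|exact: nrm_im_le d1 d2].
have Lun n : L1I (un n) by have [_ []] := qP (k n).
have Lwn n : L1I (wn n) by have [_ []] := qP (k n).
have hun n : is_hilb (un n) (v1n n) by have [] := qP (k n).
have hwn n : is_hilb (wn n) (v2n n) by have [] := qP (k n).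
have c1 := is_hilb_fast Lu Lun h1 hun (fun n => (dn n).1).
have c2 := is_hilb_fast Lw Lwn h2 hwn (fun n => (dn n).2).
have m1 n : measurable_fun setT (v1n n) by have [_ _ [m _] _ _] := qP (k n).
have m2 n : measurable_fun setT (v2n n) by have [_ _ _ [m _] _] := qP (k n).
rewrite (L1norm_rep rT); have [mT1 mT2 _] := rT.
apply: (@nrm_fatou R (fun n => mod2 (fun t => pi^-1 * v1n n t) (fun t => pi^-1 * v2n n t))).
- by move=> n; apply: measurable_mod2; exact: measurable_funM.
- exact: measurable_mod2.
- apply: offnull_imp (offnull_and c1 c2) => t _ [e1 e2].
  by apply: cvg_mod2; apply: cvgM => //; exact: cvg_cst.
- by move=> n; have [_ _ _ _ rn] := qP (k n); rewrite -(L1norm_rep rn).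
Qed.

Lemma LlogL_L1 f : LlogL f -> L1 f.
Proof.
move=> [f0 fi]; split => //; apply: le_lt_trans fi; rewrite LlogLnorm_Phi.
have /L0_rep[u [w r]] := f0; have [mf mw _] := r.
rewrite (L1norm_rep r) (Phi_rep r).
have := nrm_le_Phi (measurable_mod2 mf mw).
by rewrite (_ : (fun x => `|mod2 u w x|) = mod2 u w)//; apply/funext => x; rewrite ger0_norm ?mod2_ge0.
Qed.

Lemma hilbert_zero : aeI (fun t => T (fun=> 0) t = 0).
Proof.
have r : rep (fun=> 0 : C R) (fun=> 0) (fun=> 0) by split => //; exact: offnull_all.
have [_ _ h] := finite_hilbert_rep r is_hilb0 is_hilb0.
apply/aeI_offnull; apply: offnull_imp h => t _ [e1 e2].
by apply: eq_re_im; [rewrite e1 mulr0|rewrite e2 mulr0].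
Qed.

Lemma aeI_imp (P Q : R -> Prop) : (forall t, I11 t -> P t -> Q t) -> aeI P -> aeI Q.
Proof. by move=> PQ /aeI_offnull h; apply/aeI_offnull; exact: offnull_imp h. Qed.

Lemma aeI_and (P Q : R -> Prop) : aeI P -> aeI Q -> aeI (fun t => P t /\ Q t).
Proof. by move=> /aeI_offnull h /aeI_offnull h'; apply/aeI_offnull; exact: offnull_and. Qed.

Lemma aeI_all (P : R -> Prop) : (forall t, I11 t -> P t) -> aeI P.
Proof. by move=> h; apply/aeI_offnull; exact: offnull_all. Qed.

End HilbertL1.

(** * L log L as a Banach function space *)

Section LlogLSpace.
Variable R : realType.
Local Notation mu := (@lebesgue_measure R).
Implicit Types (f g h : R -> C R) (u v w a b : R -> R) (x t : R).

Lemma Phi_modulus_add f g : L0 f -> L0 g ->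
  (Phi (fun x => modulus ((f \+ g) x)) <= Phi (fun x => modulus (f x)) + Phi (fun x => modulus (g x)))%E.
Proof.
move=> /L0_rep[a [b r]] /L0_rep[a' [b' r']].
have [m1 m2 _] := r; have [m3 m4 _] := r'.
rewrite (Phi_rep r) (Phi_rep r') (Phi_rep (rep_add r r')).
apply: le_trans (Phi_add (measurable_mod2 m1 m2) (measurable_mod2 m3 m4) (mod2_ge0 _ _) (mod2_ge0 _ _)).
by apply: Phi_mono => x _; exact: mod2D.
Qed.

Lemma LlogL_add f g : LlogL f -> LlogL g -> LlogL (f \+ g).
Proof.
move=> [f0]; rewrite LlogLnorm_Phi => ff [g0]; rewrite LlogLnorm_Phi => gf.
split; first exact: L0_add.
rewrite LlogLnorm_Phi; apply: (le_lt_trans (Phi_modulus_add f0 g0)).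
exact: lte_add_pinfty.
Qed.

Lemma LlogLnormD f g : LlogL f -> LlogL g ->
  (LlogLnorm (f \+ g)%R <= LlogLnorm f + LlogLnorm g)%E.
Proof. by move=> [f0 _] [g0 _]; rewrite !LlogLnorm_Phi; exact: Phi_modulus_add. Qed.

Lemma LlogL_ideal f g : LlogL f -> L0 g -> dominated g f ->
  LlogL g /\ (LlogLnorm g <= LlogLnorm f)%E.
Proof.
move=> [f0 ff] g0 /dominated_offnull gf.
have le : (LlogLnorm g <= LlogLnorm f)%E by rewrite !LlogLnorm_Phi; exact: Phi_le_ae.
by split; [split; [exact: g0|exact: (le_lt_trans le ff)]|exact: le].
Qed.

(** Half of the homogeneity; the other half is this one for [c^-1]. *)
Lemma rearrangement_scale (c : C R) f t : c != 0 ->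
  (rearrangement (c \*o f)%R t <= (modulus c)%:E * rearrangement f t)%E.
Proof.
move=> c0; have m0 : 0 < modulus c.
  by rewrite lt_neqAle modulus_ge0 andbT eq_sym; apply: contra_neq c0; exact: modulus0_eq0.
rewrite -lee_pdivrMl//; apply: le_ereal_inf_tmp => _ [l [l0 hl] <-].
rewrite lee_pdivrMl// -EFinM; apply: ereal_inf_lbound; exists (modulus c * l) => //; split.
  by rewrite mulr_ge0// ltW.
rewrite (_ : distribution_fun _ _ = distribution_fun f l)//.
congr (leb R _); apply/seteqP; split => x [Ix /=]; rewrite modulusM ltr_pM2l// => h; split => //.
Qed.

Lemma rearrangementZ (c : C R) f t : c != 0 ->
  rearrangement (c \*o f) t = ((modulus c)%:E * rearrangement f t)%E.
Proof.
move=> c0; have m0 : 0 < modulus c.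
  by rewrite lt_neqAle modulus_ge0 andbT eq_sym; apply: contra_neq c0; exact: modulus0_eq0.
apply/eqP; rewrite eq_le rearrangement_scale//=.
have ci0 : c^-1 != 0 by rewrite invr_eq0.
have := @rearrangement_scale c^-1 (c \*o f) t ci0.
rewrite (_ : c^-1 \*o (c \*o f) = f); last by apply/funext => x; rewrite /= mulKf.
have -> : modulus c^-1 = (modulus c)^-1 by exact: ComplexField.Normc.normcV.
by rewrite lee_pdivlMl.
Qed.

Lemma measurable_rearrangement_log f : measurable_fun (`]0%R, 2%R[%classic : set (lebType R))
  (fun t : R => rearrangement f t * (ln (2 * expR 1 / t))%:E)%E.
Proof.
apply: emeasurable_funM; last first.
  apply: borel_lebe => //; apply/measurable_EFinP; apply: measurable_funTS.
  by apply: measurableT_comp => //; apply: measurable_funM => //; exact: measurable_inv.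
apply: borel_lebe => //.
rewrite (_ : rearrangement f = (fun t => \int[mu]_(l in `]0%R, +oo[) (t < dist (fun x => modulus (f x)) l)%R%:R%:E)%E); last first.
  by apply/funext => t; rewrite rearrangement_integral.
apply: (@measurable_tonelli _ _ (measurableTypeR R) (measurableTypeR R) R mu _ _
    (fun t l => (t < dist (fun x => modulus (f x)) l)%R%:R%:E)) => //.
apply: measurable_funTS.
apply: (@measurable_fun_lt_indic _ _ R setT (fun z => z.1) (fun z => dist (fun x => modulus (f x)) z.2)) => //; first exact: measurable_fst.
by apply: (measurableT_comp (@measurable_dist R (fun x => modulus (f x)) setT)); exact: measurable_snd.
Qed.

Lemma LlogLnorm0 f : (forall x, f x = 0) -> LlogLnorm f = 0%E.
Proof.
move=> f0; rewrite LlogLnorm_Phi /Phi integral0_eq// => l; rewrite /= in_itv/= andbT => l0.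
by rewrite dist_gt ?Wf0// => x _; rewrite f0 modulus0 ltW.
Qed.

Lemma LlogLnormZ (c : C R) f : LlogLnorm (c \*o f) = ((modulus c)%:E * LlogLnorm f)%E.
Proof.
have [->|c0] := eqVneq c 0.
  by rewrite modulus0 mul0e LlogLnorm0// => x; rewrite /= mul0r.
pose F := fun t : R => (rearrangement f t * (ln (2 * expR 1 / t))%:E)%E.
have mD : measurable (`]0%R, 2%R[%classic : set (lebType R)) by apply: borel_cara.
have F0 (t : lebType R) : `]0%R, 2%R[%classic t -> (0 <= F t)%E.
  rewrite /= in_itv/= => /andP[t0 t2]; apply: mule_ge0.
    by apply: le_ereal_inf_tmp => _ [l [l0 _] <-]; rewrite lee_fin.
  rewrite lee_fin; apply: ln_ge0; rewrite ler_pdivlMr// mul1r.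
  have := @expR_ge1Dx R 1 => h; apply: (le_trans (ltW t2)); rewrite ler_peMr//.
  by lra.
have k0 : (0 <= (modulus c)%:E)%E by rewrite lee_fin modulus_ge0.
have Z := @ge0_integralZl _ (lebType R) R (leb R) _ mD F (measurable_rearrangement_log f) (modulus c)%:E F0 k0.
apply: etrans Z; rewrite /LlogLnorm.
by apply: eq_integral => t _; rewrite rearrangementZ// /F muleA.
Qed.

Lemma LlogL_scale (c : C R) f : LlogL f -> LlogL (c \*o f).
Proof.
move=> [f0 ff]; split; first exact: L0_scale.
by rewrite LlogLnormZ lte_mul_pinfty// lee_fin modulus_ge0.
Qed.

Lemma subE_scale f g : f \- g = f \+ ((-1) \*o g).
Proof. by apply/funext => x; rewrite /= mulN1r. Qed.

Lemma LlogL_sub f g : LlogL f -> LlogL g -> LlogL (f \- g).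
Proof. by move=> ff gg; rewrite subE_scale; apply: LlogL_add; [exact: ff|exact: LlogL_scale]. Qed.

Lemma LlogLnorm_ge0 f : (0 <= LlogLnorm f)%E.
Proof. by rewrite LlogLnorm_Phi Phi_ge0. Qed.

Lemma L1norm_le_LlogL f : L0 f -> (L1norm f <= LlogLnorm f)%E.
Proof.
move=> /L0_rep[u [w r]]; have [mf mw _] := r.
rewrite LlogLnorm_Phi (L1norm_rep r) (Phi_rep r).
have := nrm_le_Phi (measurable_mod2 mf mw).
by rewrite (_ : (fun x => `|mod2 u w x|) = mod2 u w)//; apply/funext => x; rewrite ger0_norm ?mod2_ge0.
Qed.

Lemma LlogLnorm_eq0 f : LlogL f -> (LlogLnorm f <= 0)%E -> aeI (fun x => f x = 0).
Proof.
move=> [f0 _] z; have := le_trans (L1norm_le_LlogL f0) z.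
move: f0 => /L0_rep[u [w r]]; have [mf mw _] := r; rewrite (L1norm_rep r) => n0.
(* A constant sequence of norm 0 satisfies the rate [4^-n], so it tends to 0 a.e.; hence the
   function vanishes a.e. *)
have h : offnull (fun x => (fun n : nat => mod2 u w x) n @[n --> \oo] --> (0 : R)).
  apply: (@fast_cvg R (fun=> mod2 u w)) => n; first exact: measurable_mod2.
  by apply: (le_trans n0); rewrite lee_fin invr_ge0 exprn_ge0.
apply/aeI_offnull; apply: offnull_imp (offnull_and h (rep_modulus r)) => x _ [c e].
apply: modulus0_eq0; rewrite e; exact: (cvg_unique _ (cvg_cst _) c).
Qed.

Lemma fast_limit (w : nat -> R -> R) : (forall n, measurable_fun setT (w n)) ->
  (forall n, (nrm (fun x => w n.+1 x - w n x)%R <= (4 ^- n)%:E)%E) ->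
  exists2 a : R -> R, measurable_fun setT a & offnull (fun x => w n x @[n --> \oo] --> a x).
Proof.
move=> mw hw; exists (fun x => fine (limn_esup (fun n => (w n x)%:E))).
  apply: measurableT_comp => //; apply: measurable_fun_limn_esup => n.
  exact/measurable_EFinP.
have md n : measurable_fun setT (fun x => w n.+1 x - w n x) by exact: measurable_funB.
apply: offnull_imp (fast_cvg0 md hw) => x _ [N h].
have tele n j : (N <= n)%N -> `|w n x - w (n + j)%N x| <= 2 * 2 ^- n - 2 * 2 ^- (n + j).
  move=> Nn; elim: j => [|j IH]; first by rewrite addn0 !subrr normr0.
  have h1 := h (n + j)%N (leq_trans Nn (leq_addr _ _)); rewrite addnS.
  have := ler_distD (w (n + j)%N x) (w n x) (w (n + j).+1 x).
  rewrite (distrC (w (n + j)%N x)) => h2; apply: (le_trans h2); apply: (le_trans (lerD IH h1)).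
  by rewrite (exprS 2 (n + j)) invfM; lra.
have /cvg_ex[l cl] : cvgn (fun n => w n x).
  apply: cauchy_seq_cvg => e e0.
  have e20 : 0 < e / 4 by rewrite divr_gt0.
  have /cvgrPdist_le/(_ _ e20)[n0 _ hn0] := @pow2_cvg0 R.
  exists (maxn N n0) => m nm; rewrite -(subnKC nm).
  apply: (le_lt_trans (tele _ _ (leq_maxl _ _))).
  have := hn0 _ (leq_maxr N n0); rewrite /= sub0r normrN ger0_norm ?invr_ge0 ?exprn_ge0// => h3.
  have : 0 < 2 ^- (maxn N n0 + (m - maxn N n0)) :> R by rewrite invr_gt0 exprn_gt0.
  lra.
suff -> : fine (limn_esup (fun n => (w n x)%:E)) = l by [].
suff /cvg_limn_einf_sup[_ ->] : (w n x)%:E @[n --> \oo] --> l%:E by [].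
by apply: cvg_EFin => //; near=> n.
Unshelve. all: by end_near. Qed.

(** A subsequence that converges at rate [4^-k] in [L1] provides an a.e. limit. [Phi_fatou] along
    this subsequence transfers the Cauchy estimate to the distance from the limit. *)
Lemma LlogL_complete (u : nat -> R -> C R) : (forall n, LlogL (u n)) ->
  (forall e : R, 0 < e -> exists n0 : nat, forall m n : nat,
    (n0 <= m)%N -> (n0 <= n)%N -> (LlogLnorm (u m \- u n)%R < e%:E)%E) ->
  exists2 f, LlogL f & LlogLnorm (u n \- f)%R @[n --> \oo] --> 0%E.
Proof.
move=> Lu cau.
have /choice[q qP] : forall n, exists q : (R -> R) * (R -> R), rep (u n) q.1 q.2.
  by move=> n; have [/L0_rep[a [b r]] _] := Lu n; exists (a, b).
have p4 n : 0 < 4 ^- n :> R by rewrite invr_gt0 exprn_gt0.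
have /choice[N0 N0P] : forall k, exists n0 : nat, forall m n : nat,
    (n0 <= m)%N -> (n0 <= n)%N -> (LlogLnorm (u m \- u n)%R < (4 ^- k)%:E)%E.
  by move=> k; exact: cau.
pose nk := nat_rect (fun _ => nat) (N0 0%N) (fun k n => maxn n.+1 (N0 k.+1)).
have nkN k : (N0 k <= nk k)%N by case: k => [|k] //=; exact: leq_maxr.
have nkS k : (nk k < nk k.+1)%N by exact: leq_maxl.
have nkk k : (k <= nk k)%N by elim: k => // k IH; exact: leq_ltn_trans (nkS k).
have ma n : measurable_fun setT (q n).1 by have [] := qP n.
have mb n : measurable_fun setT (q n).2 by have [] := qP n.
have dk k : (nrm (fun x => (q (nk k.+1)).1 x - (q (nk k)).1 x)%R <= (4 ^- k)%:E)%E /\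
    (nrm (fun x => (q (nk k.+1)).2 x - (q (nk k)).2 x)%R <= (4 ^- k)%:E)%E.
  have h := N0P k (nk k.+1) (nk k) (leq_trans (nkN k) (ltnW (nkS k))) (nkN k).
  have r := rep_sub (qP (nk k.+1)) (qP (nk k)).
  have := L1norm_le_LlogL (L0_sub (Lu (nk k.+1)).1 (Lu (nk k)).1).
  rewrite (L1norm_rep r) => h1; have h2 := le_trans h1 (ltW h).
  have m1 := measurable_funB (ma (nk k.+1)) (ma (nk k)).
  have m2 := measurable_funB (mb (nk k.+1)) (mb (nk k)).
  by split; apply: le_trans h2; [exact: nrm_re_le m1 m2|exact: nrm_im_le m1 m2].
have [a mla ca] := @fast_limit (fun k => (q (nk k)).1) (fun k => ma _) (fun k => (dk k).1).
have [b mlb cb] := @fast_limit (fun k => (q (nk k)).2) (fun k => mb _) (fun k => (dk k).2).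
pose f x : C R := Complex (a x) (b x).
have rf : rep f a b by split => //; exact: offnull_all.
have f0 : L0 f by apply/L0_rep; exists a, b.
have close (e : R) : 0 < e -> exists n0 : nat, forall n, (n0 <= n)%N -> (LlogLnorm (u n \- f)%R <= e%:E)%E.
  move=> e0; have [n0 h0] := cau _ e0; exists n0 => n nn0.
  rewrite LlogLnorm_Phi (Phi_rep (rep_sub (qP n) rf)).
  apply: (@Phi_fatou R (fun k => mod2 (fun x => (q n).1 x - (q (nk (n0 + k)%N)).1 x) (fun x => (q n).2 x - (q (nk (n0 + k)%N)).2 x))).
  - by move=> k; apply: measurable_mod2; exact: measurable_funB.
  - apply: offnull_imp (offnull_and ca cb) => x _ [h1 h2]; apply: cvg_mod2.
      apply: cvgB; first exact: cvg_cst.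
      by move: h1; rewrite -(cvg_shiftn n0); apply: cvg_trans; apply: near_eq_cvg; near=> k; rewrite /= addnC.
    apply: cvgB; first exact: cvg_cst.
    by move: h2; rewrite -(cvg_shiftn n0); apply: cvg_trans; apply: near_eq_cvg; near=> k; rewrite /= addnC.
  - move=> k; have := h0 n (nk (n0 + k)%N) nn0 (leq_trans (leq_addr _ _) (nkk _)).
    by rewrite LlogLnorm_Phi (Phi_rep (rep_sub (qP n) (qP _))) => /ltW.
exists f; last first.
  by apply: cvge0_ge => [n|e e0]; [exact: LlogLnorm_ge0|exact: close].
have [n0 /(_ n0 (leqnn _)) h] := close 1 ltr01.
have Ld : LlogL (u n0 \- f).
  split; first by apply: L0_sub; [exact: (Lu n0).1|exact: f0].
  by apply: (le_lt_trans h); rewrite ltry.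
rewrite (_ : f = u n0 \- (u n0 \- f)); first by apply: LlogL_sub; [exact: Lu|exact: Ld].
by apply/funext => x; rewrite /= subKr.
Unshelve. all: by end_near. Qed.

Lemma leC_parts (z w : C R) : z <= w -> im z = im w /\ re z <= re w.
Proof. by case: z => ? ?; case: w => ? ?; rewrite lecE/= => /andP[/eqP -> ->]. Qed.

(** The order of [C] forces [u n x] to be real and nonnegative, so the hypotheses of the Fatou
    property become statements on moduli, the only thing the two norms depend on. *)
Lemma monotone_limit (u : nat -> R -> C R) f :
  aeI (fun x => forall n, 0 <= u n x <= u n.+1 x) ->
  aeI (fun x => u n x @[n --> \oo] --> f x) ->
  aeI (fun x => (forall n, modulus (u n x) <= modulus (u n.+1 x) /\ modulus (u n x) <= modulus (f x)) /\
    modulus (u n x) @[n --> \oo] --> modulus (f x)).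
Proof.
move=> h1 h2; apply: aeI_imp (aeI_and h1 h2) => x _ [mono cu].
have P n : im (u n x) = 0 /\ 0 <= re (u n x) by have /andP[/leC_parts[<- h] _] := mono n.
have mE n : modulus (u n x) = re (u n x).
  by have [i0 r0] := P n; rewrite modulusE i0 expr0n addr0 sqrtr_sqr ger0_norm.
have S n : re (u n x) <= re (u n.+1 x) by have /andP[_ /leC_parts[_]] := mono n.
have cr : re (u n x) @[n --> \oo] --> re (f x) by apply: cvg_re.
have nd : nondecreasing_seq (fun n => re (u n x)) by apply/nondecreasing_seqP.
have le n : re (u n x) <= re (f x).
  have := nondecreasing_cvgn_le nd (cvgP _ cr) n.
  by rewrite (cvg_lim _ cr).
have if0 : im (f x) = 0.
  have ci : im (u n x) @[n --> \oo] --> im (f x) by apply: cvg_im.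
  have c0 : im (u n x) @[n --> \oo] --> (0 : R).
    by apply: cvg_near_cst; apply: nearW => n; have [] := P n.
  exact: (cvg_unique _ ci c0).
have fE : modulus (f x) = re (f x).
  rewrite modulusE if0 expr0n addr0 sqrtr_sqr ger0_norm//.
  by apply: le_trans (le 0%N); have [] := P 0%N.
split; first by move=> n; rewrite !mE fE.
rewrite fE (_ : (fun n => modulus (u n x)) = (fun n => re (u n x)))//.
by apply/funext => n.
Qed.

Lemma mono_norm_cvg (s : nat -> \bar R) (l : \bar R) : (forall n, (s n <= s n.+1)%E) ->
  (forall n, (s n <= l)%E) -> (l <= ereal_sup (range s))%E -> s n @[n --> \oo] --> l.
Proof.
move=> sS sl ls; have nd : nondecreasing_seq s by apply/nondecreasing_seqP.
suff <- : ereal_sup (range s) = l by exact: ereal_nondecreasing_cvgn.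
apply/eqP; rewrite eq_le ls andbT; apply: ge_ereal_sup => _ [n _ <-]; exact: sl.
Qed.

Lemma LlogL_fatou_le (u : nat -> R -> C R) f (M : \bar R) : (forall n, LlogL (u n)) -> L0 f ->
  aeI (fun x => modulus (u n x) @[n --> \oo] --> modulus (f x)) ->
  (forall n, (LlogLnorm (u n) <= M)%E) -> (LlogLnorm f <= M)%E.
Proof.
move=> Lu /L0_rep[a [b r]] /aeI_offnull cu uM.
have /choice[q qP] : forall n, exists q : (R -> R) * (R -> R), rep (u n) q.1 q.2.
  by move=> n; have [/L0_rep[a' [b' r']] _] := Lu n; exists (a', b').
rewrite LlogLnorm_Phi (Phi_rep r).
apply: (@Phi_fatou R (fun n => mod2 (q n).1 (q n).2)).
- by move=> n; have [m1 m2 _] := qP n; exact: measurable_mod2.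
- have hq := offnull_forall (fun n => rep_modulus (qP n)).
  apply: offnull_imp (offnull_and cu (offnull_and hq (rep_modulus r))) => x _ [c [e1 e2]].
  rewrite -e2; rewrite (_ : (fun n => mod2 _ _ x) = (fun n => modulus (u n x)))//.
  by apply/funext => n; rewrite e1.
- by move=> n; have := uM n; rewrite LlogLnorm_Phi (Phi_rep (qP n)).
Qed.

Theorem LlogL_bfs : is_bfs (@LlogL R) (@LlogLnorm R).
Proof.
split.
- by move=> f [].
- by split; [exact: L0_zero|rewrite LlogLnorm0 ?ltry].
- exact: LlogL_add.
- exact: LlogL_scale.
- by move=> f [_ ff]; rewrite LlogLnorm_ge0.
- by move=> f Lf e; apply: LlogLnorm_eq0; [exact: Lf|rewrite e].
- by move=> c f _; exact: LlogLnormZ.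
- exact: LlogLnormD.
- exact: LlogL_complete.
- exact: LlogL_ideal.
- move=> u f Lu f0 mono cu sf; have h := monotone_limit mono cu.
  have cm : aeI (fun x => modulus (u n x) @[n --> \oo] --> modulus (f x)) by apply: aeI_imp h => x _ [].
  have le : (LlogLnorm f <= ereal_sup (range (fun n => LlogLnorm (u n))))%E.
    by apply: (LlogL_fatou_le Lu f0 cm) => n; apply: ereal_sup_ubound; exists n.
  have Lf : LlogL f by split; [exact: f0|exact: (le_lt_trans le sf)].
  split; first exact: Lf.
  apply: mono_norm_cvg; last exact: le; move=> n.
    apply: (LlogL_ideal (Lu n.+1) (Lu n).1 _).2.
    by apply: aeI_imp h => x _ [/(_ n)[]].
  apply: (LlogL_ideal Lf (Lu n).1 _).2.
  by apply: aeI_imp h => x _ [/(_ n)[]].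
Qed.

End LlogLSpace.

(** * The optimal domain *)

Section Optimal.
Variable R : realType.
Local Notation mu := (@lebesgue_measure R).
Local Notation T := (@finite_hilbert R).
Implicit Types (f g h : R -> C R) (u v w a b : R -> R) (x t : R).

Definition rmul u f : R -> C R := fun x => real_complex R (u x) * f x.

Lemma rep_rmul k f u w : measurable_fun setT k -> rep f u w ->
  rep (rmul k f) (fun x => k x * u x) (fun x => k x * w x).
Proof.
move=> mk [m1 m2 h]; split; [exact: measurable_funM|exact: measurable_funM|].
apply: offnull_imp h => x _ [e1 e2].
by rewrite /rmul reM imM re_real im_real e1 e2 !mul0r subr0 addr0.
Qed.

Lemma L0_rmul k f : measurable_fun setT k -> L0 f -> L0 (rmul k f).
Proof.
move=> mk /L0_rep[u [w r]]; apply/L0_rep.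
by eexists; eexists; exact: (rep_rmul mk r).
Qed.

Lemma modulus_rmul k f x : modulus (rmul k f x) = `|k x| * modulus (f x).
Proof. by rewrite /rmul modulusM modulus_real. Qed.

Lemma dominated_trans f g h : dominated f g -> dominated g h -> dominated f h.
Proof. by move=> h1 h2; apply: aeI_imp (aeI_and h1 h2) => x _ [e1 e2]; exact: le_trans e2. Qed.

Lemma hilbert_le_optimal f h : L0 h -> dominated h f -> (L1norm (T h) <= optimal_norm f)%E.
Proof. by move=> h0 d; apply: ereal_sup_ubound; exists h. Qed.

Lemma optimal_le_ub f (M : \bar R) :
  (forall h, L0 h -> dominated h f -> (L1norm (T h) <= M)%E) -> (optimal_norm f <= M)%E.
Proof. by move=> H; apply: ge_ereal_sup => _ [h [h0 d] <-]; exact: H. Qed.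

Lemma L1norm_ge0 f : (0 <= L1norm f)%E.
Proof. by apply: integral_ge0 => x _; rewrite lee_fin modulus_ge0. Qed.

Lemma optimal_norm_ge0 f : (0 <= optimal_norm f)%E.
Proof.
apply: (le_trans (L1norm_ge0 (T (fun=> 0)))); apply: hilbert_le_optimal; first exact: L0_zero.
by apply: aeI_all => x _; rewrite modulus0 modulus_ge0.
Qed.

Lemma optimal_upper f : LlogL f -> (optimal_norm f <= (20 / pi)%:E * LlogLnorm f)%E.
Proof.
move=> Lf; apply: optimal_le_ub => h h0 d; have [Lh le] := LlogL_ideal Lf h0 d.
apply: (le_trans (hilbert_upper (LlogL_L1 Lh))); rewrite -LlogLnorm_Phi.
by apply: lee_wpmul2l => //; rewrite lee_fin divr_ge0// pi_ge0.
Qed.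

Lemma optimal_norm_fin f : LlogL f -> (optimal_norm f < +oo)%E.
Proof.
move=> Lf; apply: (le_lt_trans (optimal_upper Lf)); apply: lte_mul_pinfty; last exact: Lf.2.
- by rewrite lee_fin divr_ge0// pi_ge0.
- by [].
Qed.

Lemma optimal_lower_fin f (K : R) : L0 f -> (optimal_norm f <= K%:E)%E ->
  (LlogLnorm f <= (200 * (pi * K))%:E)%E.
Proof.
move=> f0 fK; rewrite LlogLnorm_Phi; apply: (Phi_lower f0) => u M mu_ uM d.
by apply: le_trans fK; apply: hilbert_le_optimal => //; exact: L0_real.
Qed.

Lemma optimal_lower f : LlogL f -> ((200 * pi)^-1%:E * LlogLnorm f <= optimal_norm f)%E.
Proof.
move=> Lf; have E : optimal_norm f = (fine (optimal_norm f))%:E.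
  by rewrite fineK// ge0_fin_numE ?optimal_norm_ge0// optimal_norm_fin.
have p0 : 0 < 200 * pi :> R := mulr_gt0 (ltr0Sn R 199) (pi_gt0 R).
rewrite lee_pdivrMl// E -EFinM -mulrA; apply: (optimal_lower_fin Lf.1).
by rewrite -E.
Qed.

Lemma optimal_sub_LlogL f : optimal_domain f -> LlogL f.
Proof.
move=> [Lf H]; split; first exact: Lf.1.
have /L0_rep[a [b r]] := Lf.1; have [ma mb _] := r.
have mm := measurable_mod2 ma mb.
rewrite LlogLnorm_Phi (Phi_rep r).
have Lm : L1I (mod2 a b) by split => //; rewrite -(L1norm_rep r); exact: Lf.2.
have fin u v : measurable_fun setT u -> (forall t, I11 t -> `|u t| <= mod2 a b t) ->
    is_hilb u v -> (nrm v < +oo)%E.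
  move=> mu_ ug hv; apply: (le_lt_trans (L1norm_hilbert_real mu_ hv)).
  apply: lte_mul_pinfty; [by rewrite lee_fin pi_ge0|by []|].
  apply: (H _ (L0_real mu_) _).2; apply/dominated_offnull.
  apply: offnull_imp (rep_modulus r) => x Ix ->; rewrite modulus_real; exact: ug.
have [N hN] := gliding_hump Lm (mod2_ge0 a b) fin.
by apply: (le_lt_trans (lower_bound mm (mod2_ge0 a b) hN)); rewrite ltry.
Qed.

Lemma LlogL_sub_optimal f : LlogL f -> optimal_domain f.
Proof.
move=> Lf; split; first exact: LlogL_L1.
move=> h h0 d; have [Lh _] := LlogL_ideal Lf h0 d; have L1h := LlogL_L1 Lh.
split; first exact: hilbert_L0.
by apply: (le_lt_trans (hilbert_le_optimal h0 d)); exact: optimal_norm_fin.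
Qed.

Theorem optimal_domainE : @optimal_domain R = @LlogL R.
Proof.
apply/seteqP; split => f; [exact: optimal_sub_LlogL|exact: LlogL_sub_optimal].
Qed.

Lemma hilbert_normZ (c : C R) h : L1 h -> L1norm (T (c \*o h)) = ((modulus c)%:E * L1norm (T h))%E.
Proof.
move=> Lh; rewrite -(L1normZ c (hilbert_L0 Lh)); apply: L1norm_ae; last exact: hilbert_scale.
by apply: hilbert_L0; exact: L1_scale.
Qed.

Lemma optimal_norm_scale (c : C R) f : LlogL f -> c != 0 ->
  (optimal_norm (c \*o f)%R <= (modulus c)%:E * optimal_norm f)%E.
Proof.
move=> Lf c0; apply: optimal_le_ub => h h0 d.
have ci : c * c^-1 = 1 by rewrite mulfV.
have E : h = c \*o (c^-1 \*o h) by apply/funext => x; rewrite /= mulrA ci mul1r.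
have g0 : L0 (c^-1 \*o h) by exact: L0_scale.
have m0 : 0 < modulus c.
  by rewrite lt_neqAle modulus_ge0 andbT eq_sym; apply: contra_neq c0; exact: modulus0_eq0.
have dg : dominated (c^-1 \*o h) f.
  apply: aeI_imp d => x _; rewrite {1}E /= !modulusM -modulusM.
  by rewrite modulusM ler_pM2l.
have [Lg _] := LlogL_ideal Lf g0 dg.
rewrite E hilbert_normZ; last exact: LlogL_L1.
by apply: lee_wpmul2l; [rewrite lee_fin ltW|exact: hilbert_le_optimal].
Qed.

Lemma optimal_normZ (c : C R) f : LlogL f ->
  optimal_norm (c \*o f) = ((modulus c)%:E * optimal_norm f)%E.
Proof.
move=> Lf; have [->|c0] := eqVneq c 0.
  rewrite modulus0 mul0e; apply/eqP; rewrite eq_le optimal_norm_ge0 andbT.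
  apply: (le_trans (optimal_upper (LlogL_scale 0 Lf))).
  by rewrite LlogLnormZ modulus0 mul0e mule0.
apply/eqP; rewrite eq_le optimal_norm_scale//=.
have m0 : 0 < modulus c.
  by rewrite lt_neqAle modulus_ge0 andbT eq_sym; apply: contra_neq c0; exact: modulus0_eq0.
have ci0 : c^-1 != 0 by rewrite invr_eq0.
have := @optimal_norm_scale c^-1 (c \*o f) (LlogL_scale c Lf) ci0.
rewrite (_ : c^-1 \*o (c \*o f) = f); last by apply/funext => x; rewrite /= mulKf.
have -> : modulus c^-1 = (modulus c)^-1 by exact: ComplexField.Normc.normcV.
by rewrite lee_pdivlMl.
Qed.

Lemma measurable_div u w : measurable_fun setT u -> measurable_fun setT w ->
  measurable_fun setT (fun x => u x / w x).
Proof.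
move=> m1 m2; apply: measurable_funM => //.
by apply: (@measurableT_comp _ _ _ _ _ _ (fun x : R => x^-1)) => //; exact: measurable_inv.
Qed.

(* [h] is divided between [f] and [g] in proportion to [|f|] and [|g|]. *)
Lemma optimal_normD f g : LlogL f -> LlogL g ->
  (optimal_norm (f \+ g)%R <= optimal_norm f + optimal_norm g)%E.
Proof.
move=> Lf Lg; apply: optimal_le_ub => h h0 d.
have /L0_rep[a [b r]] := Lf.1; have /L0_rep[a' [b' r']] := Lg.1.
have [ma mb _] := r; have [ma' mb' _] := r'.
have m1 := measurable_mod2 ma mb; have m2 := measurable_mod2 ma' mb'.
pose k x := mod2 a b x / (mod2 a b x + mod2 a' b' x).
have mk : measurable_fun setT k by apply: measurable_div => //; exact: measurable_funD.
have mk' : measurable_fun setT (fun x => 1 - k x) by exact: measurable_funB.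
have E : h = rmul k h \+ rmul (fun x => 1 - k x) h.
  by apply/funext => x; rewrite /rmul /= -mulrDl -rmorphD /= addrC subrK rmorph1 mul1r.
have K x : [/\ 0 <= k x, 0 <= 1 - k x, k x * (mod2 a b x + mod2 a' b' x) <= mod2 a b x &
    (1 - k x) * (mod2 a b x + mod2 a' b' x) <= mod2 a' b' x].
  have p1 := mod2_ge0 a b x; have p2 := mod2_ge0 a' b' x.
  (* When both moduli vanish, [k x] is 0 by the convention for division by 0, and both bounds read
     [0 <= 0] up to nonnegative terms. *)
  have [z|nz] := eqVneq (mod2 a b x + mod2 a' b' x) 0.
    by rewrite /k z invr0 !mulr0 subr0; split.
  have q : 0 < mod2 a b x + mod2 a' b' x by rewrite lt_neqAle eq_sym nz addr_ge0.
  have e : k x * (mod2 a b x + mod2 a' b' x) = mod2 a b x by rewrite /k divfK.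
  have k1 : k x <= 1 by rewrite /k ler_pdivrMr// mul1r lerDl.
  split; [by rewrite divr_ge0// ltW|by rewrite subr_ge0|by rewrite e|].
  by rewrite mulrBl mul1r e addrAC subrr add0r.
have hh : offnull (fun x => modulus (h x) <= mod2 a b x + mod2 a' b' x /\
    modulus (f x) = mod2 a b x /\ modulus (g x) = mod2 a' b' x).
  have dd := (dominated_offnull _ _).1 d.
  apply: offnull_imp (offnull_and dd (offnull_and (rep_modulus r) (rep_modulus r'))) => x _ [e1 [e2 e3]].
  by split => //; apply: (le_trans e1); rewrite -e2 -e3; exact: modulusD.
have d1 : dominated (rmul k h) f.
  apply/dominated_offnull; apply: offnull_imp hh => x _ [e1 [-> _]].
  have [k0 _ k1 _] := K x; rewrite modulus_rmul ger0_norm//.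
  by apply: le_trans k1; exact: ler_wpM2l.
have d2 : dominated (rmul (fun x => 1 - k x) h) g.
  apply/dominated_offnull; apply: offnull_imp hh => x _ [e1 [_ ->]].
  have [_ k0 _ k1] := K x; rewrite modulus_rmul ger0_norm//.
  by apply: le_trans k1; exact: ler_wpM2l.
have l1 : L0 (rmul k h) by exact: L0_rmul.
have l2 : L0 (rmul (fun x => 1 - k x) h) by exact: L0_rmul.
have L1h1 := LlogL_L1 (LlogL_ideal Lf l1 d1).1.
have L1h2 := LlogL_L1 (LlogL_ideal Lg l2 d2).1.
rewrite E (L1norm_ae (hilbert_L0 (L1_add L1h1 L1h2)) (hilbert_add L1h1 L1h2)).
apply: (le_trans (L1normD (hilbert_L0 L1h1) (hilbert_L0 L1h2))).
by apply: leeD; exact: hilbert_le_optimal.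
Qed.

(** Completeness is inherited from L log L: the lower bound carries the Cauchy condition over and
    the upper bound carries the convergence back. *)
Lemma optimal_complete (u : nat -> R -> C R) : (forall n, LlogL (u n)) ->
  (forall e : R, 0 < e -> exists n0 : nat, forall m n : nat,
    (n0 <= m)%N -> (n0 <= n)%N -> (optimal_norm (u m \- u n)%R < e%:E)%E) ->
  exists2 f, LlogL f & optimal_norm (u n \- f)%R @[n --> \oo] --> 0%E.
Proof.
move=> Lu cau; have pp : 0 < pi :> R by exact: pi_gt0.
have [e e0|f Lf cf] := LlogL_complete Lu.
  have q0 : 0 < e / 2 / (200 * pi) := divr_gt0 (divr_gt0 e0 (ltr0Sn R 1)) (mulr_gt0 (ltr0Sn R 199) pp).
  have [n0 h] := cau _ q0; exists n0 => m n mn nn.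
  have := optimal_lower_fin (L0_sub (Lu m).1 (Lu n).1) (ltW (h m n mn nn)).
  move=> /le_lt_trans; apply; rewrite lte_fin.
  have E (q : R) : q != 0 -> 200 * (q * (e / 2 / (200 * q))) = e / 2 by move=> nq; field.
  rewrite E ?gt_eqF ?pi_gt0//.
  by rewrite ltr_pdivrMr// ltr_pMr// ltr1n.
exists f; first exact: Lf.
apply: cvge0_ge => [n|e e0]; first exact: optimal_norm_ge0.
have q0 : 0 < e / (20 / pi) by rewrite !divr_gt0.
have [N hN] := cvge0_le cf q0; exists N => n /hN hn.
apply: (le_trans (optimal_upper (LlogL_sub (Lu n) Lf))).
apply: (@le_trans _ _ ((20 / pi)%:E * (e / (20 / pi))%:E)%E).
  by apply: lee_wpmul2l => //; rewrite lee_fin divr_ge0// ltW.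
by rewrite -EFinM lee_fin mulrC divfK// gt_eqF// divr_gt0.
Qed.

(* [h] is approximated in L1 by [h * |u n| / |f|], which is dominated by [u n]. *)
Lemma optimal_fatou_le (u : nat -> R -> C R) f (M : \bar R) : (forall n, LlogL (u n)) -> LlogL f ->
  aeI (fun x => (forall n, modulus (u n x) <= modulus (u n.+1 x) /\ modulus (u n x) <= modulus (f x)) /\
    modulus (u n x) @[n --> \oo] --> modulus (f x)) ->
  (forall n, (optimal_norm (u n) <= M)%E) -> (optimal_norm f <= M)%E.
Proof.
move=> Lu Lf H uM; apply: optimal_le_ub => h h0 d.
have /L0_rep[a [b r]] := Lf.1; have [ma mb _] := r.
have /choice[q qP] : forall n, exists q : (R -> R) * (R -> R), rep (u n) q.1 q.2.
  by move=> n; have [/L0_rep[a' [b' r']] _] := Lu n; exists (a', b').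
have mq n : measurable_fun setT (mod2 (q n).1 (q n).2) by have [m1 m2 _] := qP n; exact: measurable_mod2.
have mf := measurable_mod2 ma mb.
(* The clamp changes the quotient only on a null set and makes [0 <= k n x <= 1] hold everywhere. *)
pose k n x := clamp 0 1 (mod2 (q n).1 (q n).2 x / mod2 a b x).
have mk n : measurable_fun setT (k n) by apply: clamp_measurable; exact: measurable_div.
have k01 n x : 0 <= k n x <= 1 by apply: clamp_between.
have [Lh _] := LlogL_ideal Lf h0 d; have L1h := LlogL_L1 Lh.
have /L0_rep[p [p' rp]] := h0; have [mp mp' _] := rp.
have good : offnull (fun x => modulus (h x) <= mod2 a b x /\ modulus (h x) = mod2 p p' x /\
    (forall n, modulus (u n x) = mod2 (q n).1 (q n).2 x /\ mod2 (q n).1 (q n).2 x <= mod2 a b x) /\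
    mod2 (q n).1 (q n).2 x @[n --> \oo] --> mod2 a b x).
  have dd := (dominated_offnull _ _).1 d; have HH := (aeI_offnull _).1 H.
  have hq := offnull_forall (fun n => rep_modulus (qP n)).
  apply: offnull_imp (offnull_and dd (offnull_and HH (offnull_and hq (offnull_and (rep_modulus r) (rep_modulus rp))))).
  move=> x _ [e1 [[e2 e3] [e4 [e5 e6]]]]; rewrite -e5; split => //; split => //; split.
    by move=> n; rewrite -e4; split => //; have [] := e2 n.
  rewrite (_ : (fun n => mod2 _ _ x) = (fun n => modulus (u n x)))//.
  by apply/funext => n; rewrite e4.
pose hn n := rmul (k n) h.
have l0 n : L0 (hn n) by exact: L0_rmul.
have dn n : dominated (hn n) (u n).
  apply/dominated_offnull; apply: offnull_imp good => x _ [e1 [_ [/(_ n)[e2 e3] _]]].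
  have /andP[k0 k1] := k01 n x; rewrite /hn modulus_rmul ger0_norm// e2.
  have [z|nz] := eqVneq (mod2 a b x) 0.
    have : modulus (h x) <= 0 by rewrite -z.
    rewrite le_eqVlt ltNge modulus_ge0 orbF => /eqP ->; rewrite mulr0; exact: mod2_ge0.
  have m0 : 0 < mod2 a b x by rewrite lt_neqAle eq_sym nz mod2_ge0.
  have kE : k n x = mod2 (q n).1 (q n).2 x / mod2 a b x.
    rewrite /k /clamp (min_idPl _) ?(max_idPr _)//.
      by rewrite divr_ge0// mod2_ge0.
    by rewrite ler_pdivrMr// mul1r.
  rewrite kE; apply: (@le_trans _ _ (mod2 (q n).1 (q n).2 x / mod2 a b x * mod2 a b x)).
    by apply: ler_wpM2l => //; rewrite divr_ge0// mod2_ge0.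
  by rewrite divfK.
have L1n n : L1 (hn n) := LlogL_L1 (LlogL_ideal (Lu n) (l0 n) (dn n)).1.
apply: (hilbert_lsc L1h L1n) => [|n]; last first.
  by apply: (le_trans (hilbert_le_optimal (l0 n) (dn n))).
have rn n := rep_sub rp (rep_rmul (mk n) rp).
rewrite (_ : (fun n => L1norm (h \- hn n)) = (fun n => nrm (fun x => (1 - k n x) * mod2 p p' x))); last first.
  apply/funext => n; rewrite (L1norm_rep (rn n)); apply: eq_integral => x _; congr _%:E.
  have /andP[k0 k1] := k01 n x.
  have E : mod2 (fun x => p x - k n x * p x) (fun x => p' x - k n x * p' x) x =
      `|1 - k n x| * mod2 p p' x.
    rewrite /mod2 -[`|1 - k n x|]sqrtr_sqr -sqrtrM ?sqr_ge0//; congr Num.sqrt; ring.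
  by apply: etrans (_ : `|mod2 (fun x => p x - k n x * p x) (fun x => p' x - k n x * p' x) x| = _) _ => //;
    rewrite E !normrM normr_id.
have mpp := measurable_mod2 mp mp'.
apply: (@nrm_dct R _ (mod2 p p')).
- by split => //; rewrite -(L1norm_rep rp); exact: L1h.2.
- by move=> n; apply: measurable_funM => //; exact: measurable_funB.
- move=> n x _; have /andP[k0 k1] := k01 n x.
  by rewrite normrM ler_piMl// ger0_norm ?subr_ge0// gerBl.
- apply: offnull_imp good => x _ [e1 [e2 [e3 c]]].
  have [z|nz] := eqVneq (mod2 a b x) 0.
    have : modulus (h x) <= 0 by rewrite -z.
    rewrite le_eqVlt ltNge modulus_ge0 orbF e2 => /eqP ->.
    by apply: cvg_near_cst; apply: nearW => n; rewrite mulr0.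
  have m0 : 0 < mod2 a b x by rewrite lt_neqAle eq_sym nz mod2_ge0.
  have kE n : k n x = mod2 (q n).1 (q n).2 x / mod2 a b x.
    rewrite /k /clamp (min_idPl _) ?(max_idPr _)//.
      by rewrite divr_ge0// mod2_ge0.
    by rewrite ler_pdivrMr// mul1r; have [] := e3 n.
  have ck : k n x @[n --> \oo] --> (1 : R).
    rewrite -(mulfV nz) (_ : (fun n => k n x) = (fun n => mod2 (q n).1 (q n).2 x / mod2 a b x)).
      by apply: cvgM; [exact: c|exact: cvg_cst].
    exact/funext/kE.
  rewrite -(mul0r (mod2 p p' x)) -(subrr 1); apply: cvgM; last exact: cvg_cst.
  by apply: cvgB => //; exact: cvg_cst.
Qed.

Theorem optimal_bfs : is_bfs (@optimal_domain R) (@optimal_norm R).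
Proof.
rewrite optimal_domainE; have B := LlogL_bfs R; split.
- exact: (bfs_sub_L0 B).
- exact: (bfs_zero B).
- exact: (bfs_add B).
- exact: (bfs_scale B).
- by move=> f Lf; rewrite optimal_norm_ge0 optimal_norm_fin.
- move=> f Lf e; apply: LlogLnorm_eq0; first exact: Lf.
  have := @optimal_lower_fin f 0 Lf.1; rewrite e mulr0 mulr0; exact.
- by move=> c f Lf; exact: optimal_normZ.
- exact: optimal_normD.
- exact: optimal_complete.
- move=> f g Lf g0 d; split; first exact: (LlogL_ideal Lf g0 d).1.
  by apply: optimal_le_ub => h h0 dh; apply: hilbert_le_optimal => //; exact: dominated_trans d.
- move=> u f Lu f0 mono cu sf; have H := monotone_limit mono cu.
  have uS n : (optimal_norm (u n) <= ereal_sup (range (fun n => optimal_norm (u n))))%E.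
    by apply: ereal_sup_ubound; exists n.
  have S0 : (0 <= ereal_sup (range (fun n => optimal_norm (u n))))%E.
    exact: le_trans (optimal_norm_ge0 (u 0%N)) (uS 0%N).
  have SE : ereal_sup (range (fun n => optimal_norm (u n))) = (fine (ereal_sup (range (fun n => optimal_norm (u n)))))%:E.
    by rewrite fineK// ge0_fin_numE.
  have Lf : LlogL f.
    split; first exact: f0.
    have cm : aeI (fun x => modulus (u n x) @[n --> \oo] --> modulus (f x)) by apply: aeI_imp H => x _ [].
    apply: (@le_lt_trans _ _ (200 * (pi * fine (ereal_sup (range (fun n => optimal_norm (u n))))))%:E); last by rewrite ltry.
    apply: (LlogL_fatou_le Lu f0 cm) => n; apply: optimal_lower_fin; first exact: (Lu n).1.
    by rewrite -SE; exact: uS.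
  split; first exact: Lf.
  have dS n : dominated (u n) (u n.+1) by apply: aeI_imp H => x _ [/(_ n)[]].
  have dL n : dominated (u n) f by apply: aeI_imp H => x _ [/(_ n)[]].
  apply: mono_norm_cvg.
  + by move=> n; apply: optimal_le_ub => h h0 dh; apply: hilbert_le_optimal => //; exact: dominated_trans (dS n).
  + by move=> n; apply: optimal_le_ub => h h0 dh; apply: hilbert_le_optimal => //; exact: dominated_trans (dL n).
  + exact: (optimal_fatou_le Lu Lf H uS).
Qed.

(* Near 0 the extension is bounded by 1, hence by homogeneity [T] is bounded
   on the bounded functions dominated by [f]; this is all [Phi_lower] needs. *)
Theorem no_extension (X : set (R -> C R)) (N : (R -> C R) -> \bar R)
    (S : (R -> C R) -> R -> C R) : is_bfs X N -> @LlogL R `<=` X ->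
  continuous_linear_to_L1 X N S -> extends_finite_hilbert S -> X `<=` @LlogL R.
Proof.
move=> B LX CS ES f Xf; have f0 : L0 f by exact: (bfs_sub_L0 B).
split; first exact: f0.
have Nf := bfs_norm_fin B Xf.
have LZ : LlogL (fun=> 0 : C R) := bfs_zero (LlogL_bfs R).
have [d d0 hd] := cl_continuous CS (bfs_zero B) ltr01.
pose K := fine (N f); have NE : N f = K%:E.
  by rewrite fineK// ge0_fin_numE; case/andP: Nf.
have K0 : 0 <= K by rewrite -lee_fin -NE; case/andP: Nf.
(* This scaling brings the norm of [f], and so of every function it dominates, below [d]; adding 1
   covers the case [K = 0]. *)
pose c := d / (K + 1); have c0 : 0 < c by rewrite divr_gt0// ltr_wpDl.
have cK : c * K < d.
  by rewrite /c mulrAC ltr_pdivrMr ?ltr_wpDl// ltr_pM2l// ltrDl.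
rewrite LlogLnorm_Phi; apply: (@le_lt_trans _ _ (200 * (pi * c^-1))%:E); last by rewrite ltry.
apply: (Phi_lower f0) => u M mu_ uM du.
pose h : R -> C R := fun x => real_complex R (u x).
have h0 : L0 h by exact: L0_real.
have Lh : LlogL h.
  split; first exact: h0.
  rewrite LlogLnorm_Phi (Phi_rep (rep_real mu_)).
  have M10 : 0 < `|M| + 1 by rewrite ltr_wpDl.
  have uM1 x : I11 x -> `|u x| <= `|M| + 1.
    by move=> /uM h1; apply: (le_trans h1); have := ler_norm M; lra.
  apply: le_lt_trans (L1I_fin_Phi M10 mu_ uM1); apply: Phi_mono => x _.
  by apply: (le_trans (mod2_le _ _ _)); rewrite normr0 addr0.
have [Xh Nh] := bfs_ideal B Xf h0 du.
pose cc : C R := real_complex R c.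
have mc : modulus cc = c by rewrite modulus_real gtr0_norm.
have Xch : X (cc \*o h) := bfs_scale B cc Xh.
have Lch : LlogL (cc \*o h) := LlogL_scale cc Lh.
have small : (N ((cc \*o h) \- (fun=> 0))%R < d%:E)%E.
  rewrite (_ : (cc \*o h) \- (fun=> 0) = cc \*o h); last by apply/funext => x; rewrite /= subr0.
  rewrite (bfs_normZ B cc Xh) mc; apply: (@le_lt_trans _ _ (c%:E * N f)%E).
    by apply: lee_wpmul2l => //; rewrite lee_fin ltW.
  by rewrite NE -EFinM lte_fin.
have := hd _ Xch small.
(* [S] acts on representatives, so [S] of the zero function is only a.e. zero. Both terms are known
   because the zero function and [cc \*o h] belong to L log L. *)
have TS : aeI (fun t => T (cc \*o h) t = (S (cc \*o h) \- S (fun=> 0)) t).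
  apply: aeI_imp (aeI_and (ES _ Lch) (aeI_and (ES _ LZ) (hilbert_zero R))) => t _ [e1 [e2 e3]].
  apply: esym; apply: etrans (subr0 _); exact: (f_equal2 (fun a b : C R => a - b) e1 (etrans e2 e3)).
have L1ch := LlogL_L1 Lch.
have EN := etrans (esym (L1norm_ae (hilbert_L0 L1ch) TS)) (hilbert_normZ cc (LlogL_L1 Lh)).
move=> lt1; have h1 := eq_ind _ (fun y => is_true (y < 1%:E)%E) lt1 _ EN; rewrite mc in h1.
by rewrite -[leRHS]mule1 lee_pdivlMl// ltW.
Qed.

End Optimal.

Unset Implicit Arguments.

Theorem theorem5p6 (R : realType) :
  [/\ is_bfs (@optimal_domain R) (@optimal_norm R),
      is_bfs (@LlogL R) (@LlogLnorm R),
      @optimal_domain R = @LlogL R &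
      exists c1 c2 : R, [/\ 0 < c1, 0 < c2 &
        forall f : R -> C R, LlogL f ->
          (c1%:E * LlogLnorm f <= optimal_norm f)%E /\
          (optimal_norm f <= c2%:E * LlogLnorm f)%E]]
  /\
  ~ exists (X : set (R -> C R)) (N : (R -> C R) -> \bar R)
      (S : (R -> C R) -> R -> C R),
    [/\ is_bfs X N, @LlogL R `<` X,
        continuous_linear_to_L1 X N S & extends_finite_hilbert S].
Proof.
split.
  split; [exact: optimal_bfs|exact: LlogL_bfs|exact: optimal_domainE|].
  exists (200 * pi)^-1, (20 / pi); split.
  - by rewrite invr_gt0; exact: mulr_gt0 (ltr0Sn R 199) (pi_gt0 R).
  - exact: divr_gt0 (ltr0Sn R 19) (pi_gt0 R).
  - by move=> f Lf; split; [exact: optimal_lower|exact: optimal_upper].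
by move=> [X [N [S [B [LX nXL] CS ES]]]]; apply: nXL; exact: no_extension B LX CS ES.
Qed.
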